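(* For every $R^-,R^+\in SO(2)$ there exists a family $A_\varepsilon\in L^1(Q_{1/2};\mathbb{R}^{2\times2})$, $\varepsilon>0$, such that $$A_\varepsilon\to I_{R^-,R^+}\quad\text{in }L^1(Q_{1/2};\mathbb{R}^{2\times2})\qquad\text{and}\qquad\lim_{\varepsilon\to0^+}F_\varepsilon(A_\varepsilon,Q_{1/2})=\psi_0(R^-,R^+),$$ and for every $\delta\in(0,\frac14)$, for all sufficiently small $\varepsilon>0$ (depending on $\delta$), $$A_\varepsilon(x)=I_{R^-,R^+}(x)\qquad\forall\,x\in Q_{1/2}\ \text{with}\ |x_1|>\delta.$$
   Context: Notation: $Q_r=(-r,r)\times(-r,r)$ and $I_{R^-,R^+}(x):=R^-\chi_{\{x_1<0\}}(x)+R^+\chi_{\{x_1\ge0\}}(x)$. Model. Fix parameters $\lambda,\tau>0$. For $\varepsilon>0$ and a bounded open set $\Omega\subset\mathbb{R}^2$, $\mathcal{C}_\varepsilon(\Omega)$ is the set of pairs $(A,S)$ with $A\in L^1(\Omega;\mathbb{R}^{2\times2})$ and $S\subset\Omega$ relatively closed such that: (a) $S\supseteq\mathrm{supp}(\mathrm{Curl}\,A)$, where $\mathrm{Curl}\,A$ is the row-wise distributional curl; (b) for every simple rectifiable closed curve $\gamma$ in $\Omega\setminus S$ one has $\int_\gamma A\in\tau\varepsilon\mathbb{Z}^2$. Here $\int_\gamma A:=-\mathrm{sgn}(\gamma)\int_\Omega A\,\nabla^\perp\varphi\,dx$, where $D\subset\Omega$ is the open set with $\gamma=\partial D$, $\mathrm{sgn}(\gamma)=+1$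 if $\gamma$ is anticlockwise and $-1$ if clockwise, $\varphi\in C_c^\infty(\Omega)$ is any function with $\varphi=1$ on $D$ and $(\mathrm{supp}\,\varphi)\setminus D\subset\Omega\setminus S$, and $\nabla^\perp\varphi=(\partial_2\varphi,-\partial_1\varphi)$ (this does not depend on $\varphi$ and is the usual line integral for continuous $A$). Energy. For $(A,S)\in\mathcal{C}_\varepsilon(\Omega)$, $$\mathcal{F}_\varepsilon(A,S;\Omega):=\int_{\Omega\setminus B_{\lambda\varepsilon}(S)}\mathrm{dist}^2(A(x),SO(2))\,dx+|B_{\lambda\varepsilon}(S)|,$$ where $B_{\lambda\varepsilon}(S):=\{x\in\Omega:\mathrm{dist}(x,S)<\lambda\varepsilon\}$ and $|\cdot|$ is Lebesgue measure (Euclidean/Frobenius norm on matrices). For $A\in L^1(Q;\mathbb{R}^{2\times2})$ on an open square $Q$, $F_\varepsilon(A,Q):=\frac1\varepsilon\inf\{\mathcal{F}_\varepsilon(A,S;Q):(A,S)\in\mathcal{C}_\varepsilon(Q)\}$. Optimal interfacial energy: $$\psi_0(R^-,R^+):=\inf\Big\{\liminf_{\varepsilon\to0}\tfrac1\varepsilon\mathcal{F}_\varepsilon(A_\varepsilon,S_\varepsilon;Q_{1/2}):(A_\varepsilon,S_\varepsilon)\in\mathcal{C}_\varepsilon(Q_{1/2}),\ A_\varepsilon\chi_{Q_{1/2}\setminus B_{\lambda\varepsilon}(S_\varepsilon)}\to I_{R^-,R^+}\text{ in }L^1(Q_{1/2})\Big\}.$$ *)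

(* Defs.v *)
From HB Require Import structures.
From mathcomp Require Import all_boot all_order all_algebra.
From mathcomp Require Import all_classical all_reals all_analysis.
Set Implicit Arguments.
Unset Strict Implicit.
Unset Printing Implicit Defensive.
Import Order.TTheory GRing.Theory Num.Theory.
Import numFieldNormedType.Exports.
Local Open Scope classical_set_scope.
Local Open Scope ring_scope.

Notation leb2 R := (@lebesgue_measure R \x @lebesgue_measure R)%E (only parsing).

Definition open_square (R : realType) (r : R) : set (R * R) :=
  `]-r, r[%classic `*` `]-r, r[%classic.

(* The library norm on [R * R] is the sup norm and the one on ['M[R]_2] is the
   max norm: they give the right topologies, but every distance below is
   Euclidean (Frobenius on matrices). *)
Definition enorm (R : realType) (x : R * R) : R :=
  Num.sqrt (x.1 ^+ 2 + x.2 ^+ 2).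

Definition frobenius (R : realType) (M : 'M[R]_2) : R :=
  Num.sqrt (\sum_i \sum_j M i j ^+ 2).

(* Extended-real valued, so that the distance to the empty set is [+oo]. *)
Definition dist_set (R : realType) (V : zmodType) (N : V -> R) (x : V)
    (S : set V) : \bar R :=
  ereal_inf [set (N (x - y))%:E | y in S].

Definition SO2 (R : realType) : set 'M[R]_2 :=
  [set M | M^T *m M = 1%:M /\ \det M = 1].

(* Elements of L^1 are represented by functions; every notion below other than
   pointwise equality is invariant under modification on null sets. *)
Definition L1_field (R : realType) (Omega : set (R * R))
    (A : R * R -> 'M[R]_2) : Prop :=
  forall i j, (leb2 R).-integrable Omega (fun x => (A x i j)%:E).

(* Convergence in L^1(Omega) of a family indexed by eps > 0, as eps -> 0. *)
Definition cvg_L1 (R : realType) (Omega : set (R * R))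
    (A : R -> R * R -> 'M[R]_2) (B : R * R -> 'M[R]_2) : Prop :=
  (\int[leb2 R]_(x in Omega) (frobenius (A eps x - B x))%:E
     @[eps --> 0^'+] --> 0)%E.

Definition partial1 (R : realType) (f : R * R -> R) (x : R * R) : R :=
  'D_(1, 0) f x.

Definition partial2 (R : realType) (f : R * R -> R) (x : R * R) : R :=
  'D_(0, 1) f x.

Fixpoint Cn (R : realType) (n : nat) (f : R * R -> R) : Prop :=
  if n is m.+1 then
    [/\ continuous f,
        forall x, derivable f x (1, 0) /\ derivable f x (0, 1),
        Cn m (partial1 f) & Cn m (partial2 f)]
  else continuous f.

Definition supp (R : realType) (f : R * R -> R) : set (R * R) :=
  closure [set x | f x != 0].

(* C_c^oo(U), as functions on the whole plane. *)
Definition test_function (R : realType) (U : set (R * R))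
    (phi : R * R -> R) : Prop :=
  [/\ forall n, Cn n phi, compact (supp phi) & supp phi `<=` U].

Definition grad_perp (R : realType) (phi : R * R -> R) (x : R * R) :
    'cV[R]_2 :=
  \col_i (if i == 0 then partial2 phi x else - partial1 phi x).

(* int_Omega A grad_perp phi. For phi in C_c^oo(Omega) this is also the pairing
   of phi with the row-wise distributional curl d_1 A_i2 - d_2 A_i1. *)
Definition curl_pairing (R : realType) (Omega : set (R * R))
    (A : R * R -> 'M[R]_2) (phi : R * R -> R) : 'cV[R]_2 :=
  \col_i \int[leb2 R]_(x in Omega) (A x *m grad_perp phi x) i 0.

Definition supp_curl (R : realType) (Omega : set (R * R))
    (A : R * R -> 'M[R]_2) : set (R * R) :=
  [set x | Omega x /\
    ~ exists U : set (R * R), [/\ open U, U x, U `<=` Omega &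
        forall phi, test_function U phi -> curl_pairing Omega A phi = 0]].

Definition polygon_length (R : realType) (gamma : R -> R * R) (s : seq R) : R :=
  \sum_(0 <= n < size s) enorm (gamma (nth 0 s n) - gamma (nth 0 (0 :: s) n)).

Definition rectifiable (R : realType) (gamma : R -> R * R) : Prop :=
  has_ubound [set polygon_length gamma s | s in itv_partition 0 1].

(* Curves are parametrized by [0, 1]. *)
Definition simple_closed_curve (R : realType) (gamma : R -> R * R) : Prop :=
  [/\ {within `[0, 1], continuous gamma}, gamma 0 = gamma 1 &
      {in `[0, 1[ &, injective gamma}].

Definition trace_curve (R : realType) (gamma : R -> R * R) : set (R * R) :=
  gamma @` `[0, 1].

(* For a bounded open D, the boundary determines D (Jordan curve theorem). *)
Definition interior_domain (R : realType) (Omega : set (R * R))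
    (gamma : R -> R * R) (D : set (R * R)) : Prop :=
  [/\ open D, D `<=` Omega & closure D `\` interior D = trace_curve gamma].

(* A continuous determination of the angle of gamma around p increases by
   2 pi, i.e. gamma has winding number +1 around p. *)
Definition winds_once (R : realType) (gamma : R -> R * R) (p : R * R) : Prop :=
  exists theta : R -> R,
    [/\ {within `[0, 1], continuous theta},
        forall t, t \in `[0, 1] ->
          gamma t - p = (enorm (gamma t - p) * cos (theta t),
                         enorm (gamma t - p) * sin (theta t)) &
        theta 1 - theta 0 = 2 * pi].

Definition sgn_curve (R : realType) (gamma : R -> R * R)
    (D : set (R * R)) : R :=
  if `[< forall p, D p -> winds_once gamma p >] then 1 else - 1.

Definition cutoff (R : realType) (Omega S D : set (R * R))
    (phi : R * R -> R) : Prop :=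
  [/\ test_function Omega phi, forall x, D x -> phi x = 1 &
      supp phi `\` D `<=` Omega `\` S].

Definition line_integral (R : realType) (Omega : set (R * R))
    (A : R * R -> 'M[R]_2) (gamma : R -> R * R) (D : set (R * R))
    (phi : R * R -> R) : 'cV[R]_2 :=
  - sgn_curve gamma D *: curl_pairing Omega A phi.

(* The class C_eps(Omega). *)
Definition admissible (R : realType) (tau eps : R) (Omega : set (R * R))
    (A : R * R -> 'M[R]_2) (S : set (R * R)) : Prop :=
  [/\ L1_field Omega A,
      (exists2 C : set (R * R), closed C & S = Omega `&` C),
      supp_curl Omega A `<=` S &
      forall (gamma : R -> R * R) (D : set (R * R)) (phi : R * R -> R),
        simple_closed_curve gamma -> rectifiable gamma ->
        trace_curve gamma `<=` Omega `\` S ->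
        interior_domain Omega gamma D -> cutoff Omega S D phi ->
        exists z : 'cV[int]_2,
          line_integral Omega A gamma D phi
            = (tau * eps) *: map_mx (fun m : int => m%:~R) z].

Definition tube (R : realType) (Omega : set (R * R)) (r : R)
    (S : set (R * R)) : set (R * R) :=
  [set x | Omega x /\ (dist_set (@enorm R) x S < r%:E)%E].

(* The calligraphic F_eps(A, S; Omega). *)
Definition energy (R : realType) (lam eps : R) (A : R * R -> 'M[R]_2)
    (S Omega : set (R * R)) : \bar R :=
  (\int[leb2 R]_(x in Omega `\` tube Omega (lam * eps) S)
      (dist_set (@frobenius R) (A x) (@SO2 R) ^+ 2)
   + leb2 R (tube Omega (lam * eps) S))%E.

(* F_eps(A, Q). *)
Definition reduced_energy (R : realType) (lam tau eps : R)
    (A : R * R -> 'M[R]_2) (Q : set (R * R)) : \bar R :=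
  ((eps^-1)%:E *
   ereal_inf [set energy lam eps A S Q | S in admissible tau eps Q A])%E.

Definition interface (R : realType) (Rm Rp : 'M[R]_2) (x : R * R) : 'M[R]_2 :=
  if x.1 < 0 then Rm else Rp.

Definition outside_tube (R : realType) (Omega : set (R * R)) (r : R)
    (A : R * R -> 'M[R]_2) (S : set (R * R)) (x : R * R) : 'M[R]_2 :=
  \1_(Omega `\` tube Omega r S) x *: A x.

Definition psi0 (R : realType) (lam tau : R) (Rm Rp : 'M[R]_2) : \bar R :=
  let Q := open_square (2^-1 : R) in
  ereal_inf [set l | exists (A : R -> R * R -> 'M[R]_2)
                            (S : R -> set (R * R)),
    [/\ forall eps, 0 < eps -> admissible tau eps Q (A eps) (S eps),
        cvg_L1 Q (fun eps => outside_tube Q (lam * eps) (A eps) (S eps))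
               (interface Rm Rp) &
        l = limf_einf (fun eps : R =>
              ((eps^-1)%:E * energy lam eps (A eps) (S eps) Q)%E) 0^'+]].

(* Main.v *)
Require Import Defs.
From mathcomp Require Import all_boot all_order all_algebra.
From mathcomp Require Import all_classical all_reals all_analysis.
From mathcomp Require Import measurable_realfun.
From mathcomp Require Import ring lra zify.
Set Implicit Arguments.
Unset Strict Implicit.
Unset Printing Implicit Defensive.
Import Order.TTheory GRing.Theory Num.Theory.
Import numFieldNormedType.Exports.
Local Open Scope classical_set_scope.
Local Open Scope ring_scope.

(** The interface is invariant under dilations and under translations along its
    axis, and this is why the optimal energy can be reached in the limit by
    fields equal to the interface away from the axis. Take a pair (A, S) that is
    nearly optimal at one small scale e on the unit square. Modify A across two
    thin vertical strips so that it becomes the interface beyond them; shrink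
    the result by a factor rho, and stack about 1 / rho copies along the axis.
    Each copy carries rho^2 times the energy of the tile, so the stack carries rho
    times it, as is right at the scale rho e; and the stack equals the interface
    at distance rho from the axis. Hence one competitor at one scale yields
    competitors at all smaller scales (localisation), and a diagonal choice
    (diagonal) gives the upper bound. For the lower bound, the fields so obtained
    with nearly optimal singular sets compete in the infimum that defines the
    optimal energy (reduced_energy_lower).

    Two things have to be paid for. The first is that the modified field be
    admissible. Circuits are unsuited to gluing, so the circuit condition is
    dualised: an admissible field pairs, row by row, into the lattice tau eps Z
    with every test function that is locally constant and integer-valued near
    S, and conversely (lattice_of_admissible, admissible_of_lattice). The
    direct part rests on a combinatorial fact, that a finite union of grid cells
    is built from insides of simple cycles of its boundary (grid_induction).
    In the dual form the gluing is an integration by parts. The strips are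
    divided into cells; in a cell the deviation a of a row from the interface is
    replaced by phi a + phi' (g + c) e_1, where phi is the cut-off, g the
    vertical primitive of the second entry of a, and c a free constant. The
    boundaries between cells and the cells meeting the tube around S are
    added to the singular set. The constants c adjust the circulations along the
    axis: a test function without increments across the cells vanishes near all
    the added singular set, and pairs with the glued field as another one does
    with A (tile_pairing_lattice); the general case follows from a statement on
    functionals modulo a lattice (hom_extension). Only the classes of the c
    modulo tau e matter, so they are at most tau e.

    The second is the energy of the welds, which must be small compared to e.
    The strips have width K e and the cells height of order M e, so the constants
    cost about (tau e / K e)^2 K e = tau^2 e / K, and the added slits about
    e K / M. The other costs are the squared deviation from the interface in the
    strips and the area of the cells meeting the tube; there are about 1 / e
    disjoint places for the strips, and in the cheapest of them (cheap_strip)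
    these costs are of order e times quantities that vanish with e. Indeed the
    squared deviation is at most the squared distance to the rotations plus a
    term linear in the deviation (frob2_le_dist2). *)

(** * Smooth functions on the plane *)

Section Smooth.
Variable R : realType.
Implicit Types (f g : R * R -> R) (n : nat).

Definition smooth f := forall n, Cn n f.

Lemma CnW n f : Cn n.+1 f -> Cn n f.
Proof.
elim: n f => [|n IH] f; first by case.
case=> cf df d1 d2.
by split; [exact: cf|exact: df|exact (IH _ d1)|exact (IH _ d2)].
Qed.

(** An affine map that sends the direction v to w carries difference quotients
    to difference quotients, so derivability and derivatives transfer with no
    differentiability hypothesis. *)
Lemma derive_comp_affine (U V W : normedModType R) (f : V -> W)
    (L : U -> V) (a v : U) (w : V) :
  (forall h : R, L (h *: v + a) = h *: w + L a) ->
  ('D_v (f \o L) a = 'D_w f (L a)) *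
  (derivable (f \o L) a v = derivable f (L a) w).
Proof.
move=> HL.
have E : (fun h : R => h^-1 *: (((f \o L) \o shift a) (h *: v) - (f \o L) a)) =
  (fun h : R => h^-1 *: ((f \o shift (L a)) (h *: w) - f (L a))).
  by apply/funext => h /=; rewrite HL.
by split; rewrite /derive /derivable E.
Qed.

Lemma derive_line1 f x :
  ('D_(1, 0) f x = 'D_1 (fun s => f (s, x.2)) x.1) *
  (derivable f x (1, 0) = derivable (fun s => f (s, x.2)) x.1 1).
Proof.
case: x => a b.
have HL (h : R) : (h *: (1 : R^o) + a, b) = h *: ((1, 0) : R * R) + (a, b).
  by congr pair; rewrite /= scaler0 add0r.
have [E1 E2] := @derive_comp_affine R^o (R * R)%type R f (fun s => (s, b)) a 1 (1, 0) HL.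
by split; [exact: esym E1|exact: esym E2].
Qed.

Lemma derive_line2 f x :
  ('D_(0, 1) f x = 'D_1 (fun s => f (x.1, s)) x.2) *
  (derivable f x (0, 1) = derivable (fun s => f (x.1, s)) x.2 1).
Proof.
case: x => a b.
have HL (h : R) : (a, h *: (1 : R^o) + b) = h *: ((0, 1) : R * R) + (a, b).
  by congr pair; rewrite /= scaler0 add0r.
have [E1 E2] := @derive_comp_affine R^o (R * R)%type R f (fun s => (a, s)) b 1 (0, 1) HL.
by split; [exact: esym E1|exact: esym E2].
Qed.

Lemma Cn_cst n (c : R) : Cn n (fun _ : R * R => c).
Proof.
elim: n c => [|n IH] c; first exact: cst_continuous.
split; [exact: cst_continuous|by move=> x; split; exact: derivable_cst|..].
- by rewrite (_ : partial1 _ = fun=> 0) //; apply/funext => x; rewrite /partial1 derive_cst.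
- by rewrite (_ : partial2 _ = fun=> 0) //; apply/funext => x; rewrite /partial2 derive_cst.
Qed.

Lemma partial1D f g : (forall x, derivable f x (1, 0)) ->
  (forall x, derivable g x (1, 0)) ->
  partial1 (fun x => f x + g x) = fun x => partial1 f x + partial1 g x.
Proof. by move=> df dg; apply/funext => x; rewrite /partial1 deriveD. Qed.

Lemma partial2D f g : (forall x, derivable f x (0, 1)) ->
  (forall x, derivable g x (0, 1)) ->
  partial2 (fun x => f x + g x) = fun x => partial2 f x + partial2 g x.
Proof. by move=> df dg; apply/funext => x; rewrite /partial2 deriveD. Qed.

Lemma partial1M f g : (forall x, derivable f x (1, 0)) ->
  (forall x, derivable g x (1, 0)) ->
  partial1 (fun x => f x * g x) = fun x => f x * partial1 g x + partial1 f x * g x.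
Proof.
move=> df dg; apply/funext => x; rewrite /partial1 deriveM//=.
by congr (_ + _); rewrite mulrC.
Qed.

Lemma partial2M f g : (forall x, derivable f x (0, 1)) ->
  (forall x, derivable g x (0, 1)) ->
  partial2 (fun x => f x * g x) = fun x => f x * partial2 g x + partial2 f x * g x.
Proof.
move=> df dg; apply/funext => x; rewrite /partial2 deriveM//=.
by congr (_ + _); rewrite mulrC.
Qed.

Lemma CnD n f g : Cn n f -> Cn n g -> Cn n (fun x => f x + g x).
Proof.
elim: n f g => [|n IH] f g.
  by move=> cf cg x; apply: continuousD; [exact: cf|exact: cg].
move=> [cf df d1f d2f] [cg dg d1g d2g]; split.
- by move=> x; apply: continuousD; [exact: cf|exact: cg].
- move=> x; have [f1 f2] := df x; have [g1 g2] := dg x.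
  by split; [exact: (derivableD f1 g1)|exact: (derivableD f2 g2)].
- by rewrite partial1D; [exact: IH|move=> x; case: (df x)|move=> x; case: (dg x)].
- by rewrite partial2D; [exact: IH|move=> x; case: (df x)|move=> x; case: (dg x)].
Qed.

Lemma CnM n f g : Cn n f -> Cn n g -> Cn n (fun x => f x * g x).
Proof.
elim: n f g => [|n IH] f g.
  by move=> cf cg x; apply: continuousM; [exact: cf|exact: cg].
move=> Cf Cg; have [cf df d1f d2f] := Cf; have [cg dg d1g d2g] := Cg; split.
- by move=> x; apply: continuousM; [exact: cf|exact: cg].
- move=> x; have [f1 f2] := df x; have [g1 g2] := dg x.
  by split; [exact: (derivableM f1 g1)|exact: (derivableM f2 g2)].
- rewrite partial1M; [|by move=> x; case: (df x)|by move=> x; case: (dg x)].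
  by apply: CnD; apply: IH => //; exact: CnW.
- rewrite partial2M; [|by move=> x; case: (df x)|by move=> x; case: (dg x)].
  by apply: CnD; apply: IH => //; exact: CnW.
Qed.

Lemma near_derive (f g : R * R -> R) x v : (\forall y \near x, f y = g y) ->
  derivable f x v -> derivable g x v /\ 'D_v f x = 'D_v g x.
Proof.
move=> fg df; split; last exact: near_eq_derive.
by apply: near_eq_derivable df.
Qed.

Lemma near_continuous_at (f g : R * R -> R) (x : R * R) :
  (\forall y \near x, f y = g y) -> f @ x --> f x -> g @ x --> g x.
Proof.
move=> fg; have <- : f x = g x by exact: nbhs_singleton fg.
by apply: cvg_trans; apply: near_eq_cvg.
Qed.

(** Smoothness is local: this is what allows a smooth function to be truncated
    where it vanishes. *)
Lemma Cn_local n g : (forall x : R * R, exists2 f, Cn n f & \forall y \near x, f y = g y) ->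
  Cn n g.
Proof.
elim: n g => [|n IH] g H.
  move=> x; have [f cf fg] := H x.
  exact: near_continuous_at fg (cf x).
split.
- move=> x; have [f [cf _ _ _] fg] := H x.
  exact: near_continuous_at fg (cf x).
- move=> x; have [f [_ df _ _] fg] := H x; have [d1 d2] := df x.
  by split; [exact: (near_derive fg d1).1|exact: (near_derive fg d2).1].
- apply: IH => x; have [f [_ df d1 _] fg] := H x; exists (partial1 f) => //.
  have := near_join fg; apply: filterS => y fgy.
  by apply: (near_derive fgy (df y).1).2.
- apply: IH => x; have [f [_ df _ d2] fg] := H x; exists (partial2 f) => //.
  have := near_join fg; apply: filterS => y fgy.
  by apply: (near_derive fgy (df y).2).2.
Qed.

Lemma continuous_fst (f : R -> R) : continuous f ->
  continuous (fun x : R * R => f x.1).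
Proof.
move=> cf x; apply: (@cvg_comp _ _ _ fst f _ (nbhs x.1)); last exact: cf.
exact: cvg_fst.
Qed.

Lemma continuous_snd (f : R -> R) : continuous f ->
  continuous (fun x : R * R => f x.2).
Proof.
move=> cf x; apply: (@cvg_comp _ _ _ snd f _ (nbhs x.2)); last exact: cf.
exact: cvg_snd.
Qed.

(** The one-variable analogue of Cn: the functions used below are products of
    functions of one coordinate, whose regularity is lifted by C1n_tensor1 and
    C1n_tensor2. *)
Fixpoint C1n (n : nat) (f : R -> R) : Prop :=
  if n is m.+1 then
    [/\ continuous f, forall x, derivable f x 1 & C1n m (fun x => 'D_1 f x)]
  else continuous f.

Lemma C1n_tensor1 n (f : R -> R) : C1n n f -> Cn n (fun x : R * R => f x.1).
Proof.
elim: n f => [|n IH] f.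
  by move=> cf; exact: continuous_fst.
move=> [cf df d1]; split.
- exact: continuous_fst.
- move=> x; rewrite (derive_line1 _ x).2 (derive_line2 _ x).2; split.
    exact (df x.1).
  exact: (@derivable_cst _ _ _ (f x.1) x.2 1).
- rewrite (_ : partial1 _ = fun x => 'D_1 f x.1); first exact (IH _ d1).
  by apply/funext => x; rewrite /partial1 derive_line1.
- rewrite (_ : partial2 _ = fun x => 0); first exact: Cn_cst.
  by apply/funext => x; rewrite /partial2 derive_line2; exact: (@derive_cst _ _ _ (f x.1) x.2 1).
Qed.

Lemma C1n_tensor2 n (f : R -> R) : C1n n f -> Cn n (fun x : R * R => f x.2).
Proof.
elim: n f => [|n IH] f.
  by move=> cf; exact: continuous_snd.
move=> [cf df d1]; split.
- exact: continuous_snd.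
- move=> x; rewrite (derive_line1 _ x).2 (derive_line2 _ x).2; split.
    exact: (@derivable_cst _ _ _ (f x.2) x.1 1).
  exact (df x.2).
- rewrite (_ : partial1 _ = fun x => 0); first exact: Cn_cst.
  by apply/funext => x; rewrite /partial1 derive_line1; exact: (@derive_cst _ _ _ (f x.2) x.1 1).
- rewrite (_ : partial2 _ = fun x => 'D_1 f x.2); first exact (IH _ d1).
  by apply/funext => x; rewrite /partial2 derive_line2.
Qed.

End Smooth.

(** * A smooth step *)

Section Smooth1.
Variable R : realType.
Implicit Types (f g : R -> R) (n : nat).

Lemma C1nW n f : C1n n.+1 f -> C1n n f.
Proof.
elim: n f => [|n IH] f; first by case.
by case=> cf df d1; split; [exact: cf|exact: df|exact (IH _ d1)].
Qed.

Lemma C1n_cont n f : C1n n f -> continuous f.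
Proof. by case: n => [//|n] []. Qed.

Lemma C1n_cst n (c : R) : C1n n (fun=> c).
Proof.
elim: n c => [|n IH] c; first exact: cst_continuous.
split; [exact: cst_continuous|by move=> x; exact: (@derivable_cst _ _ _ c x 1)|].
have E : (fun x : R => 'D_1 (fun _ : R => c) x) = (fun=> 0).
  by apply/funext => x; exact: (@derive_cst _ _ _ c x 1).
exact (eq_ind_r (C1n n) (IH 0) E).
Qed.

Lemma C1nD n f g : C1n n f -> C1n n g -> C1n n (fun x => f x + g x).
Proof.
elim: n f g => [|n IH] f g.
  by move=> cf cg x; apply: continuousD; [exact: cf|exact: cg].
move=> [cf df d1f] [cg dg d1g]; split.
- by move=> x; apply: continuousD; [exact: cf|exact: cg].
- by move=> x; exact: (derivableD (df x) (dg x)).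
- rewrite (_ : (fun x => _) = fun x => 'D_1 f x + 'D_1 g x); first exact (IH _ _ d1f d1g).
  by apply/funext => x; exact: (deriveD (df x) (dg x)).
Qed.

Lemma C1nM n f g : C1n n f -> C1n n g -> C1n n (fun x => f x * g x).
Proof.
elim: n f g => [|n IH] f g.
  by move=> cf cg x; apply: continuousM; [exact: cf|exact: cg].
move=> Cf Cg; have [cf df d1f] := Cf; have [cg dg d1g] := Cg; split.
- by move=> x; apply: continuousM; [exact: cf|exact: cg].
- by move=> x; exact: (derivableM (df x) (dg x)).
- rewrite (_ : (fun x => _) = fun x => f x * 'D_1 g x + g x * 'D_1 f x).
    by apply: C1nD; apply: IH => //; exact: C1nW.
  by apply/funext => x; exact: (deriveM (df x) (dg x)).
Qed.

Lemma C1nV n f : (forall x, f x != 0) -> C1n n f -> C1n n (fun x => (f x)^-1).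
Proof.
move=> f0; elim: n => [|n IH].
  by move=> cf x; apply: continuousV; [exact: f0|exact: cf].
move=> Cf; have [cf df d1f] := Cf; split.
- by move=> x; apply: continuousV; [exact: f0|exact: cf].
- by move=> x; exact: (derivableV (f0 x) (df x)).
- rewrite (_ : (fun x => _) = fun x => -1 * ((f x)^-1 * (f x)^-1) * 'D_1 f x).
    have IHf := IH (C1nW Cf).
    apply: C1nM => //; apply: C1nM; first exact: C1n_cst.
    exact: C1nM.
  apply/funext => x; rewrite (deriveV (f0 x) (df x)).
  by rewrite /GRing.scale/= mulN1r -exprVn expr2.
Qed.

Lemma derive_affine f (a b x : R) : derivable f (a * x + b) 1 ->
  is_derive x 1 (fun x => f (a * x + b)) ('D_1 f (a * x + b) * a).
Proof.
move=> df.
have H : is_derive x 1 (fun x : R => a * x + b) a.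
  have H1 := is_deriveD (is_deriveZ a (is_derive_id x (1:R))) (is_derive_cst b x (1 : R)).
  by apply: (is_derive_eq H1); rewrite addr0 /GRing.scale/= mulr1.
have H2 : is_derive (a * x + b) 1 f ('D_1 f (a * x + b)) by exact: DeriveDef.
exact: (@is_derive1_comp R f (fun x => a * x + b) x _ _ H2 H).
Qed.

Lemma C1n_affine n f (a b : R) : C1n n f -> C1n n (fun x => f (a * x + b)).
Proof.
elim: n f => [|n IH] f.
  move=> cf x; apply: (@continuous_comp _ _ _ (fun x : R => a * x + b) f).
    by apply: continuousD; [apply: mulrl_continuous|exact: cst_continuous].
  exact: cf.
move=> [cf df d1f]; split.
- move=> x; apply: (@continuous_comp _ _ _ (fun x : R => a * x + b) f).
    by apply: continuousD; [apply: mulrl_continuous|exact: cst_continuous].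
  exact: cf.
- by move=> x; have [] := derive_affine (df (a * x + b)).
- rewrite (_ : (fun x => _) = fun x => 'D_1 f (a * x + b) * a).
    by apply: C1nM; [exact: IH _ d1f|exact: C1n_cst].
  by apply/funext => x; have [_ ->] := derive_affine (df (a * x + b)).
Qed.

(** The functions [x^-k exp(-1/x)], extended by 0, are closed under
    differentiation up to linear combinations, hence smooth. *)
Definition flat_exp (k : nat) (x : R) : R :=
  if 0 < x then x ^- k * expR (- x^-1) else 0.

Lemma flat_exp_ge0 k x : 0 <= flat_exp k x.
Proof.
rewrite /flat_exp; case: ifPn => // x0.
by rewrite mulr_ge0 ?expR_ge0// invr_ge0 exprn_ge0// ltW.
Qed.

(** With y = 1/x, this is y^(k+1) <= (k+1)! exp y. *)
Lemma flat_exp_le k x : 0 < x -> flat_exp k x <= (k.+1)`!%:R * x.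
Proof.
move=> x0; rewrite /flat_exp x0 expRN.
have y0 : 0 < x^-1 by rewrite invr_gt0.
have H := expR_ge1Dxn k (ltW y0).
have E0 : 0 < expR x^-1 by exact: expR_gt0.
rewrite ler_pdivrMr//.
have F0 : 0 < (k.+1)`!%:R :> R by rewrite ltr0n fact_gt0.
have : x^-1 ^+ k.+1 / k.+1`!%:R <= expR x^-1 by apply: le_trans H; rewrite lerDr.
rewrite ler_pdivrMr// => H2.
have -> : (k.+1)`!%:R * x * expR x^-1 = x * (expR x^-1 * (k.+1)`!%:R) by ring.
apply: le_trans (_ : x * (x^-1 ^+ k.+1) <= _); last by rewrite ler_pM2l.
by rewrite exprS mulrA divff ?gt_eqF// mul1r exprVn.
Qed.

Lemma flat_exp0 k : flat_exp k 0 = 0.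
Proof. by rewrite /flat_exp ltxx. Qed.

Lemma flat_exp_norm_le k x : `|flat_exp k x| <= (k.+1)`!%:R * `|x|.
Proof.
have F0 : 0 <= (k.+1)`!%:R :> R by rewrite ler0n.
rewrite ger0_norm ?flat_exp_ge0//.
have [x0|x0] := ltP 0 x; first by rewrite gtr0_norm//; exact: flat_exp_le.
by rewrite /flat_exp ltNge x0/= mulr_ge0.
Qed.

Lemma flat_exp_cvg0 k : flat_exp k x @[x --> 0] --> 0.
Proof.
apply/cvgrPdist_lt => e e0.
have F0 : 0 < (k.+1)`!%:R :> R by rewrite ltr0n fact_gt0.
near=> x.
rewrite sub0r normrN (le_lt_trans (flat_exp_norm_le _ _))//.
rewrite mulrC -ltr_pdivlMr//.
near: x.
have e1 : 0 < e / (k.+1)`!%:R by rewrite divr_gt0.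
exact: (@nbhs0_lt _ R^o _ e1).
Unshelve. all: by end_near. Qed.

(** Only the origin is delicate: there the difference quotient is the next
    function of the family, which tends to 0. *)
Lemma is_derive_flat_exp (k : nat) (x : R) :
  is_derive x 1 (flat_exp k) (flat_exp k.+2 x - k%:R * flat_exp k.+1 x).
Proof.
have [x0|x0|x0] := ltgtP x 0.
- rewrite /flat_exp !ltNge !(ltW x0)/= mulr0 subr0.
  have H : {near x, (fun=> 0 : R) =1 flat_exp k}.
    near=> y; rewrite /flat_exp ltNge (_ : y <= 0)//.
    by near: y; exact: lt_le_nbhsl.
  by apply: (near_eq_is_derive H); exact: is_derive_cst.
- have H : {near x, (fun y => y ^- k * expR (- y^-1)) =1 flat_exp k}.
    near=> y; rewrite /flat_exp (_ : 0 < y)//.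
    by near: y; exact: lt_nbhsr.
  apply: (near_eq_is_derive H).
  have xn0 : x != 0 by rewrite gt_eqF.
  have H1 : is_derive x 1 (fun y : R => y^-1) (- x ^- 2 *: 1).
    exact: (@is_deriveV _ id x 1 1 xn0 (is_derive_id _ _)).
  have H2 : is_derive x 1 (fun y : R => - y^-1) (- (- x ^- 2 *: 1)).
    exact: is_deriveN.
  have H3 := @is_derive1_comp R expR (fun y : R => - y^-1) x _ _ (is_derive_expR (- x^-1)) H2.
  have H4 : is_derive x 1 (fun y : R => (y^-1) ^+ k) (k%:R * (x^-1) ^+ k.-1 *: (- x ^- 2 *: 1)).
    have := @is_deriveX _ _ (fun y : R => y^-1) k x 1 _ H1.
    by rewrite exprfctE => H5; exact H5.
  have := is_deriveM H4 H3.
  rewrite (_ : (fun y => y ^- k * _) = (fun y => y^-1 ^+ k) * (expR \o (fun y => - y^-1))); last first.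
    by apply/funext => y/=; rewrite -exprVn.
  move=> H5; apply: (is_derive_eq H5).
  rewrite /flat_exp x0 /GRing.scale/= !mulr1 opprK -!exprVn.
  by case: (k) => [|j]; rewrite /= ?exprS; ring.
- subst x; rewrite !flat_exp0 mulr0 subr0.
  have H : (h^-1 *: ((flat_exp k \o shift 0) (h *: 1) - flat_exp k 0)) @[h --> 0^'] --> 0.
    rewrite flat_exp0.
    apply: (@cvg_trans _ (flat_exp k.+1 h @[h --> 0^'])).
      apply: near_eq_cvg; near=> h.
      rewrite subr0 /= addr0 /GRing.scale/= mulr1 /flat_exp.
      case: ifPn => _; last by rewrite mulr0.
      by rewrite exprS invfM mulrA.
    by apply: cvg_within_filter; exact: flat_exp_cvg0.
  apply: DeriveDef; first by apply/cvg_ex; exists 0.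
  exact: cvg_lim H.
Unshelve. all: by end_near. Qed.

Lemma C1n_flat_exp n k : C1n n (flat_exp k).
Proof.
elim: n k => [|n IH] k.
  move=> x; apply: differentiable_continuous; apply/derivable1_diffP.
  by have [] := is_derive_flat_exp k x.
split.
- move=> x; apply: differentiable_continuous; apply/derivable1_diffP.
  by have [] := is_derive_flat_exp k x.
- by move=> x; have [] := is_derive_flat_exp k x.
- rewrite (_ : (fun x => _) = fun x => flat_exp k.+2 x + (- k%:R) * flat_exp k.+1 x).
    by apply: C1nD => //; apply: C1nM => //; exact: C1n_cst.
  by apply/funext => x; have [_ ->] := is_derive_flat_exp k x; rewrite mulNr.
Qed.

(** A smooth transition from 0 on the negative half-line to 1 beyond 1; the
    denominator never vanishes because x and 1 - x are not both nonpositive. *)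
Definition smooth_step (x : R) : R :=
  flat_exp 0 x / (flat_exp 0 x + flat_exp 0 (1 - x)).

Lemma flat_exp_gt0 k x : 0 < x -> 0 < flat_exp k x.
Proof.
by move=> x0; rewrite /flat_exp x0 mulr_gt0 ?expR_gt0// invr_gt0 exprn_gt0.
Qed.

Lemma flat_exp_le0 k x : x <= 0 -> flat_exp k x = 0.
Proof. by move=> x0; rewrite /flat_exp ltNge x0. Qed.

Lemma smooth_step_den x : 0 < flat_exp 0 x + flat_exp 0 (1 - x).
Proof.
have [x0|x0] := ltP 0 x; first by rewrite ltr_pwDl ?flat_exp_gt0 ?flat_exp_ge0.
by rewrite ltr_wpDl ?flat_exp_gt0 ?flat_exp_ge0//; lra.
Qed.

Lemma smooth_step_le0 x : x <= 0 -> smooth_step x = 0.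
Proof. by move=> x0; rewrite /smooth_step flat_exp_le0// mul0r. Qed.

Lemma smooth_step_ge1 x : 1 <= x -> smooth_step x = 1.
Proof.
move=> x1; rewrite /smooth_step [flat_exp 0 (1 - x)]flat_exp_le0; last lra.
by rewrite addr0 divff// gt_eqF// flat_exp_gt0//; lra.
Qed.

Lemma smooth_step_ge0 x : 0 <= smooth_step x.
Proof. by rewrite divr_ge0 ?flat_exp_ge0// ltW// smooth_step_den. Qed.

Lemma smooth_step_le1 x : smooth_step x <= 1.
Proof. by rewrite ler_pdivrMr ?smooth_step_den// mul1r lerDl flat_exp_ge0. Qed.

Lemma C1n_smooth_step n : C1n n smooth_step.
Proof.
apply: C1nM; first exact: C1n_flat_exp.
apply: C1nV; first by move=> x; rewrite gt_eqF// smooth_step_den.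
apply: C1nD; first exact: C1n_flat_exp.
rewrite (_ : (fun x => _) = fun x => flat_exp 0 ((-1) * x + 1)).
  exact/C1n_affine/C1n_flat_exp.
by apply/funext => x; congr flat_exp; ring.
Qed.

Lemma derivable_smooth_step x : derivable smooth_step x 1.
Proof. have [_ d _] := C1n_smooth_step 1; exact (d x). Qed.

Lemma continuous_D_smooth_step : continuous (fun x => 'D_1 smooth_step x).
Proof. by have [_ _] := C1n_smooth_step 1. Qed.

Lemma D_smooth_step_out x : x < 0 \/ 1 < x -> 'D_1 smooth_step x = 0.
Proof.
case=> hx.
- have H : {near x, (fun=> 0 : R) =1 smooth_step}.
    near=> y; rewrite smooth_step_le0//.
    by near: y; exact: lt_le_nbhsl.
  by rewrite -(near_eq_derive _ H)//; exact: (@derive_cst _ _ _ (0 : R) x 1).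
- have H : {near x, (fun=> 1 : R) =1 smooth_step}.
    near=> y; rewrite smooth_step_ge1// ltW//.
    by near: y; exact: lt_nbhsr.
  by rewrite -(near_eq_derive _ H)//; exact: (@derive_cst _ _ _ (1 : R) x 1).
Unshelve. all: by end_near. Qed.

(** The derivative is continuous and vanishes outside [0, 1]. *)
Lemma D_smooth_step_bounded : exists2 C : R, 0 < C & forall x, `|'D_1 smooth_step x| <= C.
Proof.
have cD : {within `[0, 1], continuous (fun x : R => `|'D_1 smooth_step x|)}.
  apply: continuous_subspaceT => x.
  by apply: cvg_norm; exact: continuous_D_smooth_step.
have [c _ Hc] := EVT_max (@ler01 R) cD.
exists (`|'D_1 smooth_step c| + 1); first by rewrite ltr_wpDl.
move=> x; have [x0|x0] := ltP x 0.
  by rewrite D_smooth_step_out ?normr0 ?addr_ge0//; left.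
have [x1|x1] := ltP 1 x.
  by rewrite D_smooth_step_out ?normr0 ?addr_ge0//; right.
by apply: (le_trans (Hc x _)); rewrite ?lerDl// in_itv/= x0 x1.
Qed.

End Smooth1.

(** * Boundaries of unions of grid cells *)

Section GridCycles.
Local Open Scope nat_scope.
Implicit Types (E D : nat -> nat -> bool) (c : seq (nat * nat)) (i j n : nat).

(** A union of cells of the square grid is a predicate E on pairs of indices;
    its edges are the places where E changes. The edge from (i, j) to
    (i, j + 1) separates the cells (i - 1, j) and (i, j); with the truncated
    predecessor, the border of the grid carries no edge. *)
Definition vedge E i j := E i.-1 j (+) E i j.
Definition hedge E i j := E i j.-1 (+) E i j.
Definition in_box n E := forall i j, E i j -> (0 < i < n) && (0 < j < n).

Definition vertex_box n (p : nat * nat) := (0 < p.1 <= n) && (0 < p.2 <= n).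

Definition unit_step (p q : nat * nat) :=
  [|| q == (p.1, p.2.+1), q == (p.1.+1, p.2), p == (q.1.+1, q.2) | p == (q.1, q.2.+1)].

Definition grid_cycle n c :=
  [/\ uniq c, 2 < size c, {in c, forall p, vertex_box n p} &
      {in c, forall p, unit_step p (next c p)}].

Definition cycle_edge c (p q : nat * nat) :=
  (p \in c) && ((next c p == q) || (prev c p == q)).
Definition cycle_vedge c i j := cycle_edge c (i, j) (i, j.+1).
Definition cycle_hedge c i j := cycle_edge c (i, j) (i.+1, j).

(** Cell (i, j) is inside a cycle when the horizontal ray arriving from the
    left crosses the vertical edges of the cycle an odd number of times. *)
Fixpoint inside c i j : bool :=
  if i is i'.+1 then inside c i' j (+) cycle_vedge c i j else false.

Lemma cycle_edge_sym c p q : uniq c -> cycle_edge c p q = cycle_edge c q p.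
Proof.
move=> uc; suff H : forall p q, cycle_edge c p q -> cycle_edge c q p.
  by apply/idP/idP; exact: H.
move=> {}p {}q /andP[pc] /orP[]/eqP <-; rewrite /cycle_edge.
  by rewrite mem_next pc prev_next// eqxx orbT.
by rewrite mem_prev pc next_prev// eqxx.
Qed.

Lemma cycle_edge_mem c p q : cycle_edge c p q -> (p \in c) && (q \in c).
Proof.
by case/andP=> pc /orP[]/eqP <-; rewrite ?mem_next ?mem_prev pc.
Qed.

Lemma next_neq_prev c p : uniq c -> 2 < size c -> p \in c -> next c p != prev c p.
Proof.
move=> uc sc pc; apply/eqP => E.
have := @rot_to _ c p pc; case=> k c' Ec.
have uc' : uniq (p :: c') by rewrite -Ec rot_uniq.
have sc' : 2 < size (p :: c') by rewrite -Ec size_rot.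
move: E; rewrite -(next_rot k uc) -(prev_rot k uc) Ec.
case: c' Ec uc' sc' => [//|q [//|r c']] Ec uc' _.
have H : prev [:: p, q, r & c'] p = last r c'.
  move: uc'; rewrite /= !inE !negb_or -!andbA => /and5P[pq pr pc' _ _].
  rewrite (negPf pq) (negPf pr).
  elim: c' r pr pc' {Ec} => [|s c' IH] r pr pc' /=; first by rewrite eqxx.
  move: pc'; rewrite inE negb_or => /andP[ps pc'].
  by rewrite (negPf ps); exact: IH.
rewrite H /= eqxx => E.
have : q \in r :: c' by rewrite E mem_last.
by move: uc'; rewrite /= => /and3P[_ /negP].
Qed.

(** A vertex of a cycle carries exactly two of its edges, next and prev, and
    every other vertex carries none. *)
Lemma vertex_parity c n i j : grid_cycle n c ->
  cycle_hedge c i j.+1 (+) cycle_vedge c i.+1 j (+) cycle_vedge c i.+1 j.+1 =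
  cycle_hedge c i.+1 j.+1.
Proof.
move=> [uc sc cb cs]; rewrite /cycle_hedge /cycle_vedge.
rewrite (cycle_edge_sym (i, j.+1) _ uc) (cycle_edge_sym (i.+1, j) _ uc).
have [uin|unin] := boolP ((i.+1, j.+1) \in c); last by rewrite /cycle_edge (negPf unin).
have := next_neq_prev uc sc uin.
have := cs _ uin.
have := cs (prev c (i.+1, j.+1)); rewrite mem_prev next_prev// => /(_ uin).
rewrite /cycle_edge uin /=.
case: (prev c _) => b1 b2; case: (next c _) => a1 a2.
rewrite /unit_step /= !xpair_eqE.
have n1 k : (k == k.+1) = false by lia.
have n2 k : (k.+1 == k) = false by lia.
have n3 k : (k == k.+2) = false by lia.
have n4 k : (k.+2 == k) = false by lia.
move=> Hb.
have {Hb} : [|| (b1 == i.+1) && (b2 == j), (b1 == i) && (b2 == j.+1),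
    (b1 == i.+2) && (b2 == j.+1) | (b1 == i.+1) && (b2 == j.+2)] by move: Hb; lia.
case/or4P => /andP[/eqP-> /eqP->] Ha;
have {Ha} : [|| (a1 == i.+1) && (a2 == j.+2), (a1 == i.+2) && (a2 == j.+1),
    (a1 == i) && (a2 == j.+1) | (a1 == i.+1) && (a2 == j)] by move: Ha; lia.
all: by case/or4P => /andP[/eqP-> /eqP->]; rewrite ?eqSS ?eqxx ?n1 ?n2 ?n3 ?n4.
Qed.

(** [inside] changes exactly across the edges of the cycle: across vertical
    ones by construction, across horizontal ones because a vertex of the cycle
    meets an even number of its edges. *)
Lemma vedge_inside n c i j : grid_cycle n c -> vedge (inside c) i j = cycle_vedge c i j.
Proof.
move=> gc; case: i => [|i]; last by rewrite /vedge /= addbA addbb.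
rewrite /vedge addbb; apply/esym/negbTE/negP => /cycle_edge_mem/andP[+ _].
by case: gc => _ _ cb _ /cb; rewrite /vertex_box.
Qed.

Lemma hedge_inside n c i j : grid_cycle n c -> hedge (inside c) i j = cycle_hedge c i j.
Proof.
move=> gc; have [_ _ cb _] := gc.
case: j => [|j].
  rewrite /hedge addbb; apply/esym/negbTE/negP => /cycle_edge_mem/andP[/cb + _].
  by rewrite /vertex_box andbF.
elim: i => [|i IH].
  apply/esym/negbTE/negP => /cycle_edge_mem/andP[/cb + _].
  by rewrite /vertex_box.
rewrite -(vertex_parity i j gc) -IH /hedge /=.
by case: (inside c i j); case: (inside c i j.+1);
  case: (cycle_vedge c i.+1 j); case: (cycle_vedge _ _ _).
Qed.

(** A ray leaving the box on the right has crossed the cycle an even number of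
    times: along the bottom row nothing is crossed, and moving up one row does
    not change the parity beyond the box. *)
Lemma inside_in_box n c : grid_cycle n c -> in_box n (inside c).
Proof.
move=> gc; have [_ _ cb _] := gc.
have H0 j : (j == 0) || (n <= j) -> forall i, inside c i j = false.
  move=> Hj; elim=> [//|i /= ->]; rewrite addFb.
  apply/negP => /cycle_edge_mem/andP[/cb + /cb]; rewrite /vertex_box /=; lia.
have H1 i j : n <= i -> inside c i j = false.
  move=> ni; elim: j => [|j IH]; first exact: H0.
  have := hedge_inside i j.+1 gc; rewrite /hedge /= IH addFb => ->.
  apply/negP => /cycle_edge_mem/andP[_ /cb]; rewrite /vertex_box /=; lia.
move=> i j Dij; apply/andP; split; apply/andP; split.
- by case: i Dij.
- by rewrite ltnNge; apply/negP => /H1 H; rewrite H in Dij.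
- by rewrite lt0n; apply/negP => j0; rewrite H0 ?j0 in Dij.
- by rewrite ltnNge; apply/negP => nj; rewrite H0 ?nj ?orbT in Dij.
Qed.

(** Iterating a self-map of a finite set eventually loops; the first loop is a
    simple cycle. *)
Lemma exists_fcycle (T : eqType) (g : T -> T) (s : seq T) (x : T) :
  x \in s -> {in s, forall y, g y \in s} ->
  exists c : seq T, [/\ uniq c, fcycle g c, 0 < size c & {subset c <= s}].
Proof.
move=> xs gs.
have its n : iter n g x \in s by elim: n => [//|n IH] /=; exact: gs.
have : exists n, looping g x n.
  exists (size s); apply/negPn/negP; rewrite -looping_uniq => /uniq_leq_size => /(_ s).
  rewrite size_traject ltnn => H; have // : false; apply: H.
  by move=> y /trajectP[k _ ->].
move=> ex; case: (ex_minnP ex) => -[|n] ln minn; first by [].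
have un : uniq (traject g x n.+1).
  by rewrite looping_uniq; apply/negP => /minn; rewrite ltnn.
have [k kn Ek] := trajectP ln.
pose m := n - k; pose y := iter k g x.
have Em : iter m.+1 g y = y.
  by rewrite /y -iterD (_ : m.+1 + k = n.+1) ?Ek//; rewrite /m; lia.
exists (traject g y m.+1); split.
- have := un; rewrite (_ : n.+1 = k + m.+1); last by rewrite /m; lia.
  by rewrite trajectD cat_uniq => /and3P[_ _].
- have : path (frel g) y (traject g (g y) m.+1) by exact: fpath_traject.
  by rewrite trajectSr -iterSr Em.
- by rewrite size_traject.
- by move=> z /trajectP[l _ ->]; rewrite /y -iterD.
Qed.

(** The successor of a boundary vertex along an outgoing boundary edge of E,
    oriented with E on its left. Where two cells of E meet only at the vertex
    there are two such edges, and the first in a fixed order is taken. *)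
Definition bnd_next E (p : nat * nat) : nat * nat :=
  let: (i, j) := p in
  let nw := E i.-1 j in let ne := E i j in
  let sw := E i.-1 j.-1 in let se := E i j.-1 in
  if nw && ~~ ne then (i, j.+1) else if ne && ~~ se then (i.+1, j) else
  if sw && ~~ nw then (i.-1, j) else if se && ~~ sw then (i, j.-1) else (i, j).

Definition bnd_vertex E (p : nat * nat) : bool :=
  let: (i, j) := p in
  ~~ [&& E i.-1 j == E i j, E i j == E i j.-1 & E i j.-1 == E i.-1 j.-1].

Arguments bnd_next : simpl never.
Arguments bnd_vertex : simpl never.

Lemma bnd_vertex_box n E p : in_box n E -> bnd_vertex E p -> vertex_box n p.
Proof.
case: p => i j bE; rewrite /bnd_vertex /vertex_box /= => H.
have E0 a b : ~~ ((0 < a < n) && (0 < b < n)) -> E a b = false.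
  by move=> h; apply/negbTE; apply: contra h; exact: bE.
apply/andP; split; apply/andP; split.
- by case: i H => // H; rewrite !E0 ?eqxx in H.
- rewrite leqNgt; apply/negP => h; move: H; rewrite !E0 ?eqxx//; lia.
- by case: j H => // H; rewrite !E0 ?eqxx ?andbF in H.
- rewrite leqNgt; apply/negP => h; move: H; rewrite !E0 ?eqxx//; lia.
Qed.

Variant bnd_next_spec E i j : nat * nat -> Prop :=
| BndN of E i.-1 j & ~~ E i j : bnd_next_spec E i j (i, j.+1)
| BndE of E i j & ~~ E i j.-1 : bnd_next_spec E i j (i.+1, j)
| BndW of E i.-1 j.-1 & ~~ E i.-1 j : bnd_next_spec E i j (i.-1, j)
| BndS of E i j.-1 & ~~ E i.-1 j.-1 : bnd_next_spec E i j (i, j.-1).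

Lemma bnd_nextP E i j : bnd_vertex E (i, j) -> bnd_next_spec E i j (bnd_next E (i, j)).
Proof.
rewrite /bnd_vertex /bnd_next => H.
case: ifP => [/andP[]|h1]; first exact: BndN.
case: ifP => [/andP[]|h2]; first exact: BndE.
case: ifP => [/andP[]|h3]; first exact: BndW.
case: ifP => [/andP[]|h4]; first exact: BndS.
by exfalso; move: H h1 h2 h3 h4; do 4 case: (E _ _).
Qed.

Lemma bnd_next_vertex n E p : in_box n E -> bnd_vertex E p -> bnd_vertex E (bnd_next E p).
Proof.
case: p => i j bE Hp; have := bnd_vertex_box bE Hp; rewrite /vertex_box /=.
case: i Hp => // i; case: j => [|j] Hp; first by case/and3P.
move=> _.
by case: (bnd_nextP Hp) => /= h1 h2; rewrite /bnd_vertex /=; move: h1 h2;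
  do 4 ? case: (E _ _).
Qed.

Lemma bnd_next_neq n E p : in_box n E -> bnd_vertex E p ->
  [/\ bnd_next E p != p, bnd_next E (bnd_next E p) != p & unit_step p (bnd_next E p)].
Proof.
move=> bE Hp; have := bnd_next_vertex bE Hp; case: p Hp => i j Hp.
have := bnd_vertex_box bE Hp; rewrite /vertex_box /unit_step /=.
case: i Hp => // i; case: j => [|j] Hp; first by case/and3P.
move=> _.
have D (b1 b2 b3 : bool) : b1 -> b2 -> b3 -> [/\ b1, b2 & b3] by [].
case: (bnd_nextP Hp) => /= h1 h2 Hq; have := bnd_vertex_box bE Hq; rewrite /vertex_box /=.
- move=> _; apply: D; rewrite ?xpair_eqE; [lia| |lia].
  by case: (bnd_nextP Hq) => /= g1 g2; rewrite ?xpair_eqE; lia.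
- move=> _; apply: D; rewrite ?xpair_eqE; [lia| |lia].
  by case: (bnd_nextP Hq) => /= g1 g2; rewrite ?xpair_eqE; lia.
- case: i Hp h1 h2 Hq => // i Hp h1 h2 Hq _; apply: D; rewrite ?xpair_eqE; [lia| |lia].
  by case: (bnd_nextP Hq) => /= g1 g2; rewrite ?xpair_eqE; lia.
- case: j Hp h1 h2 Hq => [|j] Hp h1 h2 Hq; [by case/and3P|move=> _]; apply: D; rewrite ?xpair_eqE; [lia| |lia].
  by case: (bnd_nextP Hq) => /= g1 g2; rewrite ?xpair_eqE; lia.
Qed.

Lemma bnd_next_edge n E p q : in_box n E -> bnd_vertex E p -> bnd_next E p = q ->
  (q = (p.1, p.2.+1) -> vedge E p.1 p.2) /\ (p = (q.1, q.2.+1) -> vedge E q.1 q.2) /\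
  (q = (p.1.+1, p.2) -> hedge E p.1 p.2) /\ (p = (q.1.+1, q.2) -> hedge E q.1 q.2).
Proof.
move=> bE Hp <- {q}; case: p Hp => i j Hp.
have := bnd_vertex_box bE Hp; rewrite /vertex_box /=.
case: i Hp => // i; case: j => [|j] Hp; first by case/and3P.
move=> _.
rewrite /vedge /hedge; case: (bnd_nextP Hp) => /= h1 h2; do 3 ? split; move=> e;
  rewrite ?h1 ?(negbTE h2) //; exfalso; by case: e; lia.
Qed.

Definition grid_points n : seq (nat * nat) :=
  flatten [seq [seq (a, b) | b <- iota 0 n.+1] | a <- iota 0 n.+1].

Lemma mem_grid_points n (p : nat * nat) : p.1 <= n -> p.2 <= n -> p \in grid_points n.
Proof.
case: p => a b /= an bn; apply/flattenP; exists [seq (a, b) | b <- iota 0 n.+1].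
  by apply/mapP; exists a => //; rewrite mem_iota ltnS.
by apply/mapP; exists b => //; rewrite mem_iota ltnS.
Qed.

(** Follow bnd_next on the finite set of boundary vertices until it loops. *)
Lemma exists_grid_cycle n E i j : in_box n E -> vedge E i j || hedge E i j ->
  exists c, [/\ grid_cycle n c,
    forall i j, cycle_vedge c i j -> vedge E i j &
    forall i j, cycle_hedge c i j -> hedge E i j].
Proof.
move=> bE He.
have Hv : bnd_vertex E (i, j).
  move: He; rewrite /vedge /hedge /bnd_vertex.
  by do 4 case: (E _ _).
pose s := [seq p <- grid_points n | bnd_vertex E p].
have sP p : (p \in s) = bnd_vertex E p.
  rewrite mem_filter; apply/andP/idP => [[]//|Hp]; split=> //.
  have := bnd_vertex_box bE Hp; rewrite /vertex_box => /andP[/andP[_ p1] /andP[_ p2]].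
  exact: mem_grid_points.
have [||c [uc fc sc subc]] := @exists_fcycle _ (bnd_next E) s (i, j).
- by rewrite sP.
- by move=> p; rewrite !sP; exact: bnd_next_vertex bE.
have nextE p : p \in c -> next c p = bnd_next E p.
  by move=> pc; apply/esym/eqP; exact: (next_cycle fc pc).
have vc p : p \in c -> bnd_vertex E p by move=> /subc; rewrite sP.
have gc : grid_cycle n c.
  split=> //.
  - case: c uc fc sc subc nextE vc => [//|p [|q [//|//]]] uc fc _ _ nextE vc /=.
      have pc : p \in [:: p] by rewrite inE.
      have [] := bnd_next_neq bE (vc p pc); rewrite -(nextE _ pc) /= eqxx.
      by rewrite eqxx.
    have pc : p \in [:: p; q] by rewrite inE eqxx.
    have qc : q \in [:: p; q] by rewrite !inE eqxx orbT.
    have [_ + _] := bnd_next_neq bE (vc p pc).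
    have := nextE _ pc; have := nextE _ qc => /=; rewrite !eqxx.
    move: uc; rewrite /= inE andbT => /negPf; rewrite eq_sym => ->.
    by move=> E1 <-; rewrite -E1 eqxx.
  - by move=> p /vc; exact: bnd_vertex_box.
  - move=> p pc; rewrite nextE//.
    by have [] := bnd_next_neq bE (vc p pc).
exists c; split=> // a b /andP[abc].
- move=> /orP[/eqP|/eqP Ep].
    rewrite nextE// => Ep.
    by have [+ _] := bnd_next_edge bE (vc _ abc) Ep; exact.
  have pc : (a, b.+1) \in c by rewrite -Ep mem_prev.
  have := next_prev uc (a, b); rewrite Ep nextE// => Ep'.
  by have [_ [+ _]] := bnd_next_edge bE (vc _ pc) Ep'; exact.
- move=> /orP[/eqP|/eqP Ep].
    rewrite nextE// => Ep.
    by have [_ [_ [+ _]]] := bnd_next_edge bE (vc _ abc) Ep; exact.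
  have pc : (a.+1, b) \in c by rewrite -Ep mem_prev.
  have := next_prev uc (a, b); rewrite Ep nextE// => Ep'.
  by have [_ [_ [_ +]]] := bnd_next_edge bE (vc _ pc) Ep'; exact.
Qed.

Definition nedges n E : nat :=
  \sum_(a < n.+1) \sum_(b < n.+1) (vedge E a b + hedge E a b).

Lemma edge_box n E i j : in_box n E -> vedge E i j || hedge E i j ->
  (i < n.+1) && (j < n.+1).
Proof.
move=> bE He.
have Hv : bnd_vertex E (i, j).
  move: He; rewrite /vedge /hedge /bnd_vertex.
  by do 4 case: (E _ _).
by have := bnd_vertex_box bE Hv; rewrite /vertex_box /= !ltnS => /andP[/andP[_ ->]/andP[_ ->]].
Qed.

Lemma nedges0 n E : in_box n E -> nedges n E = 0 -> forall i j, E i j = false.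
Proof.
move=> bE E0.
have V0 i j : vedge E i j = false.
  apply/negP => V; have /andP[ai bj] : (i < n.+1) && (j < n.+1).
    by apply: (@edge_box n E i j) => //; rewrite V.
  move: E0 => /eqP; rewrite /nedges sum_nat_eq0 => /forallP/(_ (Ordinal ai)) /=.
  rewrite sum_nat_eq0 => /forallP/(_ (Ordinal bj)) /=.
  by rewrite V.
elim=> [|i IH] j; first by apply/negP => /bE.
by have := V0 i.+1 j; rewrite /vedge /= IH addFb.
Qed.

Lemma nedges_gt0 n E : 0 < nedges n E -> exists i j, vedge E i j || hedge E i j.
Proof.
rewrite lt0n /nedges sum_nat_eq0 negb_forall => /existsP[a] /=.
rewrite sum_nat_eq0 negb_forall => /existsP[b] /= H.
by exists a, b; move: H; case: vedge; case: hedge.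
Qed.

Lemma nedgesD n E1 E2 E3 :
  (forall i j, vedge E1 i j + vedge E2 i j = vedge E3 i j :> nat) ->
  (forall i j, hedge E1 i j + hedge E2 i j = hedge E3 i j :> nat) ->
  nedges n E1 + nedges n E2 = nedges n E3.
Proof.
move=> HV HH; rewrite /nedges -big_split /=; apply: eq_bigr => a _.
rewrite -big_split /=; apply: eq_bigr => b _.
by rewrite -HV -HH; lia.
Qed.

Ltac bool_cases := move=> /=; (try by []); intros;
  repeat match goal with H : is_true true -> _ |- _ => specialize (H isT) end; by [].

(** Every finite union of cells is obtained from insides of simple cycles
    contained in its boundary by disjoint unions and proper differences: cut
    the union along the inside of a cycle of its boundary; if one of the two
    pieces is empty, fill in or complement that inside instead. *)
Theorem grid_induction n (av ah : nat -> nat -> bool)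
    (P : (nat -> nat -> bool) -> Prop) :
  P (fun _ _ => false) ->
  (forall E1 E2, P E1 -> P E2 -> (forall i j, ~~ (E1 i j && E2 i j)) ->
     P (fun i j => E1 i j || E2 i j)) ->
  (forall E1 E2, P E1 -> P E2 -> (forall i j, E2 i j ==> E1 i j) ->
     P (fun i j => E1 i j && ~~ E2 i j)) ->
  (forall c, grid_cycle n c -> (forall i j, cycle_vedge c i j -> av i j) ->
     (forall i j, cycle_hedge c i j -> ah i j) -> P (inside c)) ->
  forall E, in_box n E -> (forall i j, vedge E i j -> av i j) ->
     (forall i j, hedge E i j -> ah i j) -> P E.
Proof.
move=> P0 PU PD Pc E.
have [m] := ubnP (nedges n E); elim: m E => // m IH E.
rewrite ltnS => Em bE Ev Eh.
have [E0|Egt] := posnP (nedges n E).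
  rewrite (_ : E = fun _ _ => false)//.
  by apply/funext => i; apply/funext => j; exact: nedges0 E0 i j.
have [i0 [j0 He]] := nedges_gt0 Egt.
have [c [gc cv ch]] := exists_grid_cycle bE He.
have PI : P (inside c).
  apply: Pc => // i j => [/cv/Ev//|/ch/Eh//].
have bD := inside_in_box gc.
have dv i j : vedge (inside c) i j -> vedge E i j by rewrite (vedge_inside _ _ gc); exact: cv.
have dh i j : hedge (inside c) i j -> hedge E i j by rewrite (hedge_inside _ _ gc); exact: ch.
have cgt : 0 < nedges n (inside c).
  have [uc sc cb cs] := gc.
  case: c {cv ch} gc PI bD dv dh uc sc cb cs => [//|p c] gc PI bD dv dh uc sc cb cs.
  rewrite lt0n; apply/negP => /eqP /(nedges0 bD) D0.
  have pc : p \in p :: c by rewrite inE eqxx.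
  have DV i j : cycle_vedge (p :: c) i j = false by rewrite -(vedge_inside _ _ gc) /vedge !D0.
  have DH i j : cycle_hedge (p :: c) i j = false by rewrite -(hedge_inside _ _ gc) /hedge !D0.
  have := cs _ pc; rewrite /unit_step.
  pose q := next (p :: c) p; rewrite -/q.
  have Ee : cycle_edge (p :: c) p q by rewrite /cycle_edge pc eqxx.
  have Ee' : cycle_edge (p :: c) q p by rewrite cycle_edge_sym.
  case/or4P => /eqP Eq.
  - by have := DV p.1 p.2; rewrite /cycle_vedge -Eq -surjective_pairing Ee.
  - by have := DH p.1 p.2; rewrite /cycle_hedge -Eq -surjective_pairing Ee.
  - by have := DH q.1 q.2; rewrite /cycle_hedge -Eq -surjective_pairing Ee'.
  - by have := DV q.1 q.2; rewrite /cycle_vedge -Eq -surjective_pairing Ee'.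
(* cutting along the cycle creates no edge: those of its inside belong to E *)
have Ssplit : nedges n (fun i j => E i j && inside c i j) +
    nedges n (fun i j => E i j && ~~ inside c i j) = nedges n E.
  apply: nedgesD => i j.
    have := dv i j; rewrite /vedge.
    by do 2 case: (E _ _); do 2 case: (inside _ _ _); bool_cases.
  have := dh i j; rewrite /hedge.
  by do 2 case: (E _ _); do 2 case: (inside _ _ _); bool_cases.
have b1 : in_box n (fun i j => E i j && inside c i j) by move=> i j /andP[/bE].
have b2 : in_box n (fun i j => E i j && ~~ inside c i j) by move=> i j /andP[/bE].
(* E avoids the inside: fill it in, then remove it *)
have [S1|S1] := posnP (nedges n (fun i j => E i j && inside c i j)).
  have D0 := nedges0 b1 S1.
  have SS : nedges n (fun i j => E i j || inside c i j) + nedges n (inside c) = nedges n E.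
    apply: nedgesD => i j.
      have := dv i j; have := D0 i j; have := D0 i.-1 j; rewrite /vedge.
      by do 2 case: (E _ _); do 2 case: (inside _ _ _); bool_cases.
    have := dh i j; have := D0 i j; have := D0 i j.-1; rewrite /hedge.
    by do 2 case: (E _ _); do 2 case: (inside _ _ _); bool_cases.
  rewrite (_ : E = fun i j => (E i j || inside c i j) && ~~ inside c i j); last first.
    apply/funext => i; apply/funext => j; have := D0 i j.
    by case: (E _ _); case: (inside _ _ _).
  apply: PD => //; last by move=> i j; case: (inside _ _ _); rewrite ?orbT.
  apply: IH.
  - by move: cgt Em SS; lia.
  - by move=> i j /orP[/bE|/bD].
  - move=> i j H; apply: Ev; move: H; have := dv i j; have := D0 i j; have := D0 i.-1 j; rewrite /vedge.
    by do 2 case: (E _ _); do 2 case: (inside _ _ _); bool_cases.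
  - move=> i j H; apply: Eh; move: H; have := dh i j; have := D0 i j; have := D0 i j.-1; rewrite /hedge.
    by do 2 case: (E _ _); do 2 case: (inside _ _ _); bool_cases.
(* E is contained in the inside: it is the inside minus its complement *)
have [S2|S2] := posnP (nedges n (fun i j => E i j && ~~ inside c i j)).
  have D0 := nedges0 b2 S2.
  have SS : nedges n (fun i j => inside c i j && ~~ E i j) + nedges n (inside c) = nedges n E.
    apply: nedgesD => i j.
      have := dv i j; have := D0 i j; have := D0 i.-1 j; rewrite /vedge.
      by do 2 case: (E _ _); do 2 case: (inside _ _ _); bool_cases.
    have := dh i j; have := D0 i j; have := D0 i j.-1; rewrite /hedge.
    by do 2 case: (E _ _); do 2 case: (inside _ _ _); bool_cases.
  rewrite (_ : E = fun i j => inside c i j && ~~ (inside c i j && ~~ E i j)); last first.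
    apply/funext => i; apply/funext => j; have := D0 i j.
    by case: (E _ _); case: (inside _ _ _).
  apply: (PD (inside c) (fun i j => inside c i j && ~~ E i j)) => //; last first.
    by move=> i j; case: (inside _ _ _); rewrite ?implybT.
  apply: IH.
  - by move: cgt Em SS; lia.
  - by move=> i j /andP[/bD].
  - move=> i j H; apply: Ev; move: H; have := dv i j; have := D0 i j; have := D0 i.-1 j; rewrite /vedge.
    by do 2 case: (E _ _); do 2 case: (inside _ _ _); bool_cases.
  - move=> i j H; apply: Eh; move: H; have := dh i j; have := D0 i j; have := D0 i j.-1; rewrite /hedge.
    by do 2 case: (E _ _); do 2 case: (inside _ _ _); bool_cases.
rewrite (_ : E = fun i j => (E i j && inside c i j) || (E i j && ~~ inside c i j)); last first.
  by apply/funext => i; apply/funext => j; case: (E _ _); case: (inside _ _ _).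
apply: PU; last by move=> i j; case: (E _ _); case: (inside _ _ _).
- apply: IH => //; first by move: S1 S2 Em Ssplit; lia.
  + move=> i j H; apply: Ev; move: H; have := dv i j; rewrite /vedge.
    by do 2 case: (E _ _); do 2 case: (inside _ _ _); bool_cases.
  + move=> i j H; apply: Eh; move: H; have := dh i j; rewrite /hedge.
    by do 2 case: (E _ _); do 2 case: (inside _ _ _); bool_cases.
- apply: IH => //; first by move: S1 S2 Em Ssplit; lia.
  + move=> i j H; apply: Ev; move: H; have := dv i j; rewrite /vedge.
    by do 2 case: (E _ _); do 2 case: (inside _ _ _); bool_cases.
  + move=> i j H; apply: Eh; move: H; have := dh i j; rewrite /hedge.
    by do 2 case: (E _ _); do 2 case: (inside _ _ _); bool_cases.
Qed.

End GridCycles.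

(** * Topology of the plane and broken lines *)

Section Plane.
Variable R : realType.
Implicit Types (x y : R * R).

(** Neighbourhoods of the product are described by squares, which is the form
    in which they meet the cells of a grid. *)
Lemma near2P (x : R * R) (P : set (R * R)) : (\forall y \near x, P y) <->
  exists2 r : R, 0 < r & forall y : R * R, `|y.1 - x.1| < r -> `|y.2 - x.2| < r -> P y.
Proof.
split.
  move=> /nbhs_ballP[r /= r0 H]; exists r => // y y1 y2; apply: H.
  by split; rewrite /ball /= distrC.
move=> [r r0 H]; apply/nbhs_ballP; exists r => //= y [/= y1 y2].
by apply: H; rewrite distrC.
Qed.

Lemma open2P (U : set (R * R)) : open U <-> forall x, U x ->
  exists2 r : R, 0 < r & forall y : R * R, `|y.1 - x.1| < r -> `|y.2 - x.2| < r -> U y.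
Proof.
rewrite openE; split=> H x Ux; first by apply/near2P; exact: H.
by apply/near2P; exact: H.
Qed.

Lemma closure2P (U : set (R * R)) x : closure U x <-> forall r : R, 0 < r ->
  exists2 y : R * R, U y & `|y.1 - x.1| < r /\ `|y.2 - x.2| < r.
Proof.
split.
  move=> cU r r0.
  have [|y [Uy [h1 h2]]] := cU [set y | `|y.1 - x.1| < r /\ `|y.2 - x.2| < r]; last by exists y.
  by apply/near2P; exists r.
move=> H B /near2P[r r0 HB]; have [y Uy [h1 h2]] := H r r0.
by exists y; split=> //; exact: HB.
Qed.

Lemma open_square_open (r : R) : open (open_square r : set (R * R)).
Proof.
apply/open2P => -[a b]; rewrite /open_square /= !in_itv/= => -[/andP[a1 a2] /andP[b1 b2]].
exists (Num.min (Num.min (a + r) (r - a)) (Num.min (b + r) (r - b))).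
  by rewrite !lt_min; do ? (apply/andP; split); lra.
move=> [c d]; rewrite /= !lt_min !ltr_norml => /andP[/andP[c1 c2] _] /andP[_ /andP[d1 d2]].
by rewrite !in_itv/=; split; apply/andP; split; lra.
Qed.

Lemma closed_square_compact (a b : R) : compact (`[a, b]%classic `*` `[a, b]%classic : set (R * R)).
Proof. by apply: compact_setX; exact: segment_compact. Qed.

Lemma enorm_le (x : R * R) : enorm x <= `|x.1| + `|x.2|.
Proof.
rewrite /enorm -(ler_pXn2r (n:=2))// ?nnegrE ?sqrtr_ge0 ?addr_ge0//.
rewrite sqr_sqrtr ?addr_ge0 ?sqr_ge0//.
rewrite -(real_normK (num_real x.1)) -(real_normK (num_real x.2)).
have := normr_ge0 x.1; have := normr_ge0 x.2; nra.
Qed.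

Lemma supp_near0 (f : R * R -> R) x : ~ supp f x -> \forall y \near x, f y = 0.
Proof.
move=> nx; have : (~` supp f) x by [].
have : open (~` supp f) by apply: closed_openC; exact: closed_closure.
rewrite openE => /[apply]; apply: filterS => y ny.
apply: contrapT => fy; apply: ny; apply: subset_closure => /=.
by apply/eqP.
Qed.

End Plane.

Section Clamp.
Variable R : realType.

(** Truncation to [0, 1], written with absolute values so that the Lipschitz
    bound is immediate. *)
Definition clamp (x : R) : R := (`|x| - `|x - 1| + 1) / 2.

Lemma clamp_le0 x : x <= 0 -> clamp x = 0.
Proof. by move=> x0; rewrite /clamp !ler0_norm; lra. Qed.

Lemma clamp_ge1 x : 1 <= x -> clamp x = 1.
Proof. by move=> x0; rewrite /clamp !ger0_norm; lra. Qed.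

Lemma clamp_id x : 0 <= x <= 1 -> clamp x = x.
Proof. by move=> /andP[x0 x1]; rewrite /clamp ger0_norm ?ler0_norm; lra. Qed.

Lemma clamp_lip x y : `|clamp x - clamp y| <= `|x - y|.
Proof.
rewrite /clamp.
have h1 := lerB_dist x y; have h2 := lerB_dist y x.
have h3 := lerB_dist (x - 1) (y - 1); have h4 := lerB_dist (y - 1) (x - 1).
have E1 : `|y - x| = `|x - y| by rewrite distrC.
have E2 : `|(x - 1) - (y - 1)| = `|x - y| by congr `|_|; ring.
have E3 : `|(y - 1) - (x - 1)| = `|x - y| by rewrite -E1; congr `|_|; ring.
rewrite E1 in h2; rewrite E2 in h3; rewrite E3 in h4.
by rewrite ler_norml; apply/andP; split; lra.
Qed.

(** The broken line through w 0, ..., w m, one unit of time per edge: as a sum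
    of clamped increments it is globally Lipschitz. *)
Fixpoint broken_line (w : nat -> R) (m : nat) (t : R) : R :=
  if m is m'.+1 then broken_line w m' t + clamp (t - m'%:R) * (w m'.+1 - w m')
  else w 0%N.

Lemma broken_line_after w m (t : R) : m%:R <= t -> broken_line w m t = w m.
Proof.
elim: m => [//|m IH] mt /=; rewrite IH; last by apply: le_trans mt; rewrite ler_nat.
rewrite clamp_ge1 ?mul1r; first by rewrite addrC subrK.
by move: mt; rewrite -natr1; lra.
Qed.

Lemma broken_line_before w m l (t : R) : t <= m%:R -> broken_line w (m + l) t = broken_line w m t.
Proof.
move=> tm; elim: l => [|l IH]; first by rewrite addn0.
rewrite addnS /= IH clamp_le0 ?mul0r ?addr0//.
by rewrite subr_le0 (le_trans tm)// ler_nat leq_addr.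
Qed.

Lemma broken_line_on w m k (t : R) : (m < k)%N -> m%:R <= t <= m.+1%:R ->
  broken_line w k t = w m + (t - m%:R) * (w m.+1 - w m).
Proof.
move=> mk /andP[t1 t2].
rewrite -(subnKC mk) broken_line_before//= broken_line_after// clamp_id//.
by move: t2; rewrite -natr1 => t2; apply/andP; split; lra.
Qed.

Lemma broken_line_lip w k (M t u : R) : (forall m, `|w m.+1 - w m| <= M) ->
  `|broken_line w k t - broken_line w k u| <= k%:R * M * `|t - u|.
Proof.
move=> wM; have M0 : 0 <= M by apply: le_trans (wM 0%N).
elim: k => [|k IH] /=; first by rewrite subrr normr0 !mul0r.
have -> : forall a b c d e : R, a + b * c - (d + e * c) = (a - d) + (b - e) * c by move=> *; ring.
apply: (le_trans (ler_normD _ _)).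
rewrite (_ : k.+1%:R * M * `|t - u| = k%:R * M * `|t - u| + M * `|t - u|); last first.
  by rewrite -natr1; ring.
apply: lerD => //; rewrite normrM mulrC; apply: ler_pM => //.
apply: (le_trans (clamp_lip _ _)).
by rewrite (_ : t - k%:R - (u - k%:R) = t - u)//; ring.
Qed.

Lemma lip_continuous (f : R -> R) (M : R) :
  (forall t u, `|f t - f u| <= M * `|t - u|) -> continuous f.
Proof.
move=> H x; apply/cvgrPdist_lt => e e0.
have M0 : 0 <= M by have := H 1 0; rewrite subr0 normr1 mulr1; exact: le_trans.
have d0 : 0 < e / (M + 1) by rewrite divr_gt0// ltr_wpDl.
near=> y; apply: (le_lt_trans (H _ _)).
have xy : `|x - y| < e / (M + 1) by near: y; exact: cvgr_dist_lt.
apply: (@le_lt_trans _ _ ((M + 1) * `|x - y|)).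
  by rewrite ler_wpM2r// lerDl.
by rewrite mulrC -ltr_pdivlMr// ltr_wpDl.
Unshelve. all: by end_near. Qed.

End Clamp.

(** * The closed polygon traced by a grid cycle *)

Section Polygon.
Variables (R : realType) (o s : R) (s0 : 0 < s) (n : nat) (c : seq (nat * nat)).
Hypothesis gc : grid_cycle n c.
Implicit Types (x y : R * R).

Definition grid_coord (i : nat) : R := o + s * i%:R.

Definition in_cell (i j : nat) (x : R * R) : bool :=
  (grid_coord i <= x.1 <= grid_coord i.+1) && (grid_coord j <= x.2 <= grid_coord j.+1).

Let v0 := head (0, 0)%N c.
Let vtx (m : nat) := nth v0 c m.
Let k := size c.

(** The polygon through the vertices of the cycle c, travelled once at constant
    speed; k is the number of edges and vtx k is vtx 0. *)
Definition cycle_curve (t : R) : R * R :=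
  (broken_line (fun m => grid_coord (vtx m).1) k (k%:R * t),
   broken_line (fun m => grid_coord (vtx m).2) k (k%:R * t)).

Lemma k0 : (0 < k)%N.
Proof. by case: gc => _ + _ _; rewrite /k; case: (size c). Qed.

Lemma vtx_in m : (m < k)%N -> vtx m \in c.
Proof. exact: mem_nth. Qed.

Lemma vtx_next m : (m < k)%N -> next c (vtx m) = vtx m.+1.
Proof.
have [uc _ _ _] := gc.
rewrite /vtx /v0 /k; case: c uc => [//|p p'] uc mk.
rewrite next_nth (mem_nth _ mk); congr (nth p p' _).
exact: (@index_uniq _ p m (p :: p') mk uc).
Qed.

Lemma vtx_step m : (m < k)%N -> unit_step (vtx m) (vtx m.+1).
Proof. by move=> mk; have [_ _ _ cs] := gc; rewrite -vtx_next//; exact/cs/vtx_in. Qed.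

Lemma vtx_loop : vtx k = vtx 0.
Proof. by rewrite /vtx nth_default// /v0; case: (c). Qed.

Lemma step_coord (p q : nat * nat) : unit_step p q ->
  `|grid_coord q.1 - grid_coord p.1| <= s /\ `|grid_coord q.2 - grid_coord p.2| <= s.
Proof.
have H (a : nat) : grid_coord a.+1 - grid_coord a = s by rewrite /grid_coord -natr1; ring.
case: p q => a b [a' b']; rewrite /unit_step => /or4P[] /eqP[-> ->] /=;
  rewrite ?subrr ?normr0 ?H ?(distrC _ (grid_coord _.+1)) ?H ?gtr0_norm//; split=> //; exact: ltW.
Qed.

Lemma vtx_lip m : `|grid_coord (vtx m.+1).1 - grid_coord (vtx m).1| <= s /\
  `|grid_coord (vtx m.+1).2 - grid_coord (vtx m).2| <= s.
Proof.
have [mk|km] := ltnP m k; first exact/step_coord/vtx_step.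
by rewrite /vtx !nth_default ?subrr ?normr0 ?ltW// (leq_trans km).
Qed.

Lemma cycle_curve_lip t u :
  `|(cycle_curve t).1 - (cycle_curve u).1| <= k%:R * s * k%:R * `|t - u| /\
  `|(cycle_curve t).2 - (cycle_curve u).2| <= k%:R * s * k%:R * `|t - u|.
Proof.
have E : k%:R * `|t - u| = `|k%:R * t - k%:R * u| by rewrite -mulrBr normrM normr_nat.
by rewrite -!mulrA mulrA E; split; apply: broken_line_lip => m; have [] := vtx_lip m.
Qed.

(** Lipschitz curves are rectifiable: telescope over the partition. *)
Lemma cycle_curve_rectifiable : rectifiable cycle_curve.
Proof.
exists (2 * (k%:R * s * k%:R)) => _ [l [lp /eqP l1]] <-.
set M := k%:R * s * k%:R.
apply: (@le_trans _ _ (\sum_(0 <= a < size l) (2 * M) * (nth 0 (0 :: l) a.+1 - nth 0 (0 :: l) a))).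
  rewrite /polygon_length !big_mkord; apply: ler_sum => a _ /=.
  apply: (le_trans (enorm_le _)).
  have [h1 h2] := cycle_curve_lip (nth 0 l a) (nth 0 (0 :: l) a).
  have pos : 0 <= nth 0 l a - nth 0 (0 :: l) a.
    rewrite subr_ge0 ltW//.
    by have /(pathP 0) := lp; apply.
  rewrite (ger0_norm pos) in h1 h2; rewrite /= in h1 h2 *; rewrite -/M in h1 h2.
  lra.
rewrite -mulr_sumr telescope_sumr//= -[nth 0 (0 :: l) _]/(nth 0 (0 :: l) (size l)).
rewrite nth_last /= l1 subr0 mulr1//.
Qed.

Lemma cycle_curve_on (m : nat) (t : R) : (m < k)%N -> m%:R <= k%:R * t <= m.+1%:R ->
  cycle_curve t =
    (grid_coord (vtx m).1 + (k%:R * t - m%:R) * (grid_coord (vtx m.+1).1 - grid_coord (vtx m).1),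
     grid_coord (vtx m).2 + (k%:R * t - m%:R) * (grid_coord (vtx m.+1).2 - grid_coord (vtx m).2)).
Proof. by move=> mk h; rewrite /cycle_curve !(broken_line_on _ mk h). Qed.

Lemma kR0 : 0 < k%:R :> R.
Proof. by rewrite ltr0n k0. Qed.

Lemma find_edge (t : R) : 0 <= t < 1 -> exists2 m, (m < k)%N & m%:R <= k%:R * t < m.+1%:R.
Proof.
move=> /andP[t0 t1].
have kt : 0 <= k%:R * t by rewrite mulr_ge0// ler0n.
have H := truncn_itv kt; exists (Num.truncn (k%:R * t)) => //.
rewrite -(ltr_nat R); case/andP: H => /le_lt_trans + _; apply.
by rewrite -[X in _ < X]mulr1 ltr_pM2l ?kR0.
Qed.

Definition on_segment (p q : nat * nat) (x : R * R) := exists2 th : R, 0 <= th <= 1 &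
  x = (grid_coord p.1 + th * (grid_coord q.1 - grid_coord p.1),
       grid_coord p.2 + th * (grid_coord q.2 - grid_coord p.2)).

Lemma on_segment_sym p q x : on_segment p q x -> on_segment q p x.
Proof.
move=> [th /andP[h0 h1] ->]; exists (1 - th); first by apply/andP; split; lra.
by congr pair; ring.
Qed.

Lemma trace_cycleP x : trace_curve cycle_curve x <->
  exists2 m, (m < k)%N & on_segment (vtx m) (vtx m.+1) x.
Proof.
split.
  move=> [t]; rewrite /= in_itv/= => /andP[t0 t1] <-.
  have [t1'|] := ltP t 1.
    have [|m mk h] := find_edge (t := t); first by rewrite t0.
    exists m => //; exists (k%:R * t - m%:R); last first.
      by apply: cycle_curve_on => //; case/andP: h => -> /ltW ->.
    by move: h; rewrite -natr1 => /andP[h1 h2]; apply/andP; split; lra.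
  move=> t1'; have E : t = 1 by apply/eqP; rewrite eq_le t1 t1'.
  have Hk : k.-1.+1 = k by rewrite prednK ?k0.
  exists k.-1; first by rewrite -{2}Hk.
  exists 1; first by rewrite lexx ler01.
  have h1 : k.-1%:R <= k%:R * t <= k.-1.+1%:R.
    by rewrite Hk E mulr1 lexx ler_nat leq_pred.
  have mk : (k.-1 < k)%N by rewrite -{2}Hk.
  have e1 : k%:R * t - k.-1%:R = 1 by rewrite E mulr1 -{1}Hk -natr1; ring.
  by rewrite (cycle_curve_on mk h1) e1.
move=> [m mk [th /andP[h0 h1] ->]].
exists ((m%:R + th) / k%:R).
  rewrite /= in_itv/= divr_ge0 ?addr_ge0//= ler_pdivrMr ?kR0// mul1r.
  apply: (@le_trans _ _ (m.+1%:R)); last by rewrite ler_nat.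
  by rewrite -natr1 lerD2l.
have E : k%:R * ((m%:R + th) / k%:R) = m%:R + th.
  by rewrite mulrC -mulrA mulVf ?mulr1// gt_eqF ?kR0.
rewrite (@cycle_curve_on m)// E; last by rewrite lerDl h0 -natr1 lerD2l.
by rewrite (_ : m%:R + th - m%:R = th)//; ring.
Qed.

Lemma cycle_edge_vtx p q : cycle_edge c p q ->
  exists2 m, (m < k)%N & (p = vtx m /\ q = vtx m.+1) \/ (q = vtx m /\ p = vtx m.+1).
Proof.
have [uc _ _ _] := gc.
move=> /andP[pc /orP[]/eqP <-].
  exists (index p c); first by rewrite index_mem.
  left; rewrite -vtx_next ?index_mem//; have -> // : vtx (index p c) = p.
  exact: nth_index.
exists (index (prev c p) c); first by rewrite index_mem mem_prev.
right; rewrite -vtx_next ?index_mem ?mem_prev//.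
have -> : vtx (index (prev c p) c) = prev c p by rewrite /vtx nth_index// mem_prev.
by rewrite next_prev.
Qed.

Lemma trace_cycle_edge x : trace_curve cycle_curve x <->
  exists p q, cycle_edge c p q /\ on_segment p q x.
Proof.
split.
  move=> /trace_cycleP[m mk xs]; exists (vtx m), (vtx m.+1); split=> //.
  by rewrite /cycle_edge vtx_in// vtx_next// eqxx.
move=> [p [q [/cycle_edge_vtx[m mk pq] xs]]]; apply/trace_cycleP; exists m => //.
by case: pq => -[<- <-] //; exact: on_segment_sym.
Qed.

Lemma nat_eq_of_lt1 (a b : nat) (u v : R) :
  a%:R + u = b%:R + v -> -1 < u - v < 1 -> a = b.
Proof.
move=> e /andP[h1 h2]; have [h|h|//] := ltngtP a b; exfalso;
  have : (1 <= `|a%:R - b%:R| :> R); move: h; rewrite -(ler_nat R) -natr1 => h;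
  rewrite ?ger0_norm ?ler0_norm; lra.
Qed.

Lemma unit_step_real (p q : nat * nat) : unit_step p q ->
  [\/ q.1%:R - p.1%:R = 0 :> R /\ q.2%:R - p.2%:R = 1 :> R,
      q.1%:R - p.1%:R = 1 :> R /\ q.2%:R - p.2%:R = 0 :> R,
      q.1%:R - p.1%:R = -1 :> R /\ q.2%:R - p.2%:R = 0 :> R |
      q.1%:R - p.1%:R = 0 :> R /\ q.2%:R - p.2%:R = -1 :> R].
Proof.
case: p q => a b [a1 b1]; rewrite /unit_step /= => /or4P[] /eqP[-> ->];
  [constructor 1|constructor 2|constructor 3|constructor 4]; rewrite -?natr1; split; ring.
Qed.

(** This is what makes the polygon injective: a vertex belongs to its outgoing
    edge only, and an edge can otherwise meet itself only when travelled
    backwards. *)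
Lemma half_open_edges (p q p' q' : nat * nat) (th th' : R) :
  unit_step p q -> unit_step p' q' -> 0 <= th < 1 -> 0 <= th' < 1 ->
  p.1%:R + th * (q.1%:R - p.1%:R) = p'.1%:R + th' * (q'.1%:R - p'.1%:R) ->
  p.2%:R + th * (q.2%:R - p.2%:R) = p'.2%:R + th' * (q'.2%:R - p'.2%:R) ->
  p = p' \/ (q = p' /\ q' = p).
Proof.
move=> /unit_step_real U /unit_step_real U' /andP[t0 t1] /andP[t0' t1'].
case: p q p' q' U U' => a b [a1 b1] [a' b'] [a1' b1'] /= U U' e1 e2.
have inj (u v : nat) : u%:R = v%:R :> R -> u = v by move=> /eqP; rewrite eqr_nat => /eqP.
have same : -1 < th * (a1%:R - a%:R) - th' * (a1'%:R - a'%:R) < 1 ->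
    -1 < th * (b1%:R - b%:R) - th' * (b1'%:R - b'%:R) < 1 -> (a, b) = (a', b').
  by move=> /(nat_eq_of_lt1 e1) -> /(nat_eq_of_lt1 e2) ->.
case: U => -[d1 d2]; case: U' => -[d1' d2']; rewrite d1 d2 d1' d2' in same e1 e2;
  try (by left; apply: same; clear e1 e2 d1 d2 d1' d2'; apply/andP; split; lra).
- have [h|h] := ltP (th + th') 1; first by left; apply: same; clear e1 e2 d1 d2 d1' d2'; apply/andP; split; lra.
  have Eb : b.+1 = b'.
    by apply: (@nat_eq_of_lt1 _ _ (th - 1) (- th')); [rewrite -natr1; lra|apply/andP; split; lra].
  have Eb' : b.+1%:R = b'%:R :> R by rewrite Eb.
  rewrite -natr1 in Eb'.
  by right; split; congr pair; apply: inj; lra.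
- have [h|h] := ltP (th + th') 1; first by left; apply: same; clear e1 e2 d1 d2 d1' d2'; apply/andP; split; lra.
  have Eb : a.+1 = a'.
    by apply: (@nat_eq_of_lt1 _ _ (th - 1) (- th')); [rewrite -natr1; lra|apply/andP; split; lra].
  have Eb' : a.+1%:R = a'%:R :> R by rewrite Eb.
  rewrite -natr1 in Eb'.
  by right; split; congr pair; apply: inj; lra.
- have [h|h] := ltP (th + th') 1; first by left; apply: same; clear e1 e2 d1 d2 d1' d2'; apply/andP; split; lra.
  have Eb : a'.+1 = a.
    by apply: (@nat_eq_of_lt1 _ _ (th' - 1) (- th)); [rewrite -natr1; lra|apply/andP; split; lra].
  have Eb' : a'.+1%:R = a%:R :> R by rewrite Eb.
  rewrite -natr1 in Eb'.
  by right; split; congr pair; apply: inj; lra.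
- have [h|h] := ltP (th + th') 1; first by left; apply: same; clear e1 e2 d1 d2 d1' d2'; apply/andP; split; lra.
  have Eb : b'.+1 = b.
    by apply: (@nat_eq_of_lt1 _ _ (th' - 1) (- th)); [rewrite -natr1; lra|apply/andP; split; lra].
  have Eb' : b'.+1%:R = b%:R :> R by rewrite Eb.
  rewrite -natr1 in Eb'.
  by right; split; congr pair; apply: inj; lra.
Qed.

(** Two equal points lie on half-open edges with the same origin, hence on the
    same edge as the cycle visits each vertex once; opposite edges are excluded
    because the cycle has more than two vertices. *)
Lemma cycle_curve_simple : simple_closed_curve cycle_curve.
Proof.
have [uc sc _ cs] := gc.
split.
- have c1 : continuous (fun t => (cycle_curve t).1).
    by apply: (lip_continuous (M := k%:R * s * k%:R)) => t u; have [] := cycle_curve_lip t u.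
  have c2 : continuous (fun t => (cycle_curve t).2).
    by apply: (lip_continuous (M := k%:R * s * k%:R)) => t u; have [] := cycle_curve_lip t u.
  apply: continuous_subspaceT => x.
  exact: (cvg_pair (c1 x) (c2 x)).
- have H0 : 0%N%:R <= k%:R * (0 : R) <= 1%N%:R.
    by rewrite mulr0 mulr0n mulr1n lexx ler01.
  have Hk : k.-1.+1 = k by rewrite prednK ?k0.
  have H1 : k.-1%:R <= k%:R * (1 : R) <= k.-1.+1%:R by rewrite Hk mulr1 lexx ler_nat leq_pred.
  rewrite (cycle_curve_on k0 H0) (cycle_curve_on _ H1); last by rewrite -{2}Hk.
  rewrite Hk vtx_loop mulr0 mulr1 subr0 !mul0r !addr0 (_ : k%:R - k.-1%:R = 1); last first.
    by rewrite -{1}Hk -natr1; ring.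
  by congr pair; ring.
- move=> t u; rewrite !in_itv/= => t01 u01.
  have [m mk mt] := find_edge t01; have [l lk lu] := find_edge u01.
  have mt' : m%:R <= k%:R * t <= m.+1%:R by case/andP: mt => -> /ltW ->.
  have lu' : l%:R <= k%:R * u <= l.+1%:R by case/andP: lu => -> /ltW ->.
  rewrite (cycle_curve_on mk mt') (cycle_curve_on lk lu').
  set th := _ * t - _; set th' := _ * u - _ => -[e1 e2].
  have h : 0 <= th < 1.
    by case/andP: mt; rewrite -natr1 /th => *; apply/andP; split; lra.
  have h' : 0 <= th' < 1.
    by case/andP: lu; rewrite -natr1 /th' => *; apply/andP; split; lra.
  have gcE (a b a' b' : nat) : grid_coord a + th * (grid_coord b - grid_coord a) =
      grid_coord a' + th' * (grid_coord b' - grid_coord a') ->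
      a%:R + th * (b%:R - a%:R) = a'%:R + th' * (b'%:R - a'%:R).
    rewrite /grid_coord => E.
    have : s * (a%:R + th * (b%:R - a%:R)) = s * (a'%:R + th' * (b'%:R - a'%:R)) by lra.
    by move=> /mulfI; apply; rewrite gt_eqF.
  have := half_open_edges (vtx_step mk) (vtx_step lk) h h' (gcE _ _ _ _ e1) (gcE _ _ _ _ e2).
  have vinj : vtx m = vtx l -> m = l.
    by move=> E; apply/eqP; rewrite -(nth_uniq v0 mk lk uc); apply/eqP.
  case=> [/vinj E|[E1 E2]]; last first.
    have := next_neq_prev uc sc (vtx_in mk).
    by rewrite vtx_next// E1 -E2 -vtx_next// prev_next// eqxx.
  subst l; have [e|e] := eqVneq th th'.
    have : k%:R * t = k%:R * u by move: e; rewrite /th /th'; lra.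
    by move=> /mulfI; apply; rewrite gt_eqF ?kR0.
  exfalso; have := vtx_step mk.
  have d (a b : R) : a + th * (b - a) = a + th' * (b - a) -> b = a.
    move=> E'; have : (th - th') * (b - a) = 0 by rewrite mulrBl; lra.
    by move/eqP; rewrite mulf_eq0 subr_eq0 (negPf e)/= subr_eq0 => /eqP.
  have ge (a : nat) : grid_coord a.+1 = grid_coord a -> False.
    rewrite /grid_coord -natr1 => E'; have s00 : s = 0 by lra.
    by have := s0; rewrite s00 ltxx.
  have := d _ _ e1; have := d _ _ e2.
  move: (vtx m) (vtx m.+1) => [a b] [a1 b1].
  rewrite /unit_step /= => d2 d1 /or4P[]/eqP[E1 E2].
  + by apply: (ge b); rewrite -E2.
  + by apply: (ge a); rewrite -E1.
  + by apply: (ge a1); rewrite -E1.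
  + by apply: (ge b1); rewrite -E2.
Qed.

End Polygon.

(** * The domain enclosed by a grid cycle and its cut-off *)

Section Plateau.
Variable R : realType.

Lemma Cn_prod_seq n (I : Type) (l : seq I) (f : I -> R * R -> R) :
  (forall i, Cn n (f i)) -> Cn n (fun x => \prod_(i <- l) f i x).
Proof.
move=> Hf; elim: l => [|i l IH].
  rewrite (_ : (fun x => _) = fun=> 1); first exact: Cn_cst.
  by apply/funext => x; rewrite big_nil.
rewrite (_ : (fun x => _) = fun x => f i x * \prod_(j <- l) f j x).
  exact: CnM.
by apply/funext => x; rewrite big_cons.
Qed.

(** A smooth function equal to 1 on [l, u] and to 0 outside ]l - w, u + w[. *)
Definition plateau (l u w t : R) : R :=
  smooth_step ((t - (l - w)) / w) * smooth_step (((u + w) - t) / w).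

Lemma C1n_plateau n l u w : C1n n (plateau l u w).
Proof.
apply: C1nM.
  rewrite (_ : (fun x => _) = fun x => smooth_step (w^-1 * x + - (l - w) / w)).
    exact/C1n_affine/C1n_smooth_step.
  by apply/funext => x; congr smooth_step; rewrite !mulrDl; ring.
rewrite (_ : (fun x => _) = fun x => smooth_step ((- w^-1) * x + (u + w) / w)).
  exact/C1n_affine/C1n_smooth_step.
by apply/funext => x; congr smooth_step; rewrite !mulrDl; ring.
Qed.

Lemma plateau1 (l u w t : R) : 0 < w -> l <= t <= u -> plateau l u w t = 1.
Proof.
move=> w0 /andP[lt tu]; rewrite /plateau !smooth_step_ge1 ?mulr1//;
  by rewrite ler_pdivlMr//; lra.
Qed.

Lemma plateau_neq0 (l u w t : R) : 0 < w -> plateau l u w t != 0 -> l - w < t < u + w.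
Proof.
move=> w0; apply: contraR; rewrite negb_and -!leNgt => /orP[h|h]; apply/eqP.
  by rewrite /plateau smooth_step_le0 ?mul0r// pmulr_lle0 ?invr_gt0//; lra.
by rewrite /plateau [X in _ * X]smooth_step_le0 ?mulr0// pmulr_lle0 ?invr_gt0//; lra.
Qed.

Lemma plateau_ge0 (l u w t : R) : 0 <= plateau l u w t.
Proof. by rewrite mulr_ge0// smooth_step_ge0. Qed.

End Plateau.

Section CycleDomain.
Variables (R : realType) (o s : R) (s0 : 0 < s).

Local Notation gcd_ := (grid_coord o s).

Lemma grid_coordS i : gcd_ i.+1 = gcd_ i + s.
Proof. by rewrite /grid_coord -natr1; ring. Qed.

Lemma grid_coord_mono i j : (i <= j)%N -> gcd_ i <= gcd_ j.
Proof. by move=> ij; rewrite /grid_coord lerD2l ler_pM2l// ler_nat. Qed.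

Lemma near_interval (t : R) : exists2 r : R, 0 < r & forall u, `|u - t| < r ->
  forall i : nat, gcd_ i <= u <= gcd_ i.+1 -> gcd_ i <= t <= gcd_ i.+1.
Proof.
pose T := (t - o) / s; pose z := Num.floor T.
have zT : z%:~R <= T by rewrite /z ge_floor.
have Tz : T < (z + 1)%:~R by rewrite /z floorD1_gt.
pose a := if T == z%:~R then (z - 1)%R else z.
have aT : a%:~R < T.
  rewrite /a; case: eqP => [->|/eqP h]; first by rewrite ltr_int; lia.
  by rewrite lt_neqAle eq_sym h zT.
exists (s * Num.min (T - a%:~R) ((z + 1)%:~R - T)).
  by rewrite mulr_gt0// lt_min; apply/andP; split; rewrite subr_gt0.
move=> u; rewrite mulrC -ltr_pdivrMr// lt_min => /andP[h1 h2] i /andP[i1 i2].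
pose U := (u - o) / s.
have TU : `|U - T| = `|u - t| / s.
  by rewrite /U /T -mulrBl normrM normfV (gtr0_norm s0); congr (`|_| / _); ring.
rewrite -TU in h1 h2.
have Ut : u = o + s * U by rewrite /U mulrC divfK ?gt_eqF//; ring.
have Tt : t = o + s * T by rewrite /T mulrC divfK ?gt_eqF//; ring.
move: i1 i2; rewrite Ut Tt /grid_coord !lerD2l !ler_pM2l// => i1 i2.
have aU : a%:~R < U by move: h1; rewrite ltr_norml => /andP[k1 k2]; lra.
have Uz : U < (z + 1)%:~R by move: h2; rewrite ltr_norml => /andP[k1 k2]; lra.
have iz : (i%:Z < z + 1)%R.
  by rewrite -(ltr_int R); apply: le_lt_trans Uz; rewrite -pmulrn.
have ai : (a < i.+1%:Z)%R.
  by rewrite -(ltr_int R); apply: lt_le_trans aU _; rewrite -pmulrn.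
apply/andP; split.
  by apply: le_trans zT; rewrite pmulrn ler_int -ltzD1.
move: ai; rewrite /a; case: eqP => [-> ai|_ ai].
  rewrite pmulrn ler_int; clear -ai; lia.
apply: (le_trans (ltW Tz)); rewrite pmulrn ler_int; clear -ai; lia.
Qed.

(** Closed cells are locally finite: near x, no new cell appears. *)
Lemma near_cells (x : R * R) : exists2 r : R, 0 < r & forall y : R * R,
  `|y.1 - x.1| < r -> `|y.2 - x.2| < r ->
  forall i j, in_cell o s i j y -> in_cell o s i j x.
Proof.
have [r1 r10 H1] := near_interval x.1; have [r2 r20 H2] := near_interval x.2.
exists (Num.min r1 r2); first by rewrite lt_min r10 r20.
move=> y; rewrite !lt_min => /andP[a1 _] /andP[_ a2] i j /andP[c1 c2].
by apply/andP; split; [exact: H1 c1|exact: H2 c2].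
Qed.

Lemma cell_exists (x : R * R) : o <= x.1 -> o <= x.2 -> exists i j, in_cell o s i j x.
Proof.
have H (t : R) : o <= t -> exists i, gcd_ i <= t <= gcd_ i.+1.
  move=> ot; exists (Num.truncn ((t - o) / s)).
  have t0 : 0 <= (t - o) / s by rewrite divr_ge0 ?subr_ge0// ltW.
  have /andP[h1 h2] := truncn_itv t0.
  have E : t = o + s * ((t - o) / s) by rewrite mulrC divfK ?gt_eqF//; ring.
  by rewrite {2 3}E /grid_coord !lerD2l !ler_pM2l// h1 ltW.
by move=> /H[i hi] /H[j hj]; exists i, j; apply/andP.
Qed.

Lemma cells_adj (i i' : nat) (t t' : R) : gcd_ i <= t <= gcd_ i.+1 ->
  gcd_ i' <= t' <= gcd_ i'.+1 -> `|t - t'| <= s / 2 -> i != i' ->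
  exists2 a, (a = i.+1 /\ a = i') \/ (a = i'.+1 /\ a = i) &
    `|gcd_ a - t'| <= `|t - t'|.
Proof.
move=> /andP[h1 h2] /andP[h1' h2'] ht ii.
have tt1 : t - t' <= s / 2 by apply: le_trans ht; exact: ler_norm.
have tt2 : t' - t <= s / 2 by apply: le_trans ht; rewrite distrC; exact: ler_norm.
have [i2|i2|/eqP] := ltngtP i i'; last by rewrite (negPf ii).
  have E : i' = i.+1.
    apply/eqP; rewrite eqn_leq i2 andbT leqNgt; apply/negP => h.
    have := grid_coord_mono h; rewrite !grid_coordS => h3.
    rewrite grid_coordS in h2; have := s0; lra.
  exists i'; first by left.
  rewrite E; rewrite E in h1'.
  have e1 : gcd_ i.+1 - t' <= 0 by rewrite subr_le0.
  have e2 : t - t' <= 0 by rewrite subr_le0 (le_trans h2).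
  by rewrite !ler0_norm//; lra.
have E : i = i'.+1.
  apply/eqP; rewrite eqn_leq i2 andbT leqNgt; apply/negP => h.
  have := grid_coord_mono h; rewrite !grid_coordS => h3.
  rewrite grid_coordS in h2'; have := s0; lra.
exists i; first by right.
rewrite E; rewrite E in h1.
by rewrite ger0_norm ?subr_ge0// ger0_norm ?subr_ge0; [rewrite lerD2r|exact: le_trans h1].
Qed.

Variables (n : nat) (c : seq (nat * nat)) (gc : grid_cycle n c).

Local Notation trace := (trace_curve (cycle_curve o s c)).

(** The interior of the union of the closed cells inside the cycle: a point
    belongs to it when all the closed cells containing it are inside. *)
Definition cycle_domain : set (R * R) := [set x |
  (exists i j, in_cell o s i j x /\ inside c i j) /\
  forall i j, in_cell o s i j x -> inside c i j].

(** Change one index at a time: between a cell inside the cycle and a cell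
    outside it there is an edge of the cycle. *)
Lemma crossing (x z : R * R) i j i2 j2 :
  `|z.1 - x.1| <= s / 2 -> `|z.2 - x.2| <= s / 2 ->
  in_cell o s i j z -> inside c i j -> in_cell o s i2 j2 x -> ~~ inside c i2 j2 ->
  exists2 w, trace w & `|w.1 - x.1| <= `|z.1 - x.1| /\ `|w.2 - x.2| <= `|z.2 - x.2|.
Proof.
move=> h1 h2 /andP[z1 z2] Eij /andP[x1 x2] NE.
have th (t : R) b : gcd_ b <= t <= gcd_ b.+1 ->
    0 <= (t - gcd_ b) / s <= 1 /\ t = gcd_ b + (t - gcd_ b) / s * (gcd_ b.+1 - gcd_ b).
  move=> /andP[b1 b2]; rewrite grid_coordS in b2 *.
  rewrite divr_ge0 ?subr_ge0 ?(ltW s0)//= ler_pdivrMr// mul1r.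
  split; first by rewrite lerBlDl.
  by rewrite [gcd_ b + s - _]addrAC subrr add0r divfK ?gt_eqF//; ring.
have [E2|NE2] := boolP (inside c i2 j).
  have jj : j != j2 by apply/eqP => E; rewrite -E E2 in NE.
  have [b Hb bd] := cells_adj z2 x2 h2 jj.
  exists (x.1, gcd_ b); last by rewrite /= subrr normr0.
  apply/(trace_cycle_edge o s gc).
  exists (i2, b), (i2.+1, b); split; last first.
    have [t1 t2] := th _ _ x1; exists ((x.1 - gcd_ i2) / s) => //=.
    by rewrite -t2 subrr mulr0 addr0.
  rewrite -/(cycle_hedge c i2 b) -(hedge_inside _ _ gc) /hedge.
  case: Hb => -[-> E]; rewrite /= ?E; first by rewrite -E /= E E2 (negPf NE).
  by rewrite -E /= E E2 (negPf NE).
have ii : i != i2 by apply/eqP => E; rewrite -E Eij in NE2.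
have [a Ha ad] := cells_adj z1 x1 h1 ii.
exists (gcd_ a, z.2) => //.
apply/(trace_cycle_edge o s gc).
exists (a, j), (a, j.+1); split; last first.
  have [t1 t2] := th _ _ z2; exists ((z.2 - gcd_ j) / s) => //=.
  by rewrite -t2 subrr mulr0 addr0.
rewrite -/(cycle_vedge c a j) -(vedge_inside _ _ gc) /vedge.
by case: Ha => -[Ea E]; rewrite {1}Ea {1}E /= Eij (negPf NE2).
Qed.

Lemma trace_cells x : trace x ->
  (exists i j, in_cell o s i j x /\ inside c i j) /\
  (exists i j, in_cell o s i j x /\ ~~ inside c i j).
Proof.
move=> /(trace_cycle_edge o s gc)[p [q [pq xs]]].
have [uc _ cb cs] := gc.
have [us pb qb] : [/\ unit_step p q \/ unit_step q p, vertex_box n p & vertex_box n q].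
  have /andP[pc qc] := cycle_edge_mem pq.
  split; [|exact: cb|exact: cb].
  case/andP: pq => _ /orP[]/eqP <-; first by left; exact: cs.
  by right; have := cs (prev c p); rewrite mem_prev next_prev//; exact.
wlog H : p q xs us pb qb pq / (q == (p.1, p.2.+1)) || (q == (p.1.+1, p.2)).
  move=> W; have := us; rewrite /unit_step => -[/or4P[]|/or4P[]] h.
  - by apply: (W p q) => //; rewrite h.
  - by apply: (W p q) => //; rewrite h orbT.
  - by apply: (W q p) => //; [exact: on_segment_sym|case: us; [right|left]|rewrite cycle_edge_sym|rewrite h orbT].
  - by apply: (W q p) => //; [exact: on_segment_sym|case: us; [right|left]|rewrite cycle_edge_sym|rewrite h].
  - by apply: (W q p) => //; [exact: on_segment_sym|case: us; [right|left]|rewrite cycle_edge_sym|rewrite h].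
  - by apply: (W q p) => //; [exact: on_segment_sym|case: us; [right|left]|rewrite cycle_edge_sym|rewrite h orbT].
  - by apply: (W p q) => //; rewrite h orbT.
  - by apply: (W p q) => //; rewrite h.
case: xs => th /andP[t0 t1]; case: p q us pb qb pq H => a b q us pb qb pq H.
have st : 0 <= th * s <= s by rewrite mulr_ge0 ?(ltW s0)//= ler_piMl// ltW.
case/andP: st => st0 st1; have s00 := s0.
case/orP: H pq => /eqP -> pq /=; rewrite !grid_coordS subrr mulr0 addr0 => -> {x}.
- have a0 : (0 < a)%N by case/andP: pb => /andP[].
  have V : vedge (inside c) a b by rewrite (vedge_inside _ _ gc).
  have C1 : in_cell o s a b (gcd_ a, gcd_ b + th * (gcd_ b + s - gcd_ b)).
    rewrite /in_cell /= !grid_coordS [gcd_ b + s - _]addrAC subrr add0r.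
    by apply/andP; split; apply/andP; split; lra.
  have C2 : in_cell o s a.-1 b (gcd_ a, gcd_ b + th * (gcd_ b + s - gcd_ b)).
    have Eg : gcd_ a = gcd_ a.-1 + s by rewrite -grid_coordS prednK.
    rewrite /in_cell /= !grid_coordS Eg [gcd_ b + s - _]addrAC subrr add0r.
    by apply/andP; split; apply/andP; split; lra.
  move: V; rewrite /vedge; case E1: (inside c a.-1 b); case E2: (inside c a b) => // _.
    by split; [exists a.-1, b|exists a, b; rewrite E2].
  by split; [exists a, b|exists a.-1, b; rewrite E1].
- have b0 : (0 < b)%N by case/andP: pb => _ /andP[].
  have V : hedge (inside c) a b by rewrite (hedge_inside _ _ gc).
  have C1 : in_cell o s a b (gcd_ a + th * (gcd_ a + s - gcd_ a), gcd_ b).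
    rewrite /in_cell /= !grid_coordS [gcd_ a + s - _]addrAC subrr add0r.
    by apply/andP; split; apply/andP; split; lra.
  have C2 : in_cell o s a b.-1 (gcd_ a + th * (gcd_ a + s - gcd_ a), gcd_ b).
    have Eg : gcd_ b = gcd_ b.-1 + s by rewrite -grid_coordS prednK.
    rewrite /in_cell /= !grid_coordS Eg [gcd_ a + s - _]addrAC subrr add0r.
    by apply/andP; split; apply/andP; split; lra.
  move: V; rewrite /hedge; case E1: (inside c a b.-1); case E2: (inside c a b) => // _.
    by split; [exists a, b.-1|exists a, b; rewrite E2].
  by split; [exists a, b|exists a, b.-1; rewrite E1].
Qed.

Lemma cycle_domain_open : open cycle_domain.
Proof.
apply/open2P => x [[i [j [xij Eij]]] Hx].
have [r r0 H] := near_cells x.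
have oi (t : R) k : gcd_ k <= t <= gcd_ k.+1 -> o + s * k%:R <= t by case/andP.
have i0 : (0 < i)%N by have /andP[/andP[]] := inside_in_box gc Eij.
have j0 : (0 < j)%N by have /andP[_ /andP[]] := inside_in_box gc Eij.
exists (Num.min r s); first by rewrite lt_min r0 s0.
move=> y; rewrite !lt_min => /andP[y1 y1'] /andP[y2 y2'].
have Hy k l : in_cell o s k l y -> inside c k l by move=> /(H _ y1 y2); exact: Hx.
split=> //.
have ge_o (t u : R) (k : nat) : (0 < k)%N -> gcd_ k <= t <= gcd_ k.+1 -> `|u - t| < s -> o <= u.
  move=> k0 /andP[kt _]; rewrite ltr_norml => /andP[h _].
  have : gcd_ 1 <= gcd_ k by exact: grid_coord_mono.
  by rewrite /grid_coord mulr1; rewrite /grid_coord in kt; lra.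
case/andP: xij => c1 c2.
have [k [l kl]] := cell_exists (ge_o _ _ _ i0 c1 y1') (ge_o _ _ _ j0 c2 y2').
by exists k, l; split=> //; exact: Hy.
Qed.

Lemma closure_cycle_domain x : closure cycle_domain x <->
  exists i j, in_cell o s i j x /\ inside c i j.
Proof.
split.
  have [r r0 H] := near_cells x.
  move=> /closure2P /(_ r r0)[y [[i [j [yij Eij]]] _] [y1 y2]].
  by exists i, j; split=> //; exact: H yij.
move=> [i [j [/andP[x1 x2] Eij]]]; apply/closure2P => r r0.
pose th := Num.min (1 / 2) (r / (2 * s)).
have th0 : 0 < th by rewrite lt_min !divr_gt0// mulr_gt0.
have th1 : th <= 1 / 2 by rewrite ge_min lexx.
have thr : th * s <= r / 2.
  apply: (@le_trans _ _ (r / (2 * s) * s)).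
    by rewrite ler_pM2r// ge_min lexx orbT.
  by rewrite invfM mulrA mulfVK ?gt_eqF.
have mid (t : R) k : gcd_ k <= t <= gcd_ k.+1 ->
    gcd_ k < t + th * (gcd_ k + s / 2 - t) < gcd_ k.+1 /\
    `|t + th * (gcd_ k + s / 2 - t) - t| < r.
  rewrite grid_coordS => /andP[k1 k2]; have s00 := s0.
  have e1 : 0 <= (1 - th) * (t - gcd_ k) by rewrite mulr_ge0; lra.
  have e2 : 0 <= (1 - th) * (gcd_ k + s - t) by rewrite mulr_ge0; lra.
  have e3 : 0 < th * s by rewrite mulr_gt0.
  have e4 : 0 <= th * (t - gcd_ k) by rewrite mulr_ge0; lra.
  have e5 : 0 <= th * (gcd_ k + s - t) by rewrite mulr_ge0; lra.
  split; first by apply/andP; split; nra.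
  by rewrite ltr_norml; apply/andP; split; nra.
have [m1 d1] := mid _ _ x1; have [m2 d2] := mid _ _ x2.
exists (x.1 + th * (gcd_ i + s / 2 - x.1), x.2 + th * (gcd_ j + s / 2 - x.2)) => //.
have uniq_cell (t : R) k l : gcd_ k < t < gcd_ k.+1 -> gcd_ l <= t <= gcd_ l.+1 -> l = k.
  move=> /andP[k1 k2] /andP[l1 l2].
  have [/grid_coord_mono h|/grid_coord_mono h|//] := ltngtP l k.
    by have := le_lt_trans (le_trans l2 h) k1; rewrite ltxx.
  by have := le_lt_trans (le_trans h l1) k2; rewrite ltxx.
have Hk k l : in_cell o s k l (x.1 + th * (gcd_ i + s / 2 - x.1), x.2 + th * (gcd_ j + s / 2 - x.2)) ->
    inside c k l.
  by case/andP => /= /(uniq_cell _ _ _ m1) -> /(uniq_cell _ _ _ m2) ->.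
split=> //; exists i, j; split=> //; apply/andP; split => /=.
  by case/andP: m1 => /ltW -> /ltW ->.
by case/andP: m2 => /ltW -> /ltW ->.
Qed.

(** A point of the closure lying off the domain belongs both to a cell inside
    and to a cell outside, hence to the trace by crossing. *)
Lemma cycle_domain_boundary : closure cycle_domain `\` interior cycle_domain = trace.
Proof.
rewrite (interior_id _).1; last exact: cycle_domain_open.
apply/seteqP; split=> x.
  move=> [/closure_cycle_domain[i [j [xij Eij]]] nD].
  have [k [l [xkl NE]]] : exists k l, in_cell o s k l x /\ ~~ inside c k l.
    apply: contrapT => h; apply: nD; split; first by exists i, j.
    move=> k l xkl; apply: contrapT => NE; apply: h; exists k, l; split=> //.
    exact/negP.
  have e (t : R) : `|t - t| <= s / 2 by rewrite subrr normr0 divr_ge0// ltW.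
  have [w tw [w1 w2]] := crossing (e _) (e _) xij Eij xkl NE.
  rewrite subrr normr0 normr_le0 subr_eq0 in w1.
  rewrite subrr normr0 normr_le0 subr_eq0 in w2.
  by rewrite (surjective_pairing x) -(eqP w1) -(eqP w2) -surjective_pairing.
move=> /trace_cells[h1 [k [l [xkl NE]]]]; split; first exact/closure_cycle_domain.
by move=> [_ /(_ _ _ xkl) E]; rewrite E in NE.
Qed.

Definition cell_bump (p : nat * nat) (x : R * R) : R :=
  plateau (gcd_ p.1) (gcd_ p.1.+1) (s / 4) x.1 *
  plateau (gcd_ p.2) (gcd_ p.2.+1) (s / 4) x.2.

(** A smooth function equal to 1 on the cells inside the cycle and to 0 away
    from them: one minus the product of the complements of the bumps of these
    cells. *)
Definition cycle_bump (x : R * R) : R :=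
  1 - \prod_(p <- [seq p <- grid_points n | inside c p.1 p.2]) (1 - cell_bump p x).

Lemma Cn_cycle_bump m : Cn m cycle_bump.
Proof.
have N1 (f : R * R -> R) : Cn m f -> Cn m (fun x => 1 - f x).
  move=> Cf; rewrite (_ : (fun x => _) = fun x => 1 + (-1) * f x).
    apply: CnD; first exact: Cn_cst.
    by apply: CnM => //; exact: Cn_cst.
  by apply/funext => x; rewrite mulN1r.
apply: (N1 (fun x => \prod_(p <- [seq p <- grid_points n | inside c p.1 p.2]) (1 - cell_bump p x))).
apply: (@Cn_prod_seq _ _ _ _ (fun p x => 1 - cell_bump p x)) => p.
apply: N1; apply: CnM; [apply: C1n_tensor1|apply: C1n_tensor2]; exact: C1n_plateau.
Qed.

Let s40 : 0 < s / 4. Proof. by rewrite divr_gt0. Qed.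

Lemma cycle_bump1 x i j : in_cell o s i j x -> inside c i j -> cycle_bump x = 1.
Proof.
move=> /andP[x1 x2] Eij; rewrite /cycle_bump.
have ijin : (i, j) \in [seq p <- grid_points n | inside c p.1 p.2].
  have /andP[/andP[_ i1] /andP[_ j1]] := inside_in_box gc Eij.
  by rewrite mem_filter /= Eij mem_grid_points//= ltnW.
rewrite (big_rem _ ijin) /= /cell_bump !plateau1// mulr1 subrr mul0r subr0//.
Qed.

Lemma supp_cycle_bump x : supp cycle_bump x -> exists i j, inside c i j /\
  (gcd_ i - s / 2 <= x.1 <= gcd_ i.+1 + s / 2) && (gcd_ j - s / 2 <= x.2 <= gcd_ j.+1 + s / 2).
Proof.
move=> /closure2P /(_ _ s40)[y /= ny [y1 y2]].
have [p pin nb] : exists2 p, p \in [seq p <- grid_points n | inside c p.1 p.2] & cell_bump p y != 0.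
  apply: contrapT => h; move/negP: ny; apply; apply/eqP.
  rewrite /cycle_bump big_seq big1 ?subrr// => p pin.
  have [->|nb] := eqVneq (cell_bump p y) 0; first by rewrite subr0.
  by exfalso; apply: h; exists p.
move: pin; rewrite mem_filter => /andP[Ep _].
exists p.1, p.2; split=> //.
move: nb; rewrite /cell_bump mulf_eq0 negb_or => /andP[/(plateau_neq0 s40) b1 /(plateau_neq0 s40) b2].
move: b1 b2 y1 y2; rewrite !ltr_norml => /andP[? ?] /andP[? ?] /andP[? ?] /andP[? ?].
by apply/andP; split; apply/andP; split; lra.
Qed.

Variable (r : R) (S : set (R * R)).
Hypotheses (or : o = - r) (sr : s * n.+1%:R = 2 * r).
Hypothesis Strace : forall w y, trace w -> `|w.1 - y.1| <= s / 2 -> `|w.2 - y.2| <= s / 2 -> ~ S y.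

Lemma grid_coord_box i : (0 < i < n)%N -> - r + s <= gcd_ i /\ gcd_ i.+1 <= r - s.
Proof.
move=> /andP[i0 ii]; split.
  have := grid_coord_mono i0; rewrite {1}/grid_coord or mulr1; exact.
have := grid_coord_mono ii; rewrite {2}/grid_coord or.
by move: sr; rewrite -natr1; lra.
Qed.

Lemma supp_cycle_bump_square x : supp cycle_bump x ->
  (- r + s / 2 <= x.1 <= r - s / 2) && (- r + s / 2 <= x.2 <= r - s / 2).
Proof.
move=> /supp_cycle_bump[i [j [Eij /andP[/andP[? ?] /andP[? ?]]]]].
have /andP[ib jb] := inside_in_box gc Eij.
have [? ?] := grid_coord_box ib; have [? ?] := grid_coord_box jb.
by apply/andP; split; apply/andP; split; lra.
Qed.

Lemma test_cycle_bump : test_function (open_square r) cycle_bump.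
Proof.
split; first exact: Cn_cycle_bump.
- rewrite (_ : supp cycle_bump = (`[- r, r]%classic `*` `[- r, r]%classic) `&` supp cycle_bump).
    apply: compact_closedI; last exact: closed_closure.
    exact: closed_square_compact.
  apply/seteqP; split=> [x Sx|x []//]; split=> //.
  have := supp_cycle_bump_square Sx; have s00 := s0.
  move=> /andP[/andP[? ?] /andP[? ?]].
  by split; rewrite /= in_itv/=; apply/andP; split; lra.
- move=> x /supp_cycle_bump_square /andP[/andP[? ?] /andP[? ?]]; have s00 := s0.
  by split; rewrite /= in_itv/=; apply/andP; split; lra.
Qed.

Lemma supp_cycle_bump_avoid x : supp cycle_bump x -> ~ cycle_domain x -> ~ S x.
Proof.
move=> Sx nD; have := supp_cycle_bump_square Sx => /andP[/andP[q1 _] /andP[q2 _]].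
have s00 := s0.
have [i [j [Eij xb]]] := supp_cycle_bump Sx.
have [k [l [xkl NE]]] : exists k l, in_cell o s k l x /\ ~~ inside c k l.
  apply: contrapT => h; apply: nD.
  have all_in k l : in_cell o s k l x -> inside c k l.
    by move=> xkl; apply: contrapT => NE; apply: h; exists k, l; split=> //; exact/negP.
  split=> //; have [k [l kl]] : exists k l, in_cell o s k l x.
    by apply: cell_exists; rewrite or; lra.
  by exists k, l; split=> //; exact: all_in.
have proj (t : R) a : gcd_ a - s / 2 <= t <= gcd_ a.+1 + s / 2 ->
    exists2 u, gcd_ a <= u <= gcd_ a.+1 & `|u - t| <= s / 2.
  move=> /andP[t1 t2]; have := grid_coordS a => Ea.
  have [h|h] := ltP t (gcd_ a).
    by exists (gcd_ a); [apply/andP; split; lra|rewrite ler_norml; apply/andP; split; lra].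
  have [h'|h'] := ltP (gcd_ a.+1) t.
    by exists (gcd_ a.+1); [apply/andP; split; lra|rewrite ler_norml; apply/andP; split; lra].
  by exists t; [apply/andP|rewrite subrr normr0; lra].
case/andP: xb => /proj[u1 v1 d1] /proj[u2 v2 d2].
have zij : in_cell o s i j (u1, u2) by apply/andP.
have [w tw [w1 w2]] := @crossing x (u1, u2) i j k l d1 d2 zij Eij xkl NE.
by apply: (Strace tw); [exact: le_trans w1 d1|exact: le_trans w2 d2].
Qed.

Lemma cycle_domain_sub : cycle_domain `<=` open_square r.
Proof.
move=> x [[i [j [/andP[/andP[? ?] /andP[? ?]] Eij]]] _].
have /andP[ib jb] := inside_in_box gc Eij; have s00 := s0.
have [? ?] := grid_coord_box ib; have [? ?] := grid_coord_box jb.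
by split; rewrite /= in_itv/=; apply/andP; split; lra.
Qed.

Lemma trace_cycle_sub : trace `<=` open_square r `\` S.
Proof.
move=> x tx; split; last first.
  by apply: (Strace tx); rewrite subrr normr0 divr_ge0// ltW.
have [[i [j [/andP[/andP[? ?] /andP[? ?]] Eij]]] _] := trace_cells tx.
have /andP[ib jb] := inside_in_box gc Eij; have s00 := s0.
have [? ?] := grid_coord_box ib; have [? ?] := grid_coord_box jb.
by split; rewrite /= in_itv/=; apply/andP; split; lra.
Qed.

Lemma cycle_interior_domain : interior_domain (open_square r) (cycle_curve o s c) cycle_domain.
Proof. by split; [exact: cycle_domain_open|exact: cycle_domain_sub|exact: cycle_domain_boundary]. Qed.

(** The bump differs from 1 and 0 only within half a mesh of the trace, where S
    is absent by hypothesis. *)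
Lemma cycle_cutoff : cutoff (open_square r) S cycle_domain cycle_bump.
Proof.
split; first exact: test_cycle_bump.
  by move=> x [[i [j [xij Eij]]] _]; exact: cycle_bump1 xij Eij.
move=> x [Sx nD]; split; last exact: supp_cycle_bump_avoid.
by have [_ _] := test_cycle_bump; exact.
Qed.

(** As S stays half a mesh away from the trace, near a point of S the cut-off is
    locally constant, with value 1 inside and 0 outside. *)
Lemma cycle_bump_near x i j : S x -> in_cell o s i j x ->
  \forall y \near x, cycle_bump y = (inside c i j)%:R.
Proof.
move=> Sx xij.
have nt : ~ trace x.
  by move=> tx; apply: (Strace tx _ _ Sx); rewrite subrr normr0 divr_ge0// ltW.
case E: (inside c i j).
  have : cycle_domain x.
    apply: contrapT => nD; apply: nt; rewrite -cycle_domain_boundary; split.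
      by apply/closure_cycle_domain; exists i, j.
    by move=> /interior_subset.
  have := cycle_domain_open; rewrite openE => /[apply]; apply: filterS => y [[k [l [ykl Ekl]]] _].
  exact: cycle_bump1 ykl Ekl.
apply: supp_near0 => Sb; apply: (supp_cycle_bump_avoid Sb) => // -[_ /(_ _ _ xij)].
by rewrite E.
Qed.

End CycleDomain.

(** * From circuits to integer-valued test functions *)

Section TestFunctions.
Variable R : realType.
Implicit Types (f g : R * R -> R) (U : set (R * R)).

Definition vanish_near (S : set (R * R)) f := forall x, S x -> \forall y \near x, f y = 0.

(** The class of test functions dual to the circuit condition: a cut-off
    associated with a circuit is locally 0 or 1 near S, and integral
    combinations of such cut-offs are locally integer-valued there. *)
Definition int_near (S : set (R * R)) f :=
  forall x, S x -> exists z : int, \forall y \near x, f y = z%:~R.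

Definition in_lattice (L t : R) := exists z : int, t = L * z%:~R.

Lemma in_lattice0 L : in_lattice L 0.
Proof. by exists 0; rewrite mulr0. Qed.

Lemma in_latticeD L t u : in_lattice L t -> in_lattice L u -> in_lattice L (t + u).
Proof. by move=> [z ->] [w ->]; exists (z + w); rewrite intrD mulrDr. Qed.

Lemma in_latticeMz L t (z : int) : in_lattice L t -> in_lattice L (z%:~R * t).
Proof. by move=> [w ->]; exists (z * w); rewrite intrM; ring. Qed.

Lemma in_latticeN L t : in_lattice L t -> in_lattice L (- t).
Proof. by move=> [w ->]; exists (- w); rewrite intrN mulrN. Qed.

Lemma supp_out f x : ~ supp f x -> f x = 0.
Proof. by move=> nx; apply: contrapT => /eqP fx; apply: nx; apply: subset_closure. Qed.

Lemma supp_sub f g : (forall x, f x = 0 -> g x = 0) -> supp g `<=` supp f.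
Proof.
move=> H; apply: closure_subset => x /= gx.
by apply/eqP => fx; move/eqP: gx; apply; exact: H.
Qed.

Lemma near0_supp f x : (\forall y \near x, f y = 0) -> ~ supp f x.
Proof. by move=> f0 sx; have [y [/= /eqP ny]] := sx _ f0; exact. Qed.

Lemma test_sub U V f : test_function U f -> supp f `<=` V -> test_function V f.
Proof. by move=> [sf cf _] fV; split. Qed.

Lemma test_mul U f g : smooth g -> test_function U f -> test_function U (fun x => g x * f x).
Proof.
move=> sg [sf cf fU].
have sub : supp (fun x => g x * f x) `<=` supp f.
  by apply: supp_sub => x ->; rewrite mulr0.
split.
- by move=> n; apply: CnM; [exact: sg|exact: sf].
- by apply: subclosed_compact sub => //; exact: closed_closure.
- exact: subset_trans sub fU.
Qed.

Lemma test0 U : test_function U (fun=> 0 : R).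
Proof.
have E : supp (fun _ : R * R => 0 : R) = set0.
  rewrite /supp (_ : [set x | _] = set0) ?closure0//.
  by apply/seteqP; split=> x //=; rewrite eqxx.
by split; [move=> n; exact: Cn_cst|rewrite E; exact: compact0|rewrite E].
Qed.

Lemma test_add U f g (a : R) : test_function U f -> test_function U g ->
  test_function U (fun x => f x + a * g x).
Proof.
move=> [sf cf fU] [sg cg gU].
have sub : supp (fun x => f x + a * g x) `<=` supp f `|` supp g.
  rewrite -closureU; apply: closure_subset => x /=.
  have [->|fx] := eqVneq (f x) 0; last by left.
  rewrite add0r mulf_eq0 negb_or => /andP[_ gx]; by right.
split.
- move=> n; apply: CnD; first exact: sf.
  by apply: CnM; [exact: Cn_cst|exact: sg].
- apply: subclosed_compact sub; first exact: closed_closure.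
  exact: compactU.
- by move=> x /sub[/fU|/gU].
Qed.

Lemma test_out U f x : test_function U f -> ~ U x -> f x = 0.
Proof. by move=> [_ _ fU] nU; apply: supp_out => /fU. Qed.

Lemma near_add (P : R * R -> R) (x : R * R) (f g : R * R -> R) (a u v : R) :
  (\forall y \near x, f y = u) -> (\forall y \near x, g y = v) ->
  \forall y \near x, f y + a * g y = u + a * v.
Proof. by move=> fu gv; near=> y; congr (_ + _ * _); near: y. Unshelve. all: by end_near. Qed.

(** Lebesgue number lemma on a square, for a property inherited by subsets; the
    factor 4 leaves room for the neighbours of a cell of side 1 / (N + 1). *)
Lemma square_lebesgue_number (a b : R) (P : set (R * R) -> Prop) :
  (forall U V, U `<=` V -> P V -> P U) ->
  (forall x : R * R, x.1 \in `[a, b] -> x.2 \in `[a, b] ->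
     exists2 r : R, 0 < r & P [set y | `|y.1 - x.1| < r /\ `|y.2 - x.2| < r]) ->
  exists N : nat, forall x : R * R, x.1 \in `[a, b] -> x.2 \in `[a, b] ->
     P [set y | `|y.1 - x.1| < 4 / N.+1%:R /\ `|y.2 - x.2| < 4 / N.+1%:R].
Proof.
move=> PS Px.
have /compact_near_coveringP K := @closed_square_compact R a b.
have := K nat \oo (fun N x => P [set y | `|y.1 - x.1| < 4 / N.+1%:R /\ `|y.2 - x.2| < 4 / N.+1%:R]) _.
move=> H.
have [|N _ HN] := H _ _; last first.
  by exists N => x x1 x2; apply: (HN N (leqnn N)).
move=> x [x1 x2]; have [r r0 Pr] := Px x x1 x2.
have [M HM] : exists M : nat, forall N, (M <= N)%N -> 4 / N.+1%:R < r / 2 :> R.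
  exists (Num.truncn (8 / r)) => N MN.
  rewrite ltr_pdivrMr// mulrAC ltr_pdivlMr//.
  have h : 8 / r < N.+1%:R.
    apply: lt_le_trans (truncnS_gt (8 / r)) _.
    by rewrite ler_nat.
  move: h; rewrite ltr_pdivrMr// => h; lra.
exists ([set y : R * R | `|y.1 - x.1| < r / 2 /\ `|y.2 - x.2| < r / 2], [set N | (M <= N)%N]).
  split; last by exists M.
  by apply/near2P; exists (r / 2); rewrite ?divr_gt0.
move=> [y N] [/= [y1 y2] MN].
apply: PS Pr => w [w1 w2] /=.
have hN := HM N MN.
move: w1 w2 hN; set q := 4 / _ => w1 w2 hN.
have e : q + r / 2 < r by lra.
split; first by apply: le_lt_trans (ler_distD y.1 _ _) _; apply: lt_trans (ltrD w1 y1) e.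
by apply: le_lt_trans (ler_distD y.2 _ _) _; apply: lt_trans (ltrD w2 y2) e.
Qed.

(** Hat functions centred at the points of a grid; consecutive differences of a
    smooth step telescope, so they form a partition of unity. *)
Definition hat (o s : R) (i : nat) (t : R) : R :=
  smooth_step ((t - o) / s - i%:R + 1) - smooth_step ((t - o) / s - i%:R).

Lemma C1n_hat o s i n : C1n n (hat o s i).
Proof.
rewrite (_ : hat o s i = fun x => smooth_step (s^-1 * x + (- o / s - i%:R + 1)) +
   (-1) * smooth_step (s^-1 * x + (- o / s - i%:R))).
  apply: C1nD; first exact/C1n_affine/C1n_smooth_step.
  by apply: C1nM; [exact: C1n_cst|exact/C1n_affine/C1n_smooth_step].
apply/funext => x; rewrite /hat mulN1r; congr (smooth_step _ - smooth_step _); ring.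
Qed.

Lemma hat_neq0 (o s t : R) i : 0 < s -> hat o s i t != 0 -> `|t - (o + s * i%:R)| < s.
Proof.
move=> s0; have E : t = o + s * ((t - o) / s) by rewrite mulrC divfK ?gt_eqF//; ring.
rewrite /hat {3}E; set u := (t - o) / s.
rewrite (_ : o + s * u - (o + s * i%:R) = s * (u - i%:R)); last by ring.
rewrite normrM (gtr0_norm s0) -[X in _ -> _ < X]mulr1 ltr_pM2l// ltr_norml.
apply: contraR; rewrite negb_and -!leNgt => /orP[h|h].
  by rewrite !smooth_step_le0 ?subrr//; lra.
by rewrite !smooth_step_ge1 ?subrr//; lra.
Qed.

Lemma sum_hat (o s t : R) (M : nat) : 0 < s -> o <= t <= o + s * M%:R ->
  \sum_(0 <= i < M.+1) hat o s i t = 1.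
Proof.
move=> s0 /andP[h1 h2]; have u0 : 0 <= (t - o) / s by rewrite divr_ge0 ?subr_ge0// ltW.
have uM : (t - o) / s <= M%:R by rewrite ler_pdivrMr// mulrC lerBlDl.
pose F (i : nat) := - smooth_step ((t - o) / s - i%:R + 1).
rewrite (eq_big_nat _ _ (F2 := fun i => F i.+1 - F i)); last first.
  move=> i _; rewrite /hat /F -natr1 opprK addrC; congr (- smooth_step _ + _); ring.
rewrite telescope_sumr// /F opprK smooth_step_le0; last by rewrite -natr1; lra.
by rewrite subr0 smooth_step_ge1 ?oppr0 ?add0r//; lra.
Qed.

End TestFunctions.

Section CircuitLattice.
Variables (R : realType) (S : set (R * R)) (L : R) (Lam : (R * R -> R) -> R).
Let T : set (R * R) := open_square 2^-1.
Hypothesis S_closed : exists2 C : set (R * R), closed C & S = T `&` C.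
Hypothesis Lam_linear : forall f g a, test_function T f -> test_function T g ->
  Lam (fun x => f x + a * g x) = Lam f + a * Lam g.
Hypothesis Lam_local : forall x, T x -> ~ S x -> exists U : set (R * R),
  [/\ open U, U x, U `<=` T & forall phi, test_function U phi -> Lam phi = 0].
Hypothesis Lam_circuit : forall (gamma : R -> R * R) (D : set (R * R)) (phi : R * R -> R),
  simple_closed_curve gamma -> rectifiable gamma -> trace_curve gamma `<=` T `\` S ->
  interior_domain T gamma D -> cutoff T S D phi -> in_lattice L (Lam phi).

Lemma Lam0 : Lam (fun=> 0) = 0.
Proof.
have := @Lam_linear _ _ (-1) (test0 T) (test0 T).
rewrite (_ : (fun x => _) = fun=> 0); last by apply/funext => x; rewrite mulr0 addr0.
by move=> ->; rewrite mulN1r subrr.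
Qed.

Lemma test_sum (I : Type) (l : seq I) (f : I -> R * R -> R) (a : I -> R) :
  (forall i, test_function T (f i)) -> test_function T (fun x => \sum_(i <- l) a i * f i x) /\
  Lam (fun x => \sum_(i <- l) a i * f i x) = \sum_(i <- l) a i * Lam (f i).
Proof.
move=> tf; elim: l => [|i l [IH1 IH2]].
  rewrite (_ : (fun x => _) = fun=> 0) ?Lam0 ?big_nil; last by apply/funext => x; rewrite big_nil.
  by split=> //; exact: test0.
rewrite (_ : (fun x => _) = fun x => \sum_(i <- l) a i * f i x + a i * f i x); last first.
  by apply/funext => x; rewrite big_cons addrC.
split; first exact: test_add.
by rewrite Lam_linear// IH2 big_cons addrC.
Qed.

Let K0 (x : R * R) : T x -> x.1 \in `[- 2^-1, 2^-1] /\ x.2 \in `[- 2^-1, 2^-1].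
Proof.
by rewrite /T /open_square /= !in_itv/= => -[/andP[/ltW -> /ltW ->] /andP[/ltW -> /ltW ->]].
Qed.

(** A test function vanishing near S is split by a fine partition of unity into
    pieces supported either in open sets where Lam vanishes or where psi does. *)
Lemma Lam_vanish_near psi : test_function T psi -> vanish_near S psi -> Lam psi = 0.
Proof.
move=> tpsi vpsi; have [spsi _ psiT] := tpsi.
pose P (V : set (R * R)) := (exists U : set (R * R), V `<=` U /\ forall phi, test_function U phi -> Lam phi = 0) \/
  (forall y, V y -> psi y = 0).
have [N HN] : exists N : nat, forall x : R * R, x.1 \in `[- 2^-1, 2^-1] -> x.2 \in `[- 2^-1, 2^-1] ->
     P [set y | `|y.1 - x.1| < 4 / N.+1%:R /\ `|y.2 - x.2| < 4 / N.+1%:R].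
  apply: square_lebesgue_number.
    move=> U V UV [[W [VW HW]]|HV]; first by left; exists W; split=> //; exact: subset_trans VW.
    by right=> y /UV /HV.
  move=> x x1 x2; have [sx|nx] := pselect (supp psi x).
    have [|U [oU Ux UT HU]] := @Lam_local x (psiT _ sx).
      by move=> /vpsi /near0_supp.
    have /open2P /(_ x Ux)[r r0 Hr] := oU.
    exists r => //; left; exists U; split=> // y [y1 y2]; exact: Hr.
  have /near2P[r r0 Hr] := supp_near0 nx.
  by exists r => //; right=> y [y1 y2]; exact: Hr.
pose s : R := N.+1%:R^-1; have s0 : 0 < s by rewrite invr_gt0.
pose o : R := - 2^-1.
pose pr := [seq (i, j) | i <- index_iota 0 N.+2, j <- index_iota 0 N.+2].
pose b (p : nat * nat) (x : R * R) := hat o s p.1 x.1 * hat o s p.2 x.2.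
have sb p : smooth (b p).
  by move=> n; apply: CnM; [apply: C1n_tensor1|apply: C1n_tensor2]; exact: C1n_hat.
have Epsi : psi = fun x => \sum_(p <- pr) 1 * (b p x * psi x).
  apply/funext => x; have [Tx|nTx] := pselect (T x); last first.
    by rewrite (test_out tpsi nTx) big1// => p _; rewrite mulr0 mulr0.
  under eq_bigr => p _ do rewrite mul1r.
  rewrite -mulr_suml /b big_allpairs_dep /=.
  under eq_bigr => i _ do rewrite -mulr_sumr.
  rewrite -mulr_suml.
  have [] := K0 Tx; rewrite !in_itv/= => h1 h2.
  have sN : s * N.+1%:R = 1 by rewrite mulVf.
  by rewrite !sum_hat ?mul1r// sN /o; [move: h2|move: h1] => /andP[? ?]; apply/andP; split; lra.
rewrite Epsi; have [_ ->] := @test_sum _ pr (fun p x => b p x * psi x) (fun=> 1) (fun p => test_mul (sb p) tpsi).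
rewrite big_seq big1// => p pin; rewrite mul1r.
have [i [j [/= hi hj ep]]] : exists i j, [/\ (i < N.+2)%N, (j < N.+2)%N & p = (i, j)].
  move: pin => /allpairsP[[i j] /= []]; rewrite !mem_index_iota => /andP[_ hi] /andP[_ hj] ->.
  by exists i, j.
have inK (k : nat) : (k < N.+2)%N -> o + s * k%:R \in `[- 2^-1, 2^-1].
  rewrite ltnS -(ler_nat R) in_itv /= => kN.
  have : s * k%:R <= 1 by rewrite mulrC ler_pdivrMr ?mul1r.
  have : 0 <= s * k%:R by rewrite mulr_ge0// ltW.
  by rewrite /o => *; apply/andP; split; lra.
have tb := test_mul (sb p) tpsi.
have sN4 : s < 4 / N.+1%:R by rewrite -/s; lra.
have loc x : b p x * psi x != 0 -> `|x.1 - (o + s * i%:R)| < s /\ `|x.2 - (o + s * j%:R)| < s.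
  rewrite /b ep /= !mulf_eq0 !negb_or => /andP[/andP[h1 h2] _].
  by split; exact: hat_neq0.
case: (HN (o + s * i%:R, o + s * j%:R) (inK _ hi) (inK _ hj)) => /=.
  move=> [U [sU HU]]; apply: HU; apply: test_sub tb _ => x /closure2P /(_ s s0)[y /loc [h1 h2] [h3 h4]].
  apply: sU => /=; rewrite -/s; rewrite distrC in h3; rewrite distrC in h4.
  by split; [rewrite (_ : x.1 - _ = (x.1 - y.1) + (y.1 - (o + s * i%:R)))|
             rewrite (_ : x.2 - _ = (x.2 - y.2) + (y.2 - (o + s * j%:R)))]; try ring;
    apply: le_lt_trans (ler_normD _ _) _; lra.
move=> H0; rewrite (_ : (fun x => _) = fun=> 0) ?Lam0//.
apply/funext => x; apply/eqP; apply: contraT => nz.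
have [h1 h2] := loc _ nz; move: nz; rewrite H0 ?mulr0 ?eqxx//=.
by split; [exact: lt_trans h1 _|exact: lt_trans h2 _].
Qed.

(** Edges along which a circuit may run: S keeps half a mesh away from them. *)
Definition edge_free (o s : R) (p q : nat * nat) := forall w y,
  on_segment o s p q w -> `|w.1 - y.1| <= s / 2 -> `|w.2 - y.2| <= s / 2 -> ~ S y.

Lemma edge_free_sym (o s : R) p q : edge_free o s p q -> edge_free o s q p.
Proof. by move=> H w y /on_segment_sym; exact: H. Qed.

(** The circuit condition extends from cut-offs of simple closed curves to all
    test functions that are locally constant with integer values near S. On a
    fine grid, the cells close to S on which psi takes the value m form a union
    E m whose boundary edges avoid S, since cells with different labels cannot
    be close to a common point of S. By grid_induction, E m is represented by a
    combination rho m of cut-offs of circuits. Then psi and the sum of the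
    m * rho m agree near S, and Lam_vanish_near disposes of their difference. *)
Theorem circuit_int_near psi : test_function T psi -> int_near S psi ->
  in_lattice L (Lam psi).
Proof.
move=> tpsi ipsi; have [spsi _ psiT] := tpsi; have [C cC SC] := S_closed.
(* a small square avoids S or carries a single integer value of psi *)
pose P (V : set (R * R)) := (forall y, V y -> ~ S y) \/ (exists z : int, forall y, V y -> psi y = z%:~R).
have [N HN] : exists N : nat, forall x : R * R, x.1 \in `[- 2^-1, 2^-1] -> x.2 \in `[- 2^-1, 2^-1] ->
     P [set y | `|y.1 - x.1| < 4 / N.+1%:R /\ `|y.2 - x.2| < 4 / N.+1%:R].
  apply: square_lebesgue_number.
    move=> U V UV [HV|[z HV]]; first by left=> y /UV /HV.
    by right; exists z => y /UV /HV.
  move=> x x1 x2; have [Sx|nSx] := pselect (S x).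
    have [z /near2P[r r0 Hr]] := ipsi _ Sx.
    by exists r => //; right; exists z => y [y1 y2]; exact: Hr.
  have [sx|nx] := pselect (supp psi x); last first.
    have /near2P[r r0 Hr] := supp_near0 nx.
    by exists r => //; right; exists 0 => y [y1 y2]; exact: Hr.
  have nC : (~` C) x by move=> Cx; apply: nSx; rewrite SC; split=> //; exact: psiT.
  have /open2P /(_ x nC)[r r0 Hr] : open (~` C) by exact: closed_openC.
  by exists r => //; left=> y [y1 y2]; rewrite SC => -[_]; exact: Hr.
pose s : R := N.+1%:R^-1; have s0 : 0 < s by rewrite invr_gt0.
have s4 : 4 / N.+1%:R = 4 * s by [].
pose o : R := - 2^-1.
have sN : s * N.+1%:R = 1 by rewrite mulVf.
have orr : o = - 2^-1 by [].
have sr : s * N.+1%:R = 2 * 2^-1 by rewrite sN divff.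
pose ctr (i j : nat) : R * R := (grid_coord o s i + s / 2, grid_coord o s j + s / 2).
pose near_ctr (i j : nat) (y : R * R) := `|y.1 - (ctr i j).1| < 2 * s /\ `|y.2 - (ctr i j).2| < 2 * s.
pose hit (i j : nat) := `[< exists2 y, S y & near_ctr i j y >].
have gK (k : nat) : (k <= N)%N -> - 2^-1 <= grid_coord o s k /\ grid_coord o s k.+1 <= 2^-1.
  move=> kN; split; first by rewrite /grid_coord orr lerDl mulr_ge0// ltW.
  have : grid_coord o s k.+1 <= grid_coord o s N.+1 by exact: grid_coord_mono.
  by rewrite {2}/grid_coord sN orr; lra.
have ctrK i j : (i <= N)%N -> (j <= N)%N -> (ctr i j).1 \in `[- 2^-1, 2^-1] /\ (ctr i j).2 \in `[- 2^-1, 2^-1].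
  move=> /gK[i1 i2] /gK[j1 j2]; rewrite !grid_coordS in i2 j2; have s00 := s0.
  by rewrite /ctr !in_itv /=; split; apply/andP; split; lra.
have const i j : (i <= N)%N -> (j <= N)%N -> hit i j -> exists z : int, forall y,
    `|y.1 - (ctr i j).1| < 4 * s -> `|y.2 - (ctr i j).2| < 4 * s -> psi y = z%:~R.
  move=> iN jN /asboolP[y Sy [y1 y2]]; have [c1 c2] := ctrK i j iN jN.
  case: (HN _ c1 c2) => [H|[z Hz]].
    exfalso; apply: (H y) => //=; rewrite s4; have s00 := s0.
    by split; [apply: lt_trans y1 _|apply: lt_trans y2 _]; lra.
  by exists z => w w1 w2; apply: Hz => /=; rewrite s4.
have in_ctr i j x : in_cell o s i j x -> near_ctr i j x.
  move=> /andP[]; rewrite !grid_coordS => /andP[? ?] /andP[? ?]; have s00 := s0.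
  by split; rewrite /ctr /= ltr_norml; apply/andP; split; lra.
(* the cells close to S, labelled by the value of psi at their centre *)
pose E (m : int) (i j : nat) := [&& (i <= N)%N, (j <= N)%N, hit i j & psi (ctr i j) == m%:~R].
have ctr_self i j : `|(ctr i j).1 - (ctr i j).1| < 4 * s /\ `|(ctr i j).2 - (ctr i j).2| < 4 * s.
  by rewrite !subrr normr0; split; rewrite mulr_gt0.
have E_box m : m != 0 -> in_box N (E m).
  move=> m0 i j /and4P[iN jN hij /eqP psim].
  have [z Hz] := const i j iN jN hij.
  have zm : forall y : R * R, `|y.1 - (ctr i j).1| < 4 * s -> `|y.2 - (ctr i j).2| < 4 * s -> T y.
    move=> y y1 y2; apply: contrapT => nT; move/eqP: m0; apply.
    have [c1 c2] := ctr_self i j.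
    have : m%:~R = 0 :> R by rewrite -psim (Hz _ c1 c2) -(Hz _ y1 y2); exact: test_out tpsi nT.
    by move/eqP; rewrite intr_eq0 => /eqP.
  have s00 := s0.
  have e1 : `|- (s / 2)| < 4 * s by rewrite normrN gtr0_norm; lra.
  have e2 : `|s / 2| < 4 * s by rewrite gtr0_norm; lra.
  have e3 : `|0 : R| < 4 * s by rewrite normr0; lra.
  have [g1 g2] := gK _ iN; have [g3 g4] := gK _ jN; rewrite !grid_coordS in g2 g4.
  have L1 : T (grid_coord o s i, grid_coord o s j + s / 2).
    apply: zm; rewrite /ctr /=; last by rewrite subrr.
    by rewrite (_ : _ - _ = - (s / 2)) //; ring.
  have L2 : T (grid_coord o s i + s, grid_coord o s j + s / 2).
    apply: zm; rewrite /ctr /=; last by rewrite subrr.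
    by rewrite (_ : _ - _ = s / 2) //; field.
  have L3 : T (grid_coord o s i + s / 2, grid_coord o s j).
    apply: zm; rewrite /ctr /=; first by rewrite subrr.
    by rewrite (_ : _ - _ = - (s / 2)) //; ring.
  have L4 : T (grid_coord o s i + s / 2, grid_coord o s j + s).
    apply: zm; rewrite /ctr /=; first by rewrite subrr.
    by rewrite (_ : _ - _ = s / 2) //; field.
  move: L1 L2 L3 L4; rewrite /T /open_square /= !in_itv/=.
  move=> [/andP[l1 _] _] [/andP[_ l2] _] [_ /andP[l3 _]] [_ /andP[_ l4]].
  have gpos (k : nat) : - 2^-1 < grid_coord o s k -> (0 < k)%N.
    by case: k => // h; exfalso; move: h; rewrite /grid_coord orr mulr0 addr0 ltxx.
  have glt (k : nat) : (k <= N)%N -> grid_coord o s k + s < 2^-1 -> (k < N)%N.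
    rewrite -grid_coordS leq_eqVlt => /orP[/eqP ->|//] h; exfalso; move: h.
    by rewrite /grid_coord sN orr; lra.
  by rewrite !gpos// !glt.
pose av a b := `[< edge_free o s (a, b) (a, b.+1) >].
pose ah a b := `[< edge_free o s (a, b) (a.+1, b) >].
(* cells with different labels cannot be close to a common point of S *)
have clash m i j i' j' y : (i <= N)%N -> (j <= N)%N -> (i' <= N)%N -> (j' <= N)%N ->
    near_ctr i j y -> near_ctr i' j' y -> S y -> E m i j = E m i' j'.
  suff H : forall i j i' j', (i <= N)%N -> (j <= N)%N -> (i' <= N)%N -> (j' <= N)%N ->
    near_ctr i j y -> near_ctr i' j' y -> S y -> E m i j -> E m i' j'.
    by move=> *; apply/idP/idP; apply: H.
  move=> {}i {}j {}i' {}j' iN jN iN' jN' n1 n2 Sy /and4P[_ _ hij /eqP psim].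
  have hij' : hit i' j' by apply/asboolP; exists y.
  rewrite /E iN' jN' hij' /=; apply/eqP.
  have [z Hz] := const i j iN jN hij; have [z' Hz'] := const i' j' iN' jN' hij'.
  have [c1 c2] := ctr_self i j; have [c1' c2'] := ctr_self i' j'.
  rewrite (Hz' _ c1' c2') -psim (Hz _ c1 c2); have s00 := s0.
  have up (t : R) : t < 2 * s -> t < 4 * s by move=> h; lra.
  case: n1 => /up u1 /up u2; case: n2 => /up u1' /up u2'.
  by rewrite -(Hz _ u1 u2) (Hz' _ u1' u2').
have close (a : R) (k : nat) (w y : R) : `|w - (grid_coord o s k + s / 2)| <= s / 2 -> `|w - y| <= s / 2 ->
    `|y - (grid_coord o s k + s / 2)| < 2 * s.
  move=> h1 h2; apply: le_lt_trans (ler_distD w _ _) _; rewrite (distrC y w).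
  by have s00 := s0; lra.
have mid_edge (k : nat) (w th : R) : 0 <= th <= 1 ->
    w = grid_coord o s k + th * (grid_coord o s k.+1 - grid_coord o s k) -> `|w - (grid_coord o s k + s / 2)| <= s / 2.
  move=> /andP[t0 t1] ->; rewrite grid_coordS; have s00 := s0.
  have h0 : 0 <= th * s by rewrite mulr_ge0// ltW.
  have h1 : th * s <= s by rewrite ler_piMl// ltW.
  by rewrite ler_norml; apply/andP; split; lra.
have endl (k : nat) : `|grid_coord o s k - (grid_coord o s k + s / 2)| <= s / 2.
  by rewrite (_ : _ - _ = - (s / 2)); [rewrite normrN gtr0_norm//; have := s0; lra|ring].
have endr (k : nat) : `|grid_coord o s k.+1 - (grid_coord o s k + s / 2)| <= s / 2.
  by rewrite grid_coordS (_ : _ - _ = s / 2); [rewrite gtr0_norm//; have := s0; lra|field].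
have E_v m : m != 0 -> forall i j, vedge (E m) i j -> av i j.
  move=> m0 i j V; apply/asboolP => w y [th th01 ->] /= h1 h2 Sy.
  have /andP[iN jN] := edge_box (E_box m m0) (i := i) (j := j) ltac:(by rewrite V).
  case: i V iN h1 => [|i] V iN h1; first by rewrite /vedge addbb in V.
  have jN' : (j <= N)%N by [].
  have iN' : (i.+1 <= N)%N by [].
  rewrite subrr mulr0 addr0 in h1.
  have n1 : near_ctr i j y.
    split; first exact: (close 0 i _ _ (endr i) h1).
    exact: (close 0 j _ _ (mid_edge j _ th th01 erefl) h2).
  have n2 : near_ctr i.+1 j y.
    split; first exact: (close 0 i.+1 _ _ (endl i.+1) h1).
    exact: (close 0 j _ _ (mid_edge j _ th th01 erefl) h2).
  by move: V; rewrite /vedge /= (clash m i j i.+1 j y (ltnW iN') jN' iN' jN' n1 n2 Sy) addbb.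
have E_h m : m != 0 -> forall i j, hedge (E m) i j -> ah i j.
  move=> m0 i j V; apply/asboolP => w y [th th01 ->] /= h1 h2 Sy.
  have /andP[iN jN] := edge_box (E_box m m0) (i := i) (j := j) ltac:(by rewrite V orbT).
  case: j V jN h2 => [|j] V jN h2; first by rewrite /hedge addbb in V.
  have iN' : (i <= N)%N by [].
  have jN' : (j.+1 <= N)%N by [].
  rewrite subrr mulr0 addr0 in h2.
  have n1 : near_ctr i j y.
    split; last exact: (close 0 j _ _ (endr j) h2).
    exact: (close 0 i _ _ (mid_edge i _ th th01 erefl) h1).
  have n2 : near_ctr i j.+1 y.
    split; last exact: (close 0 j.+1 _ _ (endl j.+1) h2).
    exact: (close 0 i _ _ (mid_edge i _ th th01 erefl) h1).
  by move: V; rewrite /hedge /= (clash m i j i j.+1 y iN' (ltnW jN') iN' jN' n1 n2 Sy) addbb.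
pose represented (F : nat -> nat -> bool) := exists rho : R * R -> R,
  [/\ test_function T rho, in_lattice L (Lam rho) &
    forall x i j, S x -> in_cell o s i j x -> \forall y \near x, rho y = (F i j)%:R].
have repE m : m != 0 -> represented (E m).
  move=> m0; apply: (@grid_induction N av ah represented) (E_box m m0) (E_v m m0) (E_h m m0).
  - exists (fun=> 0); split; first exact: test0.
      by rewrite Lam0; exact: in_lattice0.
    by move=> x i j _ _; near=> y.
  - move=> E1 E2 [r1 [t1 l1 n1]] [r2 [t2 l2 n2]] dis.
    exists (fun x => r1 x + 1 * r2 x); split; first exact: test_add.
      by rewrite Lam_linear// mul1r; exact: in_latticeD.
    move=> x i j Sx xij; have := dis i j.
    rewrite (_ : (E1 i j || E2 i j)%:R = (E1 i j)%:R + 1 * (E2 i j)%:R :> R) => [_|].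
      by apply: (@near_add _ (fun=> 0)); [exact: n1|exact: n2].
    by have := dis i j; case: (E1 i j); case: (E2 i j) => //= _; ring.
  - move=> E1 E2 [r1 [t1 l1 n1]] [r2 [t2 l2 n2]] dis.
    exists (fun x => r1 x + (-1) * r2 x); split; first exact: test_add.
      by rewrite Lam_linear// mulN1r; apply: in_latticeD => //; exact: in_latticeN.
    move=> x i j Sx xij.
    rewrite (_ : (E1 i j && ~~ E2 i j)%:R = (E1 i j)%:R + (-1) * (E2 i j)%:R :> R).
      by apply: (@near_add _ (fun=> 0)); [exact: n1|exact: n2].
    by have := dis i j; case: (E1 i j); case: (E2 i j) => //= _; ring.
  - move=> c gc cv ch.
    have St : forall w y, trace_curve (cycle_curve o s c) w -> `|w.1 - y.1| <= s / 2 ->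
        `|w.2 - y.2| <= s / 2 -> ~ S y.
      move=> w y /(trace_cycle_edge o s gc)[p [q [pq wpq]]].
      suff : edge_free o s p q by move=> /(_ w y wpq); exact.
      have [uc _ cb cs] := gc.
      have us : unit_step p q \/ unit_step q p.
        have /andP[pc qc] := cycle_edge_mem pq.
        case/andP: pq => _ /orP[]/eqP <-; first by left; exact: cs.
        by right; have := cs (prev c p); rewrite mem_prev next_prev//; exact.
      have dir p' q' : cycle_edge c p' q' -> (q' == (p'.1, p'.2.+1)) || (q' == (p'.1.+1, p'.2)) ->
          edge_free o s p' q'.
        case: p' => a b pq' /orP[]/eqP Eq; rewrite Eq in pq' *.
          by have /asboolP := cv a b pq'.
        by have /asboolP := ch a b pq'.
      have qp : cycle_edge c q p by rewrite cycle_edge_sym.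
      case: us => /or4P[] h.
      + by apply: dir pq _; rewrite h.
      + by apply: dir pq _; rewrite h orbT.
      + by apply: edge_free_sym; apply: dir qp _; rewrite h orbT.
      + by apply: edge_free_sym; apply: dir qp _; rewrite h.
      + by apply: edge_free_sym; apply: dir qp _; rewrite h.
      + by apply: edge_free_sym; apply: dir qp _; rewrite h orbT.
      + by apply: dir pq _; rewrite h orbT.
      + by apply: dir pq _; rewrite h.
    exists (cycle_bump o s N c); split.
    + exact: (test_cycle_bump s0 gc orr sr).
    + exact (@Lam_circuit _ (cycle_domain o s c) _ (cycle_curve_simple o s0 gc)
        (cycle_curve_rectifiable o s0 gc) (trace_cycle_sub s0 gc orr sr St)
        (cycle_interior_domain s0 gc orr sr) (cycle_cutoff s0 gc orr sr St)).
    + move=> x i j Sx xij; exact: (cycle_bump_near s0 gc orr sr St Sx xij).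
pose lev := undup [seq Num.floor (psi (ctr p.1 p.2)) | p <- grid_points N].
pose lev0 := [seq m <- lev | m != 0].
have /choice[rho Hrho] : forall m : int, exists rho : R * R -> R, m != 0 ->
   [/\ test_function T rho, in_lattice L (Lam rho) &
    forall x i j, S x -> in_cell o s i j x -> \forall y \near x, rho y = (E m i j)%:R].
  move=> m; have [->|m0] := eqVneq m 0; first by exists (fun=> 0).
  by have [rho H] := repE m m0; exists rho.
pose rho' (m : int) := if m != 0 then rho m else fun=> 0.
have trho m : test_function T (rho' m).
  by rewrite /rho'; case: ifPn => [/Hrho[]//|_]; exact: test0.
have [tsum Lsum] := test_sum lev0 (fun m => m%:~R) trho.
have lat : in_lattice L (Lam (fun x => \sum_(m <- lev0) m%:~R * rho' m x)).
  rewrite Lsum; elim/big_ind: _ => [|? ? ? ?|m _]; first exact: in_lattice0.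
    exact: in_latticeD.
  apply: in_latticeMz; rewrite /rho'; case: ifPn => [/Hrho[]//|_].
  by rewrite Lam0; exact: in_lattice0.
have vdiff : vanish_near S (fun x => psi x + (-1) * \sum_(m <- lev0) m%:~R * rho' m x).
  move=> x Sx; have Tx : T x by rewrite SC in Sx; case: Sx.
  have [] := K0 Tx; rewrite !in_itv/= => /andP[x1 x1'] /andP[x2 x2'].
  have [i [j xij]] := @cell_exists _ o s s0 x x1 x2.
  have lt12 (t : R) (k : nat) : grid_coord o s k <= t -> t < 2^-1 -> (k <= N)%N.
    move=> h1 h2; rewrite -ltnS ltnNge; apply/negP => h.
    have := @grid_coord_mono R o s s0 _ _ h; rewrite {1}/grid_coord sN => h3.
    by have := le_lt_trans (le_trans h3 h1) h2; rewrite orr; lra.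
  have [iN jN] : (i <= N)%N /\ (j <= N)%N.
    case/andP: xij => /andP[xi _] /andP[xj _].
    move: Tx; rewrite /T /open_square /= !in_itv/= => -[/andP[_ t1] /andP[_ t2]].
    by split; [exact: lt12 xi t1|exact: lt12 xj t2].
  have nx := in_ctr _ _ _ xij.
  have hij : hit i j by apply/asboolP; exists x.
  have [z Hz] := const i j iN jN hij; have s00 := s0.
  have psiz : psi (ctr i j) = z%:~R by have [c1 c2] := ctr_self i j; exact: Hz.
  have zlev : z \in lev.
    rewrite mem_undup; apply/mapP; exists (i, j); first exact: mem_grid_points.
    by rewrite /= psiz intrKfloor.
  have nz : \forall y \near x, psi y = z%:~R.
    apply/near2P; exists s => // y y1 y2; case: nx => n1 n2; apply: Hz.
      by apply: le_lt_trans (ler_distD x.1 _ _) _; lra.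
    by apply: le_lt_trans (ler_distD x.2 _ _) _; lra.
  have nsum (l : seq int) : all (fun m => m != 0) l ->
      \forall y \near x, \sum_(m <- l) m%:~R * rho' m y = \sum_(m <- l) m%:~R * (z == m)%:R.
    elim: l => [_|m l IH /= /andP[m0 /IH H]].
      by near=> y; rewrite !big_nil.
    have [_ _ /(_ x i j Sx xij)] := Hrho _ m0.
    rewrite /E iN jN hij psiz eqr_int /= => Hm.
    by near=> y; rewrite !big_cons; congr (_ * _ + _); [rewrite /rho' m0|]; near: y.
  have : \forall y \near x, psi y + (-1) * \sum_(m <- lev0) m%:~R * rho' m y =
      z%:~R + (-1) * \sum_(m <- lev0) m%:~R * (z == m)%:R.
    by apply: (@near_add _ (fun=> 0)) => //; apply: nsum; exact: filter_all.
  apply: filterS => y ->.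
  have [z0|z0] := eqVneq z 0.
    rewrite z0 big1_seq ?mulr0 ?addr0// => m /andP[_]; rewrite mem_filter => /andP[m0 _].
    by rewrite eq_sym (negPf m0) mulr0.
  have zl : z \in lev0 by rewrite mem_filter z0.
  have ul : uniq lev0 by rewrite filter_uniq// undup_uniq.
  rewrite (bigD1_seq z)//= eqxx mulr1 big1 ?addr0 ?mulN1r ?subrr// => m mz.
  by rewrite eq_sym (negPf mz) mulr0.
have := Lam_vanish_near (test_add (-1) tpsi tsum) vdiff.
rewrite Lam_linear// mulN1r => /eqP; rewrite subr_eq0 => /eqP ->.
exact: lat.
Unshelve. all: by end_near. Qed.

End CircuitLattice.

(** * Integration on the plane *)

Section PlaneMeasure.
Variable R : realType.
Implicit Types (f g : R * R -> R).

Notation leb := (@lebesgue_measure R).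
Notation mu2 := (leb \x leb)%E.

Lemma rat_box (x : R * R) (r : R) : 0 < r -> exists q : (rat * rat) * rat,
  [/\ `|x.1 - ratr q.1.1| < ratr q.2, `|x.2 - ratr q.1.2| < ratr q.2 & ratr q.2 <= r / 2].
Proof.
move=> r0; have r40 : 0 < r / 4 by rewrite divr_gt0.
have lt4 : r / 4 < r / 2 by lra.
have [q] := rat_in_itvoo lt4; rewrite in_itv /= => /andP[q1 q2].
have q0 : 0 < ratr q :> R by exact: lt_trans q1.
have ap (t : R) : exists p : rat, `|t - ratr p| < ratr q.
  have lt1 : t - ratr q < t + ratr q by lra.
  have [p] := rat_in_itvoo lt1; rewrite in_itv /= => /andP[p1 p2].
  by exists p; rewrite ltr_norml; apply/andP; split; lra.
have [p1 h1] := ap x.1; have [p2 h2] := ap x.2.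
by exists ((p1, p2), q); split=> //; apply: ltW; move: q2; lra.
Qed.

(** An open set of the plane is a countable union of rational boxes. *)
Lemma open2_measurable (U : set (R * R)) : open U -> measurable U.
Proof.
move=> /open2P oU.
pose B (q : (rat * rat) * rat) : set (R * R) :=
  `]ratr q.1.1 - ratr q.2, ratr q.1.1 + ratr q.2[%classic `*`
  `]ratr q.1.2 - ratr q.2, ratr q.1.2 + ratr q.2[%classic.
rewrite (_ : U = \bigcup_(q in [set q | B q `<=` U]) B q).
  rewrite bigcup_mkcond; apply: countable_bigcupT_measurable.
    exact: countableP.
  by move=> q; case: ifP => // _; apply: measurableX.
apply/seteqP; split=> x.
  move=> Ux; have [r r0 Hr] := oU x Ux.
  have [q [q1 q2 qr]] := rat_box x r0.
  exists q => /=; last first.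
    by split; rewrite /= in_itv/=; move: q1 q2; rewrite !ltr_norml => /andP[? ?] /andP[? ?]; apply/andP; split; lra.
  move=> y [] /=; rewrite !in_itv/= => /andP[? ?] /andP[? ?].
  move: q1 q2; rewrite !ltr_norml => /andP[? ?] /andP[? ?].
  by apply: Hr; rewrite ltr_norml; apply/andP; split; lra.
by move=> [q /= qU] /qU.
Qed.

Lemma continuous2_measurable f : continuous f -> measurable_fun setT f.
Proof.
move=> cf; apply: (measurability _ (RGenOpens.measurableE R)).
move=> _ [_ [a [b ->] <-]]; rewrite setTI.
apply: open2_measurable; move/continuousP : cf; apply; exact: interval_open.
Qed.

(** Integrability of real functions on the whole plane; functions defined on a
    domain are extended by 0, so that no domain needs to be carried around. *)
Definition integ f := mu2.-integrable setT (EFin \o f).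

Lemma integD f g : integ f -> integ g -> integ (fun x => f x + g x).
Proof. by move=> hf hg; have := integrableD measurableT hf hg; apply: eq_integrable. Qed.

Lemma integZ f (k : R) : integ f -> integ (fun x => k * f x).
Proof. by move=> hf; have := integrableZl measurableT k hf; apply: eq_integrable. Qed.

Lemma integ_measurable f : integ f -> measurable_fun setT f.
Proof. by move=> /measurable_int /measurable_EFinP. Qed.

Lemma le_integ f g : measurable_fun setT f -> (forall x, `|f x| <= g x) -> integ g -> integ f.
Proof.
move=> mf fg ig; apply: (le_integrable measurableT _ _ ig).
  exact/measurable_EFinP.
move=> x _ /=; rewrite lee_fin; apply: (le_trans (fg x)); exact: ler_norm.
Qed.

Lemma integ_norm f : integ f -> integ (fun x => `|f x|).
Proof. by move=> hf; apply: integrable_norm. Qed.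

Lemma integMbounded f g (M : R) : measurable_fun setT g -> (forall x, `|g x| <= M) ->
  integ f -> integ (fun x => g x * f x).
Proof.
move=> mg gM hf; apply: (@le_integ _ (fun x => M * `|f x|)).
- by apply: measurable_funM => //; exact: integ_measurable.
- by move=> x; rewrite normrM ler_wpM2r.
- exact/integZ/integ_norm.
Qed.

Lemma integ_sum (I : Type) (l : seq I) (F : I -> R * R -> R) :
  (forall i, integ (F i)) -> integ (fun x => \sum_(i <- l) F i x).
Proof.
move=> h; elim: l => [|i l IH].
  rewrite (_ : (fun x => _) = fun=> 0); last by apply/funext => x; rewrite big_nil.
  exact: integrable0.
rewrite (_ : (fun x => _) = fun x => F i x + \sum_(i <- l) F i x).
  exact: integD.
by apply/funext => x; rewrite big_cons.
Qed.

Definition I2 f : R := \int[mu2]_x f x.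

Lemma I2D f g : integ f -> integ g -> I2 (fun x => f x + g x) = I2 f + I2 g.
Proof. by move=> hf hg; rewrite /I2 RintegralD. Qed.

Lemma I2Z f k : integ f -> I2 (fun x => k * f x) = k * I2 f.
Proof. by move=> hf; rewrite /I2 RintegralZl. Qed.

Lemma I2_eq f g : (forall x, f x = g x) -> I2 f = I2 g.
Proof. by move=> /funext ->. Qed.

Lemma I2_EFin f : integ f -> (I2 f)%:E = (\int[mu2]_x (f x)%:E)%E.
Proof. by move=> hf; rewrite /I2 /Rintegral fineK//; exact: integrable_fin_num. Qed.

Lemma I2_sum (I : Type) (l : seq I) (F : I -> R * R -> R) :
  (forall i, integ (F i)) -> I2 (fun x => \sum_(i <- l) F i x) = \sum_(i <- l) I2 (F i).
Proof.
move=> h; elim: l => [|i l IH].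
  rewrite big_nil (_ : (fun x => _) = fun=> 0); last by apply/funext => x; rewrite big_nil.
  by rewrite /I2 /Rintegral integral0.
rewrite big_cons -IH -I2D//; last exact: integ_sum.
by apply: I2_eq => x; rewrite big_cons.
Qed.

(** Fubini, in the only form needed below: an integral vanishes as soon as the
    slices in one direction have zero integral. *)
Lemma I2_slices2 f : integ f ->
  {ae leb, forall x, (\int[leb]_y (f (x, y))%:E = 0)%E} -> I2 f = 0.
Proof.
move=> hf h; apply: EFin_inj; rewrite I2_EFin// -integral12_prod_meas1//.
rewrite (ae_eq_integral (cst 0%E))//; first exact: integral0.
  exact: (measurable_fubini_F hf).
by apply: (@filterS _ _ (ae_filter_ringOfSetsType leb) _ _ _ h) => x {}h _; rewrite /fubini_F /=.
Qed.

Lemma I2_slices1 f : integ f ->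
  (forall y, (\int[leb]_x (f (x, y))%:E = 0)%E) -> I2 f = 0.
Proof.
move=> hf h; apply: EFin_inj; rewrite I2_EFin// -integral21_prod_meas1//.
rewrite (eq_integral (cst 0%E)) ?integral0// => y _.
by rewrite /fubini_G /= h.
Qed.

Definition box (l u y0 y1 : R) : set (R * R) := `[l, u]%classic `*` `[y0, y1]%classic.

Lemma box_measurable l u y0 y1 : measurable (box l u y0 y1).
Proof. exact: measurableX. Qed.

Lemma box_closed l u y0 y1 : closed (box l u y0 y1).
Proof.
move=> x /closure2P cx; rewrite /box /= !in_itv /=.
split; apply/andP; split; rewrite leNgt; apply/negP => h; have h' := h; rewrite -subr_gt0 in h';
  have [y [/=]] := cx _ h'; rewrite !in_itv /= => /andP[? ?] /andP[? ?] [];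
  rewrite !ltr_norml => /andP[? ?] /andP[? ?]; lra.
Qed.

Lemma box_measure (l u y0 y1 : R) : l <= u -> y0 <= y1 ->
  mu2 (box l u y0 y1) = ((u - l) * (y1 - y0))%:E.
Proof.
move=> lu yy; rewrite /box; transitivity (leb `[l, u]%classic * leb `[y0, y1]%classic)%E.
  exact: product_measure1E.
rewrite !lebesgue_measure_itv/= !lte_fin.
have H (a b : R) : a <= b -> (if a < b then (b%:E - a%:E)%E else 0%E) = (b - a)%:E.
  by rewrite le_eqVlt => /orP[/eqP ->|->//]; rewrite ltxx subrr.
by have /= -> := H _ _ lu; have /= -> := H _ _ yy; rewrite -EFinM.
Qed.

Lemma integ_indic (A : set (R * R)) : measurable A -> (mu2 A < +oo)%E -> integ (\1_A).
Proof.
move=> mA Aoo; apply/integrableP; split; first exact/measurable_EFinP.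
rewrite (_ : (\int[mu2]_x _)%E = (\int[mu2]_x (\1_A x)%:E)%E); last first.
  by apply: eq_integral => x _; rewrite /= ger0_norm.
by rewrite integral_indic// setIT.
Qed.

Lemma integ_bounded_on (A : set (R * R)) f (M : R) : measurable A -> (mu2 A < +oo)%E ->
  measurable_fun setT f -> (forall x, `|f x| <= M) -> integ (fun x => f x * \1_A x).
Proof. by move=> mA Aoo mf fM; apply: integMbounded fM _ => //; exact: integ_indic. Qed.

Lemma partial_continuous (phi : R * R -> R) : smooth phi ->
  [/\ continuous phi, continuous (partial1 phi) & continuous (partial2 phi)].
Proof. by move=> /(_ 1%N)[c _ c1 c2]. Qed.

Lemma partial_supp (phi : R * R -> R) x : ~ supp phi x -> partial1 phi x = 0 /\ partial2 phi x = 0.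
Proof.
move=> /supp_near0 H.
have H' : \forall y \near x, (fun=> 0 : R) y = phi y by apply: filterS H => y ->.
split; rewrite /partial1 /partial2.
  by rewrite -(near_eq_derive _ H'); exact: (@derive_cst _ _ _ (0 : R) x (1, 0)).
by rewrite -(near_eq_derive _ H'); exact: (@derive_cst _ _ _ (0 : R) x (0, 1)).
Qed.

Lemma compact_bounded (K : set (R * R)) f : compact K -> continuous f ->
  (forall x, ~ K x -> f x = 0) -> exists2 M : R, 0 <= M & forall x, `|f x| <= M.
Proof.
move=> cK cf f0.
have /compact_bounded[M [_ HM]] : compact (f @` K).
  by apply: continuous_compact => //; exact: continuous_subspaceT.
exists (`|M| + 1); first by rewrite addr_ge0.
move=> x; have [Kx|/f0 ->] := pselect (K x); last by rewrite normr0 addr_ge0.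
by apply: HM; [rewrite (le_lt_trans (ler_norm M))// ltrDl|exists x].
Qed.

Lemma test_bounded U (phi : R * R -> R) : test_function U phi ->
  exists2 M : R, 0 <= M & forall x, [/\ `|phi x| <= M, `|partial1 phi x| <= M & `|partial2 phi x| <= M].
Proof.
move=> [sp cK _]; have [c0 c1 c2] := partial_continuous sp.
have [M0 M00 H0] := compact_bounded cK c0 (fun x => @supp_out _ phi x).
have [M1 M10 H1] := compact_bounded cK c1 (fun x nx => (partial_supp nx).1).
have [M2 M20 H2] := compact_bounded cK c2 (fun x nx => (partial_supp nx).2).
exists (M0 + M1 + M2); first by rewrite !addr_ge0.
have L0 : M0 <= M0 + M1 + M2 by rewrite -addrA lerDl addr_ge0.
have L1 : M1 <= M0 + M1 + M2 by rewrite addrAC lerDr addr_ge0.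
have L2 : M2 <= M0 + M1 + M2 by rewrite lerDr addr_ge0.
by move=> x; split; [exact: le_trans L0|exact: le_trans L1|exact: le_trans L2].
Qed.

(** The pairing of a row (a1, a2) with the rotated gradient of phi, that is its
    distributional curl tested against phi. *)
Definition row_pairing (a1 a2 phi : R * R -> R) : R :=
  I2 (fun x => partial2 phi x * a1 x - partial1 phi x * a2 x).

Lemma row_pairing_integ (a1 a2 phi : R * R -> R) U : integ a1 -> integ a2 -> test_function U phi ->
  integ (fun x => partial2 phi x * a1 x - partial1 phi x * a2 x).
Proof.
move=> i1 i2 tp; have [M M0 HM] := test_bounded tp; have [sp _ _] := tp.
have [_ c1 c2] := partial_continuous sp.
have E : (fun x => partial2 phi x * a1 x - partial1 phi x * a2 x) =
   (fun x => partial2 phi x * a1 x + (-1) * (partial1 phi x * a2 x)).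
  by apply/funext => x; rewrite mulN1r.
rewrite E; apply: integD; last apply: integZ.
  by apply: (@integMbounded _ _ M) => //; [exact: continuous2_measurable|move=> x; have [] := HM x].
by apply: (@integMbounded _ _ M) => //; [exact: continuous2_measurable|move=> x; have [] := HM x].
Qed.

Lemma row_pairing_linear (a1 a2 f g : R * R -> R) k U : integ a1 -> integ a2 ->
  test_function U f -> test_function U g ->
  row_pairing a1 a2 (fun x => f x + k * g x) = row_pairing a1 a2 f + k * row_pairing a1 a2 g.
Proof.
move=> i1 i2 tf tg; have pf := row_pairing_integ i1 i2 tf; have pg := row_pairing_integ i1 i2 tg.
rewrite /row_pairing -(I2Z k pg) -(I2D pf (integZ k pg)).
have [sf _ _] := tf; have [sg _ _] := tg.
have [_ df _ _] := sf 1%N; have [_ dg _ _] := sg 1%N.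
apply: I2_eq => x.
have dkg v : derivable g x v -> derivable (fun x => k * g x) x v /\ 'D_v (fun x => k * g x) x = k * 'D_v g x.
  move=> d; have -> : (fun x => k * g x) = k *: g by [].
  by split; [exact: derivableZ|exact: deriveZ].
have [f1 f2] := df x; have [g1 g2] := dg x.
have E1 : partial1 (fun x => f x + k * g x) x = partial1 f x + k * partial1 g x.
  rewrite /partial1; have [d e] := dkg _ g1; rewrite -e; exact: (deriveD f1 d).
have E2 : partial2 (fun x => f x + k * g x) x = partial2 f x + k * partial2 g x.
  rewrite /partial2; have [d e] := dkg _ g2; rewrite -e; exact: (deriveD f2 d).
by rewrite E1 E2; ring.
Qed.

Lemma continuous_slice2 (f : R * R -> R) (x1 : R) : continuous f -> continuous (fun y => f (x1, y)).
Proof.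
move=> cf y; apply: (@cvg_comp _ _ _ (fun y : R => (x1, y)) f (nbhs y) (filter_prod (nbhs x1) (nbhs y))).
  move=> P [[A B] /= [hA hB] hP]; apply: filterS hB => z Bz.
  by apply: hP; split=> //=; exact: nbhs_singleton.
exact: cf (x1, y).
Qed.

Lemma continuous_slice1 (f : R * R -> R) (y : R) : continuous f -> continuous (fun x => f (x, y)).
Proof.
move=> cf x; apply: (@cvg_comp _ _ _ (fun x : R => (x, y)) f (nbhs x) (filter_prod (nbhs x) (nbhs y))).
  move=> P [[A B] /= [hA hB] hP]; apply: filterS hA => z Az.
  by apply: hP; split=> //=; exact: nbhs_singleton.
exact: cf (x, y).
Qed.

Lemma FTC_partial2 (psi : R * R -> R) (x1 y0 y1 : R) : smooth psi -> y0 < y1 ->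
  (\int[leb]_(y in `[y0, y1]) (partial2 psi (x1, y))%:E = (psi (x1, y1))%:E - (psi (x1, y0))%:E)%E.
Proof.
move=> sp y01; have [c0 c1 c2] := partial_continuous sp.
have [_ dp _ _] := sp 1%N.
have dpsi (y : R) : is_derive y 1 (fun y => psi (x1, y)) (partial2 psi (x1, y)).
  have [_ d2] := dp (x1, y); rewrite /partial2 (derive_line2 psi (x1, y)).1 /=.
  rewrite (derive_line2 psi (x1, y)).2 /= in d2.
  exact: (DeriveDef d2 erefl).
have cs (f : R * R -> R) : continuous f -> continuous (fun y => f (x1, y)).
  by move=> cf; exact: continuous_slice2.
apply: (@continuous_FTC2 _ (fun y => partial2 psi (x1, y)) (fun y => psi (x1, y))) => //.
- by apply: continuous_subspaceT; exact: cs.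
- split.
  + by move=> y _; have [] := dpsi y.
  + exact: cvg_at_right_filter (cs _ c0 y0).
  + exact: cvg_at_left_filter (cs _ c0 y1).
- by move=> y _; rewrite derive1E; have [_ ->] := dpsi y.
Qed.

Lemma FTC_partial1 (psi : R * R -> R) (y x0 x1 : R) : smooth psi -> x0 < x1 ->
  (\int[leb]_(x in `[x0, x1]) (partial1 psi (x, y))%:E = (psi (x1, y))%:E - (psi (x0, y))%:E)%E.
Proof.
move=> sp y01; have [c0 c1 c2] := partial_continuous sp.
have [_ dp _ _] := sp 1%N.
have dpsi (x : R) : is_derive x 1 (fun x => psi (x, y)) (partial1 psi (x, y)).
  have [d2 _] := dp (x, y); rewrite /partial1 (derive_line1 psi (x, y)).1 /=.
  rewrite (derive_line1 psi (x, y)).2 /= in d2.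
  exact: (DeriveDef d2 erefl).
have cs (f : R * R -> R) : continuous f -> continuous (fun x => f (x, y)).
  by move=> cf; exact: continuous_slice1.
apply: (@continuous_FTC2 _ (fun x => partial1 psi (x, y)) (fun x => psi (x, y))) => //.
- by apply: continuous_subspaceT; exact: cs.
- split.
  + by move=> x _; have [] := dpsi x.
  + exact: cvg_at_right_filter (cs _ c0 x0).
  + exact: cvg_at_left_filter (cs _ c0 x1).
- by move=> x _; rewrite derive1E; have [_ ->] := dpsi x.
Qed.

End PlaneMeasure.

(** * Interfaces and primitives along slices *)

Section Slices.
Variable R : realType.
Notation leb := (@lebesgue_measure R).
Notation mu2 := (leb \x leb)%E.

Lemma leb_itv (a b : R) : a <= b -> leb `[a, b]%classic = (b - a)%:E.
Proof.
rewrite lebesgue_measure_itv/= lte_fin le_eqVlt => /orP[/eqP ->|->//].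
by rewrite ltxx subrr.
Qed.

Lemma integral_supported (D : set R) (h : R -> R) : (forall y, ~ D y -> h y = 0) ->
  (\int[leb]_y (h y)%:E = \int[leb]_(y in D) (h y)%:E)%E.
Proof.
move=> h0; rewrite [RHS]integral_mkcond; apply: eq_integral => y _.
by rewrite patchE; case: ifPn => // /negP; rewrite inE => /h0 ->.
Qed.

Lemma integral_indicM (D : set R) (h : R -> R) :
  (\int[leb]_y (\1_D y * h y)%:E = \int[leb]_(y in D) (h y)%:E)%E.
Proof.
rewrite [RHS]integral_mkcond; apply: eq_integral => y _.
by rewrite patchE indicE; case: ifPn; rewrite ?mul1r ?mul0r.
Qed.

Lemma continuous_integrable1 (h : R -> R) (a b : R) : continuous h ->
  leb.-integrable `[a, b] (EFin \o h).
Proof.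
move=> ch; apply: continuous_compact_integrable; first exact: segment_compact.
exact: continuous_subspaceT.
Qed.

(** Integrate the derivatives of chi along lines: every piece contributes the
    difference of two values of chi, taken on the axis or outside the support,
    hence 0. *)
Lemma row_pairing_interface (r m1 p1 m2 p2 : R) (chi : R * R -> R) : 0 < r ->
  test_function (open_square r) chi -> (forall y, chi (0, y) = 0) ->
  row_pairing (fun x => \1_(open_square r) x * if x.1 < 0 then m1 else p1)
              (fun x => \1_(open_square r) x * if x.1 < 0 then m2 else p2) chi = 0.
Proof.
move=> r0 tchi chi0; have [schi _ chiT] := tchi.
have [c0 c1 c2] := partial_continuous schi.
set T := open_square r.
have mT : measurable T by apply: open2_measurable; exact: open_square_open.
have Tfin : (mu2 T < +oo)%E.
  apply: (@le_lt_trans _ _ (mu2 (box (- r) r (- r) r))); last by rewrite box_measure ?ltry//; lra.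
  apply: le_measure; rewrite ?inE//; first exact: box_measurable.
  move=> x [/=]; rewrite !in_itv/= => /andP[/ltW a1 /ltW a2] /andP[/ltW b1 /ltW b2].
  by rewrite /box /= !in_itv /= a1 a2 b1 b2.
have ia (m p : R) : integ (fun x : R * R => \1_T x * if x.1 < 0 then m else p).
  rewrite (_ : (fun x => _) = (fun x => (if x.1 < 0 then m else p) * \1_T x)); last first.
    by apply/funext => x; rewrite mulrC.
  apply: (@integ_bounded_on _ _ _ (`|m| + `|p|)) => //.
    apply: measurable_fun_ifT => //.
    apply: measurable_fun_ltr => //; exact: measurable_fst.
  by move=> x; case: ifP => _; rewrite ?lerDl ?lerDr.
have out x : ~ T x -> partial1 chi x = 0 /\ partial2 chi x = 0.
  by move=> nT; apply: partial_supp => /chiT.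
have in1 (t : R) x : ~ `[- r, r]%classic t -> (x.1 = t \/ x.2 = t) -> ~ T x.
  move=> nt e [/=]; rewrite !in_itv /= => /andP[a1 a2] /andP[b1 b2]; apply: nt.
  by rewrite /= in_itv /=; case: e => <-; apply/andP; split; apply: ltW.
have bd x : x.1 = r \/ x.1 = - r \/ x.2 = r \/ x.2 = - r -> chi x = 0.
  move=> e; apply: (test_out tchi) => -[/=]; rewrite !in_itv /= => /andP[a1 a2] /andP[b1 b2].
  by case: e => [e|[e|[e|e]]]; move: a1 a2 b1 b2; rewrite ?e ?ltxx.
have [M M0 HM] := test_bounded tchi.
have i1 : integ (fun x => partial2 chi x * (\1_T x * if x.1 < 0 then m1 else p1)).
  by apply: (@integMbounded _ _ _ M) => //; [exact: continuous2_measurable|move=> x; have [] := HM x].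
have i2 : integ (fun x => partial1 chi x * (\1_T x * if x.1 < 0 then m2 else p2)).
  by apply: (@integMbounded _ _ _ M) => //; [exact: continuous2_measurable|move=> x; have [] := HM x].
have T1 x k : partial2 chi x * (\1_T x * k) = k * partial2 chi x.
  have [Tx|nTx] := pselect (T x); first by rewrite indicE mem_set// mul1r mulrC.
  by rewrite (out x nTx).2 mul0r mulr0.
have T2 x k : partial1 chi x * (\1_T x * k) = k * partial1 chi x.
  have [Tx|nTx] := pselect (T x); first by rewrite indicE mem_set// mul1r mulrC.
  by rewrite (out x nTx).1 mul0r mulr0.
have rr : - r < r by lra.
have Z1 : I2 (fun x => partial2 chi x * (\1_T x * if x.1 < 0 then m1 else p1)) = 0.
  apply: I2_slices2 => //; apply: aeW => x /=.
  under eq_integral => y _ do rewrite T1.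
  rewrite (@integral_supported `[- r, r]); last first.
    by move=> y ny; rewrite (out (x, y) _).2 ?mulr0//; apply: (in1 y) => //; right.
  under eq_integral => y _ do rewrite EFinM.
  rewrite integralZl//; last by apply: continuous_integrable1; exact: continuous_slice2.
  have e1 : chi (x, r) = 0 by apply: bd; right; right; left.
  have e2 : chi (x, - r) = 0 by apply: bd; right; right; right.
  by rewrite FTC_partial2// e1 e2 -EFinB subrr mule0.
have Z2 : I2 (fun x => partial1 chi x * (\1_T x * if x.1 < 0 then m2 else p2)) = 0.
  apply: I2_slices1 => // y.
  have E x : partial1 chi (x, y) * (\1_T (x, y) * (if (x, y).1 < 0 then m2 else p2)) =
      m2 * (\1_`[- r, r] x * partial1 chi (x, y)) + (p2 - m2) * (\1_`[0, r] x * partial1 chi (x, y)).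
    rewrite T2 /= !indicE !mem_setE !in_itv /=.
    have [nx|] := pselect (~ T (x, y)); first by rewrite (out _ nx).1 !mulr0 addr0.
    move=> /contrapT [/= + _]; rewrite in_itv /= => /andP[a1 a2].
    rewrite (ltW a1) (ltW a2) andbT /=.
    by case: ltP => h; rewrite /= ?mul0r ?mul1r; ring.
  under eq_integral => x _ do rewrite E EFinD !EFinM.
  have ii (a b : R) : leb.-integrable setT (fun x => (\1_`[a, b] x)%:E * (partial1 chi (x, y))%:E)%E.
    have := @continuous_integrable1 (fun x => partial1 chi (x, y)) a b (continuous_slice1 c1).
    rewrite integrable_mkcond//; apply: eq_integrable => // x _.
    by rewrite patchE indicE; case: ifPn => _ /=; rewrite ?mul1e ?mul0e.
  have JJ (a b : R) : a < b -> (\int[leb]_x ((\1_`[a, b] x)%:E * (partial1 chi (x, y))%:E) =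
      (chi (b, y))%:E - (chi (a, y))%:E)%E.
    move=> ab; rewrite -FTC_partial1// -integral_indicM.
    by apply: eq_integral => x _; rewrite EFinM.
  rewrite integralD//; try by apply: integrableZl.
  have e1 : chi (r, y) = 0 by apply: bd; left.
  have e2 : chi (- r, y) = 0 by apply: bd; right; left.
  by rewrite !integralZl// !JJ// chi0 e1 e2 -EFinB subrr !mule0 adde0.
rewrite /row_pairing.
rewrite (_ : I2 _ = I2 (fun x => partial2 chi x * (\1_T x * if x.1 < 0 then m1 else p1) +
   (-1) * (partial1 chi x * (\1_T x * if x.1 < 0 then m2 else p2)))); last first.
  by apply: I2_eq => x; rewrite mulN1r.
by rewrite I2D ?I2Z// ?Z1 ?Z2 ?mulr0 ?addr0//; exact: integZ.
Qed.

(** The primitive in x_2 of a, started at the bottom of the strip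
    y0 <= x_2 <= y1. The cut-off s <= x_2 is a factor of the integrand so that
    joint measurability is that of a parametric integral. *)
Definition strip_prim (y0 y1 : R) (a : R * R -> R) (x : R * R) : R :=
  \int[leb]_s (\1_`[y0, y1] s * ((s <= x.2)%R)%:R * a (x.1, s)).

Let kern (y0 y1 : R) (a : R * R -> R) (z : (R * R) * R) : \bar R :=
  (\1_`[y0, y1] z.2 * ((z.2 <= z.1.2)%R)%:R * a (z.1.1, z.2))%:E.

Lemma measurable_kern y0 y1 a : measurable_fun setT a -> measurable_fun setT (kern y0 y1 a).
Proof.
move=> ma; apply/measurable_EFinP.
have m2 : measurable_fun setT (fun z : (R * R) * R => z.2) by exact: measurable_snd.
have m1 : measurable_fun setT (fun z : (R * R) * R => z.1) by exact: measurable_fst.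
have m12 : measurable_fun setT (fun z : (R * R) * R => z.1.2).
  by apply: (measurableT_comp (f := snd)) => //; exact: measurable_snd.
have m11 : measurable_fun setT (fun z : (R * R) * R => z.1.1).
  by apply: (measurableT_comp (f := fst)) => //; exact: measurable_fst.
apply: measurable_funM; first apply: measurable_funM.
- have mi : measurable_fun setT (\1_`[y0, y1] : R -> R) by [].
  exact: (measurableT_comp mi m2).
- rewrite (_ : (fun z => _) = (fun z : R * R * R => if z.2 <= z.1.2 then 1 else 0)); last first.
    by apply/funext => z; case: (_ <= _).
  apply: measurable_fun_ifT => //; exact: measurable_fun_ler.
- apply: (measurableT_comp (f := a)) => //.
  exact: measurable_fun_pair.
Qed.

Lemma measurable_param_integral (f : (R * R) * R -> \bar R) : measurable_fun setT f ->
  (forall z, (0 <= f z)%E) -> measurable_fun setT (fun x => \int[leb]_s f (x, s))%E.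
Proof.
move=> mf f0; exact: (@measurable_fun_fubini_tonelli_F _ _ _ _ _ leb f mf f0).
Qed.

Lemma strip_prim_measurable y0 y1 a : measurable_fun setT a -> measurable_fun setT (strip_prim y0 y1 a).
Proof.
move=> /(measurable_kern y0 y1) mk.
rewrite (_ : strip_prim y0 y1 a = fun x => fine (\int[leb]_s (kern y0 y1 a)^\+ (x, s) -
    \int[leb]_s (kern y0 y1 a)^\- (x, s))%E); last first.
  apply/funext => x; rewrite /strip_prim /Rintegral; congr fine.
  rewrite [LHS]integralE; congr (_ - _)%E; apply: eq_integral => s _;
    rewrite unlock /=//.
have mf : measurable_fun setT (fine : \bar R -> R) by [].
apply: (measurableT_comp mf).
apply: emeasurable_funB.
  have mm : measurable_fun setT ((kern y0 y1 a)^\+)%E by exact: measurable_funepos.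
  by apply: (measurable_param_integral mm) => z.
have mm : measurable_fun setT ((kern y0 y1 a)^\-)%E by exact: measurable_funeneg.
by apply: (measurable_param_integral mm) => z.
Qed.

Lemma measurable_slice (b : R * R -> R) (x1 : R) : measurable_fun setT b ->
  measurable_fun setT (fun s => b (x1, s)).
Proof.
move=> mb; by apply: (measurableT_comp (f := b)).
Qed.

Lemma strip_prim_le y0 y1 a x : measurable_fun setT a ->
  ((`|strip_prim y0 y1 a x|)%:E <= \int[leb]_s (\1_`[y0, y1] s * `|a (x.1, s)|)%:E)%E.
Proof.
move=> ma.
have fabs (t : \bar R) : ((`|fine t|)%:E <= `|t|)%E by case: t => [t||] //=; rewrite normr0 leey.
apply: (le_trans (fabs _)).
have mh : measurable_fun setT (fun s => \1_`[y0, y1] s * ((s <= x.2)%R)%:R * a (x.1, s)).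
  apply: measurable_funM; last exact: measurable_slice.
  apply: measurable_funM => //.
  rewrite (_ : (fun s => _) = (fun s : R => if s <= x.2 then 1 else 0)); last first.
    by apply/funext => z; case: (_ <= _).
  apply: measurable_fun_ifT => //; exact: measurable_fun_ler.
apply: le_trans (le_abse_integral _ _ _) _ => //; first exact/measurable_EFinP.
apply: ge0_le_integral => //.
- by apply: measurableT_comp => //; exact/measurable_EFinP.
- apply/measurable_EFinP; apply: measurable_funM => //.
  by apply: measurableT_comp => //; exact: measurable_slice.
- move=> s _ /=; rewrite lee_fin !normrM ger0_norm// -mulrA ler_wpM2l//.
  by rewrite ler_piMl//; case: (s <= x.2)%R; rewrite ?normr1 ?normr0.
Qed.

(** Cauchy-Schwarz on a slice. *)
Lemma strip_prim_sqr_le y0 y1 a x : y0 < y1 -> measurable_fun setT a ->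
  ((strip_prim y0 y1 a x ^+ 2)%:E <=
   (y1 - y0)%:E * \int[leb]_s (\1_`[y0, y1] s * a (x.1, s) ^+ 2)%:E)%E.
Proof.
move=> y01 ma; have H := strip_prim_le y0 y1 x ma.
have msl := measurable_slice x.1 ma.
have mi : measurable_fun setT (\1_`[y0, y1] : R -> R) by [].
set A := strip_prim y0 y1 a x in H *.
set B := (\int[leb]_s (\1_`[y0, y1] s * a (x.1, s) ^+ 2)%:E)%E.
have B0 : (0 <= B)%E by apply: integral_ge0 => s _; rewrite lee_fin mulr_ge0// sqr_ge0.
have m2 : measurable_fun setT (fun s => \1_`[y0, y1] s * a (x.1, s) ^+ 2).
  by apply: measurable_funM => //; exact: measurable_funX.
have ma1 : measurable_fun setT (fun s => \1_`[y0, y1] s * `|a (x.1, s)|).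
  by apply: measurable_funM => //; apply: measurableT_comp.
have key (m : R) : 0 < m -> ((2 * m * `|A|)%:E <= (m ^+ 2 * (y1 - y0))%:E + B)%E.
  move=> m0.
  have H1 : ((2 * m * `|A|)%:E <= \int[leb]_s ((2 * m)%:E * (\1_`[y0, y1] s * `|a (x.1, s)|)%:E))%E.
    rewrite ge0_integralZl_EFin//; last by rewrite mulr_ge0// ltW.
      by rewrite EFinM lee_wpmul2l// lee_fin mulr_ge0// ltW.
    exact/measurable_EFinP.
  apply: (le_trans H1).
  have H2 : (m ^+ 2 * (y1 - y0))%:E = (\int[leb]_s ((m ^+ 2)%:E * (\1_`[y0, y1] s)%:E))%E.
    rewrite ge0_integralZl_EFin ?sqr_ge0//; last exact/measurable_EFinP.
    have -> : (\int[leb]_s (\1_`[y0, y1] s)%:E)%E = (y1 - y0)%:E.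
      by rewrite integral_indic// setIT; apply: leb_itv; exact: ltW.
    by rewrite EFinM.
  have mB : measurable_fun setT (fun s => (\1_`[y0, y1] s * a (x.1, s) ^+ 2)%:E) by exact/measurable_EFinP.
  have mI : measurable_fun setT (fun s => ((m ^+ 2)%:E * (\1_`[y0, y1] s)%:E)%E).
    by apply: measurable_funeM; exact/measurable_EFinP.
  rewrite H2 /B -ge0_integralD//; last 2 first.
  - by move=> s _; rewrite -EFinM lee_fin mulr_ge0// sqr_ge0.
  - by move=> s _; rewrite lee_fin mulr_ge0// sqr_ge0.
  have mC : measurable_fun setT (fun s => ((2 * m)%:E * (\1_`[y0, y1] s * `|a (x.1, s)|)%:E)%E).
    by apply: measurable_funeM; exact/measurable_EFinP.
  have mD : measurable_fun setT (fun s => ((m ^+ 2)%:E * (\1_`[y0, y1] s)%:E + (\1_`[y0, y1] s * a (x.1, s) ^+ 2)%:E)%E).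
    exact: emeasurable_funD.
  apply: ge0_le_integral => //.
  - by move=> s _; rewrite -EFinM lee_fin !mulr_ge0// ltW.
  - move=> s _; rewrite -!EFinM -EFinD lee_fin mulrCA [m ^+ 2 * _]mulrC -mulrDr ler_wpM2l//.
    have := sqr_ge0 (m - `|a (x.1, s)|); rewrite -(real_normK (num_real (a (x.1, s)))); nra.
have [->|A0] := eqVneq A 0.
  by rewrite expr0n /= mule_ge0// lee_fin subr_ge0 ltW.
have nA : 0 < `|A| by rewrite normr_gt0.
have h0 : 0 < y1 - y0 by rewrite subr_gt0.
case: B B0 key => [B||] B0 key; last 2 first.
- by rewrite gt0_muley ?lte_fin// leey.
- by [].
have := key (`|A| / (y1 - y0)) (divr_gt0 nA h0).
rewrite -EFinD -EFinM !lee_fin => k.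
have E1 : 2 * (`|A| / (y1 - y0)) * `|A| = 2 * (A ^+ 2 / (y1 - y0)).
  by rewrite -(real_normK (num_real A)); ring.
have E2 : (`|A| / (y1 - y0)) ^+ 2 * (y1 - y0) = A ^+ 2 / (y1 - y0).
  rewrite -(real_normK (num_real A)); field; lra.
rewrite E1 E2 in k.
have k2 : A ^+ 2 / (y1 - y0) <= B by lra.
by rewrite mulrC -ler_pdivrMr.
Qed.

End Slices.

(** * Integration by parts on boxes *)

Section ByParts.
Variable R : realType.
Notation leb := (@lebesgue_measure R).
Notation mu2 := (leb \x leb)%E.

Lemma integral_itv_indic (a b : R) : a <= b -> (\int[leb]_s (\1_`[a, b] s)%:E = (b - a)%:E)%E.
Proof. by move=> ab; rewrite integral_indic// setIT; apply: leb_itv. Qed.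

Lemma box_indic (l u y0 y1 : R) (x y : R) :
  \1_(box l u y0 y1) (x, y) = \1_`[l, u] x * \1_`[y0, y1] y :> R.
Proof.
rewrite !indicE /box -natrM mulnb; congr ((nat_of_bool _)%:R).
by apply/idP/andP; rewrite !inE.
Qed.

Lemma tonelli_box l u y0 y1 (b : R * R -> R) : y0 <= y1 -> measurable_fun setT b ->
  (forall x, 0 <= b x) ->
  (\int[mu2]_z ((\1_(box l u y0 y1) z)%:E * \int[leb]_s (\1_`[y0, y1] s * b (z.1, s))%:E) =
   (y1 - y0)%:E * \int[mu2]_z (\1_(box l u y0 y1) z * b z)%:E)%E.
Proof.
move=> y01 mb b0.
have mi : measurable_fun setT (\1_`[y0, y1] : R -> R) by [].
have mB : measurable_fun setT (\1_(box l u y0 y1) : R * R -> R).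
  by apply: measurable_indic; exact: box_measurable.
have mK : measurable_fun setT (fun z : R * R => \int[leb]_s (\1_`[y0, y1] s * b (z.1, s))%:E)%E.
  apply: (@measurable_param_integral R (fun z => (\1_`[y0, y1] z.2 * b (z.1.1, z.2))%:E)).
    apply/measurable_EFinP; apply: measurable_funM.
      exact: (measurableT_comp mi measurable_snd).
    apply: (measurableT_comp mb); apply: measurable_fun_pair; last exact: measurable_snd.
    by apply: (measurableT_comp (f := fst)) => //; exact: measurable_fst.
  by move=> z; rewrite lee_fin mulr_ge0.
have K0 x : (0 <= \int[leb]_s (\1_`[y0, y1] s * b (x, s))%:E)%E.
  by apply: integral_ge0 => s _; rewrite lee_fin mulr_ge0.
have mL : measurable_fun setT (fun z : R * R => (\1_(box l u y0 y1) z)%:E * \int[leb]_s (\1_`[y0, y1] s * b (z.1, s))%:E)%E.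
  by apply: emeasurable_funM => //; exact/measurable_EFinP.
have mRr : measurable_fun setT (fun z : R * R => (\1_(box l u y0 y1) z * b z)%:E).
  by apply/measurable_EFinP; exact: measurable_funM.
rewrite (@fubini_tonelli1 _ _ _ _ _ leb leb _ mL); last by move=> z; rewrite mule_ge0.
rewrite (@fubini_tonelli1 _ _ _ _ _ leb leb _ mRr); last by move=> z; rewrite lee_fin mulr_ge0.
have mF := @measurable_fun_fubini_tonelli_F _ _ _ _ _ leb _ mRr (fun z => mulr_ge0 (ltac:(done) : 0 <= \1_(box l u y0 y1) z) (b0 z)).
rewrite -ge0_integralZl_EFin//; last 2 first.
- by move=> x _; apply: integral_ge0 => s _; rewrite lee_fin mulr_ge0.
- by rewrite subr_ge0.
apply: eq_integral => x _; rewrite /fubini_F /=.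
under eq_integral => y _ do rewrite box_indic EFinM muleAC muleC.
under [in RHS]eq_integral => y _ do rewrite box_indic -mulrA EFinM.
have e1 : (\int[leb]_s (\1_`[y0, y1] s)%:E)%E = (y1 - y0)%:E.
  by rewrite integral_indic// setIT; apply: leb_itv.
rewrite ge0_integralZr//; last 2 first.
- exact/measurable_EFinP.
- by rewrite mule_ge0.
rewrite e1 [in RHS]ge0_integralZl_EFin//; last 2 first.
- by move=> s _; rewrite lee_fin mulr_ge0.
- by apply/measurable_EFinP; apply: measurable_funM => //; exact: measurable_slice.
Qed.

Lemma integ_strip_prim l u y0 y1 (a : R * R -> R) : y0 <= y1 -> integ a ->
  integ (fun x => \1_(box l u y0 y1) x * strip_prim y0 y1 a x).
Proof.
move=> y01 ia; have ma := integ_measurable ia.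
have mB : measurable_fun setT (\1_(box l u y0 y1) : R * R -> R).
  by apply: measurable_indic; exact: box_measurable.
have mna : measurable_fun setT (fun x => `|a x|) by apply: measurableT_comp.
have mS := strip_prim_measurable y0 y1 ma.
have mf : measurable_fun setT (fun x => \1_(box l u y0 y1) x * strip_prim y0 y1 a x) by exact: measurable_funM.
apply/integrableP; split; first exact/measurable_EFinP.
have := @tonelli_box l u y0 y1 (fun x => `|a x|) y01 mna (fun x => normr_ge0 _).
set r := (_ * _)%E => E.
have roo : (r < +oo)%E.
  have ib : integ (fun z => \1_(box l u y0 y1) z * `|a z|).
    apply: (@integMbounded _ _ _ 1) => //; last exact: integ_norm.
    by move=> x; rewrite ger0_norm// indicE; case: (_ \in _).
  have /integrableP[_] := ib.
  rewrite /r => H; rewrite lte_mul_pinfty// ?lee_fin ?subr_ge0//.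
  rewrite (_ : (\int[mu2]_z _)%E =
      (\int[mu2]_x `|(EFin \o (fun z => (\1_(box l u y0 y1) z * `|a z|)%R)) x|)%E)//.
  by apply: eq_integral => x _ /=; rewrite [in RHS]ger0_norm ?mulr_ge0.
apply: le_lt_trans roo; rewrite -E.
apply: ge0_le_integral => //.
- by apply: measurableT_comp => //; exact/measurable_EFinP.
- apply: emeasurable_funM; first exact/measurable_EFinP.
  apply: (@measurable_param_integral R (fun z => (\1_`[y0, y1] z.2 * `|a (z.1.1, z.2)|)%:E)).
    have mi : measurable_fun setT (\1_`[y0, y1] : R -> R) by [].
    apply/measurable_EFinP; apply: measurable_funM.
      exact: (measurableT_comp mi measurable_snd).
    apply: (measurableT_comp mna); apply: measurable_fun_pair; last exact: measurable_snd.
    by apply: (measurableT_comp (f := fst)) => //; exact: measurable_fst.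
  by move=> z; rewrite lee_fin mulr_ge0.
- move=> x _ /=; rewrite normrM ger0_norm// EFinM lee_wpmul2l//.
  exact: strip_prim_le.
Qed.

(** A one-dimensional Poincare inequality in x_2, integrated over the box: the
    primitive costs a factor equal to the square of the height. *)
Lemma integral_strip_prim_sqr l u y0 y1 (a : R * R -> R) : y0 < y1 -> measurable_fun setT a ->
  (\int[mu2]_x (\1_(box l u y0 y1) x * strip_prim y0 y1 a x ^+ 2)%:E <=
   ((y1 - y0) ^+ 2)%:E * \int[mu2]_x (\1_(box l u y0 y1) x * a x ^+ 2)%:E)%E.
Proof.
move=> y01 ma.
have mB : measurable_fun setT (\1_(box l u y0 y1) : R * R -> R).
  by apply: measurable_indic; exact: box_measurable.
have mna : measurable_fun setT (fun x => a x ^+ 2) by exact: measurable_funX.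
have mS := strip_prim_measurable y0 y1 ma.
have := @tonelli_box l u y0 y1 (fun x => a x ^+ 2) (ltW y01) mna (fun x => sqr_ge0 _).
have mi : measurable_fun setT (\1_`[y0, y1] : R -> R) by [].
have mK : measurable_fun setT (fun x : R * R => \int[leb]_s (\1_`[y0, y1] s * a (x.1, s) ^+ 2)%:E)%E.
  apply: (@measurable_param_integral R (fun z => (\1_`[y0, y1] z.2 * a (z.1.1, z.2) ^+ 2)%:E)).
    apply/measurable_EFinP; apply: measurable_funM.
      exact: (measurableT_comp mi measurable_snd).
    apply: (measurableT_comp mna); apply: measurable_fun_pair; last exact: measurable_snd.
    by apply: (measurableT_comp (f := fst)) => //; exact: measurable_fst.
  by move=> z; rewrite lee_fin mulr_ge0// sqr_ge0.
have mBK : measurable_fun setT (fun x : R * R => (\1_(box l u y0 y1) x)%:E * \int[leb]_s (\1_`[y0, y1] s * a (x.1, s) ^+ 2)%:E)%E.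
  by apply: emeasurable_funM => //; exact/measurable_EFinP.
have K0 (x : R * R) : (0 <= (\1_(box l u y0 y1) x)%:E * \int[leb]_s (\1_`[y0, y1] s * a (x.1, s) ^+ 2)%:E)%E.
  by rewrite mule_ge0//; apply: integral_ge0 => s _; rewrite lee_fin mulr_ge0// sqr_ge0.
move=> E; rewrite expr2 EFinM -muleA -E -ge0_integralZl_EFin//; last by rewrite subr_ge0 ltW.
have m1 : measurable_fun setT (fun x => (\1_(box l u y0 y1) x * strip_prim y0 y1 a x ^+ 2)%:E).
  by apply/measurable_EFinP; apply: measurable_funM => //; exact: measurable_funX.
have m2 : measurable_fun setT (fun x : R * R => (y1 - y0)%:E * ((\1_(box l u y0 y1) x)%:E * \int[leb]_s (\1_`[y0, y1] s * a (x.1, s) ^+ 2)%:E))%E.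
  exact: measurable_funeM.
apply: ge0_le_integral => //.
  by move=> x _; rewrite lee_fin mulr_ge0// sqr_ge0.
move=> x _; rewrite EFinM muleCA lee_wpmul2l//.
exact: strip_prim_sqr_le.
Qed.

(** Integration by parts against the primitive of an integrable function: no
    regularity of b is available, so it is Fubini's theorem on the triangle. *)
Lemma slice_by_parts (y0 y1 M : R) (b u u' : R -> R) : y0 < y1 ->
  leb.-integrable setT (EFin \o b) -> continuous u -> continuous u' ->
  (forall y, `|u y| <= M) -> (forall y, `|u' y| <= M) ->
  (forall s, y0 <= s -> s < y1 ->
     (\int[leb]_(y in `[s, y1]) (u' y)%:E = (u y1)%:E - (u s)%:E)%E) ->
  u y1 = 0 ->
  (\int[leb]_y (\1_`[y0, y1] y * (u' y * \int[leb]_s (\1_`[y0, y1] s * ((s <= y)%R)%:R * b s)%R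
      + u y * b y))%:E = 0)%E.
Proof.
move=> y01 ib cu cu' uM u'M ftc uy1.
have mb : measurable_fun setT b by apply/measurable_EFinP; exact: measurable_int ib.
have mi : measurable_fun setT (\1_`[y0, y1] : R -> R) by [].
have mu : measurable_fun setT u by exact: continuous_measurable_fun.
have mu' : measurable_fun setT u' by exact: continuous_measurable_fun.
have i1 (s : R) : `|\1_`[y0, y1] s| <= 1 :> R by rewrite ger0_norm// indicE; case: (_ \in _).
have M0 : 0 <= M by apply: le_trans (uM 0).
have ibd (f g : R -> R) (K : R) : measurable_fun setT g -> (forall x, `|g x| <= K) ->
    leb.-integrable setT (EFin \o f) -> leb.-integrable setT (fun x => (g x * f x)%:E).
  move=> mg gK hf; have K0 : 0 <= K by apply: le_trans (gK 0).
  have := integrableZl measurableT K (integrable_norm hf).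
  apply: le_integrable => //.
    apply/measurable_EFinP; apply: measurable_funM => //.
    by apply/measurable_EFinP; exact: measurable_int hf.
  move=> x _ /=; rewrite lee_fin !normrM normr_id (ger0_norm K0).
  exact: ler_wpM2r.
(* the integrand over the triangle s <= y, to be integrated in both orders *)
pose k (z : R * R) := (\1_`[y0, y1] z.1 * u' z.1 * (\1_`[y0, y1] z.2 * ((z.2 <= z.1)%R)%:R * b z.2)).
have m1 : measurable_fun setT (fun z : R * R => z.1) by exact: measurable_fst.
have m2 : measurable_fun setT (fun z : R * R => z.2) by exact: measurable_snd.
have mle : measurable_fun setT (fun z : R * R => ((z.2 <= z.1)%R)%:R : R).
  rewrite (_ : (fun z => _) = (fun z : R * R => if z.2 <= z.1 then 1 else 0)); last first.
    by apply/funext => z; case: (_ <= _).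
  by apply: measurable_fun_ifT => //; exact: measurable_fun_ler.
have mk : measurable_fun setT (EFin \o k).
  apply/measurable_EFinP; apply: measurable_funM; apply: measurable_funM.
  - exact: (measurableT_comp mi m1).
  - exact: (measurableT_comp mu' m1).
  - by apply: measurable_funM => //; exact: (measurableT_comp mi m2).
  - exact: (measurableT_comp mb m2).
have le1 (y s : R) : `|((s <= y)%R)%:R| <= 1 :> R by case: (s <= y); rewrite ?normr1 ?normr0.
have ik : mu2.-integrable setT (EFin \o k).
  apply/(integrable12ltyP leb leb mk).
  have /integrableP[_] := ib; set B := (\int[leb]_x _)%E => Boo.
  have B0 : (0 <= B)%E by apply: integral_ge0.
  apply: (@le_lt_trans _ _ (\int[leb]_y ((M * \1_`[y0, y1] y)%:E * B))%E).
    apply: ge0_le_integral => //.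
    - by move=> x _; apply: integral_ge0.
    - have mak : measurable_fun setT (fun z : R * R => `|(EFin \o k) z|%E) by apply: measurableT_comp.
      exact: (@measurable_fun_fubini_tonelli_F _ _ _ _ _ leb _ mak (fun z => abse_ge0 _)).
    - apply: emeasurable_funM => //; apply/measurable_EFinP; exact: measurable_funM.
    - move=> y _; rewrite -ge0_integralZl//; last 2 first.
      + by apply: measurableT_comp => //; exact: measurable_int ib.
      + by rewrite lee_fin mulr_ge0.
      apply: ge0_le_integral => //.
      + apply: measurableT_comp => //.
        exact: (measurableT_comp mk (pair1_measurable y)).
      + apply: measurable_funeM; apply: measurableT_comp => //; exact: measurable_int ib.
      + move=> s _; rewrite /k /= lee_fin !normrM.
        have h1 := i1 s; have h2 := le1 y s; have h3 := u'M y.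
        have e : `|\1_`[y0, y1] y| = \1_`[y0, y1] y :> R by rewrite ger0_norm.
        rewrite e; apply: (@le_trans _ _ (\1_`[y0, y1] y * M * (1 * `|b s|))).
          apply: ler_pM; rewrite ?mulr_ge0//.
            exact: ler_wpM2l.
          apply: ler_wpM2r => //; rewrite -[leRHS]mulr1; exact: ler_pM.
        by rewrite mul1r [M * _]mulrC.
  rewrite ge0_integralZr//; last 2 first.
  - by apply/measurable_EFinP; exact: measurable_funM.
  - by move=> y _; rewrite lee_fin mulr_ge0.
  rewrite lte_mul_pinfty//.
  - by apply: integral_ge0 => y _; rewrite lee_fin mulr_ge0.
  - under eq_integral => y _ do rewrite EFinM.
    rewrite ge0_integralZl_EFin//; last exact/measurable_EFinP.
    by rewrite integral_itv_indic// ltW.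
have isl (y : R) : leb.-integrable setT (fun s => (\1_`[y0, y1] s * ((s <= y)%R)%:R * b s)%:E).
  apply: (@ibd _ (fun s => \1_`[y0, y1] s * ((s <= y)%R)%:R) 1) => //.
    apply: measurable_funM => //; exact: (measurableT_comp mle (pair1_measurable y)).
  by move=> s; rewrite normrM -[leRHS]mulr1; apply: ler_pM.
have F1 (y : R) : fubini_F leb (EFin \o k) y =
    (\1_`[y0, y1] y * u' y * \int[leb]_s (\1_`[y0, y1] s * ((s <= y)%R)%:R * b s)%R)%:E.
  rewrite /fubini_F /k /=; under eq_integral => s _ do rewrite EFinM.
  rewrite [LHS]integralZl// [RHS]EFinM; congr (_ * _)%E.
  by rewrite /Rintegral fineK//; apply: integrable_fin_num.
have G1 (s : R) : fubini_G leb (EFin \o k) s = (- (u s * \1_`[y0, y1] s * b s))%:E.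
  rewrite /fubini_G /k /=.
  have [Is|nIs] := boolP (s \in (`[y0, y1]%classic : set R)); last first.
    have e0 : \1_`[y0, y1] s = 0 :> R by rewrite indicE (negbTE nIs).
    rewrite e0 !(mulr0, mul0r) oppr0.
    by under eq_integral => y _ do rewrite !mul0r mulr0; rewrite integral0.
  have [s0 s1] : y0 <= s /\ s <= y1 by move: Is; rewrite inE /= in_itv /= => /andP.
  have e1 : \1_`[y0, y1] s = 1 :> R by rewrite indicE Is.
  rewrite e1 !mulr1.
  have Es y : \1_`[y0, y1] y * u' y * (1 * ((s <= y)%R)%:R * b s) = b s * (\1_`[s, y1] y * u' y).
    rewrite !indicE !mem_setE !in_itv /=.
    case: (leP s y) => sy; last by rewrite /= !(mul0r, mulr0).
    by rewrite (le_trans s0 sy) /=; ring.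
  under eq_integral => y _ do rewrite Es EFinM.
  have ii : leb.-integrable setT (fun y => (\1_`[s, y1] y * u' y)%:E).
    have := @continuous_integrable1 R u' s y1 cu'.
    rewrite integrable_mkcond//; apply: eq_integrable => // y _.
    by rewrite patchE indicE; case: ifPn => _ /=; rewrite ?mul1r ?mul0r.
  rewrite integralZl// integral_indicM.
  have -> : (\int[leb]_(y in `[s, y1]) (u' y)%:E = (u y1)%:E - (u s)%:E)%E.
    move: s1; rewrite le_eqVlt => /orP[/eqP ->|s1]; last exact: ftc.
    by rewrite set_itv1 integral_set1 -EFinB subrr.
  by rewrite uy1 -EFinB -EFinM; congr EFin; ring.
have J1 := integral12_prod_meas1 ik; have J2 := integral21_prod_meas1 ik.
have J : (\int[leb]_y (\1_`[y0, y1] y * u' y * \int[leb]_s (\1_`[y0, y1] s * ((s <= y)%R)%:R * b s)%R)%:E =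
    \int[leb]_s (- (u s * \1_`[y0, y1] s * b s))%:E)%E.
  transitivity (\int[leb]_y fubini_F leb (EFin \o k) y)%E.
    by apply: eq_integral => y _; rewrite F1.
  by rewrite J1 -J2; apply: eq_integral => s _; exact: G1.
have iF : leb.-integrable setT (fun y => (\1_`[y0, y1] y * u' y * \int[leb]_s (\1_`[y0, y1] s * ((s <= y)%R)%:R * b s)%R)%:E).
  by have := integrable_fubini_F ik; apply: eq_integrable => // y _; exact: F1.
have iub : leb.-integrable setT (fun s => (u s * \1_`[y0, y1] s * b s)%:E).
  apply: (@ibd _ (fun s => u s * \1_`[y0, y1] s) M) => //; first exact: measurable_funM.
  by move=> s; rewrite normrM -[leRHS]mulr1; apply: ler_pM.
transitivity (\int[leb]_y ((\1_`[y0, y1] y * u' y * \int[leb]_s (\1_`[y0, y1] s * ((s <= y)%R)%:R * b s)%R)%:E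
   + (u y * \1_`[y0, y1] y * b y)%:E))%E.
  by apply: eq_integral => y _; rewrite -EFinD; congr EFin; ring.
rewrite integralD// J.
rewrite (_ : (\int[leb]_x (- (u x * \1_`[y0, y1] x * b x))%:E)%E =
   (- \int[leb]_x (u x * \1_`[y0, y1] x * b x)%:E)%E); last first.
  by rewrite -integralN; [apply: eq_integral|exact: integrable_add_def].
have : (\int[leb]_x (u x * \1_`[y0, y1] x * b x)%:E)%E \is a fin_num by exact: integrable_fin_num.
by move=> h; rewrite addeC subee.
Qed.

(** The curl created by a horizontal cut-off w' a is compensated by the primitive
    of a: on almost every vertical slice this is slice_by_parts. *)
Lemma box_by_parts (l u y0 y1 K : R) (a psi : R * R -> R) (w : R -> R) U : y0 < y1 ->
  integ a -> test_function U psi -> continuous w -> (forall x, `|w x| <= K) ->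
  (forall x, l <= x -> x <= u -> psi (x, y1) = 0) ->
  I2 (fun x => \1_(box l u y0 y1) x * w x.1 *
     (partial2 psi x * strip_prim y0 y1 a x + psi x * a x)) = 0.
Proof.
move=> y01 ia tpsi cw wK psi0; have [spsi _ _] := tpsi.
have [c0 c1 c2] := partial_continuous spsi.
have [M M0 HM] := test_bounded tpsi.
have mB : measurable_fun setT (\1_(box l u y0 y1) : R * R -> R).
  by apply: measurable_indic; exact: box_measurable.
have cw1 : continuous (fun x : R * R => w x.1).
  exact: continuous_fst.
have i1 (x : R * R) : `|\1_(box l u y0 y1) x| <= 1 :> R by rewrite ger0_norm// indicE; case: (_ \in _).
have K0 : 0 <= K by apply: le_trans (wK 0).
apply: I2_slices2.
  rewrite (_ : (fun x => _) = (fun x => (w x.1 * partial2 psi x) * (\1_(box l u y0 y1) x * strip_prim y0 y1 a x)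
     + (\1_(box l u y0 y1) x * (w x.1 * psi x)) * a x)); last first.
    by apply/funext => x; ring.
  apply: integD.
    apply: (@integMbounded _ _ _ (K * M)); last by apply: integ_strip_prim => //; exact: ltW.
      by apply: measurable_funM; apply: continuous2_measurable.
    by move=> x; rewrite normrM; apply: ler_pM => //; have [] := HM x.
  apply: (@integMbounded _ _ _ (1 * (K * M))) => //.
    by apply: measurable_funM => //; apply: measurable_funM; apply: continuous2_measurable.
  by move=> x; rewrite !normrM; apply: ler_pM => //; apply: ler_pM => //; have [] := HM x.
have := ae_integrable1 ia.
apply: (@filterS _ _ (ae_filter_ringOfSetsType leb)) => x ib.
have [/andP[xl xu]|nx] := boolP ((l <= x) && (x <= u)); last first.
  under eq_integral => y _ do rewrite box_indic indicE mem_setE in_itv /= (negbTE nx) !mul0r.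
  by rewrite integral0.
have cpx : continuous (fun y => partial2 psi (x, y)) by exact: continuous_slice2.
have := @slice_by_parts y0 y1 (K * M) (fun y => a (x, y)) (fun y => w x * psi (x, y))
   (fun y => w x * partial2 psi (x, y)) y01 ib.
move=> H; rewrite -[RHS]H => [||||||]; last by rewrite psi0// mulr0.
- apply: eq_integral => y _.
  rewrite box_indic indicE mem_setE in_itv /= xl xu /= mul1r /strip_prim /=; congr EFin; ring.
- by move=> y; apply: cvgM; [exact: cvg_cst|exact: continuous_slice2].
- by move=> y; apply: cvgM; [exact: cvg_cst|exact: continuous_slice2].
- by move=> y; rewrite normrM; apply: ler_pM => //; have [] := HM (x, y).
- by move=> y; rewrite normrM; apply: ler_pM => //; have [] := HM (x, y).
- move=> s s0 s1; under eq_integral => y _ do rewrite EFinM.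
  rewrite integralZl//; last exact: continuous_integrable1.
  by rewrite FTC_partial2// psi0// mulr0 -!EFinB -EFinM; congr EFin; ring.
Qed.

(** Only the increments of psi in the vertical direction matter, and these are
    constant along the box by hypothesis. *)
Lemma box_circulation (l u y0 y1 d K : R) (psi : R * R -> R) (w w' : R -> R) U : l < u -> y0 < y1 ->
  test_function U psi -> (forall x : R, is_derive x 1 w (w' x)) -> continuous w' ->
  (forall x, `|w' x| <= K) ->
  (forall x, l <= x -> x <= u -> psi (x, y1) - psi (x, y0) = d) ->
  I2 (fun x => \1_(box l u y0 y1) x * w' x.1 * partial2 psi x) = d * (w u - w l).
Proof.
move=> lu y01 tpsi dw cw' w'K psid; have [spsi _ _] := tpsi.
have [c0 c1 c2] := partial_continuous spsi.
have [M M0 HM] := test_bounded tpsi.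
have K0 : 0 <= K by apply: le_trans (w'K 0).
have cw1 : continuous (fun x : R * R => w' x.1).
  exact: continuous_fst.
have iF : integ (fun x => \1_(box l u y0 y1) x * w' x.1 * partial2 psi x).
  rewrite (_ : (fun x => _) = (fun x => (w' x.1 * partial2 psi x) * \1_(box l u y0 y1) x)); last first.
    by apply/funext => x; ring.
  apply: (@integMbounded _ _ _ (K * M)).
  - by apply: measurable_funM; apply: continuous2_measurable.
  - by move=> x; rewrite normrM; apply: ler_pM => //; have [] := HM x.
  - apply: integ_indic; first exact: box_measurable.
    by rewrite box_measure ?ltry// ltW.
apply: EFin_inj; rewrite I2_EFin// -integral12_prod_meas1//.
transitivity (\int[leb]_x (\1_`[l, u] x * (d * w' x))%:E)%E.
  apply: eq_integral => x _; rewrite /fubini_F /=.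
  have [/andP[xl xu]|nx] := boolP ((l <= x) && (x <= u)); last first.
    under eq_integral => y _ do rewrite box_indic indicE mem_setE in_itv /= (negbTE nx) !mul0r.
    by rewrite integral0 indicE mem_setE in_itv /= (negbTE nx) mul0r.
  under eq_integral => y _ do rewrite box_indic {1}indicE mem_setE in_itv /= xl xu /= mul1r -mulrA.
  rewrite integral_indicM; under eq_integral => y _ do rewrite EFinM.
  rewrite integralZl//; last by apply: continuous_integrable1; exact: continuous_slice2.
  rewrite FTC_partial2// -EFinB psid// indicE mem_setE in_itv /= xl xu /= mul1r -EFinM; congr EFin; ring.
rewrite integral_indicM; under eq_integral => x _ do rewrite EFinM.
rewrite integralZl//; last exact: continuous_integrable1.
rewrite EFinM; congr (_ * _)%E; rewrite EFinB.
have cw (x : R) : {for x, continuous w}.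
  by apply: differentiable_continuous; apply/derivable1_diffP; have [] := dw x.
apply: continuous_FTC2 => //.
- exact: continuous_subspaceT.
- split.
  + by move=> y _; have [] := dw y.
  + exact: cvg_at_right_filter (cw l).
  + exact: cvg_at_left_filter (cw u).
- by move=> y _; rewrite derive1E; have [_ ->] := dw y.
Qed.

End ByParts.

(** * Change of variables under similarities *)

Notation image_measure := measure_function_pushforward__canonical__measure_function_Measure.

Section Affine.
Variable R : realType.
Notation leb := (@lebesgue_measure R).
Notation mu2 := (leb \x leb)%E.
Variables (p : R * R) (rho : R).
Hypothesis rho0 : 0 < rho.

Definition aff (z : R * R) : R * R := (p.1 + rho * z.1, p.2 + rho * z.2).

Lemma partial_aff (f : R * R -> R) : (forall x, derivable f x (1, 0) /\ derivable f x (0, 1)) ->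
  forall x, [/\ derivable (f \o aff) x (1, 0), derivable (f \o aff) x (0, 1),
    partial1 (f \o aff) x = rho * partial1 f (aff x) & partial2 (f \o aff) x = rho * partial2 f (aff x)].
Proof.
move=> df x; have [d1 d2] := df (aff x).
rewrite (derive_line1 f (aff x)).2 /= in d1; rewrite (derive_line2 f (aff x)).2 /= in d2.
rewrite [X in derivable _ X _]addrC in d1; rewrite [X in derivable _ X _]addrC in d2.
have [D1 E1] := derive_affine d1; have [D2 E2] := derive_affine d2.
have L1 : (fun s => (f \o aff) (s, x.2)) = (fun s => f (rho * s + p.1, p.2 + rho * x.2)).
  by apply/funext => s; rewrite /aff /= addrC.
have L2 : (fun s => (f \o aff) (x.1, s)) = (fun s => f (p.1 + rho * x.1, rho * s + p.2)).
  by apply/funext => s; rewrite /aff /= [p.2 + _]addrC.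
split.
- rewrite (derive_line1 _ x).2 L1; exact D1.
- rewrite (derive_line2 _ x).2 L2; exact D2.
- rewrite /partial1 (derive_line1 _ x).1 L1 E1 (derive_line1 f (aff x)).1 /= mulrC.
  by rewrite [rho * x.1 + _]addrC.
- rewrite /partial2 (derive_line2 _ x).1 L2 E2 (derive_line2 f (aff x)).1 /= mulrC.
  by rewrite [rho * x.2 + _]addrC.
Qed.

Lemma aff_continuous : continuous aff.
Proof.
have ca (q : R) : continuous (fun t : R => q + rho * t).
  move=> t; apply: cvgD; first exact: cvg_cst.
  by apply: cvgM; [exact: cvg_cst|exact: cvg_id].
move=> x; have c1 := continuous_fst (ca p.1) (x := x).
have c2 := continuous_snd (ca p.2) (x := x).
exact: (cvg_pair c1 c2).
Qed.

Lemma Cn_aff n (f : R * R -> R) : Cn n f -> Cn n (f \o aff).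
Proof.
elim: n f => [|n IH] f.
  by move=> cf x; apply: continuous_comp; [exact: aff_continuous|exact: cf].
move=> [cf df f1 f2]; have H := partial_aff df; split.
- by move=> x; apply: continuous_comp; [exact: aff_continuous|exact: cf].
- by move=> x; have [h1 h2 _ _] := H x; split; [exact h1|exact h2].
- rewrite (_ : partial1 _ = fun x => (fun=> rho) x * (partial1 f \o aff) x); last first.
    by apply/funext => x; have [_ _ -> _] := H x.
  by apply: CnM; [exact: Cn_cst|exact: IH].
- rewrite (_ : partial2 _ = fun x => (fun=> rho) x * (partial2 f \o aff) x); last first.
    by apply/funext => x; have [_ _ _ ->] := H x.
  by apply: CnM; [exact: Cn_cst|exact: IH].
Qed.

Lemma aff_measurable : measurable_fun setT
  (aff : measurableTypeR R * measurableTypeR R -> measurableTypeR R * measurableTypeR R).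
Proof.
apply/measurable_fun_pairP; split.
  apply: measurable_funD => //; apply: measurable_funM => //; exact: measurable_fst.
apply: measurable_funD => //; apply: measurable_funM => //; exact: measurable_snd.
Qed.

Lemma leb_aff1 (q : R) (A : set R) : measurable A ->
  leb A = (rho%:E * leb ((fun t : R => (q + rho * t)%R) @^-1` A))%E.
Proof.
pose ph : measurableTypeR R -> measurableTypeR R := (fun t : R => q + rho * t).
have mph : measurable_fun setT ph by apply: measurable_funD => //; exact: measurable_funM.
move=> mA; pose m : {measure set (measurableTypeR R) -> \bar R} := mscale (NngNum (ltW rho0)) (image_measure leb mph).
have -> : (rho%:E * leb (ph @^-1` A))%E = m A by [].
suff H : forall X : set R, ocitv X -> lebesgue_measure X = m X.
  refine (@lebesgue_measure_unique R m H A mA).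
move=> X [[a b] _ <-].
change (leb `]a, b]%classic = rho%:E * leb (ph @^-1` `]a, b]%classic))%E.
rewrite (_ : ph @^-1` _ = `](a - q) / rho, (b - q) / rho]%classic); last first.
  apply/seteqP; split=> t /=; rewrite !in_itv /= ltr_pdivrMr// ler_pdivlMr// /ph.
    by move=> /andP[h1 h2]; apply/andP; split; lra.
  by move=> /andP[h1 h2]; apply/andP; split; lra.
rewrite !lebesgue_measure_itv /= !lte_fin ltr_pM2r ?invr_gt0// ltrD2r.
case: ifP => _; last by rewrite mule0.
by rewrite -!EFinB -EFinM; congr EFin; field; rewrite gt_eqF.
Qed.

(** Both sides are measures that agree on rectangles. *)
Lemma leb_aff (A : set (R * R)) : measurable A ->
  mu2 A = ((rho ^+ 2)%:E * mu2 (aff @^-1` A))%E.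
Proof.
move=> mA; pose m : {measure set (measurableTypeR R * measurableTypeR R) -> \bar R} :=
  mscale (NngNum (sqr_ge0 rho)) (image_measure mu2 aff_measurable).
have -> : ((rho ^+ 2)%:E * mu2 (aff @^-1` A))%E = m A by [].
suff H : forall X Y : set R, measurable X -> measurable Y -> m (X `*` Y) = (leb X * leb Y)%E.
  refine (@product_measure_unique _ _ _ _ R leb leb m H A mA).
move=> X Y mX mY.
change (((rho ^+ 2)%:E * mu2 (aff @^-1` (X `*` Y)))%E = (leb X * leb Y)%E).
rewrite (_ : aff @^-1` _ = ((fun t : R => p.1 + rho * t) @^-1` X) `*` ((fun t : R => p.2 + rho * t) @^-1` Y)); last first.
  by apply/seteqP; split.
have mq (q : R) : measurable_fun setT (fun t : R => q + rho * t).
  by apply: measurable_funD => //; exact: measurable_funM.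
have m1 : measurable ((fun t : R => p.1 + rho * t) @^-1` X) by rewrite -[_ @^-1` _]setTI; exact: mq.
have m2 : measurable ((fun t : R => p.2 + rho * t) @^-1` Y) by rewrite -[_ @^-1` _]setTI; exact: mq.
transitivity ((rho ^+ 2)%:E * (leb ((fun t : R => (p.1 + rho * t)%R) @^-1` X) * leb ((fun t : R => (p.2 + rho * t)%R) @^-1` Y)))%E.
  by congr (_ * _)%E; exact: product_measure1E.
by rewrite (leb_aff1 p.1 mX) (leb_aff1 p.2 mY) expr2 EFinM muleACA.
Qed.

Lemma ge0_integral_aff (f : R * R -> \bar R) : measurable_fun setT f -> (forall x, (0 <= f x)%E) ->
  (\int[mu2]_x f x = (rho ^+ 2)%:E * \int[mu2]_z f (aff z))%E.
Proof.
move=> mf f0; pose m : {measure set (measurableTypeR R * measurableTypeR R) -> \bar R} :=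
  mscale (NngNum (sqr_ge0 rho)) (image_measure mu2 aff_measurable).
transitivity (\int[m]_x f x)%E.
  refine (@eq_measure_integral _ _ _ setT m mu2 f (fun A mA _ => leb_aff mA)).
transitivity ((rho ^+ 2)%:E * \int[image_measure mu2 aff_measurable]_x f x)%E.
  exact: (@ge0_integral_mscale _ _ R (image_measure mu2 aff_measurable) setT measurableT
    (NngNum (sqr_ge0 rho)) f mf (fun x _ => f0 x)).
refine (congr1 (fun t => ((rho ^+ 2)%:E * t)%E) _).
have h : {in setT, forall y : R * R, (0 <= f y)%E} by [].
have := @ge0_integral_pushforward _ _ _ _ R _ aff_measurable mu2 setT f measurableT mf h.
by rewrite preimage_setT.
Qed.

Lemma integral_aff (f : R * R -> R) : integ f -> integ (f \o aff) /\ I2 f = rho ^+ 2 * I2 (f \o aff).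
Proof.
move=> hf; have mf := integ_measurable hf.
have mfa : measurable_fun setT (f \o aff) by apply: (measurableT_comp mf); exact: aff_measurable.
have r2 : 0 < rho ^+ 2 by rewrite exprn_gt0.
have ifa : integ (f \o aff).
  apply/integrableP; split; first exact/measurable_EFinP.
  have /integrableP[_] := hf.
  rewrite ge0_integral_aff//; last by apply: measurableT_comp => //; exact/measurable_EFinP.
  set J := (X in (_ * X)%E) => h; rewrite ltey; apply/eqP => e.
  by move: h; rewrite /J /= in e *; rewrite e gt0_muley ?lte_fin// ltxx.
split=> //; apply: EFin_inj; rewrite EFinM !I2_EFin//.
have mEf : measurable_fun setT (EFin \o f : measurableTypeR R * measurableTypeR R -> \bar R) by exact/measurable_EFinP.
have Ep := ge0_integral_aff (measurable_funepos mEf) (fun x => funepos_ge0 _ x).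
have En := ge0_integral_aff (measurable_funeneg mEf) (fun x => funeneg_ge0 _ x).
have E1 := integralE mu2 setT (EFin \o f).
have E2 := integralE mu2 setT (EFin \o (f \o aff)).
have d2 := integrable_add_def measurableT ifa.
have Ep' : (\int[mu2]_z (EFin \o f)^\+ (aff z) = \int[mu2]_z (EFin \o (f \o aff))^\+ z)%E.
  by apply: eq_integral => x _; rewrite !funeposE.
have En' : (\int[mu2]_z (EFin \o f)^\- (aff z) = \int[mu2]_z (EFin \o (f \o aff))^\- z)%E.
  by apply: eq_integral => x _; rewrite !funenegE.
rewrite Ep' in Ep; rewrite En' in En.
transitivity (\int[mu2]_x (EFin \o f)^\+ x - \int[mu2]_x (EFin \o f)^\- x)%E; first exact: E1.
transitivity ((rho ^+ 2)%:E * (\int[mu2]_x (EFin \o (f \o aff))^\+ x - \int[mu2]_x (EFin \o (f \o aff))^\- x))%E; last first.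
  by congr (_ * _)%E; symmetry; exact: E2.
by rewrite Ep En -muleBr//; exact: d2.
Qed.

End Affine.

(** * The dual form of admissibility *)

Section Admissible.
Variable R : realType.
Notation leb := (@lebesgue_measure R).
Notation mu2 := (leb \x leb)%E.

Definition entry (Omega : set (R * R)) (A : R * R -> 'M[R]_2) (i j : 'I_2) (x : R * R) : R :=
  \1_Omega x * A x i j.

Lemma integ_entry Omega A i j : measurable Omega -> L1_field Omega A -> integ (entry Omega A i j).
Proof.
move=> mO /(_ i j); rewrite integrable_mkcond//; apply: eq_integrable => // x _.
by rewrite patchE /= /entry indicE; case: ifPn => _ /=; rewrite ?mul1r ?mul0r.
Qed.

Lemma L1_field_entry Omega A : measurable Omega -> (forall i j, integ (entry Omega A i j)) ->
  L1_field Omega A.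
Proof.
move=> mO H i j; rewrite integrable_mkcond//; have := H i j; apply: eq_integrable => // x _.
by rewrite patchE /= /entry indicE; case: ifPn => _ /=; rewrite ?mul1r ?mul0r.
Qed.

Lemma curl_pairing_row Omega A phi i : measurable Omega ->
  curl_pairing Omega A phi i 0 = row_pairing (entry Omega A i 0) (entry Omega A i 1) phi.
Proof.
move=> mO; rewrite mxE /row_pairing /I2 Rintegral_mkcond; congr Rintegral.
apply/funext => x; rewrite patchE mxE big_ord_recl big_ord1 /= !mxE /= /entry !indicE.
rewrite (_ : lift ord0 ord0 = 1); last exact: val_inj.
by case: (x \in Omega) => /=; rewrite ?mul1r ?mul0r ?mulr0 ?subr0// mulrN mulrC [X in _ - X]mulrC.
Qed.

(** The dual form of the two conditions that define an admissible pair. It is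
    linear in the test function, hence stable under integration by parts and
    gluing, where circuits are awkward. *)
Definition lattice_rows (L : R) (Omega : set (R * R)) (A : R * R -> 'M[R]_2) (S : set (R * R)) :=
  forall i psi, test_function Omega psi -> int_near S psi ->
    in_lattice L (row_pairing (entry Omega A i 0) (entry Omega A i 1) psi).

(** Otherwise some multiple of t would equal L / 2. *)
Lemma in_lattice_all_scale (L t : R) : L != 0 -> (forall a, in_lattice L (a * t)) -> t = 0.
Proof.
move=> L0 H; apply/eqP; apply: contraT => t0.
have [z] := H (L / 2 / t); rewrite divfK// => /eqP.
rewrite [L / 2]mulrC -subr_eq0 mulrC -mulrBr mulf_eq0 (negbTE L0) /= subr_eq0 => /eqP e.
have : (1 : int)%:~R = (2 * z)%:~R :> R by rewrite intrM -e (_ : 2%:~R = 2 :> R)// divff// pnatr_eq0.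
by move=> /intr_inj; lia.
Qed.

(** A test function vanishing near S remains so after multiplication by any real,
    so its pairing is 0: the curl is carried by S. The cut-off of a circuit is
    1 or 0 near S. *)
Lemma admissible_of_lattice (tau eps : R) Omega A (C : set (R * R)) : 0 < tau -> 0 < eps ->
  open Omega -> L1_field Omega A -> closed C -> lattice_rows (tau * eps) Omega A (Omega `&` C) ->
  admissible tau eps Omega A (Omega `&` C).
Proof.
move=> tau0 eps0 oO L1A cC lat; have mO := open2_measurable oO.
have iA i j := integ_entry i j mO L1A.
have te0 : tau * eps != 0 by rewrite mulf_neq0 ?gt_eqF.
split=> //; first by exists C.
  move=> x [Ox]; apply: contra_notP => nS.
  exists (Omega `&` ~` C); split => //.
  - by apply: openI => //; exact: closed_openC.
  - by split=> // Cx; apply: nS; split.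
  move=> phi [sphi cphi phiU].
  have tphi : test_function Omega phi by split=> // y /phiU [].
  have nphi y : C y -> \forall z \near y, phi z = 0.
    by move=> Cy; apply: supp_near0 => /phiU [_]; exact.
  apply/colP => i; rewrite [RHS]mxE curl_pairing_row//.
  apply: (in_lattice_all_scale te0) => a.
  have t0 := @test0 R Omega; have := row_pairing_linear a (iA i 0) (iA i 1) t0 tphi.
  rewrite (_ : row_pairing _ _ (fun=> 0) = 0); last first.
    rewrite /row_pairing (_ : (fun x => _) = fun=> 0) ?/I2 /Rintegral ?integral0//.
    apply/funext => y; have [-> ->] : partial1 (fun=> 0 : R) y = 0 /\ partial2 (fun=> 0 : R) y = 0.
      by split; rewrite /partial1 /partial2; [exact: (@derive_cst _ _ _ (0 : R) y (1, 0))|exact: (@derive_cst _ _ _ (0 : R) y (0, 1))].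
    by rewrite !mul0r subr0.
  rewrite add0r => <-; apply: lat; first exact: test_add.
  move=> y [_ Cy]; exists 0; have := nphi y Cy; apply: filterS => z ->; by rewrite mulr0 addr0.
move=> gamma D phi _ _ _ [oD DO _] [tphi phi1 suppD].
have inear : int_near (Omega `&` C) phi.
  move=> x Sx; have [Dx|nDx] := pselect (D x).
    exists 1; move: oD; rewrite openE => /(_ _ Dx); apply: filterS => y Dy; exact: phi1.
  by exists 0; apply: supp_near0 => sx; have [_] := suppD _ (conj sx nDx); exact.
have Hi i : exists z : int, curl_pairing Omega A phi i 0 = tau * eps * z%:~R.
  rewrite curl_pairing_row//; exact: lat.
have [s Hs] : exists s : int, - sgn_curve gamma D = s%:~R :> R.
  by rewrite /sgn_curve; case: asboolP => _; [exists (-1)|exists 1]; rewrite ?mulrN1z ?opprK.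
have [f Hf] := choice Hi.
exists (\col_i (s * f i)); apply/colP => i; rewrite !mxE Hs.
by have := Hf i; rewrite mxE => ->; rewrite intrM; ring.
Qed.

Lemma lattice_of_admissible (tau eps : R) A S :
  admissible tau eps (open_square 2^-1) A S -> lattice_rows (tau * eps) (open_square 2^-1) A S.
Proof.
move=> [L1A SC supA circ] i psi.
have mT : measurable (open_square (2^-1 : R)) by apply: open2_measurable; exact: open_square_open.
have iA i' j := integ_entry i' j mT L1A.
apply: (circuit_int_near SC).
- by move=> f g a tf tg; exact: (row_pairing_linear a (iA i 0) (iA i 1) tf tg).
- move=> x Tx nSx; have := contra_not (@supA x) nSx; rewrite /supp_curl /= => /not_andP[//|/contrapT].
  move=> [U [oU Ux UT HU]]; exists U; split=> // phi tphi.
  by rewrite -curl_pairing_row// HU// mxE.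
- move=> gamma D phi sc rg tr idm cut.
  have [z /colP/(_ i) E] := circ gamma D phi sc rg tr idm cut.
  rewrite /line_integral mxE curl_pairing_row// !mxE in E; move: E.
  rewrite /sgn_curve; case: asboolP => _.
    by rewrite mulN1r => e; exists (- z i 0); rewrite mulrNz mulrN -e opprK.
  by rewrite opprK mul1r => ->; exists (z i 0).
Qed.

End Admissible.

(** * Extending functionals modulo a lattice *)

Section HomExtension.
Variables (R : realType) (V : zmodType) (L : R).

(** Closure under subtraction alone: test functions integral near a set form
    such a family, and the functionals below are additive only on it. *)
Definition subr_stable (G : V -> Prop) := G 0 /\ forall u v, G u -> G v -> G (u - v).
Definition subr_morph (G : V -> Prop) (I : V -> R) :=
  forall u v, G u -> G v -> I (u - v) = I u - I v.

Lemma subr_stableMz G u v (z : int) : subr_stable G -> G u -> G v -> G (u - v *~ z).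
Proof.
move=> [G0 GB] Gu Gv; have GN w : G w -> G (- w) by rewrite -sub0r; exact: GB.
have Gn w n : G w -> G (w *+ n).
  by move=> Gw; elim: n => [|n IH]; rewrite ?mulr0n// mulrS -[w *+ n]opprK; apply: GB => //; exact: GN.
apply: GB => //; case: z => n; first by rewrite -pmulrn; exact: Gn.
by rewrite NegzE mulrNz -pmulrn; apply: GN; exact: Gn.
Qed.

Lemma subr_morphMz G I u v (z : int) : subr_stable G -> subr_morph G I -> G u -> G v ->
  I (u - v *~ z) = I u - z%:~R * I v.
Proof.
move=> sG mI Gu Gv; have [G0 GB] := sG.
have I0 : I 0 = 0 by rewrite -(subr0 (0 : V)) mI// subrr.
have GMz w : G (v *~ w) by have := subr_stableMz (- w) sG G0 Gv; rewrite sub0r mulrNz opprK.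
suff H : I (v *~ z) = z%:~R * I v by rewrite mI// H.
have Hn (n : nat) : I (v *+ n) = n%:R * I v.
  elim: n => [|n IH]; first by rewrite mulr0n mul0r.
  have GN : G (- v) by rewrite -sub0r; exact: GB.
  have Gn : G (v *+ n) by rewrite pmulrn; exact: GMz.
  rewrite mulrSr -[X in _ + X]opprK mI// IH.
  have -> : I (- v) = - I v by rewrite -sub0r mI// I0 sub0r.
  by rewrite -natr1; ring.
case: z => n; first by rewrite -!pmulrn Hn.
rewrite NegzE !mulrNz -!pmulrn -sub0r mI ?Hn ?I0//; last by rewrite pmulrn; exact: GMz.
by ring.
Qed.

(** By induction on the functionals: on the kernel of one of them the others
    suffice, and its coefficient is read off an element where it takes its
    least positive value. *)
Lemma hom_extension (T : eqType) (s : seq T) (G : V -> Prop) (D : T -> V -> R) (I : V -> R) :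
  uniq s -> subr_stable G -> (forall k, subr_morph G (D k)) -> subr_morph G I ->
  (forall k u, G u -> exists z : int, D k u = z%:~R) ->
  (forall u, G u -> (forall k, k \in s -> D k u = 0) -> in_lattice L (I u)) ->
  exists c : T -> R, forall u, G u -> in_lattice L (I u - \sum_(k <- s) c k * D k u).
Proof.
elim: s G => [|k s IH] G /=.
  move=> _ _ _ _ _ H; exists (fun=> 0) => u Gu; rewrite big_nil subr0.
  by apply: H => // k; rewrite in_nil.
move=> /andP[ks us] sG mD mI Dz H; have [G0 GB] := sG.
pose G' u := G u /\ D k u = 0.
have D0 j : D j 0 = 0 by rewrite -(subr0 (0 : V)) mD// subrr.
have sG' : subr_stable G'.
  split; first by split=> //; exact: D0.
  by move=> u v [Gu u0] [Gv v0]; split; [exact: GB|rewrite mD// u0 v0 subrr].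
have [||||c Hc] := IH G' us sG'.
- by move=> j u v [Gu _] [Gv _]; exact: mD.
- by move=> u v [Gu _] [Gv _]; exact: mI.
- by move=> j u [Gu _]; exact: Dz.
- move=> u [Gu u0] us0; apply: H => // j; rewrite inE => /orP[/eqP ->//|]; exact: us0.
pose I' u := I u - \sum_(j <- s) c j * D j u.
have sumB u v (z : int) : G u -> G v -> I' (u - v *~ z) = I' u - z%:~R * I' v.
  move=> Gu Gv; rewrite /I' (subr_morphMz z sG mI)//.
  rewrite (eq_bigr (fun j => c j * D j u - z%:~R * (c j * D j v))); last first.
    by move=> j _; rewrite (subr_morphMz z sG (mD j))//; ring.
  by rewrite sumrB -mulr_sumr; ring.
have sumE (d : R) u : \sum_(j <- s) (if j == k then d else c j) * D j u = \sum_(j <- s) c j * D j u.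
  rewrite big_seq [RHS]big_seq; apply: eq_bigr => j js.
  by case: eqP => // e; move: js; rewrite e (negbTE ks).
have [Dk0|] := pselect (forall u, G u -> D k u = 0).
  exists c => u Gu; rewrite big_cons Dk0// mulr0 add0r; apply: Hc; split=> //; exact: Dk0.
move=> /existsNP[w /not_implyP[Gw /eqP w0]].
pose P (n : nat) := `[< exists2 u, G u & D k u = n.+1%:R >].
have [n0 Pn0] : exists n, P n.
  have [z Ez] := Dz k w Gw.
  case: z Ez => [[|n]|n] Ez.
  - by move: w0; rewrite Ez eqxx.
  - by exists n; apply/asboolP; exists w.
  - exists n; apply/asboolP; exists (0 - w); first exact: GB.
    by rewrite mD// D0 Ez NegzE mulrNz sub0r opprK.
have [m /asboolP[u0 Gu0 Du0] minm] := ex_minnP (ex_intro _ n0 Pn0).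
have m0 : m.+1%:R != 0 :> R by rewrite pnatr_eq0.
exists (fun j => if j == k then I' u0 / m.+1%:R else c j) => u Gu.
rewrite big_cons eqxx sumE.
have [z Ez] := Dz k u Gu.
have zq : z = (z %/ m.+1)%Z * m.+1 + (z %% m.+1)%Z by exact: divz_eq.
set q := (z %/ m.+1)%Z in zq *; have Gd := subr_stableMz q sG Gu Gu0.
have Dd : D k (u - u0 *~ q) = (z %% m.+1)%Z%:~R.
  by rewrite (subr_morphMz q sG (mD k))// Ez Du0 {1}zq intrD intrM; ring.
have r0 : (z %% m.+1)%Z = 0.
  have := ltz_pmod z (ltn0Sn m : (0 < m.+1%:Z)); have := modz_ge0 z (lt0r_neq0 (ltn0Sn m : (0 < m.+1%:Z))).
  case: (z %% m.+1)%Z Dd => // -[//|r] Dd _ lr.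
  have : (m <= r)%N by apply: minm; apply/asboolP; exists (u - u0 *~ q).
  by move: lr; rewrite ltz_nat ltnS ltnNge => /negP h /h.
rewrite r0 in Dd; have := Hc _ (conj Gd Dd); rewrite -/(I' _) sumB//.
rewrite (_ : I' u - q%:~R * I' u0 = I u - (I' u0 / m.+1%:R * D k u + \sum_(j <- s) c j * D j u))//.
have -> : D k u = q%:~R * m.+1%:R by rewrite Ez {1}zq r0 addr0 intrM.
by rewrite /I'; field.
Qed.

End HomExtension.

(** * The distance to the rotation group *)

Section Rotations.
Variable R : realType.
Implicit Types (A B M : 'M[R]_2).

Definition frob2 A : R := \sum_i \sum_j A i j ^+ 2.

Lemma frob2E A : frob2 A = A 0 0 ^+ 2 + A 0 1 ^+ 2 + A 1 0 ^+ 2 + A 1 1 ^+ 2.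
Proof.
rewrite /frob2 !big_ord_recl !big_ord0 /= (_ : lift ord0 ord0 = 1); last exact: val_inj.
by rewrite !addr0 !addrA.
Qed.

Lemma frob2_ge0 A : 0 <= frob2 A.
Proof. by rewrite frob2E !addr_ge0// sqr_ge0. Qed.

Lemma matrix2_eq A B : A 0 0 = B 0 0 -> A 0 1 = B 0 1 -> A 1 0 = B 1 0 -> A 1 1 = B 1 1 -> A = B.
Proof.
move=> h00 h01 h10 h11; apply/matrixP => i j.
have c2 (k : 'I_2) : k = 0 \/ k = 1.
  by case: k => [[|[|k]] h]; [left|right|]; try exact: val_inj.
by case: (c2 i) => ->; case: (c2 j) => ->.
Qed.

Lemma SO2P M : SO2 M <-> exists a b : R,
  [/\ a ^+ 2 + b ^+ 2 = 1, M 0 0 = a, M 1 0 = b, M 0 1 = - b & M 1 1 = a].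
Proof.
have E01 : lift (0 : 'I_2) (0 : 'I_1) = 1 by exact: val_inj.
have D : \det M = M 0 0 * M 1 1 - M 0 1 * M 1 0.
  rewrite (expand_det_row _ ord0) !big_ord_recl big_ord0 /= addr0 /cofactor !det_mx11 !mxE /=.
  rewrite !E01 (_ : lift (1 : 'I_2) 0 = 0); last exact: val_inj.
  by rewrite /bump /= expr0 expr1 mul1r; ring.
have P (i j : 'I_2) : (M^T *m M) i j = M 0 i * M 0 j + M 1 i * M 1 j.
  by rewrite mxE !big_ord_recl big_ord0 /= addr0 !mxE E01.
split.
  move=> [/matrixP MM dM]; have := MM 0 0; have := MM 0 1; have := MM 1 1.
  rewrite !P !mxE /= D in dM * => e11 e01 e00.
  exists (M 0 0), (M 1 0).
  have e1 : M 0 1 = - M 1 0.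
    have H : M 0 1 * (M 0 0 * M 0 0 + M 1 0 * M 1 0) + M 1 0 * (M 0 0 * M 1 1 - M 0 1 * M 1 0) =
       M 0 0 * (M 0 0 * M 0 1 + M 1 0 * M 1 1) by ring.
    by move: H; rewrite e00 dM e01; lra.
  have e2 : M 1 1 = M 0 0.
    have H : M 1 1 * (M 0 0 * M 0 0 + M 1 0 * M 1 0) - M 0 0 * (M 0 0 * M 1 1 - M 0 1 * M 1 0) =
       M 1 0 * (M 0 0 * M 0 1 + M 1 0 * M 1 1) by ring.
    by move: H; rewrite e00 dM e01; lra.
  by split=> //; rewrite -e00 !expr2.
move=> [a [b [ab h00 h10 h01 h11]]]; split.
  apply: matrix2_eq; rewrite P !mxE ?h00 ?h01 ?h10 ?h11 /=; move: ab; rewrite !expr2 => ab; nra.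
by rewrite D h00 h01 h10 h11 -ab; ring.
Qed.

Lemma SO2_entry_le M i j : SO2 M -> `|M i j| <= 1.
Proof.
move=> /SO2P[a [b [ab h00 h10 h01 h11]]].
have c2 (k : 'I_2) : k = 0 \/ k = 1.
  by case: k => [[|[|k]] h]; [left|right|]; try exact: val_inj.
have [a1 b1] : `|a| <= 1 /\ `|b| <= 1.
  by split; rewrite ler_norml; apply/andP; split; nra.
by case: (c2 i) => ->; case: (c2 j) => ->; rewrite ?h00 ?h10 ?h01 ?h11 ?normrN.
Qed.

(** The squared distance of A to the rotations, in closed form: minimising
    |A - M|^2 over the rotation M of angle t means maximising
    p cos t + q sin t, with p = A 0 0 + A 1 1 and q = A 1 0 - A 0 1. The closed
    form provides measurability. *)
Definition dist2_SO2 A : R := frob2 A + 2 - 2 * Num.sqrt ((A 0 0 + A 1 1) ^+ 2 + (A 1 0 - A 0 1) ^+ 2).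

Lemma dist2_SO2_le A M : SO2 M -> dist2_SO2 A <= frob2 (A - M).
Proof.
move=> /SO2P[a [b [ab h00 h10 h01 h11]]].
rewrite /dist2_SO2 !frob2E !mxE h00 h10 h01 h11.
set p := A 0 0 + A 1 1; set q := A 1 0 - A 0 1.
have : a * p + b * q <= Num.sqrt (p ^+ 2 + q ^+ 2).
  rewrite (le_trans (ler_norm _))// -sqrtr_sqr ler_wsqrtr//.
  have : 0 <= (a * q - b * p) ^+ 2 by exact: sqr_ge0.
  have : (a * p + b * q) ^+ 2 + (a * q - b * p) ^+ 2 = (a ^+ 2 + b ^+ 2) * (p ^+ 2 + q ^+ 2) by ring.
  rewrite ab mul1r => <-; lra.
rewrite /p /q; move: (Num.sqrt _) => s; nra.
Qed.

(** The rotation whose cosine and sine are proportional to (p, q). *)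
Lemma dist2_SO2_attained A : exists2 M, SO2 M & frob2 (A - M) = dist2_SO2 A.
Proof.
set p := A 0 0 + A 1 1; set q := A 1 0 - A 0 1.
have [a [b [ab E]]] : exists a b : R, a ^+ 2 + b ^+ 2 = 1 /\ a * p + b * q = Num.sqrt (p ^+ 2 + q ^+ 2).
  set s := Num.sqrt _; have s2 : s ^+ 2 = p ^+ 2 + q ^+ 2 by rewrite sqr_sqrtr// addr_ge0// sqr_ge0.
  have [s0|s0] := eqVneq s 0.
    have /eqP : p ^+ 2 + q ^+ 2 = 0 by rewrite -s2 s0 expr0n.
    rewrite paddr_eq0 ?sqr_ge0// !sqrf_eq0 => /andP[/eqP -> /eqP ->].
    by exists 1, 0; split; rewrite ?s0; ring.
  exists (p / s), (q / s); split.
    by rewrite !expr_div_n -mulrDl -s2 divff// expf_neq0.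
  by rewrite mulrAC [q / s * q]mulrAC -mulrDl -!expr2 -s2 expr2 mulfK.
pose M : 'M[R]_2 := \matrix_(i, j) (if i == j then a else if i == 0 then - b else b).
have hM : SO2 M by apply/SO2P; exists a, b; split=> //; rewrite mxE.
exists M => //; rewrite /dist2_SO2 -/p -/q -E !frob2E !mxE /= /p /q.
transitivity (A 0 0 ^+ 2 + A 0 1 ^+ 2 + A 1 0 ^+ 2 + A 1 1 ^+ 2 + 2 * (a ^+ 2 + b ^+ 2) -
  2 * (a * (A 0 0 + A 1 1) + b * (A 1 0 - A 0 1))); first by ring.
by rewrite ab mulr1.
Qed.

Lemma dist2_SO2_ge0 A : 0 <= dist2_SO2 A.
Proof. by have [M _ <-] := dist2_SO2_attained A; exact: frob2_ge0. Qed.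

Lemma dist2_SO2_0 M : SO2 M -> dist2_SO2 M = 0.
Proof.
move=> hM; apply/eqP; rewrite eq_le dist2_SO2_ge0 andbT (le_trans (dist2_SO2_le M hM))//.
by rewrite subrr frob2E !mxE expr0n !addr0.
Qed.

Lemma dist_setE A : ((dist_set (@frobenius R) A (@SO2 R)) ^+ 2 = (dist2_SO2 A)%:E)%E.
Proof.
have [M hM EM] := dist2_SO2_attained A.
suff -> : dist_set (@frobenius R) A (@SO2 R) = (Num.sqrt (dist2_SO2 A))%:E.
  by rewrite -EFin_expe sqr_sqrtr// dist2_SO2_ge0.
apply/eqP; rewrite eq_le; apply/andP; split.
  by apply: ereal_inf_lbound; exists M => //; rewrite /frobenius -/(frob2 _) EM.
apply: le_ereal_inf_tmp => _ [B hB <-]; rewrite lee_fin /frobenius ler_wsqrtr// -/(frob2 _).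
exact: dist2_SO2_le.
Qed.

(** If B is the rotation nearest to A, the entries of M - B are at most 2, so
    that the cross term is linear in A - M; it will be small in L^1. *)
Lemma frob2_le_dist2 A M : SO2 M ->
  frob2 (A - M) <= dist2_SO2 A + 4 * (\sum_i \sum_j `|(A - M) i j|).
Proof.
move=> hM; have [B hB <-] := dist2_SO2_attained A.
have bM i j := SO2_entry_le i j hM; have bB i j := SO2_entry_le i j hB.
rewrite !big_ord_recl !big_ord0 /= (_ : lift ord0 ord0 = 1); last exact: val_inj.
rewrite !frob2E !mxE.
have H (x m b : R) : `|m| <= 1 -> `|b| <= 1 -> (x - m) ^+ 2 <= (x - b) ^+ 2 + 4 * `|x - m|.
  rewrite !ler_norml => /andP[m1 m2] /andP[b1 b2].
  have := ler_norm (x - m); have := ler_norm (- (x - m)); rewrite normrN => n1 n2.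
  have -> : (x - b) ^+ 2 = (x - m) ^+ 2 + 2 * ((x - m) * (m - b)) + (m - b) ^+ 2 by ring.
  have := sqr_ge0 (m - b); nra.
have := H (A 0 0) _ _ (bM 0 0) (bB 0 0); have := H (A 0 1) _ _ (bM 0 1) (bB 0 1).
have := H (A 1 0) _ _ (bM 1 0) (bB 1 0); have := H (A 1 1) _ _ (bM 1 1) (bB 1 1).
lra.
Qed.

End Rotations.

(** * The cut-off across the interface *)

Section Cut.
Variable R : realType.

Lemma plateau_le1 (l u w s : R) : plateau l u w s <= 1.
Proof.
by rewrite /plateau -[leRHS]mulr1; apply: ler_pM; rewrite ?smooth_step_ge0 ?smooth_step_le1.
Qed.

Lemma is_derive_plateau (l u w s : R) :
  is_derive (s : R) 1 (plateau l u w) ('D_1 (plateau l u w) s).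
Proof. by have [_ d _] := C1n_plateau 1 l u w; exact: (DeriveDef (d s) erefl). Qed.

Lemma continuous_D_plateau (l u w : R) : continuous (fun s => 'D_1 (plateau l u w) s).
Proof. by have [_ _ c] := C1n_plateau 1 l u w. Qed.

(** The bound C is independent of the position and of the width of the ramp, so
    that it can be fixed before all other parameters. *)
Lemma D_plateau_bounded : exists2 C : R, 0 < C & forall (l u w s : R), 0 < w ->
  `|'D_1 (plateau l u w) s| <= C / w.
Proof.
have [C C0 HC] := D_smooth_step_bounded R.
exists (2 * C) => [|l u w s w0]; first by rewrite mulr_gt0.
have d1 := @derive_affine R (@smooth_step R) w^-1 (- (l - w) / w) s (@derivable_smooth_step R _).
have d2 := @derive_affine R (@smooth_step R) (- w^-1) ((u + w) / w) s (@derivable_smooth_step R _).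
have E : plateau l u w = (fun x => smooth_step (w^-1 * x + - (l - w) / w)) * (fun x => smooth_step (- w^-1 * x + (u + w) / w)).
  by apply/funext => x; rewrite /plateau /=; congr (smooth_step _ * smooth_step _); rewrite !mulrDl; ring.
rewrite E deriveM; [|by have [] := d1|by have [] := d2].
have [_ ->] := d1; have [_ ->] := d2.
have w1 : 0 < w^-1 by rewrite invr_gt0.
apply: le_trans (ler_normD _ _) _.
have st (x : R) : `|smooth_step x| <= 1 by rewrite ger0_norm ?smooth_step_ge0// smooth_step_le1.
have B a b c : `|b| <= C -> `|c| = w^-1 -> `|smooth_step a *: (b * c)| <= C / w.
  move=> hb hc; rewrite /GRing.scale /= normrM -[leRHS]mul1r.
  by apply: ler_pM => //; rewrite normrM hc ler_wpM2r// ltW.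
rewrite (_ : 2 * C / w = C / w + C / w); last by ring.
by apply: lerD; apply: B => //; rewrite ?normrN gtr0_norm.
Qed.

Lemma D_near_cst (f : R -> R) (s c : R) : (\forall y \near s, f y = c) -> 'D_1 f s = 0.
Proof.
move=> H; have H' : \forall y \near s, (fun=> c) y = f y by apply: filterS H => y ->.
by rewrite -(near_eq_derive _ H'); exact: (@derive_cst _ _ _ c s 1).
Qed.

Lemma near_norm_lt (s a : R) : `|s| < a -> \forall y \near s, `|y| < a.
Proof.
move=> sa; have : {for s, continuous (fun y : R => `|y|)} by exact: norm_continuous.
by move=> /(_ [set y | y < a]); apply; exact: lt_nbhsl.
Qed.

Lemma near_norm_gt (s a : R) : a < `|s| -> \forall y \near s, a < `|y|.
Proof.
move=> sa; have : {for s, continuous (fun y : R => `|y|)} by exact: norm_continuous.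
by move=> /(_ [set y | a < y]); apply; exact: lt_nbhsr.
Qed.

(** From here on, plateau (- t) t k is the cut-off in x_1 that keeps a field on
    |x_1| <= t and replaces it by the interface beyond t + k. *)
Lemma cut_core (t k s : R) : 0 < k -> `|s| <= t -> plateau (- t) t k s = 1.
Proof. by move=> k0; rewrite ler_norml => h; exact: plateau1. Qed.

Lemma cut_out (t k s : R) : 0 < k -> t + k <= `|s| -> plateau (- t) t k s = 0.
Proof.
move=> k0 h; apply/eqP; apply: contraTT h => /(plateau_neq0 k0) => /andP[h1 h2].
by rewrite -ltNge ltr_norml; apply/andP; split; lra.
Qed.

Lemma D_cut_core (t k s : R) : 0 < k -> `|s| < t -> 'D_1 (plateau (- t) t k) s = 0.
Proof.
move=> k0 h; apply: (@D_near_cst _ _ 1).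
by apply: filterS (near_norm_lt h) => y /ltW; exact: cut_core.
Qed.

Lemma D_cut_out (t k s : R) : 0 < k -> t + k < `|s| -> 'D_1 (plateau (- t) t k) s = 0.
Proof.
move=> k0 h; apply: (@D_near_cst _ _ 0).
by apply: filterS (near_norm_gt h) => y /ltW; exact: cut_out.
Qed.

Lemma partial_cut (f : R -> R) (u : R * R -> R) : (forall n, C1n n f) -> smooth u -> forall x,
  partial1 (fun x => f x.1 * u x) x = 'D_1 f x.1 * u x + f x.1 * partial1 u x /\
  partial2 (fun x => f x.1 * u x) x = f x.1 * partial2 u x.
Proof.
move=> sf su x.
have [_ df _ _] := C1n_tensor1 (sf 1%N).
have [_ du _ _] := su 1%N.
rewrite (partial1M (fun x => (df x).1) (fun x => (du x).1)).
rewrite (partial2M (fun x => (df x).2) (fun x => (du x).2)).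
have -> : partial1 (fun x : R * R => f x.1) x = 'D_1 f x.1.
  by rewrite /partial1 (derive_line1 _ x).1.
have -> : partial2 (fun x : R * R => f x.1) x = 0.
  by rewrite /partial2 (derive_line2 _ x).1 /=; exact: (@derive_cst _ _ _ (f x.1) x.2 1).
by split; ring.
Qed.

Lemma partial_near_eq (f g : R * R -> R) (x : R * R) : (\forall y \near x, f y = g y) ->
  partial1 f x = partial1 g x /\ partial2 f x = partial2 g x.
Proof. by move=> H; split; rewrite /partial1 /partial2 (near_eq_derive _ H). Qed.

Lemma partial_near0 (f : R * R -> R) (x : R * R) : (\forall y \near x, f y = 0) ->
  partial1 f x = 0 /\ partial2 f x = 0.
Proof. by move=> /near0_supp; exact: partial_supp. Qed.

End Cut.

(** * Welding one tile to the interface *)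

Section Cells.
Variables (R : realType) (n : nat) (t k : R).
Hypotheses (n0 : (0 < n)%N) (t0 : 0 < t) (k0 : 0 < k) (tk : t + k < 2^-1).

(** The two strips t <= |x_1| <= t + k in which the transition takes place are
    divided into n cells each, indexed by a row and a side (true on the right). *)
Definition row_y (j : nat) : R := - 2^-1 + j%:R / n%:R.
Definition side_lo (b : bool) : R := if b then t else - (t + k).
Definition side_hi (b : bool) : R := if b then t + k else - t.
Definition cell (q : 'I_n * bool) : set (R * R) :=
  box (side_lo q.2) (side_hi q.2) (row_y q.1) (row_y q.1.+1).

Lemma row_y0 : row_y 0 = - 2^-1. Proof. by rewrite /row_y mul0r addr0. Qed.

Lemma row_yn : row_y n = 2^-1.
Proof. by rewrite /row_y divff ?pnatr_eq0 -?lt0n//; lra. Qed.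

Lemma row_yS j : row_y j.+1 = row_y j + n%:R^-1.
Proof. by rewrite /row_y -natr1; ring. Qed.

Lemma row_y_lt i j : (row_y i < row_y j) = (i < j)%N.
Proof. by rewrite /row_y ltrD2l ltr_pM2r ?invr_gt0 ?ltr0n// ltr_nat. Qed.

Lemma row_y_le i j : (row_y i <= row_y j) = (i <= j)%N.
Proof. by rewrite /row_y lerD2l ler_pM2r ?invr_gt0 ?ltr0n// ler_nat. Qed.

Lemma side_lt b : side_lo b < side_hi b.
Proof. by have := k0; rewrite /side_lo /side_hi; case: b => h; lra. Qed.

Lemma sideP b (s : R) : side_lo b <= s <= side_hi b -> t <= `|s| <= t + k.
Proof.
have kk := k0; have tt := t0; rewrite /side_lo /side_hi; case: b => /andP[h1 h2].
  by rewrite ger0_norm ?h1 ?h2//; move: tt; lra.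
by rewrite ler0_norm; [apply/andP; split|]; move: h1 h2 tt; lra.
Qed.

Lemma side_of (s : R) : t <= `|s| <= t + k -> side_lo (0 <= s) <= s <= side_hi (0 <= s).
Proof.
rewrite /side_lo /side_hi; case: ger0P => s0 /andP[h1 h2]; apply/andP; split; lra.
Qed.

Lemma row_of (y : R) : - 2^-1 <= y -> y < 2^-1 -> exists j : 'I_n, row_y j <= y < row_y j.+1.
Proof.
move=> y0 y1; have z0 : 0 <= (y + 2^-1) * n%:R by rewrite mulr_ge0//; lra.
have /andP[h1 h2] := truncn_itv z0; set j := Num.trunc _ in h1 h2.
have n0' : 0 < n%:R :> R by rewrite ltr0n.
have jn : (j < n)%N.
  rewrite -(ltr_nat R); apply: le_lt_trans h1 _; rewrite -[ltRHS]mul1r ltr_pM2r//; lra.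
exists (Ordinal jn); rewrite /row_y /=; apply/andP; split.
  by have : j%:R / n%:R <= y + 2^-1 by [rewrite ler_pdivrMr]; lra.
by have : y + 2^-1 < j.+1%:R / n%:R by [rewrite ltr_pdivlMr]; lra.
Qed.

Lemma zone_cell_exists (x : R * R) : open_square (2^-1) x -> t <= `|x.1| <= t + k -> exists q, cell q x.
Proof.
move=> [_ /=]; rewrite in_itv /= => /andP[/ltW y0 y1] /side_of hs.
have [j /andP[j1 /ltW j2]] := row_of y0 y1.
by exists (j, 0 <= x.1); split; rewrite /= in_itv /= ?hs// j1 j2.
Qed.

Lemma cell_side q x : cell q x -> t <= `|x.1| <= t + k.
Proof. by move=> [/=]; rewrite in_itv /= => /sideP. Qed.

Lemma cell_unique q q' x : cell q x -> cell q' x -> (forall j, (j <= n)%N -> x.2 != row_y j) -> q = q'.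
Proof.
case: q q' => [j b] [j' b'] [/= + +] [/= + +] nr; rewrite !in_itv /=.
move=> /andP[h1 h2] /andP[v1 v2] /andP[h1' h2'] /andP[v1' v2'].
have bb : b = b'.
  by move: t0 k0 h1 h2 h1' h2'; rewrite /side_lo /side_hi; case: b; case: b' => //; lra.
have st (i : 'I_n) : row_y i <= x.2 -> x.2 <= row_y i.+1 -> row_y i < x.2 < row_y i.+1.
  move=> a1 a2; rewrite !lt_neqAle a1 a2 !andbT (nr i.+1)// eq_sym nr// ltnW//.
have /andP[s1 s2] := st _ v1 v2; have /andP[s1' s2'] := st _ v1' v2'.
have := lt_trans s1 s2'; have := lt_trans s1' s2; rewrite !row_y_lt !ltnS => e1 e2.
by rewrite bb; congr pair; apply/val_inj/eqP; rewrite eqn_leq e1 e2.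
Qed.

Lemma cell_sub q x : cell q x -> [/\ `|x.1| <= t + k, - 2^-1 <= x.2 & x.2 <= 2^-1].
Proof.
move=> qx; have /andP[_ h] := cell_side qx; move: qx => [_ /=]; rewrite in_itv /= => /andP[v1 v2].
split=> //; first by rewrite -row_y0; apply: le_trans v1; rewrite row_y_le.
by rewrite -row_yn; apply: le_trans v2 _; rewrite row_y_le.
Qed.

End Cells.

Section TileLattice.
Variables (R : realType) (n : nat) (t k L : R).
Hypotheses (n0 : (0 < n)%N) (t0 : 0 < t) (k0 : 0 < k) (tk : t + k < 2^-1).
Variables (bad : pred ('I_n * bool)) (S : set (R * R)) (A0 A1 : R * R -> R) (m0 p0 m1 p1 : R).
Notation leb := (@lebesgue_measure R).
Notation mu2 := (leb \x leb)%E.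
Local Notation T := (open_square (2^-1 : R)).
Local Notation phi := (plateau (- t) t k).
Local Notation dphi := (fun s : R => 'D_1 phi s).
Local Notation row_y := (row_y R n).
Local Notation cell := (@cell R n t k).

Definition jump (m p : R) (x : R * R) : R := if x.1 < 0 then m else p.
Definition deviation (A : R * R -> R) (m p : R) (x : R * R) : R := \1_T x * (A x - jump m p x).
Definition core_indic (x : R * R) : R := \1_(T `&` [set y | `|y.1| < t]) x.
Definition good (q : 'I_n * bool) : R := (~~ bad q)%:R.
(** Half-open in x_2, so that stacked copies tile without overlap. *)
Definition half_square : set (R * R) := `[- 2^-1, 2^-1]%classic `*` `[- 2^-1, 2^-1[%classic.

(** The correction added to the interface in a tile, first entry of a row: the
    deviation a of the given field is kept in the core and multiplied by the
    cut-off phi in the good cells. This creates the curl phi' a1, which is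
    removed by adding phi' g to the first entry, where g is a primitive of a1
    in x_2 along the cell. The primitive is determined up to a constant c q,
    which is kept free in order to adjust the circulations. *)
Definition weld0 (a0 a1 : R * R -> R) (c : 'I_n * bool -> R) (x : R * R) : R :=
  core_indic x * a0 x + \sum_q good q * (\1_(cell q) x *
    (phi x.1 * a0 x + dphi x.1 * (strip_prim (row_y q.1) (row_y q.1.+1) a1 x + c q))).
Definition weld1 (a1 : R * R -> R) (x : R * R) : R :=
  core_indic x * a1 x + \sum_q good q * (\1_(cell q) x * (phi x.1 * a1 x)).

(** The contribution of one tile to the pairing of the tiled field with a test
    function: the interface seen through phi u, plus the weld seen through u. *)
Definition tile_pairing (a0 a1 : R * R -> R) (c : 'I_n * bool -> R) (u : R * R -> R) : R :=
  row_pairing (fun x => \1_half_square x * jump m0 p0 x) (fun x => \1_half_square x * jump m1 p1 x)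
    (fun x => phi x.1 * u x) +
  row_pairing (weld0 a0 a1 c) (weld1 a1) u.

Lemma T_measurable : measurable T.
Proof. by apply: open2_measurable; exact: open_square_open. Qed.

Lemma half_square_measurable : measurable half_square.
Proof. exact: measurableX. Qed.

Lemma half_square_finite : (mu2 half_square < +oo)%E.
Proof.
apply: (@le_lt_trans _ _ (mu2 (box (- 2^-1) 2^-1 (- 2^-1) (2^-1 : R)))); last first.
  by rewrite box_measure ?ltry//; lra.
apply: le_measure; rewrite ?inE; [exact: half_square_measurable|exact: box_measurable|].
by move=> x [h /=]; rewrite in_itv /= => /andP[v1 /ltW v2]; split=> //=; rewrite in_itv /= v1 v2.
Qed.

Lemma T_sub_half : T `<=` half_square.
Proof.
move=> x [/=]; rewrite !in_itv /= => /andP[/ltW a1 /ltW a2] /andP[/ltW b1 b2].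
by split; rewrite /= in_itv /= ?a1 ?a2 ?b1 ?b2.
Qed.

Lemma T_finite : (mu2 T < +oo)%E.
Proof.
apply: le_lt_trans half_square_finite; apply: le_measure; rewrite ?inE.
- exact: T_measurable.
- exact: half_square_measurable.
- exact: T_sub_half.
Qed.

Lemma jump_measurable (m p : R) : measurable_fun setT (jump m p).
Proof.
apply: measurable_fun_ifT => //; apply: measurable_fun_ltr => //; exact: measurable_fst.
Qed.

Lemma jump_integ D (m p : R) : measurable D -> (mu2 D < +oo)%E -> integ (fun x => \1_D x * jump m p x).
Proof.
move=> mD Doo; rewrite (_ : (fun x => _) = (fun x => jump m p x * \1_D x)); last first.
  by apply/funext => x; rewrite mulrC.
apply: (@integ_bounded_on _ _ _ (`|m| + `|p|)) => //; first exact: jump_measurable.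
by move=> x; rewrite /jump; case: ifP => _; rewrite ?lerDl ?lerDr.
Qed.

Lemma deviation_integ A m p : integ (fun x => \1_T x * A x) -> integ (deviation A m p).
Proof.
move=> iA; have := integD iA (integZ (-1) (jump_integ m p T_measurable T_finite)).
by apply: eq_integrable => // x _; congr EFin; rewrite /deviation; ring.
Qed.

Lemma cell_measurable q : measurable (cell q).
Proof. exact: box_measurable. Qed.

Lemma cell_indic_measurable q : measurable_fun setT (\1_(cell q) : R * R -> R).
Proof. by apply: measurable_indic; exact: cell_measurable. Qed.

Lemma core_indic_measurable : measurable_fun setT core_indic.
Proof.
apply: measurable_indic; apply: measurableI; first exact: T_measurable.
apply: open2_measurable.
apply: (@open_comp _ _ (fun y : R * R => `|y.1|) [set s | s < t]); last exact: open_lt.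
have cn : continuous (fun s : R => `|s|) by move=> s; exact: norm_continuous.
by move=> x _; exact: (continuous_fst cn).
Qed.

Lemma indic_norm1 (D : set (R * R)) x : `|\1_D x| <= 1 :> R.
Proof. by rewrite ger0_norm// indicE; case: (_ \in _). Qed.

Lemma phi_measurable : measurable_fun setT (fun x : R * R => phi x.1).
Proof. apply: continuous2_measurable; apply: continuous_fst; exact: (C1n_cont (C1n_plateau 0 _ _ _)). Qed.

Lemma dphi_measurable : measurable_fun setT (fun x : R * R => dphi x.1).
Proof. apply: continuous2_measurable; exact: (continuous_fst (@continuous_D_plateau R (- t) t k)). Qed.

Lemma phi_norm1 s : `|phi s| <= 1.
Proof. by rewrite ger0_norm ?plateau_ge0// plateau_le1. Qed.

Lemma row_y_ltS j : row_y j < row_y j.+1.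
Proof. by rewrite row_y_lt. Qed.

Lemma cell_dphi_integ q : integ (fun x => \1_(cell q) x * dphi x.1).
Proof.
have [C C0 HC] := D_plateau_bounded R.
rewrite (_ : (fun x => _) = (fun x => dphi x.1 * \1_(cell q) x)); last first.
  by apply/funext => x; rewrite mulrC.
apply: (@integ_bounded_on _ _ _ (C / k)) => //.
- exact: cell_measurable.
- apply: (@le_lt_trans _ _ ((side_hi t k q.2 - side_lo t k q.2) * (row_y q.1.+1 - row_y q.1))%:E); last exact: ltry.
  rewrite le_eqVlt; apply/orP; left; apply/eqP; apply: box_measure; first exact/ltW/side_lt.
  exact/ltW/row_y_ltS.
- exact: dphi_measurable.
- by move=> x; exact: HC.
Qed.

Lemma weld1_integ a1 : integ a1 -> integ (weld1 a1).
Proof.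
move=> i1; apply: integD.
  by apply: (@integMbounded _ _ _ 1) => //; [exact: core_indic_measurable|move=> x; exact: indic_norm1].
apply: integ_sum => q; apply: integZ.
apply: (@integMbounded _ _ _ 1); [exact: cell_indic_measurable|move=> x; exact: indic_norm1|].
by apply: (@integMbounded _ _ _ 1) => //; [exact: phi_measurable|move=> x; exact: phi_norm1].
Qed.

Lemma weld0_integ a0 a1 c : integ a0 -> integ a1 -> integ (weld0 a0 a1 c).
Proof.
move=> i0 i1; have [C C0 HC] := D_plateau_bounded R; apply: integD.
  by apply: (@integMbounded _ _ _ 1) => //; [exact: core_indic_measurable|move=> x; exact: indic_norm1].
apply: integ_sum => q; apply: integZ.
rewrite (_ : (fun x => _) = fun x => \1_(cell q) x * (phi x.1 * a0 x) +
   (dphi x.1 * (\1_(cell q) x * strip_prim (row_y q.1) (row_y q.1.+1) a1 x) +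
    c q * (\1_(cell q) x * dphi x.1))); last by apply/funext => x; ring.
apply: integD.
  apply: (@integMbounded _ _ _ 1); [exact: cell_indic_measurable|move=> x; exact: indic_norm1|].
  by apply: (@integMbounded _ _ _ 1) => //; [exact: phi_measurable|move=> x; exact: phi_norm1].
apply: integD; last by apply: integZ; exact: cell_dphi_integ.
apply: (@integMbounded _ _ _ (C / k)); [exact: dphi_measurable|by move=> x; exact: HC|].
by apply: integ_strip_prim => //; exact/ltW/row_y_ltS.
Qed.

Definition side_sign (b : bool) : R := if b then - 1 else 1.

Lemma phi_side b : phi (side_hi t k b) - phi (side_lo t k b) = side_sign b.
Proof.
have E1 s : `|s| = t -> phi s = 1 by move=> h; rewrite cut_core ?h.
have E0 s : `|s| = t + k -> phi s = 0 by move=> h; rewrite cut_out ?h.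
have h : 0 < t + k by apply: addr_gt0.
rewrite /side_hi /side_lo /side_sign; case: b.
  by rewrite E0 ?E1 ?sub0r// gtr0_norm.
by rewrite E1 ?E0 ?subr0// normrN gtr0_norm.
Qed.

(** Changing the constants of the cells changes the pairing by the flux of
    phi' c e_1, which only sees the increment of u across each cell; phi goes
    from 1 to 0 on the right and from 0 to 1 on the left, whence the sign. *)
Lemma tile_pairing_circulation a0 a1 c u (d : 'I_n * bool -> R) : integ a0 -> integ a1 ->
  test_function setT u ->
  (forall q s, ~~ bad q -> side_lo t k q.2 <= s <= side_hi t k q.2 ->
     u (s, row_y q.1.+1) - u (s, row_y q.1) = d q) ->
  tile_pairing a0 a1 c u = tile_pairing a0 a1 (fun=> 0) u + \sum_q good q * c q * side_sign q.2 * d q.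
Proof.
move=> i0 i1 tu Hd; rewrite /tile_pairing -addrA; congr (_ + _).
have [su _ _] := tu; have [u0 u1 u2] := partial_continuous su.
have [M M0 HM] := test_bounded tu.
have [C C0 HC] := D_plateau_bounded R.
have iq q : integ (fun x => good q * c q * (\1_(cell q) x * dphi x.1 * partial2 u x)).
  apply: integZ; rewrite (_ : (fun x => _) = fun x => partial2 u x * (\1_(cell q) x * dphi x.1)); last first.
    by apply/funext => x; rewrite mulrC.
  apply: (@integMbounded _ _ _ M); [exact: continuous2_measurable|by move=> x; have [] := HM x|exact: cell_dphi_integ].
have ig := row_pairing_integ (weld0_integ (fun=> 0) i0 i1) (weld1_integ i1) tu.
transitivity (row_pairing (weld0 a0 a1 (fun=> 0)) (weld1 a1) u +
   I2 (fun x => \sum_q good q * c q * (\1_(cell q) x * dphi x.1 * partial2 u x))).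
  rewrite /row_pairing -I2D//; last exact: integ_sum.
  apply: I2_eq => x; rewrite /weld0.
  rewrite (_ : \sum_q good q * (\1_(cell q) x * (phi x.1 * a0 x + dphi x.1 * (strip_prim (row_y q.1) (row_y q.1.+1) a1 x + c q))) =
    \sum_q good q * (\1_(cell q) x * (phi x.1 * a0 x + dphi x.1 * (strip_prim (row_y q.1) (row_y q.1.+1) a1 x + 0))) +
    \sum_q good q * c q * (\1_(cell q) x * dphi x.1)); last first.
    by rewrite -big_split; apply: eq_bigr => q _ /=; ring.
  have -> : \sum_q good q * c q * (\1_(cell q) x * dphi x.1 * partial2 u x) =
      partial2 u x * \sum_q good q * c q * (\1_(cell q) x * dphi x.1).
    by rewrite mulr_sumr; apply: eq_bigr => q _; ring.
  by ring.
congr (_ + _); rewrite I2_sum//; apply: eq_bigr => q _.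
have [bq|gq] := boolP (bad q).
  rewrite /good bq /= !mul0r (_ : (fun x => _) = fun=> 0); last by apply/funext => x; rewrite !mul0r.
  by rewrite /I2 /Rintegral integral0.
rewrite I2Z; last first.
  rewrite (_ : (fun x => _) = fun x => partial2 u x * (\1_(cell q) x * dphi x.1)); last first.
    by apply/funext => x; rewrite mulrC.
  apply: (@integMbounded _ _ _ M); [exact: continuous2_measurable|by move=> x; have [] := HM x|exact: cell_dphi_integ].
have E : I2 (fun x => \1_(cell q) x * dphi x.1 * partial2 u x) =
    d q * (phi (side_hi t k q.2) - phi (side_lo t k q.2)).
  apply: (@box_circulation R (side_lo t k q.2) (side_hi t k q.2) (row_y q.1) (row_y q.1.+1) (d q) (C / k) u phi dphi setT) => //.
  - exact: side_lt.
  - exact: row_y_ltS.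
  - by move=> s; exact: is_derive_plateau.
  - exact: continuous_D_plateau.
  - by move=> s; exact: HC.
  - by move=> s h1 h2; apply: Hd => //; rewrite h1 h2.
by rewrite E phi_side; ring.
Qed.

Hypothesis S_T : S `<=` T.
Hypothesis S_bad : forall q x, S x -> cell q x -> bad q.
Hypothesis A_lattice : forall psi, test_function T psi -> int_near S psi ->
  in_lattice L (row_pairing (fun x => \1_T x * A0 x) (fun x => \1_T x * A1 x) psi).
Hypothesis iA0 : integ (fun x => \1_T x * A0 x).
Hypothesis iA1 : integ (fun x => \1_T x * A1 x).

Lemma T_open_near x : T x -> \forall y \near x, T y.
Proof. by move=> Tx; have := @open_square_open R 2^-1; rewrite openE => /(_ _ Tx). Qed.

Lemma near_norm1_lt (x : R * R) (s : R) : `|x.1| < s -> \forall y \near x, `|y.1| < s.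
Proof. by move=> h; exact: (cvg_fst (near_norm_lt h)). Qed.

Lemma near_norm1_gt (x : R * R) (s : R) : s < `|x.1| -> \forall y \near x, s < `|y.1|.
Proof. by move=> h; exact: (cvg_fst (near_norm_gt h)). Qed.

(** The heart of the gluing. If u vanishes near every slit, every bad cell and
    the horizontal edges of the tile, then 1_T phi u is a test function on the
    tile which is integral near S, and, by parts on each good cell, the glued
    field pairs with u as the original one does with 1_T phi u. *)
Lemma tile_pairing_lattice u : test_function setT u ->
  (forall j s, (j <= n)%N -> t <= `|s| <= t + k -> \forall y \near ((s, row_y j) : R * R), u y = 0) ->
  (forall s, `|s| <= t + k -> (\forall y \near ((s, - 2^-1) : R * R), u y = 0) /\
     (\forall y \near ((s, 2^-1) : R * R), u y = 0)) ->
  (forall q x, bad q -> cell q x -> \forall y \near (x : R * R), u y = 0) ->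
  (forall x : R * R, S x -> `|x.1| < t -> exists z : int, \forall y \near x, u y = z%:~R) ->
  in_lattice L (tile_pairing (deviation A0 m0 p0) (deviation A1 m1 p1) (fun=> 0) u).
Proof.
move=> tu uslit uedge ubad uS; have [su cu _] := tu.
set a0 := deviation A0 m0 p0; set a1 := deviation A1 m1 p1.
have i0 : integ a0 by exact: deviation_integ.
have i1 : integ a1 by exact: deviation_integ.
pose pu x := phi x.1 * u x; pose v x := \1_T x * pu x.
have spu : smooth pu by move=> m; apply: CnM; [exact/C1n_tensor1/C1n_plateau|exact: su].
have pu_out (x : R * R) : t + k < `|x.1| -> \forall y \near x, pu y = 0.
  by move=> h; apply: filterS (near_norm1_gt h) => y /ltW hy; rewrite /pu cut_out ?mul0r.
have pu_u0 (x : R * R) : (\forall y \near x, u y = 0) -> \forall y \near x, pu y = 0.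
  by apply: filterS => y uy; rewrite /pu uy mulr0.
have v_pu0 (x : R * R) : (\forall y \near x, pu y = 0) -> \forall y \near x, v y = 0.
  by apply: filterS => y uy; rewrite /v uy mulr0.
have pu_edge (x : R * R) : x.2 = - 2^-1 \/ x.2 = 2^-1 -> \forall y \near x, pu y = 0.
  case: (leP `|x.1| (t + k)) => [h e|h _]; last exact: pu_out.
  have [e1 e2] := uedge _ h; apply: pu_u0.
  by case: x h e e1 e2 => x1 x2 /= h [->|->].
have v_out x : ~ T x -> \forall y \near x, v y = 0.
  move=> nT; case: (ltP (t + k) `|x.1|) => h; first by apply: v_pu0; exact: pu_out.
  have [e|ne] := pselect (x.2 = - 2^-1 \/ x.2 = 2^-1); first by apply: v_pu0; exact: pu_edge.
  have h2 : 2^-1 < `|x.2|.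
    rewrite ltNge; apply/negP; rewrite ler_norml => /andP[b1 b2]; apply: nT.
    split; rewrite /= in_itv /=.
      by move: h; rewrite ler_norml => /andP[c1 c2]; have htk := tk; apply/andP; split; lra.
    have [n1 n2] : x.2 != - 2^-1 /\ x.2 != 2^-1.
      by split; apply/eqP => e; apply: ne; [left|right].
    by rewrite !lt_neqAle b1 b2 eq_sym n1 n2.
  have : \forall y \near x, 2^-1 < `|y.2| by exact: (cvg_snd (near_norm_gt h2)).
  apply: filterS => y hy; rewrite /v indicE memNset ?mul0r//= => -[_ /=].
  rewrite in_itv /= => /andP[c1 c2].
  have : `|y.2| < 2^-1 by rewrite ltr_norml c1 c2.
  by rewrite ltNge (ltW hy).
have v_in x : T x -> \forall y \near x, v y = pu y.
  by move=> /T_open_near; apply: filterS => y Ty; rewrite /v indicE mem_set// mul1r.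
have tv : test_function T v.
  have suppT : supp v `<=` T by move=> x sx; apply: contrapT => /v_out /near0_supp; exact.
  split=> //.
  - move=> m; apply: Cn_local => x; have [Tx|nTx] := pselect (T x).
      exists pu; first exact: spu.
      by apply: filterS (v_in x Tx) => y ->.
    exists (fun=> 0); first exact: Cn_cst.
    by apply: filterS (v_out x nTx) => y ->.
  - apply: (@subclosed_compact _ _ (supp u)) => //; first exact: closed_closure.
    by apply: supp_sub => x ux; rewrite /v /pu ux !mulr0.
have vS : int_near S v.
  move=> x Sx; have Tx := S_T Sx.
  case: (ltP `|x.1| t) => ht.
    have [z Hz] := uS x Sx ht; exists z.
    near=> y; rewrite (near (v_in x Tx) y)// /pu cut_core//; last first.
      by apply: ltW; near: y; exact: near_norm1_lt.
    by rewrite mul1r; near: y.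
  exists 0; apply: v_pu0; case: (ltP (t + k) `|x.1|) => htk; first exact: pu_out.
  have [q qx] : exists q, cell q x by apply: zone_cell_exists => //; rewrite ht htk.
  by apply: pu_u0; apply: (ubad q) => //; exact: S_bad qx.
suff -> : tile_pairing a0 a1 (fun=> 0) u = row_pairing (fun x => \1_T x * A0 x) (fun x => \1_T x * A1 x) v.
  exact: A_lattice.
rewrite /tile_pairing -/pu.
have [M M0 HM] := test_bounded tu.
have [C C0 HC] := D_plateau_bounded R.
have tpu : test_function setT pu by apply: test_mul => // m; exact/C1n_tensor1/C1n_plateau.
have iH := row_pairing_integ (jump_integ m0 p0 half_square_measurable half_square_finite)
   (jump_integ m1 p1 half_square_measurable half_square_finite) tpu.
have ig := row_pairing_integ (weld0_integ (fun=> 0) i0 i1) (weld1_integ i1) tu.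
(* what the primitives add, and which cancels by parts in each good cell *)
pose corr x := \sum_q good q * (\1_(cell q) x * dphi x.1 *
   (partial2 u x * strip_prim (row_y q.1) (row_y q.1.+1) a1 x + u x * a1 x)).
have icell q : integ (fun x => \1_(cell q) x * dphi x.1 *
   (partial2 u x * strip_prim (row_y q.1) (row_y q.1.+1) a1 x + u x * a1 x)).
  have [u0 u1 u2] := partial_continuous su.
  rewrite (_ : (fun x => _) = fun x => (dphi x.1 * partial2 u x) * (\1_(cell q) x * strip_prim (row_y q.1) (row_y q.1.+1) a1 x) +
     \1_(cell q) x * ((dphi x.1 * u x) * a1 x)); last by apply/funext => x; ring.
  have K x y : `|y| <= M -> `|dphi x * y| <= C / k * M.
    by move=> h; rewrite normrM; apply: ler_pM => //; exact: HC.
  apply: integD.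
    apply: (@integMbounded _ _ _ (C / k * M)).
    - by apply: measurable_funM; [exact: dphi_measurable|exact: continuous2_measurable].
    - by move=> x; apply: K; have [] := HM x.
    - by apply: integ_strip_prim => //; exact/ltW/row_y_ltS.
  apply: (@integMbounded _ _ _ 1); [exact: cell_indic_measurable|move=> x; exact: indic_norm1|].
  apply: (@integMbounded _ _ _ (C / k * M)) => //.
  - by apply: measurable_funM; [exact: dphi_measurable|exact: continuous2_measurable].
  - by move=> x; apply: K; have [] := HM x.
have icorr : integ corr by apply: integ_sum => q; exact/integZ/icell.
have corr0 : I2 corr = 0.
  rewrite /corr I2_sum; last by move=> q; exact/integZ/icell.
  rewrite big1 // => q _; rewrite I2Z//.
  have [bq|gq] := boolP (bad q); first by rewrite /good bq mul0r.
  have -> : I2 (fun x => \1_(cell q) x * dphi x.1 *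
     (partial2 u x * strip_prim (row_y q.1) (row_y q.1.+1) a1 x + u x * a1 x)) = 0; last by rewrite mulr0.
  apply: (@box_by_parts R (side_lo t k q.2) (side_hi t k q.2) (row_y q.1) (row_y q.1.+1) (C / k) a1 u dphi setT) => //.
  - exact: row_y_ltS.
  - exact: continuous_D_plateau.
  - by move=> s; exact: HC.
  - move=> s h1 h2; have hs : t <= `|s| <= t + k by apply: (@sideP _ _ _ t0 k0 q.2); rewrite h1 h2.
    exact: nbhs_singleton (uslit q.1.+1 s (ltn_ord q.1) hs).
rewrite -[LHS]subr0 -[X in _ - X]corr0.
rewrite /row_pairing -I2D//.
transitivity (I2 (fun x => (partial2 pu x * (\1_half_square x * jump m0 p0 x) - partial1 pu x * (\1_half_square x * jump m1 p1 x) +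
   (partial2 u x * weld0 a0 a1 (fun=> 0) x - partial1 u x * weld1 a1 x)) + (-1) * corr x)).
  have iD := integD iH ig; have iZ := integZ (-1) icorr.
  by rewrite (I2D iD iZ) (I2Z (-1) icorr) mulN1r.
apply: I2_eq => x.
have [pp1 pp2] := partial_cut (fun m => C1n_plateau m (- t) t k) su x.
rewrite -/pu in pp1 pp2.
have [pv1 pv2] : \1_T x * partial1 v x = \1_T x * partial1 pu x /\ \1_T x * partial2 v x = \1_T x * partial2 pu x.
  have [Tx|nTx] := pselect (T x); last by rewrite indicE memNset// !mul0r.
  by have [-> ->] := partial_near_eq (v_in x Tx).
transitivity (partial2 pu x * (\1_T x * A0 x) - partial1 pu x * (\1_T x * A1 x)); last first.
  have -> : partial2 pu x * (\1_T x * A0 x) = (\1_T x * partial2 pu x) * A0 x by ring.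
  have -> : partial1 pu x * (\1_T x * A1 x) = (\1_T x * partial1 pu x) * A1 x by ring.
  by rewrite -pv1 -pv2; ring.
have EH w : (w = partial1 pu x \/ w = partial2 pu x) -> w * \1_half_square x = w * \1_T x.
  move=> hw; have [Tx|nTx] := pselect (T x).
    by rewrite !indicE !mem_set//; exact: T_sub_half.
  have [hx|nhx] := pselect (half_square x); last first.
    by rewrite !indicE !memNset.
  suff /partial_near0[z1 z2] : \forall y \near x, pu y = 0 by case: hw => ->; rewrite ?z1 ?z2 !mul0r.
  case: (ltP (t + k) `|x.1|) => h; first exact: pu_out.
  apply: pu_edge; left; apply: contrapT => ne; apply: nTx.
  move: hx => [_ /=]; rewrite in_itv /= => /andP[b1 b2]; split; rewrite /= in_itv /=.
    by move: h; rewrite ler_norml => /andP[c1 c2]; have htk := tk; apply/andP; split; lra.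
  by rewrite b2 andbT lt_neqAle b1 andbT eq_sym; apply/eqP.
have -> : partial2 pu x * (\1_T x * A0 x) - partial1 pu x * (\1_T x * A1 x) =
  partial2 pu x * \1_T x * jump m0 p0 x - partial1 pu x * \1_T x * jump m1 p1 x +
  (partial2 pu x * a0 x - partial1 pu x * a1 x).
  by rewrite /a0 /a1 /deviation; ring.
have EH2 : partial2 pu x * (\1_half_square x * jump m0 p0 x) = partial2 pu x * \1_T x * jump m0 p0 x.
  by rewrite mulrA EH//; right.
have EH1 : partial1 pu x * (\1_half_square x * jump m1 p1 x) = partial1 pu x * \1_T x * jump m1 p1 x.
  by rewrite mulrA EH//; left.
rewrite EH1 EH2 -addrA; congr (_ + _); rewrite pp1 pp2 /weld0 /weld1 /corr.
pose F := phi x.1 * (partial2 u x * a0 x - partial1 u x * a1 x) - dphi x.1 * u x * a1 x.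
transitivity (core_indic x * (partial2 u x * a0 x - partial1 u x * a1 x) + \sum_q good q * \1_(cell q) x * F); last first.
  have [Tx|nTx] := pselect (T x); last first.
    have [z0 z1] : a0 x = 0 /\ a1 x = 0 by rewrite /a0 /a1 /deviation indicE memNset// !mul0r.
    rewrite /F z0 z1 !mulr0 subrr !mulr0 subrr add0r big1 ?subrr// => q _; by rewrite mulr0.
  have cE : core_indic x = (`|x.1| < t)%R%:R.
    rewrite /core_indic indicE; congr ((nat_of_bool _)%:R); apply/idP/idP; first by rewrite inE => -[].
    by move=> h; rewrite inE; split.
  case: (ltP `|x.1| t) cE => ht cE; rewrite cE /=.
    rewrite big1 => [|q _]; last first.
      rewrite [\1_(cell q) x]indicE memNset ?mulr0 ?mul0r// => /(cell_side t0 k0) /andP[].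
      by rewrite leNgt ht.
    by rewrite cut_core ?ltW// D_cut_core//; ring.
  rewrite mul0r add0r; case: (ltP (t + k) `|x.1|) => htk.
    rewrite cut_out ?ltW// D_cut_out// big1 => [|q _]; first by ring.
    by rewrite /F cut_out ?ltW// D_cut_out//; ring.
  have FE : F = phi x.1 * partial2 u x * a0 x - ('D_1 phi x.1 * u x + phi x.1 * partial1 u x) * a1 x.
    by rewrite /F; ring.
  rewrite -FE.
  have F0 : (\forall y \near x, u y = 0) -> F = 0.
    by move=> h; have [z1 z2] := partial_near0 h; rewrite /F z1 z2 (nbhs_singleton h); ring.
  have [[j [jn e]]|nj] := pselect (exists j, (j <= n)%N /\ x.2 = row_y j).
    rewrite F0 ?big1//; first by move=> q _; rewrite mulr0.
    have hh : t <= `|x.1| <= t + k by rewrite ht htk.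
    by have := uslit j x.1 jn hh; rewrite -e -surjective_pairing.
  have [q qx] : exists q, cell q x by apply: zone_cell_exists => //; rewrite ht htk.
  have [bq|gq] := boolP (bad q).
    by rewrite F0 ?big1//; [move=> q' _; rewrite mulr0|exact: ubad qx].
  rewrite (bigD1 q)//= big1 => [|q' qq']; last first.
    rewrite indicE memNset ?mulr0 ?mul0r// => q'x; move/eqP: qq'; apply.
    apply: (cell_unique n0 t0 k0 q'x qx) => j jn; apply/eqP => e; apply: nj; by exists j.
  by rewrite indicE mem_set// /good gq !mul1r addr0.
have S0 : \sum_q good q * (\1_(cell q) x * (phi x.1 * a0 x + dphi x.1 * (strip_prim (row_y q.1) (row_y q.1.+1) a1 x + 0))) * partial2 u x -
   \sum_q good q * (\1_(cell q) x * (phi x.1 * a1 x)) * partial1 u x -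
   \sum_q good q * (\1_(cell q) x * dphi x.1 * (partial2 u x * strip_prim (row_y q.1) (row_y q.1.+1) a1 x + u x * a1 x)) =
   \sum_q good q * \1_(cell q) x * F.
  rewrite -!sumrB; apply: eq_bigr => q _; rewrite /F; ring.
rewrite -S0 -!mulr_suml; ring.
Unshelve. all: by end_near.
Qed.

End TileLattice.

(** * Transport of tiles and the singular set of a tile *)

Section Similarity.
Variable R : realType.

Definition aff_inv (p : R * R) (rho : R) : R * R -> R * R := aff (- p.1 / rho, - p.2 / rho) rho^-1.

Lemma affK p rho : rho != 0 -> cancel (aff p rho) (aff_inv p rho).
Proof. by move=> r0 [x y]; rewrite /aff_inv /aff /=; congr pair; field. Qed.

Lemma aff_invK p rho : rho != 0 -> cancel (aff_inv p rho) (aff p rho).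
Proof. by move=> r0 [x y]; rewrite /aff_inv /aff /=; congr pair; field. Qed.

Lemma near_aff p rho (P : R * R -> Prop) (x : R * R) : 
  (\forall y \near aff p rho x, P y) -> \forall z \near x, P (aff p rho z).
Proof. by move=> H; have := @aff_continuous R p rho x; move=> /(_ _ H). Qed.

Lemma test_aff p rho (psi : R * R -> R) : rho != 0 -> test_function setT psi ->
  test_function setT (psi \o aff p rho).
Proof.
move=> r0 [spsi cpsi _]; split=> //; first by move=> n; apply: Cn_aff.
have cK : compact (aff_inv p rho @` supp psi).
  by apply: continuous_compact => //; apply: continuous_subspaceT => x; exact: aff_continuous.
apply: subclosed_compact cK _; first exact: closed_closure.
have cl : closed (aff p rho @^-1` supp psi).
  by apply: closed_comp; [move=> x _; exact: aff_continuous|exact: closed_closure].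
move=> x sx; exists (aff p rho x); last exact: affK.
rewrite /supp in sx; suff : (aff p rho @^-1` supp psi) x by [].
apply: cl; apply: closure_subset sx => y /= hy; exact: subset_closure.
Qed.

(** The gradient scales like 1 / rho and the area like rho^2. *)
Lemma row_pairing_aff p rho (f0 f1 psi : R * R -> R) : 0 < rho -> integ f0 -> integ f1 ->
  test_function setT psi ->
  [/\ integ (f0 \o aff_inv p rho), integ (f1 \o aff_inv p rho) &
  row_pairing (f0 \o aff_inv p rho) (f1 \o aff_inv p rho) psi = rho * row_pairing f0 f1 (psi \o aff p rho)].
Proof.
move=> r0 i0 i1 tpsi; have rn : rho != 0 by rewrite gt_eqF.
have ri : 0 < rho^-1 by rewrite invr_gt0.
have [j0 _] := integral_aff (- p.1 / rho, - p.2 / rho) ri i0.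
have [j1 _] := integral_aff (- p.1 / rho, - p.2 / rho) ri i1.
split=> //; have [spsi _ _] := tpsi; have [_ dpsi _ _] := spsi 1%N.
have iJ := row_pairing_integ j0 j1 tpsi.
have iK := row_pairing_integ i0 i1 (test_aff p rn tpsi).
rewrite /row_pairing (integral_aff p r0 iJ).2.
have [iJa _] := integral_aff p r0 iJ.
rewrite -(I2Z _ iJa) -(I2Z _ iK); apply: I2_eq => x.
have [_ _ -> ->] := partial_aff p rho dpsi x.
by rewrite /= -/(aff_inv p rho) affK//; ring.
Qed.

(** Otherwise the intermediate value theorem provides a half-integer value. *)
Lemma int_valued_const (f : R -> R) (a b : R) : a <= b -> continuous f ->
  (forall s, a <= s <= b -> exists z : int, f s = z%:~R) -> f a = f b.
Proof.
move=> ab cf Hz; apply/eqP; apply: contraT => ne.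
have [|za Ea] := Hz a; first by rewrite lexx.
have [|zb Eb] := Hz b; first by rewrite ab lexx.
pose v := Num.min (f a) (f b) + 2^-1.
have zne : za != zb by apply: contra ne => /eqP e; rewrite Ea Eb e.
have gap : `|f a - f b| >= 1.
  have : 1 <= `|za - zb|%:~R :> R by rewrite ler1z -gtz0_ge1 normr_gt0 subr_eq0.
  by rewrite Ea Eb -intrB intr_norm.
have vin : Num.min (f a) (f b) <= v <= Num.max (f a) (f b).
  rewrite /v; case: (leP (f a) (f b)) => h; move: gap;
    [rewrite ler0_norm ?subr_le0//|rewrite gtr0_norm ?subr_gt0//] => g; apply/andP; split; lra.
have [s] := IVT ab (continuous_subspaceT cf) vin.
rewrite in_itv /= => hs Es; have [z Ez] := Hz s hs.
have [w Ew] : exists w : int, Num.min (f a) (f b) = w%:~R.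
  by case: (leP (f a) (f b)) => _; [exists za|exists zb].
have : (2 * (z - w))%:~R = (1 : int)%:~R :> R.
  by rewrite intrM intrB -Ez Es /v Ew (_ : 2%:~R = 2 :> R)//; field.
by move=> /intr_inj; lia.
Qed.

Lemma int_near_continuous_const (S : set (R * R)) (u : R * R -> R) : continuous u -> int_near S u ->
  (forall x1 x2 y, x1 <= x2 -> (forall s, x1 <= s <= x2 -> S (s, y)) -> u (x1, y) = u (x2, y)) /\
  (forall x y1 y2, y1 <= y2 -> (forall s, y1 <= s <= y2 -> S (x, s)) -> u (x, y1) = u (x, y2)).
Proof.
move=> cu iu; split=> [x1 x2 y|x y1 y2] h HS.
  apply: (int_valued_const h (continuous_slice1 (y := y) cu)) => s /HS /iu[z hz].
  by exists z; exact: nbhs_singleton hz.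
apply: (int_valued_const h (continuous_slice2 (x1 := x) cu)) => s /HS /iu[z hz].
by exists z; exact: nbhs_singleton hz.
Qed.

Lemma int_near_zero (S : set (R * R)) (u : R * R -> R) (x : R * R) : int_near S u -> S x -> u x = 0 ->
  \forall y \near x, u y = 0.
Proof.
by move=> iu /iu[z hz] u0; have := nbhs_singleton hz; rewrite u0 => e; rewrite e.
Qed.

End Similarity.

Section TileSet.
Variables (R : realType) (n : nat) (t k : R).
Hypotheses (n0 : (0 < n)%N) (t0 : 0 < t) (k0 : 0 < k) (tk : t + k < 2^-1).
Variables (bad : pred ('I_n * bool)) (C0 : set (R * R)).

(** The singular set of a tile: the original one in the middle, the slits between
    consecutive cells, across which the primitives of weld0 do not match, the
    cells met by the original singular tube, and the horizontal edges by which
    the tile is stacked on its neighbours. *)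
Definition slit_set : set (R * R) := \bigcup_(q in [set: 'I_n.+1 * bool])
  box (side_lo t k q.2) (side_hi t k q.2) (row_y R n q.1) (row_y R n q.1).
Definition bad_set : set (R * R) := \bigcup_(q in [set q | bad q]) cell t k q.
Definition edge_set : set (R * R) :=
  box (- (t + k)) (t + k) (- 2^-1) (- 2^-1) `|` box (- (t + k)) (t + k) 2^-1 2^-1.
Definition inner_set : set (R * R) := C0 `&` box (- (t + k)) (t + k) (- 2^-1) 2^-1.
Definition tile_set : set (R * R) := inner_set `|` (slit_set `|` (bad_set `|` edge_set)).

Lemma tile_set_closed : closed C0 -> closed tile_set.
Proof.
move=> cC; apply: closedU; first by apply: closedI => //; exact: box_closed.
apply: closedU; first by apply: closed_bigcup => [|q _]; [exact: finite_finset|exact: box_closed].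
apply: closedU; first by apply: closed_bigcup => [|q _]; [exact: finite_finset|exact: box_closed].
by apply: closedU; exact: box_closed.
Qed.

Lemma slit_in (j : nat) s : (j <= n)%N -> t <= `|s| <= t + k -> tile_set (s, row_y R n j).
Proof.
move=> jn /(side_of) hs; right; left.
have jn' : (j < n.+1)%N by rewrite ltnS.
by exists (Ordinal jn', 0 <= s) => //; split; rewrite /= in_itv /= ?lexx ?hs.
Qed.

(** With zero increments along the cells, the value of u propagates from the
    bottom edge to all slits, bad cells and the top edge. *)
Lemma tile_vanish u : continuous u -> int_near tile_set u ->
  (forall s, `|s| <= t + k -> u (s, - 2^-1) = 0) ->
  (forall q : 'I_n * bool, u (side_lo t k q.2, row_y R n q.1.+1) = u (side_lo t k q.2, row_y R n q.1)) ->
  [/\ forall j s, (j <= n)%N -> t <= `|s| <= t + k -> u (s, row_y R n j) = 0,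
      forall q x, bad q -> cell t k q x -> u x = 0 &
      forall s, `|s| <= t + k -> u (s, 2^-1) = 0].
Proof.
move=> cu iu bot Dq; have [hor ver] := int_near_continuous_const cu iu.
have lo_norm b : `|side_lo t k b| <= t + k.
  have := @sideP R t k t0 k0 b (side_lo t k b); rewrite lexx ltW ?side_lt//.
  by move=> /(_ erefl) /andP[].
have H1 j b : (j <= n)%N -> u (side_lo t k b, row_y R n j) = 0.
  elim: j => [|j IH] jn; first by rewrite row_y0 bot.
  by have := Dq (Ordinal jn, b) => /= ->; exact/IH/ltnW.
have H2 j s : (j <= n)%N -> t <= `|s| <= t + k -> u (s, row_y R n j) = 0.
  move=> jn hs; have /andP[h1 h2] := side_of hs; rewrite -(H1 j (0 <= s) jn); symmetry.
  apply: hor => // s' /andP[s1 s2]; apply: slit_in => //.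
  by apply: (@sideP R t k t0 k0 (0 <= s)); rewrite s1 (le_trans s2 h2).
split=> //.
- move=> [j b] x bq qx; have [h1 h2] := qx; move: h1 h2 => /= ; rewrite !in_itv /= => h1 /andP[h2 h3].
  have := H2 j x.1 (ltnW (ltn_ord j)) (sideP t0 k0 h1) => <-; rewrite [x in LHS]surjective_pairing; symmetry.
  apply: ver => // s /andP[s1 s2]; right; right; left; exists (j, b) => //.
  by split; rewrite /= in_itv /= ?h1// s1 (le_trans s2 h3).
- move=> s hs; have E : u (- (t + k), 2^-1) = 0.
    by rewrite -(row_yn R n0); apply: H2 => //; rewrite normrN ger0_norm ?lexx ?lerDl ?ltW ?addr_gt0.
  rewrite -E; symmetry; move: hs; rewrite ler_norml => /andP[h1 h2].
  apply: hor => // s' /andP[s1 s2]; right; right; right; right.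
  by split; rewrite /= in_itv /= ?lexx// s1 (le_trans s2 h2).
Qed.

End TileSet.

(** * Stacking the tiles and choosing the circulations *)

Section RowAssembly.
Variables (R : realType) (n N : nat) (t k rho L : R).
Hypotheses (n0 : (0 < n)%N) (t0 : 0 < t) (k0 : 0 < k) (tk : t + k < 2^-1).
Hypotheses (rho0 : 0 < rho) (Nrho : rho * N%:R <= 1) (L0 : 0 < L).
Variables (bad : pred ('I_n * bool)) (C0 : set (R * R)) (A0 A1 : R * R -> R) (m0 p0 m1 p1 : R).
Local Notation T := (open_square (2^-1 : R)).
Local Notation phi := (plateau (- t) t k).
Hypothesis S_bad : forall q x, T x -> C0 x -> cell t k q x -> bad q.
Hypothesis A_lattice : forall psi, test_function T psi -> int_near (T `&` C0) psi ->
  in_lattice L (row_pairing (fun x => \1_T x * A0 x) (fun x => \1_T x * A1 x) psi).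
Hypothesis iA0 : integ (fun x => \1_T x * A0 x).
Hypothesis iA1 : integ (fun x => \1_T x * A1 x).

(** Copy number i of the tile, reduced by the factor rho and centred on the axis,
    occupies - 1/2 + rho i <= x_2 <= - 1/2 + rho (i + 1). The remainder of the
    axis above the last copy is covered by top_set. *)
Definition tile_origin (i : nat) : R * R := (0, - 2^-1 + rho * (i%:R + 2^-1)).
Definition tile_map (i : nat) : R * R -> R * R := aff (tile_origin i) rho.
Definition tile_inv (i : nat) : R * R -> R * R := aff_inv (tile_origin i) rho.
Definition top_set : set (R * R) := box (- (rho * (t + k))) (rho * (t + k)) (- 2^-1 + rho * N%:R) 2^-1.
Definition tiled_set : set (R * R) :=
  (\bigcup_(i in [set: 'I_N]) tile_inv i @^-1` tile_set t k bad C0) `|` top_set.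

Definition tiled0 (c : 'I_N -> 'I_n * bool -> R) (x : R * R) : R := jump m0 p0 x +
  \sum_(i < N) weld0 t k bad (deviation A0 m0 p0) (deviation A1 m1 p1) (c i) (tile_inv i x).
Definition tiled1 (x : R * R) : R := jump m1 p1 x +
  \sum_(i < N) weld1 t k bad (deviation A1 m1 p1) (tile_inv i x).

Let rhon : rho != 0. Proof. by rewrite gt_eqF. Qed.
Let ia0 : integ (deviation A0 m0 p0). Proof. exact: deviation_integ. Qed.
Let ia1 : integ (deviation A1 m1 p1). Proof. exact: deviation_integ. Qed.

Lemma tile_mapK i : cancel (tile_map i) (tile_inv i). Proof. exact: affK. Qed.
Lemma tile_invK i : cancel (tile_inv i) (tile_map i). Proof. exact: aff_invK. Qed.

Lemma tile_mapE i (x : R * R) : tile_map i x = (rho * x.1, - 2^-1 + rho * i%:R + rho * (x.2 + 2^-1)).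
Proof. by rewrite /tile_map /aff /=; congr pair; ring. Qed.

Lemma tile_invE i (x : R * R) : tile_inv i x = (x.1 / rho, (x.2 + 2^-1) / rho - i%:R - 2^-1).
Proof. by rewrite /tile_inv /aff_inv /aff /=; congr pair; field. Qed.

Lemma tiled_set_closed : closed C0 -> closed tiled_set.
Proof.
move=> cC; apply: closedU; last exact: box_closed.
apply: closed_bigcup => [|i _]; first exact: finite_finset.
apply: closed_comp; last exact: tile_set_closed.
by move=> x _; exact: aff_continuous.
Qed.

(** Integrality near the whole singular set, including the part of its closure
    outside the square where test functions vanish anyway. *)
Definition row_test (psi : R * R -> R) := test_function T psi /\ int_near tiled_set psi.

Lemma row_testP psi : test_function T psi -> int_near (T `&` tiled_set) psi -> row_test psi.
Proof.
move=> tpsi ipsi; split=> // x Sx; have [Tx|nTx] := pselect (T x); first by apply: ipsi.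
by exists 0; apply: supp_near0 => /(let: And3 _ _ h := tpsi in h).
Qed.

Lemma test_setT psi : test_function T psi -> test_function setT psi.
Proof. by move=> [s c _]; split. Qed.

(** An integer-valued function is constant along the vertical segments of
    top_set, which reach the edge of the square, where psi is 0. *)
Lemma top_vanish psi : row_test psi -> forall x, top_set x -> \forall y \near x, psi y = 0.
Proof.
move=> [tpsi ipsi] x xt; apply: (int_near_zero ipsi); first by right.
have [spsi _ _] := tpsi; have [cpsi _ _] := partial_continuous spsi.
have [_ ver] := int_near_continuous_const cpsi ipsi.
have [/= h1] := xt; rewrite in_itv /= => /andP[h2 h3].
rewrite [x]surjective_pairing (ver _ x.2 2^-1)//.
  by apply: (test_out tpsi) => -[_ /=]; rewrite in_itv /= ltxx andbF.
move=> s /andP[s1 s2]; right; split=> //=; rewrite in_itv /= s2 andbT; exact: le_trans h2 s1.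
Qed.

Lemma row_test_tile psi i : (i < N)%N -> row_test psi ->
  test_function setT (psi \o tile_map i) /\ int_near (tile_set t k bad C0) (psi \o tile_map i).
Proof.
move=> iN [tpsi ipsi]; split; first by apply: test_aff => //; exact: test_setT.
move=> x Sx; have [|z Hz] := ipsi (tile_map i x).
  by left; exists (Ordinal iN) => //=; rewrite tile_mapK.
by exists z; exact: (near_aff Hz).
Qed.

(** Replacing psi by phi(x_1 / rho) psi does not change its pairing with the
    interface, because the difference vanishes on the axis; the truncated
    function then only sees the tiles. *)
Lemma row_decomposition c psi : row_test psi ->
  row_pairing (fun x => \1_T x * tiled0 c x) (fun x => \1_T x * tiled1 x) psi =
  rho * \sum_(i < N) tile_pairing t k bad m0 p0 m1 p1
     (deviation A0 m0 p0) (deviation A1 m1 p1) (c i) (psi \o tile_map i).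
Proof.
move=> rt; have [tpsi ipsi] := rt; have tpsi' := test_setT tpsi.
have [spsi _ suppT] := tpsi; have [_ dpsi _ _] := spsi 1%N.
pose chi x := phi (x.1 / rho) * psi x.
pose phir (s : R) := phi (rho^-1 * s + 0).
have sphir m : C1n m phir by apply: C1n_affine; exact: C1n_plateau.
have tchi : test_function T (fun x => phir x.1 * psi x) by apply: test_mul => // m; exact: C1n_tensor1.
have chiE : chi = fun x => phir x.1 * psi x by apply/funext => x; rewrite /chi /phir addr0 mulrC [_ / rho]mulrC mulrC.
rewrite -chiE in tchi.
have mT := @T_measurable R; have Tf := @T_finite R.
have iJ0 := jump_integ m0 p0 mT Tf; have iJ1 := jump_integ m1 p1 mT Tf.
have out (x : R * R) : ~ T x -> partial1 psi x = 0 /\ partial2 psi x = 0.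
  by move=> nT; apply: partial_supp => /suppT.
pose H0 (x : R * R) := \1_(@half_square R) x * jump m0 p0 x.
pose H1 (x : R * R) := \1_(@half_square R) x * jump m1 p1 x.
have iH0 : integ H0 by apply: jump_integ; [exact: half_square_measurable|exact: half_square_finite].
have iH1 : integ H1 by apply: jump_integ; [exact: half_square_measurable|exact: half_square_finite].
have tchi' := test_setT tchi.
have comp i : chi \o tile_map i = fun x => phi x.1 * (psi \o tile_map i) x.
  apply/funext => x; have e : (tile_map i x).1 / rho = x.1 by rewrite tile_mapE /= [rho * _]mulrC mulfK.
  by rewrite /= /chi e.
(* 1 - phi vanishes on the axis, and the tiles partition what phi sees *)
have E1 : row_pairing (fun x => \1_T x * jump m0 p0 x) (fun x => \1_T x * jump m1 p1 x) psi =
    rho * \sum_(i < N) row_pairing H0 H1 (fun x => phi x.1 * (psi \o tile_map i) x).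
  transitivity (row_pairing (fun x => \1_T x * jump m0 p0 x) (fun x => \1_T x * jump m1 p1 x) chi).
    apply/eqP; rewrite -subr_eq0 -mulN1r -(row_pairing_linear (-1) iJ0 iJ1 tpsi tchi).
    apply/eqP; rewrite (_ : (fun x => psi x + (-1) * chi x) = (fun x => (1 + (-1) * phir x.1) * psi x)); last first.
      by apply/funext => x; rewrite chiE; ring.
    apply: (@row_pairing_interface R 2^-1); rewrite ?invr_gt0//.
      apply: test_mul => // m; apply: CnD; first exact: Cn_cst.
      by apply: CnM; [exact: Cn_cst|exact: C1n_tensor1].
    by move=> y; rewrite /phir mulr0 addr0 cut_core ?normr0 ?ltW//; ring.
  rewrite mulr_sumr (eq_bigr (fun i : 'I_N => row_pairing (H0 \o tile_inv i) (H1 \o tile_inv i) chi)); last first.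
    move=> i _; rewrite -comp.
    by have [_ _ ->] := row_pairing_aff (tile_origin i) rho0 iH0 iH1 tchi'.
  have ii i := row_pairing_integ (let: And3 h _ _ := row_pairing_aff (tile_origin i) rho0 iH0 iH1 tchi' in h)
    (let: And3 _ h _ := row_pairing_aff (tile_origin i) rho0 iH0 iH1 tchi' in h) tchi'.
  rewrite /row_pairing -I2_sum; last by move=> i; exact: (ii i).
  apply: I2_eq => x; have [schi _ _] := tchi.
  have jE m p i : jump m p (tile_inv i x) = jump m p x.
    by rewrite /jump tile_invE /= pmulr_llt0 ?invr_gt0.
  transitivity ((partial2 chi x * jump m0 p0 x - partial1 chi x * jump m1 p1 x) * \1_T x); first by ring.
  transitivity ((partial2 chi x * jump m0 p0 x - partial1 chi x * jump m1 p1 x) * \sum_(i < N) \1_(@half_square R) (tile_inv i x)); last first.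
    rewrite mulr_sumr; apply: eq_bigr => i _; rewrite /H0 /H1 /= !jE; ring.
  have [/partial_near0[z1 z2]|nz] := pselect (\forall y \near x, chi y = 0).
    by rewrite z1 z2; ring.
  congr (_ * _).
  have Tx : T x.
    by apply: contrapT => nT; apply: nz; apply: supp_near0 => /(let: And3 _ _ h := tchi in h).
  have x1 : `|x.1 / rho| <= t + k.
    rewrite leNgt; apply/negP => h; apply: nz.
    have hh : rho * (t + k) < `|x.1|.
      by move: h; rewrite normrM normfV (gtr0_norm rho0) ltr_pdivlMr// mulrC.
    apply: filterS (near_norm1_gt hh) => y hy; rewrite /chi cut_out ?mul0r//.
    by rewrite normrM normfV (gtr0_norm rho0) ler_pdivlMr// mulrC ltW.
  have x2 : x.2 < - 2^-1 + rho * N%:R.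
    rewrite ltNge; apply/negP => h; apply: nz.
    have : \forall y \near x, psi y = 0.
      apply: top_vanish => //; split; rewrite /= in_itv /=.
        by rewrite -ler_norml; move: x1; rewrite normrM normfV (gtr0_norm rho0) ler_pdivrMr// mulrC.
      by rewrite h /=; move: Tx => [_ /=]; rewrite in_itv /= => /andP[_ /ltW].
    by apply: filterS => y hy; rewrite /chi hy mulr0.
  have x2' : - 2^-1 < x.2 by move: Tx => [_ /=]; rewrite in_itv /= => /andP[].
  have z0 : 0 <= (x.2 + 2^-1) / rho by rewrite divr_ge0 ?ltW//; lra.
  have /andP[j1 j2] := truncn_itv z0; set j := Num.trunc _ in j1 j2.
  have jN : (j < N)%N.
    rewrite -(ltr_nat R); apply: le_lt_trans j1 _; rewrite ltr_pdivrMr//; lra.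
  rewrite (bigD1 (Ordinal jN))//= big1 => [|i ij]; last first.
    rewrite indicE memNset// tile_invE => -[_ /=]; rewrite in_itv /= => /andP[h1 h2].
    move/eqP: ij; apply; apply/val_inj => /=.
    have a1 : (i < j.+1)%N by rewrite -(ltr_nat R); lra.
    have a2 : (j < i.+1)%N by rewrite -(ltr_nat R) -[X in _ < X]natr1; lra.
    by apply/eqP; rewrite eqn_leq -ltnS a1 -ltnS a2.
  rewrite addr0 !indicE !mem_set// tile_invE; split; rewrite /= in_itv /=.
    by rewrite -ler_norml (le_trans x1)// ltW.
  by move: j2; rewrite -(natr1 j) => j2'; apply/andP; split; lra.
have ig0 i : integ (weld0 t k bad (deviation A0 m0 p0) (deviation A1 m1 p1) (c i)) by apply: weld0_integ.
have ig1 : integ (weld1 t k bad (deviation A1 m1 p1)) by apply: weld1_integ.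
rewrite /tile_pairing big_split mulrDr /= -E1.
rewrite mulr_sumr (eq_bigr (fun i : 'I_N => row_pairing
   (weld0 t k bad (deviation A0 m0 p0) (deviation A1 m1 p1) (c i) \o tile_inv i)
   (weld1 t k bad (deviation A1 m1 p1) \o tile_inv i) psi)); last first.
  by move=> i _; have [_ _ ->] := row_pairing_aff (tile_origin i) rho0 (ig0 i) ig1 tpsi'.
have iJ := row_pairing_integ iJ0 iJ1 tpsi.
have iG i : integ (fun x => partial2 psi x * (weld0 t k bad (deviation A0 m0 p0) (deviation A1 m1 p1) (c i) \o tile_inv i) x -
     partial1 psi x * (weld1 t k bad (deviation A1 m1 p1) \o tile_inv i) x).
  by have [h1 h2 _] := row_pairing_aff (tile_origin i) rho0 (ig0 i) ig1 tpsi'; exact: row_pairing_integ tpsi.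
rewrite /row_pairing -(I2_sum _ iG) -(I2D iJ (integ_sum _ iG)).
apply: I2_eq => x; have [Tx|/out[-> ->]] := pselect (T x); last first.
  by rewrite !mul0r big1 ?subrr ?addr0// => i _; rewrite !mul0r subrr.
rewrite indicE mem_set// !mul1r /tiled0 /tiled1 /= sumrB -!mulr_sumr; ring.
Qed.

Let base psi := rho * \sum_(i < N) tile_pairing t k bad m0 p0 m1 p1
  (deviation A0 m0 p0) (deviation A1 m1 p1) (fun=> 0) (psi \o tile_map i).

(** The vertical increments of psi across the cells of all the tiles: the
    finitely many integral functionals that detect the choice of constants. *)
Definition increment (iq : 'I_N * ('I_n * bool)) (psi : R * R -> R) : R :=
  psi (tile_map iq.1 (side_lo t k iq.2.2, row_y R n iq.2.1.+1)) -
  psi (tile_map iq.1 (side_lo t k iq.2.2, row_y R n iq.2.1)).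

Lemma subr_addN1 (u v : R * R -> R) : u - v = (fun x => u x + (-1) * v x).
Proof. by apply/funext => x; rewrite mulN1r. Qed.

Lemma row_test_sub : subr_stable row_test.
Proof.
split.
  split; first exact: test0.
  by move=> x _; exists 0; apply: filterE.
move=> u v [tu iu] [tv iv]; rewrite subr_addN1; split; first exact: test_add.
move=> x Sx; have [z Hz] := iu x Sx; have [w Hw] := iv x Sx.
exists (z - w); apply: filterS2 Hz Hw => y -> ->; by rewrite intrB mulN1r.
Qed.

Lemma base_morph : subr_morph row_test base.
Proof.
move=> u v [tu _] [tv _]; rewrite /base -mulrBr -sumrB; congr (_ * _); apply: eq_bigr => i _.
have tU w : test_function T w -> test_function setT (w \o tile_map i).
  by move=> tw; apply: test_aff => //; exact: test_setT.
have tP w : test_function T w -> test_function setT (fun x => phi x.1 * (w \o tile_map i) x).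
  by move=> tw; apply: test_mul; [move=> m; exact/C1n_tensor1/C1n_plateau|exact: tU].
have iH m p : integ (fun x => \1_(@half_square R) x * jump m p x).
  by apply: jump_integ; [exact: half_square_measurable|exact: half_square_finite].
have ig0 : integ (weld0 t k bad (deviation A0 m0 p0) (deviation A1 m1 p1) (fun=> 0)) by apply: weld0_integ.
have ig1 : integ (weld1 t k bad (deviation A1 m1 p1)) by apply: weld1_integ.
rewrite /tile_pairing subr_addN1.
have -> : ((fun x => u x + (-1) * v x) \o tile_map i) =
  (fun x => (u \o tile_map i) x + (-1) * (v \o tile_map i) x) by [].
rewrite (row_pairing_linear (-1) ig0 ig1 (tU u tu) (tU v tv)).
have -> : (fun x => phi x.1 * ((u \o tile_map i) x + (-1) * (v \o tile_map i) x)) =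
  (fun x => phi x.1 * (u \o tile_map i) x + (-1) * (phi x.1 * (v \o tile_map i) x)).
  by apply/funext => x; ring.
rewrite (row_pairing_linear (-1) (iH _ _) (iH _ _) (tP u tu) (tP v tv)).
by rewrite !mulN1r opprD addrACA.
Qed.

Lemma tile_set_in_T (x : R * R) i : (i < N)%N -> tile_set t k bad C0 x -> tiled_set (tile_map i x).
Proof. by move=> iN Sx; left; exists (Ordinal iN) => //=; rewrite tile_mapK. Qed.

Lemma increment_int iq psi : row_test psi -> exists z : int, increment iq psi = z%:~R.
Proof.
move=> [tpsi ipsi]; case: iq => i [j b].
have H (j' : nat) : (j' <= n)%N -> exists z : int, psi (tile_map i (side_lo t k b, row_y R n j')) = z%:~R.
  move=> jn; have [|z Hz] := ipsi (tile_map i (side_lo t k b, row_y R n j')).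
    apply: tile_set_in_T => //; apply: slit_in => //.
    by apply: (@sideP R t k t0 k0 b); rewrite lexx ltW// side_lt.
  by exists z; exact: nbhs_singleton Hz.
have [z Ez] := H j.+1 (ltn_ord j); have [w Ew] := H j (ltnW (ltn_ord j)).
by exists (z - w); rewrite /increment /= Ez Ew intrB.
Qed.

(** Without increments, psi vanishes near every slit, bad cell and edge of
    every tile: start from the bottom of the square, where psi has no support,
    and climb tile after tile. *)
Lemma base_lattice psi : row_test psi -> (forall iq, increment iq psi = 0) -> in_lattice (rho * L) (base psi).
Proof.
move=> rt D0; have [tpsi ipsi] := rt; have [spsi _ _] := tpsi.
have [cpsi _ _] := partial_continuous spsi.
have cu i : continuous (psi \o tile_map i).
  by move=> x; apply: continuous_comp; [exact: aff_continuous|exact: cpsi].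
have V (i : nat) : (i < N)%N -> (forall s, `|s| <= t + k -> (psi \o tile_map i) (s, - 2^-1) = 0) ->
  [/\ forall j s, (j <= n)%N -> t <= `|s| <= t + k -> (psi \o tile_map i) (s, row_y R n j) = 0,
      forall q x, bad q -> cell t k q x -> (psi \o tile_map i) x = 0 &
      forall s, `|s| <= t + k -> (psi \o tile_map i) (s, 2^-1) = 0].
  move=> iN bot; have [_ iu] := row_test_tile iN rt.
  apply: (tile_vanish n0 t0 k0 (cu i) iu bot) => q.
  by have := D0 (Ordinal iN, q); rewrite /increment /= => /eqP; rewrite subr_eq0 => /eqP.
have bottom (i : nat) : (i <= N)%N -> forall s, `|s| <= t + k -> (psi \o tile_map i) (s, - 2^-1) = 0.
  elim: i => [|i IH] iN s hs.
    apply: (test_out tpsi); rewrite tile_mapE /= mulr0 addr0 addNr mulr0 addr0 => -[_ /=].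
    by rewrite in_itv /= ltxx.
  have [_ _ top] := V i iN (IH (ltnW iN)); rewrite -(top s hs) /=; congr psi.
  by rewrite !tile_mapE /=; congr pair; rewrite -natr1; field.
have Hz (i : 'I_N) : exists z : int, tile_pairing t k bad m0 p0 m1 p1
    (deviation A0 m0 p0) (deviation A1 m1 p1) (fun=> 0) (psi \o tile_map i) = L * z%:~R.
  have iN := ltn_ord i; have [tu iu] := row_test_tile iN rt.
  have [V1 V2 V3] := V i iN (bottom i (ltnW iN)).
  have edge s : `|s| <= t + k -> tile_set t k bad C0 (s, - 2^-1) /\ tile_set t k bad C0 (s, 2^-1).
    rewrite ler_norml => hs; split; right; right; right; [left|right]; split; by rewrite /= in_itv /= ?hs ?lexx.
  apply: (@tile_pairing_lattice R n t k L n0 t0 k0 tk bad (T `&` C0) A0 A1 m0 p0 m1 p1) => //.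
  - by move=> q x [Tx Cx]; exact: S_bad.
  - move=> j s jn hs; apply: (int_near_zero iu); last exact: V1.
    exact: slit_in.
  - move=> s hs; have [e1 e2] := edge s hs; split; apply: (int_near_zero iu) => //.
      exact: bottom (ltnW iN) s hs.
    exact: V3.
  - move=> q x bq qx; apply: (int_near_zero iu); last exact: V2 bq qx.
    by right; right; left; exists q.
  - move=> x [Tx Cx] hx; apply: iu; left; split=> //.
    move: Tx => [/= _]; rewrite in_itv /= => /andP[/ltW h1 /ltW h2].
    split; rewrite /= in_itv /= ?h1 ?h2//.
    by rewrite -ler_norml (le_trans (ltW hx))// lerDl ltW.
have [f Hf] := choice Hz.
rewrite /base; exists (\sum_i f i).
rewrite (eq_bigr (fun i => L * (f i)%:~R)); last by move=> i _; exact: Hf.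
rewrite -mulr_sumr (_ : (\sum_i f i)%:~R = \sum_i (f i)%:~R); first by ring.
by rewrite (raddf_sum (intmul (1 : R))).
Qed.

Lemma in_lattice_shift (l u v : R) : in_lattice l (u - v) -> in_lattice l v -> in_lattice l u.
Proof. by move=> h1 h2; rewrite -(subrK v u); exact: in_latticeD. Qed.

(** By base_lattice the pairing without constants is integral on the test
    functions with zero increments, so by hom_extension it is, modulo the
    lattice, a combination of the increments. Constants proportional to the
    coefficients cancel this combination, and only their class modulo L
    matters. *)
Lemma row_assembly : exists c : 'I_N -> 'I_n * bool -> R,
  (forall i q, 0 <= c i q < L) /\
  forall psi, test_function T psi -> int_near (T `&` tiled_set) psi ->
    in_lattice (rho * L) (row_pairing (fun x => \1_T x * tiled0 c x) (fun x => \1_T x * tiled1 x) psi).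
Proof.
have mD iq : subr_morph row_test (increment iq).
  move=> u v _ _; rewrite /increment.
  have E x : (u - v) x = u x - v x by [].
  by rewrite !E; ring.
have lat0 u : row_test u -> (forall iq, iq \in index_enum _ -> increment iq u = 0) -> in_lattice (rho * L) (base u).
  by move=> ru D0; apply: base_lattice => // iq; apply: D0; rewrite mem_index_enum.
have [d Hd] := hom_extension (index_enum_uniq _) row_test_sub mD base_morph increment_int lat0.
(* side_sign is its own inverse: rho * c0 * side_sign cancels d *)
pose c0 i (q : 'I_n * bool) : R := - side_sign R q.2 * d (i, q) / rho.
pose c i q := c0 i q - L * (Num.floor (c0 i q / L))%:~R.
exists c; split=> [i q|psi tpsi ipsi].
  have := floor_itv (c0 i q / L); rewrite /c => /andP[h1 h2]; apply/andP; split.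
    by rewrite subr_ge0 mulrC -ler_pdivlMr.
  by rewrite ltrBlDr -[X in _ < X + _]mulr1 -mulrDr mulrC -ltr_pdivrMr// addrC -intrD1.
have rt := row_testP tpsi ipsi.
rewrite row_decomposition//.
have circ i : tile_pairing t k bad m0 p0 m1 p1 (deviation A0 m0 p0) (deviation A1 m1 p1) (c i) (psi \o tile_map i) =
  tile_pairing t k bad m0 p0 m1 p1 (deviation A0 m0 p0) (deviation A1 m1 p1) (fun=> 0) (psi \o tile_map i) +
  \sum_q good R bad q * c i q * side_sign R q.2 * increment (i, q) psi.
  have [tu iu] := row_test_tile (ltn_ord i) rt; have [su _ _] := tu.
  have [cu _ _] := partial_continuous su.
  have [hor _] := int_near_continuous_const cu iu.
  apply: tile_pairing_circulation => // q s gq /andP[h1 h2].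
  have H (j' : nat) : (j' <= n)%N -> (psi \o tile_map i) (s, row_y R n j') = psi (tile_map i (side_lo t k q.2, row_y R n j')).
    move=> jn; symmetry; apply: hor => // s' /andP[s1 s2]; apply: slit_in => //.
    by apply: (@sideP R t k t0 k0 q.2); rewrite s1 (le_trans s2 h2).
  by rewrite /increment /= -!H// ltnW.
rewrite (eq_bigr _ (fun i _ => circ i)) big_split /= mulrDr -/(base psi).
apply: (in_lattice_shift _ (Hd psi rt)).
have aux (a b e : R) : a + b - (a - e) = b + e by ring.
rewrite aux.
have incE (i : 'I_N) q : exists z : int, rho * (good R bad q * c i q * side_sign R q.2 * increment (i, q) psi) +
    d (i, q) * increment (i, q) psi = rho * L * z%:~R.
  have [z Ez] := increment_int (i, q) rt.
  have [bq|gq] := boolP (bad q).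
    have -> : increment (i, q) psi = 0.
      have [tu iu] := row_test_tile (ltn_ord i) rt; have [su _ _] := tu.
      have [cu _ _] := partial_continuous su.
      have [_ ver] := int_near_continuous_const cu iu.
      apply/eqP; rewrite subr_eq0; apply/eqP; symmetry; apply: (ver (side_lo t k q.2) (row_y R n q.1)).
        by rewrite ltW// row_y_lt.
      move=> s hs; right; right; left; exists q => //; split; rewrite /= in_itv /= ?hs//.
      by rewrite lexx ltW// side_lt.
    by exists 0; rewrite !mulr0 addr0.
  have s2 : side_sign R q.2 * side_sign R q.2 = 1 by rewrite /side_sign; case: q.2; ring.
  have [s Hs] : exists s : int, side_sign R q.2 = s%:~R.
    by rewrite /side_sign; case: q.2; [exists (-1)|exists 1]; rewrite ?mulrN1z.
  exists (- (Num.floor (c0 i q / L)) * s * z).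
  rewrite Ez /good gq /c {1}/c0 !intrM mulrNz -Hs.
  transitivity ((1 - side_sign R q.2 * side_sign R q.2) * d (i, q) * z%:~R +
    rho * L * (- (Num.floor (c0 i q / L))%:~R * side_sign R q.2 * z%:~R)); first by rewrite /=; field.
  by rewrite s2; ring.
have incE' (iq : 'I_N * ('I_n * bool)) : exists z : int,
   rho * (good R bad iq.2 * c iq.1 iq.2 * side_sign R iq.2.2 * increment iq psi) +
    d iq * increment iq psi = rho * L * z%:~R.
  by case: iq => i q; exact: incE.
have [f Hf] := choice incE'.
have -> : rho * (\sum_(i < N) \sum_q good R bad q * c i q * side_sign R q.2 * increment (i, q) psi) +
   \sum_(iq <- index_enum _) d iq * increment iq psi = rho * L * (\sum_iq f iq)%:~R.
  rewrite pair_bigA /= mulr_sumr -big_split /= (raddf_sum (intmul (1 : R))) mulr_sumr.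
  by apply: eq_bigr => -[i q] _ /=; rewrite -Hf.
by exists (\sum_iq f iq).
Qed.

End RowAssembly.

(** * The tiled field is admissible *)

Section Tubes.
Variable R : realType.
Local Notation T := (open_square (2^-1 : R)).

Lemma enorm_coord (x : R * R) : `|x.1| <= enorm x /\ `|x.2| <= enorm x.
Proof.
by rewrite /enorm -!sqrtr_sqr; split; apply: ler_wsqrtr; rewrite ?lerDl ?lerDr sqr_ge0.
Qed.

Lemma enorm0 : enorm (0 : R * R) = 0.
Proof. by rewrite /enorm /= expr0n addr0 sqrtr0. Qed.

Lemma enormZ (x : R * R) (rho : R) : 0 < rho -> enorm (rho * x.1, rho * x.2) = rho * enorm x.
Proof.
move=> r0; rewrite /enorm /= !exprMn -mulrDr sqrtrM ?sqr_ge0// sqrtr_sqr gtr0_norm//.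
Qed.

Lemma tubeP (Omega : set (R * R)) (r : R) S x :
  tube Omega r S x <-> Omega x /\ exists2 s, S s & enorm (x - s) < r.
Proof.
split=> -[Ox].
  by move=> /ereal_inf_lt[_ [s Ss <-]]; rewrite lte_fin => h; split=> //; exists s.
move=> [s Ss h]; split=> //; apply: (@le_lt_trans _ _ (enorm (x - s))%:E); last by rewrite lte_fin.
by apply: ereal_inf_lbound; exists s.
Qed.

Lemma tube_self (Omega : set (R * R)) (r : R) S x : 0 < r -> Omega x -> S x -> tube Omega r S x.
Proof. by move=> r0 Ox Sx; apply/tubeP; split=> //; exists x => //; rewrite subrr enorm0. Qed.

Lemma enorm_continuous (s : R * R) : continuous (fun x : R * R => enorm (x - s)).
Proof.
have sq (c : R) : continuous (fun a : R => (a - c) ^+ 2).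
  rewrite (_ : (fun a => _) = (fun a : R => (a - c) * (a - c))); last by apply/funext => a; rewrite expr2.
  by move=> a; apply: cvgM; apply: cvgB; [exact: cvg_id|exact: cvg_cst|exact: cvg_id|exact: cvg_cst].
have c1 : continuous (fun x : R * R => (x.1 - s.1) ^+ 2) := continuous_fst (sq s.1).
have c2 : continuous (fun x : R * R => (x.2 - s.2) ^+ 2) := continuous_snd (sq s.2).
move=> x; apply: (@continuous_comp _ _ _ (fun x : R * R => (x.1 - s.1) ^+ 2 + (x.2 - s.2) ^+ 2) Num.sqrt).
  by apply: cvgD; [exact: c1|exact: c2].
exact: sqrt_continuous.
Qed.

Lemma tube_measurable (r : R) S : measurable (tube T r S).
Proof.
apply: open2_measurable.
rewrite (_ : tube T r S = T `&` \bigcup_(s in S) [set x | enorm (x - s) < r]); last first.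
  apply/seteqP; split=> x.
    by move=> /tubeP[Tx [s Ss h]]; split=> //; exists s.
  by move=> [Tx [s Ss h]]; apply/tubeP; split=> //; exists s.
apply: openI; first exact: open_square_open.
apply: bigcup_open => s _.
by apply: (@open_comp _ _ (fun x : R * R => enorm (x - s)) [set a | a < r]);
  [move=> x _; exact: enorm_continuous|exact: open_lt].
Qed.

(** Boxes enlarged by r contain the tubes of radius r around boxes. *)
Definition thick (r l u y0 y1 : R) : set (R * R) := box (l - r) (u + r) (y0 - r) (y1 + r).

Lemma thickP r l u y0 y1 s x : box l u y0 y1 s -> enorm (x - s) < r -> thick r l u y0 y1 x.
Proof.
move=> [/=]; rewrite !in_itv /= => /andP[a1 a2] /andP[b1 b2] h.
have [/= h1 h2] := enorm_coord (x - s).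
have := le_lt_trans h1 h; have := le_lt_trans h2 h; rewrite !ltr_norml => /andP[d1 d2] /andP[c1 c2].
by split; rewrite /= in_itv /=; apply/andP; split; lra.
Qed.

End Tubes.

Section TiledField.
Variables (R : realType) (n N : nat) (t k rho lam tau e : R).
Hypotheses (n0 : (0 < n)%N) (t0 : 0 < t) (k0 : 0 < k) (tk : t + k < 2^-1).
Hypotheses (rho0 : 0 < rho) (Nrho : rho * N%:R <= 1).
Hypotheses (lam0 : 0 < lam) (tau0 : 0 < tau) (e0 : 0 < e) (lek : lam * e <= k).
Variables (C0 : set (R * R)) (A : R * R -> 'M[R]_2) (Rm Rp : 'M[R]_2).
Hypotheses (cC0 : closed C0) (SRm : SO2 Rm) (SRp : SO2 Rp).
Local Notation T := (open_square (2^-1 : R)).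
Local Notation tube0 := (tube T (lam * e) (T `&` C0)).
Hypothesis admA : admissible tau e T A (T `&` C0).

Definition bad_cell (q : 'I_n * bool) : bool := `[< exists2 x, cell t k q x & tube0 x >].
Local Notation bad := bad_cell.
Local Notation tset := (tiled_set N t k rho bad C0).

Definition dev (r s : 'I_2) : R * R -> R := deviation (fun x => A x r s) (Rm r s) (Rp r s).

Definition tiled_field (c : 'I_2 -> 'I_N -> 'I_n * bool -> R) (x : R * R) : 'M[R]_2 :=
  \matrix_(r, s) if s == 0 then
    tiled0 t k rho bad (fun x => A x r 0) (fun x => A x r 1) (Rm r 0) (Rp r 0) (Rm r 1) (Rp r 1) (c r) x
  else tiled1 N t k rho bad (fun x => A x r 1) (Rm r 1) (Rp r 1) x.

Lemma dev_out r s z : ~ T z -> dev r s z = 0.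
Proof. by move=> nT; rewrite /dev /deviation indicE memNset// mul0r. Qed.

Lemma dev_in r s z : T z -> dev r s z = A z r s - jump (Rm r s) (Rp r s) z.
Proof. by move=> Tz; rewrite /dev /deviation indicE mem_set// mul1r. Qed.

Lemma S_bad_cell q x : T x -> C0 x -> cell t k q x -> bad q.
Proof.
by move=> Tx Cx qx; apply/asboolP; exists x => //; apply: tube_self => //; rewrite mulr_gt0.
Qed.

Lemma entry_integ r s : integ (fun x => \1_T x * A x r s).
Proof. by have [LA _ _ _] := admA; apply: (integ_entry r s) LA; exact: T_measurable. Qed.

Lemma dev_integ r s : integ (dev r s).
Proof. by apply: deviation_integ; exact: entry_integ. Qed.

Lemma weld0_tile_integ r i (c : 'I_n * bool -> R) : integ (weld0 t k bad (dev r 0) (dev r 1) c \o tile_inv rho i).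
Proof.
have := @weld0_integ R n t k n0 k0 bad _ _ c (dev_integ r 0) (dev_integ r 1) => h.
have ri : 0 < rho^-1 by rewrite invr_gt0.
by have [] := integral_aff (- (tile_origin rho i).1 / rho, - (tile_origin rho i).2 / rho) ri h.
Qed.

Lemma weld1_tile_integ r i : integ (weld1 t k bad (dev r 1) \o tile_inv rho i).
Proof.
have := @weld1_integ R n t k bad _ (dev_integ r 1) => h.
have ri : 0 < rho^-1 by rewrite invr_gt0.
by have [] := integral_aff (- (tile_origin rho i).1 / rho, - (tile_origin rho i).2 / rho) ri h.
Qed.

Lemma tiled_L1 c : L1_field T (tiled_field c).
Proof.
have mT := @T_measurable R; have Tf := @T_finite R.
have iT f : integ f -> integ (fun x => \1_T x * f x).
  have mi : measurable_fun setT (\1_T : R * R -> R) by apply: measurable_indic.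
  move=> hf; apply: (@integMbounded _ _ _ 1) => //.
  by move=> x; exact: indic_norm1.
apply: L1_field_entry => // r s; rewrite /entry /tiled_field.
under eq_fun => x do rewrite mxE.
case: (s == 0).
  under eq_fun => x do rewrite /tiled0 mulrDr.
  apply: integD; first exact: jump_integ.
  by apply: iT; apply: integ_sum => i; exact: weld0_tile_integ.
under eq_fun => x do rewrite /tiled1 mulrDr.
apply: integD; first exact: jump_integ.
by apply: iT; apply: integ_sum => i; exact: weld1_tile_integ.
Qed.

(** The rows are independent; each is row_assembly, the lattice being that of
    scale rho e. *)
Theorem tiled_admissible : exists c : 'I_2 -> 'I_N -> 'I_n * bool -> R,
  (forall r i q, 0 <= c r i q < tau * e) /\
  admissible tau (rho * e) T (tiled_field c) (T `&` tset).
Proof.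
have lat := lattice_of_admissible admA.
have Hrow r : exists c : 'I_N -> 'I_n * bool -> R,
  (forall i q, 0 <= c i q < tau * e) /\
  forall psi, test_function T psi -> int_near (T `&` tset) psi ->
    in_lattice (rho * (tau * e)) (row_pairing
      (fun x => \1_T x * tiled0 t k rho bad (fun x => A x r 0) (fun x => A x r 1) (Rm r 0) (Rp r 0) (Rm r 1) (Rp r 1) c x)
      (fun x => \1_T x * tiled1 N t k rho bad (fun x => A x r 1) (Rm r 1) (Rp r 1) x) psi).
  apply: row_assembly => //.
  - by rewrite mulr_gt0.
  - exact: S_bad_cell.
  - by move=> psi tpsi ipsi; exact: lat.
  - exact: entry_integ.
  - exact: entry_integ.
have [c Hc] := choice Hrow.
exists c; split; first by move=> r; have [] := Hc r.
apply: admissible_of_lattice => //.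
- by rewrite mulr_gt0.
- exact: open_square_open.
- exact: tiled_L1.
- exact: tiled_set_closed.
move=> r psi tpsi ipsi; have [_ H] := Hc r; have := H psi tpsi ipsi.
rewrite (_ : rho * (tau * e) = tau * (rho * e)); last by ring.
rewrite (_ : entry T (tiled_field c) r 0 = fun x => \1_T x * tiled0 t k rho bad (fun x => A x r 0) (fun x => A x r 1) (Rm r 0) (Rp r 0) (Rm r 1) (Rp r 1) (c r) x); last first.
  by apply/funext => x; rewrite /entry mxE.
by rewrite (_ : entry T (tiled_field c) r 1 = fun x => \1_T x * tiled1 N t k rho bad (fun x => A x r 1) (Rm r 1) (Rp r 1) x)//;
  apply/funext => x; rewrite /entry mxE.
Qed.

End TiledField.

(** * A pointwise majorant for the tiled energy density *)

Section Cover.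
Variables (R : realType) (n N : nat) (t k rho lam tau e Cp : R).
Hypotheses (n0 : (0 < n)%N) (t0 : 0 < t) (k0 : 0 < k) (tk : t + k < 2^-1).
Hypotheses (rho0 : 0 < rho) (Nrho : rho * N%:R <= 1).
Hypotheses (lam0 : 0 < lam) (tau0 : 0 < tau) (e0 : 0 < e) (lek : lam * e <= k).
Hypothesis tlk : t + lam * e < 2^-1.
Variables (C0 : set (R * R)) (A : R * R -> 'M[R]_2) (Rm Rp : 'M[R]_2).
Hypotheses (SRm : SO2 Rm) (SRp : SO2 Rp).
Hypothesis dphi_le : forall s : R, `|'D_1 (plateau (- t) t k) s| <= Cp / k.
Local Notation T := (open_square (2^-1 : R)).
Local Notation tube0 := (tube T (lam * e) (T `&` C0)).
Local Notation bad := (@bad_cell R n t k lam e C0).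
Local Notation tset := (tiled_set N t k rho bad C0).
Local Notation dev := (dev A Rm Rp).
Local Notation row_y := (row_y R n).
Local Notation cell := (@cell R n t k).
Local Notation tinv := (tile_inv rho).
Local Notation tmap := (tile_map rho).
Variable c : 'I_2 -> 'I_N -> 'I_n * bool -> R.
Hypothesis c_bound : forall r i q, 0 <= c r i q < tau * e.
Local Notation G := (tiled_field t k rho lam e C0 A Rm Rp c).
Local Notation tube1 := (tube T (lam * (rho * e)) (T `&` tset)).

Definition density (z : R * R) : R := \1_T z * (if `[< tube0 z >] then 1 else dist2_SO2 (A z)).
Definition devsq (z : R * R) : R := \sum_r \sum_s dev r s z ^+ 2.
Definition gap (r : 'I_2) (q : 'I_n * bool) : R * R -> R :=
  strip_prim (row_y q.1) (row_y q.1.+1) (dev r 1).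
(** Bound for the squared distance to the rotations in a good cell: the welded
    field minus the interface is phi a + phi' (g + c) e_1, with |phi'| <= Cp / k
    and 0 <= c < tau e. *)
Definition zone_bound (q : 'I_n * bool) (z : R * R) : R :=
  2 * devsq z + 4 * (Cp / k) ^+ 2 * \sum_r (gap r q z ^+ 2 + (tau * e) ^+ 2).
Definition slit_thick (q : 'I_n.+1 * bool) :=
  thick (lam * e) (side_lo t k q.2) (side_hi t k q.2) (row_y q.1) (row_y q.1).
Definition cell_thick (q : 'I_n * bool) :=
  thick (lam * e) (side_lo t k q.2) (side_hi t k q.2) (row_y q.1) (row_y q.1.+1).
Definition edge_thick (y : R) := thick (lam * e) (- (t + k)) (t + k) y y.
Definition top_thick := thick (lam * (rho * e)) (- (rho * (t + k))) (rho * (t + k)) (- 2^-1 + rho * N%:R) 2^-1.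
(** In the coordinates of a tile, the density of the original energy, plus
    the cost of the welds, plus the enlarged slits, bad cells and edges. *)
Definition majorant (z : R * R) : R := density z +
  (\sum_q good R bad q * (\1_(cell q) z * zone_bound q z) +
  (\sum_q \1_(slit_thick q) z + (\sum_q (bad q)%:R * \1_(cell_thick q) z +
   (\1_(edge_thick (- 2^-1)) z + \1_(edge_thick 2^-1) z)))).

Let le0 : 0 < lam * e. Proof. by rewrite mulr_gt0. Qed.
Let rhon : rho != 0. Proof. by rewrite gt_eqF. Qed.

Lemma density_ge0 z : 0 <= density z.
Proof. by rewrite /density mulr_ge0//; case: asboolP => // _; exact: dist2_SO2_ge0. Qed.

Lemma devsq_out z : ~ T z -> devsq z = 0.
Proof.
by move=> nT; rewrite /devsq big1// => r _; rewrite big1// => s _; rewrite dev_out// expr0n.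
Qed.

Lemma devsq_ge0 z : 0 <= devsq z.
Proof. by apply: sumr_ge0 => r _; apply: sumr_ge0 => s _; exact: sqr_ge0. Qed.

Lemma zone_bound_ge0 q z : 0 <= zone_bound q z.
Proof.
apply: addr_ge0; first by rewrite mulr_ge0 ?devsq_ge0.
apply: mulr_ge0; first by rewrite mulr_ge0// sqr_ge0.
by apply: sumr_ge0 => r _; rewrite addr_ge0 ?sqr_ge0.
Qed.

Lemma majorant_parts z : let Z := \sum_q good R bad q * (\1_(cell q) z * zone_bound q z) in
  let S1 := \sum_q \1_(slit_thick q) z : R in let S2 := \sum_q (bad q)%:R * \1_(cell_thick q) z : R in
  [/\ 0 <= Z, 0 <= S1, 0 <= S2, 0 <= \1_(edge_thick (- 2^-1)) z :> R & 0 <= \1_(edge_thick 2^-1) z :> R].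
Proof.
split=> //; apply: sumr_ge0 => q _ //; rewrite mulr_ge0//.
by rewrite mulr_ge0// zone_bound_ge0.
Qed.

Lemma majorant_ge0 z : 0 <= majorant z.
Proof. by have [h1 h2 h3 h4 h5] := majorant_parts z; rewrite /majorant !addr_ge0// density_ge0. Qed.

Lemma majorant_density z : density z <= majorant z.
Proof. by have [h1 h2 h3 h4 h5] := majorant_parts z; rewrite /majorant lerDl !addr_ge0. Qed.

Lemma majorant_cell q z : ~~ bad q -> cell q z -> zone_bound q z <= majorant z.
Proof.
move=> gq qz; have [h1 h2 h3 h4 h5] := majorant_parts z; have d0 := density_ge0 z.
apply: (@le_trans _ _ (\sum_q good R bad q * (\1_(cell q) z * zone_bound q z))); last first.
  rewrite /majorant; move: h1 h2 h3 h4 h5 d0.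
  move: (\sum_q _) (\sum_q _) (\sum_q _) (\1_ _ _) (\1_ _ _) (density z) => *; lra.
rewrite (bigD1 q)//= /good gq indicE mem_set// !mul1r lerDl.
by apply: sumr_ge0 => q' _; rewrite mulr_ge0// mulr_ge0// zone_bound_ge0.
Qed.

Lemma majorant_slit (q : 'I_n.+1 * bool) z : slit_thick q z -> 1 <= majorant z.
Proof.
move=> qz; have [h1 h2 h3 h4 h5] := majorant_parts z; have d0 := density_ge0 z.
apply: (@le_trans _ _ (\sum_q \1_(slit_thick q) z)); last first.
  rewrite /majorant; move: h1 h2 h3 h4 h5 d0.
  move: (\sum_q _) (\sum_q _) (\sum_q _) (\1_ _ _) (\1_ _ _) (density z) => *; lra.
by rewrite (bigD1 q)//= indicE mem_set// lerDl; apply: sumr_ge0.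
Qed.

Lemma majorant_bad q z : bad q -> cell_thick q z -> 1 <= majorant z.
Proof.
move=> bq qz; have [h1 h2 h3 h4 h5] := majorant_parts z; have d0 := density_ge0 z.
apply: (@le_trans _ _ (\sum_q (bad q)%:R * \1_(cell_thick q) z)); last first.
  rewrite /majorant; move: h1 h2 h3 h4 h5 d0.
  move: (\sum_q _) (\sum_q _) (\sum_q _) (\1_ _ _) (\1_ _ _) (density z) => *; lra.
rewrite (bigD1 q)//= bq indicE mem_set// mulr1 lerDl; apply: sumr_ge0 => q' _; exact: mulr_ge0.
Qed.

Lemma majorant_edge z y : y = - 2^-1 \/ y = 2^-1 -> edge_thick y z -> 1 <= majorant z.
Proof.
move=> hy ez; have [h1 h2 h3 h4 h5] := majorant_parts z; have d0 := density_ge0 z.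
rewrite /majorant; case: hy => hy; rewrite hy in ez.
  move: h1 h2 h3 h5 d0; rewrite [\1_(edge_thick (- _)) z]indicE mem_set//=.
  move: (\sum_q _) (\sum_q _) (\sum_q _) (\1_ _ _) (density z) => *; lra.
move: h1 h2 h3 h4 d0; rewrite [\1_(edge_thick 2^-1) z]indicE mem_set//=.
move: (\sum_q _) (\sum_q _) (\sum_q _) (\1_ _ _) (density z) => *; lra.
Qed.

Lemma majorant_term x (i : 'I_N) : majorant (tinv i x) <= \sum_(i < N) majorant (tinv i x).
Proof. by rewrite (bigD1 i)//= lerDl; apply: sumr_ge0 => j _; exact: majorant_ge0. Qed.

Lemma tinv_dist i x s : enorm (tinv i x - tinv i s) = enorm (x - s) / rho.
Proof.
rewrite !tile_invE//; have r1 : 0 < rho^-1 by rewrite invr_gt0.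
have -> : enorm (x - s) / rho = rho^-1 * enorm (x - s) by rewrite mulrC.
rewrite -(enormZ (x - s) r1); congr enorm; congr pair => /=; ring.
Qed.

Lemma tinv_T (i : 'I_N) z : T z -> T (tmap i z).
Proof.
move=> [/=]; rewrite !in_itv /= tile_mapE => /andP[a1 a2] /andP[b1 b2].
have r1 : rho <= 1 by apply: le_trans Nrho; rewrite -[leLHS]mulr1 ler_pM2l// ler1n (leq_ltn_trans _ (ltn_ord i)).
have iN : rho * i%:R + rho <= 1.
  apply: le_trans Nrho; rewrite -[X in _ + X]mulr1 -mulrDr ler_pM2l// natr1 ler_nat; exact: ltn_ord.
have i0 : 0 <= rho * i%:R by rewrite mulr_ge0// ltW.
split; rewrite /= in_itv /=; apply/andP; split.
- have : rho * - 2^-1 < rho * z.1 by rewrite ltr_pM2l. lra.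
- have : rho * z.1 < rho * 2^-1 by rewrite ltr_pM2l. lra.
- have : 0 < rho * (z.2 + 2^-1) by rewrite mulr_gt0//; lra. lra.
- have : rho * (z.2 + 2^-1) < rho * 1 by rewrite ltr_pM2l//; lra. lra.
Qed.

(** A point of the tube is close to a singular point of some tile: either one of
    the original set, which is accounted for by the original tube, or one of the
    sets added to it, whose enlargements appear in the majorant. *)
Lemma tube_cover x : tube1 x -> 1 <= \sum_(i < N) majorant (tinv i x) + \1_top_thick x.
Proof.
have S0 : 0 <= \sum_(i < N) majorant (tinv i x) by apply: sumr_ge0 => i _; exact: majorant_ge0.
move=> /tubeP[Tx [s [Ts [[i _ /= Si]|ts]] h]]; last first.
  have tx : top_thick x by apply: thickP ts h.
  by rewrite [\1__ x]indicE mem_set// lerDr.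
apply: (@le_trans _ _ (majorant (tinv i x))); last first.
  by rewrite (le_trans (majorant_term x i))// lerDl.
set z := tinv i x; set w := tinv i s in Si.
have hz : enorm (z - w) < lam * e.
  by rewrite tinv_dist ltr_pdivrMr// -mulrA [e * _]mulrC.
move: z w Si hz => z w Si hz.
case: Si => [[Cw ww]|[[q _ qw]|[[q bq qw]|ew]]].
- have [w1 w2] := ww; move: w1 w2 => /=; rewrite !in_itv /= => w1 /andP[w2 w3].
  have [Tw|nTw] := pselect (T w); last first.
    have [e1|e1] : w.2 = - 2^-1 \/ w.2 = 2^-1.
      have [?|ne1] := eqVneq w.2 (- 2^-1); first by left.
      have [?|ne2] := eqVneq w.2 2^-1; first by right.
      exfalso; apply: nTw; split; rewrite /= in_itv /=; last by rewrite !lt_neqAle w2 w3 ne2 eq_sym ne1.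
      by move: w1 => /andP[c1 c2]; have := tk => h3; apply/andP; split; lra.
    + apply: (majorant_edge (y := - 2^-1)); first by left.
      by apply: thickP hz; split; rewrite /= in_itv /= ?w1// e1 lexx.
    + apply: (majorant_edge (y := 2^-1)); first by right.
      by apply: thickP hz; split; rewrite /= in_itv /= ?w1// e1 lexx.
  have w1' : `|w.1| <= t + k by rewrite ler_norml.
  have [wt|wt] := leP t `|w.1|.
    have [q qw] : exists q, cell q w by apply: zone_cell_exists => //; rewrite wt w1'.
    apply: (majorant_bad (q := q)); first exact: S_bad_cell Tw Cw qw.
    exact: thickP qw hz.
  have [/= d1 d2] := enorm_coord (z - w).
  have z1 : `|z.1| < t + lam * e.
    have d1' : `|z.1 - w.1| < lam * e by exact: le_lt_trans d1 hz.
    have := ler_normD (z.1 - w.1) w.1; rewrite subrK; lra.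
  have [Tz|nTz] := pselect (T z).
    have tz : tube0 z by apply/tubeP; split=> //; exists w.
    apply: le_trans (majorant_density z).
    by rewrite /density [\1__ z]indicE mem_set// asboolT// mul1r.
  have z2 : 2^-1 <= `|z.2|.
    rewrite leNgt; apply/negP => h2; apply: nTz; split; rewrite /= in_itv /= -ltr_norml//.
    by rewrite (lt_trans z1).
  have d2' : `|z.2 - w.2| < lam * e by exact: le_lt_trans d2 hz.
  have zx : - (t + k) - lam * e <= z.1 <= t + k + lam * e.
    by rewrite -[X in X <= _]opprD -ler_norml (le_trans (ltW z1))// lerD2r lerDl ltW.
  have [zs|zs] := leP 0 z.2.
    apply: (majorant_edge (y := 2^-1)); first by right.
    split; rewrite /= in_itv /= ?zx//.
    move: z2 d2'; rewrite (ger0_norm zs) ltr_norml => z2 /andP[h1 h2].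
    by have le0' := le0; apply/andP; split; lra.
  apply: (majorant_edge (y := - 2^-1)); first by left.
  split; rewrite /= in_itv /= ?zx//.
  move: z2 d2'; rewrite (ltr0_norm zs) ltr_norml => z2 /andP[h1 h2].
  by have le0' := le0; apply/andP; split; lra.
- by apply: (majorant_slit (q := q)); apply: thickP qw hz.
- by apply: (majorant_bad (q := q)) => //; apply: thickP qw hz.
- case: ew => ew; [apply: (majorant_edge (y := - 2^-1)); first by left|apply: (majorant_edge (y := 2^-1)); first by right].
    exact: thickP ew hz.
  exact: thickP ew hz.
Qed.

(** Where a tile modifies the interface. *)
Definition weld_support (z : R * R) := (T z /\ `|z.1| < t) \/ exists2 q, ~~ bad q & cell q z.

Lemma weld_out z a0 a1 d : ~ weld_support z -> weld0 t k bad a0 a1 d z = 0 /\ weld1 t k bad a1 z = 0.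
Proof.
move=> nz; have c0 : core_indic t z = 0.
  by rewrite /core_indic indicE memNset// => -[Tz hz]; apply: nz; left.
have g0 q : good R bad q * \1_(cell q) z = 0.
  rewrite /good; have [bq|gq] := boolP (bad q); first by rewrite mul0r.
  by rewrite indicE memNset ?mulr0// => qz; apply: nz; right; exists q.
rewrite /weld0 /weld1 c0 !mul0r !add0r !big1// => q _; by rewrite mulrA g0 mul0r.
Qed.

Lemma tset_tile (i : 'I_N) z : tile_set t k bad C0 z -> tset (tmap i z).
Proof. by move=> Sz; left; exists i => //=; rewrite tile_mapK. Qed.

Lemma tinv_row (i j : nat) (x : R * R) : (tinv i x).2 - (tinv j x).2 = j%:R - i%:R.
Proof. by rewrite !tile_invE//=; ring. Qed.

Lemma weld_support_row z : weld_support z -> - 2^-1 <= z.2 <= 2^-1 /\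
  (`|z.2| = 2^-1 -> tile_set t k bad C0 z).
Proof.
move=> [[[_ /=] + _]|[q gq qz]].
  rewrite in_itv /= => /andP[h1 h2]; split; first by rewrite !ltW.
  have : `|z.2| < 2^-1 by rewrite ltr_norml h1 h2.
  by move=> + e1; rewrite e1 ltxx.
have [h1 h2 h3] := cell_sub n0 t0 k0 qz; split; first by rewrite h2 h3.
have hq := cell_side t0 k0 qz.
case: (ger0P z.2) => _ e2; rewrite [z]surjective_pairing.
  by rewrite e2 -(row_yn R n0); apply: slit_in.
have -> : z.2 = - 2^-1 by rewrite -e2 opprK.
by rewrite -(row_y0 R n); apply: slit_in.
Qed.

(** Closed tiles overlap only along their horizontal edges, which are singular. *)
Lemma weld_support_unique x (i j : 'I_N) : T x -> ~ tube1 x ->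
  weld_support (tinv i x) -> weld_support (tinv j x) -> i = j.
Proof.
move=> Tx ntx Wi Wj; apply/val_inj/eqP; apply: contraT => ij.
have nt (l : 'I_N) : ~ tile_set t k bad C0 (tinv l x).
  move=> Sl; apply: ntx; apply: tube_self => //; first by rewrite !mulr_gt0.
  by split=> //; rewrite -(tile_invK rho0 l x); exact: tset_tile.
have [/andP[a1 a2] a3] := weld_support_row Wi; have [/andP[b1 b2] b3] := weld_support_row Wj.
have E := tinv_row i j x.
have st z : - 2^-1 <= z -> z <= 2^-1 -> `|z| != 2^-1 -> `|z| < 2^-1 :> R.
  by move=> h1 h2 h3; rewrite lt_neqAle h3 ler_norml h1 h2.
have ai : `|(tinv i x).2| < 2^-1 by apply: st => //; apply/eqP => /a3 /nt.
have bj : `|(tinv j x).2| < 2^-1 by apply: st => //; apply/eqP => /b3 /nt.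
move: ai bj; rewrite !ltr_norml => /andP[c1 c2] /andP[d1 d2].
move: ij; rewrite neq_ltn => /orP[h|h].
  have : i.+1%:R <= j%:R :> R by rewrite ler_nat.
  by rewrite -natr1; lra.
have : j.+1%:R <= i%:R :> R by rewrite ler_nat.
by rewrite -natr1; lra.
Qed.

Lemma jumpE r s (x : R * R) : jump (Rm r s) (Rp r s) x = interface Rm Rp x r s.
Proof. by rewrite /jump /interface; case: ifP. Qed.

Lemma interface_tinv i (x : R * R) : interface Rm Rp (tinv i x) = interface Rm Rp x.
Proof. by rewrite /interface tile_invE//= pmulr_llt0 ?invr_gt0. Qed.

Lemma interface_SO2 (x : R * R) : SO2 (interface Rm Rp x).
Proof. by rewrite /interface; case: ifP. Qed.

Lemma field_single x (i : 'I_N) : (forall j : 'I_N, j != i -> ~ weld_support (tinv j x)) ->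
  G x = \matrix_(r, s) (interface Rm Rp x r s + if s == 0 then weld0 t k bad (dev r 0) (dev r 1) (c r i) (tinv i x)
     else weld1 t k bad (dev r 1) (tinv i x)).
Proof.
move=> H; apply/matrixP => r s; rewrite !mxE.
have [->|s0] := eqVneq s 0.
  rewrite /tiled0 jumpE; congr (_ + _); rewrite (bigD1 i)//= big1 ?addr0// => j /H nW.
  exact: (weld_out _ _ _ nW).1.
have -> : s = 1 by move: s0; case: s => [[|[|m]] hm]// _; exact: val_inj.
rewrite /tiled1 jumpE; congr (_ + _); rewrite (bigD1 i)//= big1 ?addr0// => j /H nW.
exact: (weld_out (dev r 0) (dev r 1) (c r i) nW).2.
Qed.

Lemma devE r s z : T z -> dev r s z = A z r s - interface Rm Rp z r s.
Proof. by move=> Tz; rewrite dev_in// jumpE. Qed.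

Lemma ord2_sum (F : 'I_2 -> R) : \sum_i F i = F 0 + F 1.
Proof. by rewrite !big_ord_recl big_ord0 addr0 (_ : lift ord0 ord0 = 1)//; exact: val_inj. Qed.

(** Outside the tube a single tile contributes. In its core the field is the
    original one, in a good cell zone_bound applies, and elsewhere the field is
    the interface, at distance 0. *)
Lemma field_cover x : T x -> ~ tube1 x -> dist2_SO2 (G x) <= \sum_(i < N) majorant (tinv i x).
Proof.
move=> Tx ntx; have S0 : 0 <= \sum_(i < N) majorant (tinv i x) by apply: sumr_ge0 => i _; exact: majorant_ge0.
have [[i Wi]|nW] := pselect (exists i : 'I_N, weld_support (tinv i x)); last first.
  rewrite (_ : G x = interface Rm Rp x) ?dist2_SO2_0//; first exact: interface_SO2.
  apply/matrixP => r s; rewrite !mxE.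
  have nWi (i : 'I_N) : ~ weld_support (tinv i x) by move=> Wi; apply: nW; exists i.
  have [->|s0] := eqVneq s 0.
    by rewrite /tiled0 jumpE big1 ?addr0// => i _; exact: (weld_out _ _ _ (nWi i)).1.
  have -> : s = 1 by move: s0; case: s => [[|[|m]] hm]// _; exact: val_inj.
  by rewrite /tiled1 jumpE big1 ?addr0// => i _; exact: (weld_out (dev r 0) _ (fun=> 0) (nWi i)).2.
have uniq_i (j : 'I_N) : j != i -> ~ weld_support (tinv j x).
  by move=> ji Wj; move/eqP: ji; apply; exact: weld_support_unique Wj Wi.
rewrite (field_single uniq_i).
have nS : ~ tile_set t k bad C0 (tinv i x).
  move=> Sl; apply: ntx; apply: tube_self => //; first by rewrite !mulr_gt0.
  by split=> //; rewrite -(tile_invK rho0 i x); exact: tset_tile.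
apply: le_trans (majorant_term x i); rewrite -(interface_tinv i).
have xE := tile_invK rho0 i x; move: (tinv i x) xE Wi nS => z xE Wi nS.
have [ht|ht] := ltP `|z.1| t.
  have [Tz|[q gq qz]] := Wi; last first.
    by have := cell_side t0 k0 qz; rewrite leNgt ht.
  have {}Tz : T z by case: Wi => [[]//|[q gq qz]]; have := cell_side t0 k0 qz; rewrite leNgt ht.
  have c1 : core_indic t z = 1 by rewrite /core_indic indicE mem_set.
  have nc q : \1_(cell q) z = 0 :> R.
    by rewrite indicE memNset// => /(cell_side t0 k0) /andP[]; rewrite leNgt ht.
  rewrite (_ : \matrix_(r, s) _ = A z); last first.
    apply/matrixP => r s; rewrite mxE /weld0 /weld1 c1 !mul1r.
    rewrite big1 => [|q _]; last by rewrite nc mul0r mulr0.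
    rewrite big1 => [|q _]; last by rewrite nc mul0r mulr0.
    rewrite !addr0 !devE//; case: eqVneq => [->|s0]; first by rewrite addrC subrK.
    have -> : s = 1 by move: s0; case: s => [[|[|m]] hm]// _; exact: val_inj.
    by rewrite addrC subrK.
  apply: le_trans (majorant_density z); rewrite /density indicE mem_set// mul1r.
  case: asboolP => // /tubeP[_ [w [Tw Cw] h]]; exfalso; apply: ntx; apply/tubeP; split=> //.
  have [/= d1 d2] := enorm_coord (z - w); have {}d1 := le_lt_trans d1 h.
  exists (tmap i w); last first.
    rewrite -xE !tile_mapE.
    rewrite (_ : _ - _ = (rho * (z - w).1, rho * (z - w).2)); last by congr pair => /=; ring.
    rewrite enormZ// (_ : lam * (rho * e) = rho * (lam * e)); last by ring.
    by rewrite ltr_pM2l.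
  split; first exact: tinv_T.
  apply: tset_tile; left; split=> //; move: (Tw) => [_ /=]; rewrite in_itv /= => /andP[/ltW w1 /ltW w2].
  split; rewrite /= in_itv /= ?w1 ?w2// -ler_norml.
  have := ler_normD (w.1 - z.1) z.1; rewrite subrK distrC => h1.
  have lek' := lek; lra.
have [q gq qz] : exists2 q, ~~ bad q & cell q z.
  by case: Wi => // -[_]; rewrite ltNge ht.
have nrow j : (j <= n)%N -> z.2 != row_y j.
  move=> jn; apply/eqP => e2; apply: nS; rewrite [z]surjective_pairing e2.
  by apply: slit_in => //; exact: cell_side qz.
have c0' : core_indic t z = 0.
  by rewrite /core_indic indicE memNset// => -[_ /=]; rewrite ltNge ht.
have single (F : 'I_n * bool -> R) : \sum_q' good R bad q' * (\1_(cell q') z * F q') = F q.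
  rewrite (bigD1 q)//= big1 => [|q' qq']; last first.
    rewrite indicE memNset ?mul0r ?mulr0// => q'z; move/eqP: qq'; apply.
    exact: (cell_unique n0 t0 k0 q'z qz).
  by rewrite /good gq indicE mem_set// !mul1r addr0.
apply: le_trans (majorant_cell gq qz).
apply: le_trans (dist2_SO2_le _ (interface_SO2 z)) _.
rewrite /zone_bound /devsq !ord2_sum frob2E !mxE /= /weld0 /weld1 c0' !mul0r !add0r.
rewrite !(single (fun q' => plateau (- t) t k z.1 * _ z + 'D_1 (plateau (- t) t k) z.1 * (_ z + _ q'))).
rewrite !(single (fun q' => plateau (- t) t k z.1 * _ z)).
rewrite -/(gap 0 q z) -/(gap 1 q z).
set ph := plateau (- t) t k z.1; set dp := 'D_1 (plateau (- t) t k) z.1.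
have hp : 0 <= ph <= 1 by rewrite plateau_ge0 plateau_le1.
have hd : dp ^+ 2 <= (Cp / k) ^+ 2.
  rewrite -(real_normK (num_real dp)) ler_sqr ?nnegrE//; first exact: dphi_le.
  exact: le_trans (dphi_le z.1).
have B1 a : (ph * a) ^+ 2 <= a ^+ 2.
  rewrite exprMn ler_piMl ?sqr_ge0//; move: hp => /andP[h1 h2]; rewrite expr2; nra.
have B0 a g d : 0 <= d < tau * e -> (ph * a + dp * (g + d)) ^+ 2 <=
    2 * a ^+ 2 + 4 * (Cp / k) ^+ 2 * (g ^+ 2 + (tau * e) ^+ 2).
  move=> /andP[d0 d1]; have d2 : d ^+ 2 <= (tau * e) ^+ 2.
    by rewrite ler_sqr ?nnegrE ?(ltW d1)// (le_trans d0 (ltW d1)).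
  have h1 : (ph * a + dp * (g + d)) ^+ 2 <= 2 * (ph * a) ^+ 2 + 2 * (dp * (g + d)) ^+ 2.
    have := sqr_ge0 (ph * a - dp * (g + d)); nra.
  have h2 : (dp * (g + d)) ^+ 2 <= (Cp / k) ^+ 2 * (2 * (g ^+ 2 + (tau * e) ^+ 2)).
    rewrite exprMn; apply: ler_pM; rewrite ?sqr_ge0//.
    have := sqr_ge0 (g - d); nra.
  have := B1 a; lra.
have E u v : u + v - u = v :> R by ring.
rewrite !E.
have := B0 (dev 0 0 z) (gap 0 q z) _ (c_bound 0 i q).
have := B0 (dev 1 0 z) (gap 1 q z) _ (c_bound 1 i q).
have := B1 (dev 0 1 z); have := B1 (dev 1 1 z).
have := sqr_ge0 (dev 0 1 z); have := sqr_ge0 (dev 1 1 z).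
move: (dev 0 0 z) (dev 0 1 z) (dev 1 0 z) (dev 1 1 z) (gap 0 q z) (gap 1 q z) ((Cp / k) ^+ 2) ((tau * e) ^+ 2) => *; lra.
Qed.

End Cover.

(** * Integrals of nonnegative functions *)

Section NonnegIntegrals.
Variable R : realType.
Notation leb := (@lebesgue_measure R).
Notation mu2 := (leb \x leb)%E.
Implicit Types f g : R * R -> R.

(** Measurable nonnegative functions and their integrals, kept real-valued so
    that pointwise algebra is done in R. *)
Definition nnm f := measurable_fun setT f /\ forall x, 0 <= f x.
Definition nnint f : \bar R := (\int[mu2]_z (f z)%:E)%E.

Lemma nnmD f g : nnm f -> nnm g -> nnm (fun x => f x + g x).
Proof. by move=> [mf f0] [mg g0]; split=> [|x]; [exact: measurable_funD|rewrite addr_ge0]. Qed.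

Lemma nnmM f g : nnm f -> nnm g -> nnm (fun x => f x * g x).
Proof. by move=> [mf f0] [mg g0]; split=> [|x]; [exact: measurable_funM|rewrite mulr_ge0]. Qed.

Lemma nnm_cst (a : R) : 0 <= a -> nnm (fun=> a).
Proof. by split. Qed.

Lemma nnmZ (a : R) f : 0 <= a -> nnm f -> nnm (fun x => a * f x).
Proof. by move=> a0; apply: nnmM; exact: nnm_cst. Qed.

Lemma nnm_sum (I : Type) (l : seq I) (F : I -> R * R -> R) :
  (forall i, nnm (F i)) -> nnm (fun x => \sum_(i <- l) F i x).
Proof.
move=> h; split; first by apply: measurable_sum => i; have [] := h i.
by move=> x; apply: sumr_ge0 => i _; have [] := h i.
Qed.

Lemma nnm_indic (D : set (R * R)) : measurable D -> nnm (\1_D).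
Proof. by move=> mD; split=> //; exact: measurable_indic. Qed.

Lemma nnm_sqr f : measurable_fun setT f -> nnm (fun x => f x ^+ 2).
Proof. by move=> mf; split=> [|x]; [exact: measurable_funX|exact: sqr_ge0]. Qed.

Lemma nnint_ge0 f : nnm f -> (0 <= nnint f)%E.
Proof. by move=> [_ f0]; apply: integral_ge0 => x _; rewrite lee_fin. Qed.

Lemma nnint_eq f g : (forall x, f x = g x) -> nnint f = nnint g.
Proof. by move=> /funext ->. Qed.

Lemma nnintD f g : nnm f -> nnm g -> nnint (fun x => f x + g x) = (nnint f + nnint g)%E.
Proof.
move=> [mf f0] [mg g0]; rewrite /nnint; under eq_integral do rewrite EFinD.
by rewrite ge0_integralD//; try (by move=> x _; rewrite lee_fin); exact/measurable_EFinP.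
Qed.

Lemma nnintZ (a : R) f : 0 <= a -> nnm f -> nnint (fun x => a * f x) = (a%:E * nnint f)%E.
Proof.
move=> a0 [mf f0]; rewrite /nnint; under eq_integral do rewrite EFinM.
by rewrite ge0_integralZl_EFin//; [move=> x _; rewrite lee_fin|exact/measurable_EFinP].
Qed.

Lemma nnint_sum (I : Type) (l : seq I) (F : I -> R * R -> R) :
  (forall i, nnm (F i)) -> nnint (fun x => \sum_(i <- l) F i x) = (\sum_(i <- l) nnint (F i))%E.
Proof.
move=> h; elim: l => [|i l IH].
  rewrite big_nil (_ : (fun x => _) = fun=> 0); last by apply/funext => x; rewrite big_nil.
  by rewrite /nnint integral0.
rewrite big_cons -IH -nnintD//; last exact: nnm_sum.
by apply: nnint_eq => x; rewrite big_cons.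
Qed.

Lemma nnint_le f g : nnm f -> nnm g -> (forall x, f x <= g x) -> (nnint f <= nnint g)%E.
Proof.
move=> [mf f0] [mg g0] fg; apply: ge0_le_integral => //.
- by move=> x _; rewrite lee_fin.
- exact/measurable_EFinP.
- exact/measurable_EFinP.
- by move=> x _; rewrite lee_fin.
Qed.

Lemma nnint_indic (D : set (R * R)) : measurable D -> nnint (\1_D) = mu2 D.
Proof. by move=> mD; rewrite /nnint integral_indic// setIT. Qed.

Lemma nnint_tile (rho : R) i f : 0 < rho -> nnm f ->
  nnm (f \o tile_inv rho i) /\ nnint (f \o tile_inv rho i) = ((rho ^+ 2)%:E * nnint f)%E.
Proof.
move=> r0 [mf f0]; have ma : measurable_fun setT (f \o tile_inv rho i).
  by apply: (measurableT_comp mf); exact: aff_measurable.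
split; first by split=> // x; exact: f0.
rewrite /nnint (ge0_integral_aff (tile_origin rho i) r0 (f := fun z => ((f \o tile_inv rho i) z)%:E)).
- by congr (_ * _)%E; apply: eq_integral => z _; rewrite /= -/(tile_map rho i z) tile_mapK.
- exact/measurable_EFinP.
- by move=> x; rewrite lee_fin; exact: f0.
Qed.

Lemma integral_restrict (D : set (R * R)) f : measurable D ->
  (\int[mu2]_(x in D) (f x)%:E)%E = nnint (fun x => \1_D x * f x).
Proof.
move=> mD; rewrite integral_mkcond; apply: eq_integral => x _.
by rewrite patchE indicE; case: ifPn => _ /=; rewrite ?mul1r ?mul0r.
Qed.

Lemma thick_measurable (r l u y0 y1 : R) : measurable (thick r l u y0 y1).
Proof. exact: box_measurable. Qed.

Lemma thick_measure (r l u y0 y1 : R) : 0 <= r -> l <= u -> y0 <= y1 ->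
  mu2 (thick r l u y0 y1) = ((u - l + 2 * r) * (y1 - y0 + 2 * r))%:E.
Proof.
by move=> r0 lu yy; rewrite /thick box_measure; [congr EFin; ring|lra|lra].
Qed.

Lemma measurable_dist2 (A : R * R -> 'M[R]_2) : (forall r s, measurable_fun setT (fun x => A x r s)) ->
  measurable_fun setT (fun x => dist2_SO2 (A x)).
Proof.
move=> mA; rewrite /dist2_SO2; under eq_fun => x do rewrite frob2E.
have ms : measurable_fun setT (Num.sqrt : R -> R).
  by apply: continuous_measurable_fun; exact: sqrt_continuous.
apply: measurable_funB.
  by apply: measurable_funD => //; do !apply: measurable_funD; exact: measurable_funX.
apply: measurable_funM => //; apply: (measurableT_comp ms).
apply: measurable_funD; apply: measurable_funX.
  exact: measurable_funD.
exact: measurable_funB.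
Qed.

Lemma measurable_dist2_T (A : R * R -> 'M[R]_2) : L1_field (open_square 2^-1) A ->
  nnm (fun x => \1_(open_square (2^-1 : R)) x * dist2_SO2 (A x)).
Proof.
move=> LA; have mT := @T_measurable R.
split; last by move=> x; rewrite mulr_ge0// dist2_SO2_ge0.
have -> : (fun x => \1_(open_square (2^-1 : R)) x * dist2_SO2 (A x)) =
  (fun x => \1_(open_square (2^-1 : R)) x * dist2_SO2 (\1_(open_square (2^-1 : R)) x *: A x)).
  apply/funext => x; rewrite indicE; case: (_ \in _); last by rewrite !mul0r.
  by rewrite scale1r.
apply: measurable_funM; first exact: measurable_indic.
apply: measurable_dist2 => r s; under eq_fun => x do rewrite mxE.
exact: integ_measurable (integ_entry r s mT LA).
Qed.

(** The two terms of the energy are merged in a single integrand. *)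
Lemma energy_nnint (lam eps : R) (A : R * R -> 'M[R]_2) S : L1_field (open_square 2^-1) A ->
  let D := tube (open_square 2^-1) (lam * eps) S in
  energy lam eps A S (open_square 2^-1) =
    nnint (fun x => \1_(open_square 2^-1) x * (if `[< D x >] then 1 else dist2_SO2 (A x))) /\
  nnm (fun x => \1_(open_square 2^-1) x * (if `[< D x >] then 1 else dist2_SO2 (A x))).
Proof.
move=> LA D; have mD : measurable D by exact: tube_measurable.
have mT := @T_measurable R; have [m1 p1] := measurable_dist2_T LA.
have mTD : measurable (open_square (2^-1 : R) `\` D) by exact: measurableD.
have E : (fun x => \1_(open_square 2^-1) x * (if `[< D x >] then 1 else dist2_SO2 (A x))) =
   (fun x => \1_(open_square (2^-1 : R) `\` D) x * (\1_(open_square (2^-1 : R)) x * dist2_SO2 (A x)) + \1_D x).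
  apply/funext => x; rewrite !indicE in_setD.
  have [Dx|nDx] := pselect (D x).
    have [Tx _] : open_square (2^-1 : R) x /\ True by move: Dx => /tubeP[].
    by rewrite asboolT// !mem_set//= mul0r mul1r add0r.
  by rewrite asboolF// [x \in D]memNset// andbT addr0 mulrA -natrM mulnb andbb.
have n1 : nnm (fun x => \1_(open_square (2^-1 : R) `\` D) x * (\1_(open_square (2^-1 : R)) x * dist2_SO2 (A x))).
  by apply: nnmM; [exact: nnm_indic|split].
rewrite E; split; last by apply: nnmD => //; exact: nnm_indic.
rewrite (nnintD n1 (nnm_indic mD)) (nnint_indic mD) /energy; congr (_ + _)%E.
under eq_integral => x _ do rewrite dist_setE.
rewrite integral_restrict//; apply: nnint_eq => x; rewrite !indicE in_setD.
by case: (x \in open_square _); rewrite /= ?mul0r ?mul1r.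
Qed.

Lemma sum_unique_le1 (I : finType) (P : pred I) : (forall i j, P i -> P j -> i = j) ->
  \sum_i (P i)%:R <= 1 :> R.
Proof.
move=> U; have [[i Pi]|nP] := pselect (exists i, P i); last first.
  by rewrite big1 ?ler01// => i _; case Pi : (P i) => //; exfalso; apply: nP; exists i.
rewrite (bigD1 i)//= big1 ?addr0 ?Pi// => j ji; case Pj : (P j) => //.
by move: ji; rewrite (U _ _ Pj Pi) eqxx.
Qed.

End NonnegIntegrals.

(** * The integral of the majorant *)

Section MajorantIntegral.
Variables (R : realType) (n : nat) (t k lam tau e Cp : R).
Notation leb := (@lebesgue_measure R).
Notation mu2 := (leb \x leb)%E.
Hypotheses (n0 : (0 < n)%N) (t0 : 0 < t) (k0 : 0 < k) (tk : t + k < 2^-1).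
Hypotheses (lam0 : 0 < lam) (tau0 : 0 < tau) (e0 : 0 < e) (t2 : 2 * (lam * e) < t).
Hypothesis n2 : 2 * (lam * e) < n%:R^-1.
Hypothesis l1 : lam * e < 1.
Variables (C0 : set (R * R)) (A : R * R -> 'M[R]_2) (Rm Rp : 'M[R]_2).
Local Notation T := (open_square (2^-1 : R)).
Local Notation S := (T `&` C0).
Hypothesis admA : admissible tau e T A S.
Local Notation tube0 := (tube T (lam * e) S).
Local Notation bad := (@bad_cell R n t k lam e C0).
Local Notation dev := (dev A Rm Rp).
Local Notation row_y := (row_y R n).
Local Notation cell := (@cell R n t k).
Local Notation devsq := (devsq A Rm Rp).
Local Notation gap := (@gap R n A Rm Rp).
Local Notation zbound := (@zone_bound R n k tau e Cp A Rm Rp).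
Local Notation density := (density lam e C0 A).
Local Notation tile_majorant := (@majorant R n t k lam tau e Cp C0 A Rm Rp).
Local Notation ell := (lam * e).

Let le0 : 0 < ell. Proof. by rewrite mulr_gt0. Qed.
Let h0 : 0 < n%:R^-1 :> R. Proof. by rewrite invr_gt0 ltr0n. Qed.
Let n0' : 0 < n%:R :> R. Proof. by rewrite ltr0n. Qed.

(** Cells enlarged by twice the radius of the tube; strip contains them all. *)
Definition wide_cell (q : 'I_n * bool) :=
  thick (2 * ell) (side_lo t k q.2) (side_hi t k q.2) (row_y q.1) (row_y q.1.+1).
Definition strip : set (R * R) := T `&` [set z | t - 2 * ell <= `|z.1| <= t + k + 2 * ell].

Lemma strip_measurable : measurable strip.
Proof.
apply: measurableI; first exact: T_measurable.
have m1 : measurable_fun setT (fun z : R * R => `|z.1|).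
  by apply: measurableT_comp => //; exact: measurable_fst.
have -> : [set z : R * R | t - 2 * ell <= `|z.1| <= t + k + 2 * ell] =
   setT `&` (fun z : R * R => `|z.1|) @^-1` `[t - 2 * ell, t + k + 2 * ell].
  by rewrite setTI; apply/seteqP; split=> z /=; rewrite in_itv.
by apply: m1 => //; exact: measurable_itv.
Qed.

Lemma wide_side q z : wide_cell q z -> q.2 = (0 <= z.1) /\ t - 2 * ell <= `|z.1| <= t + k + 2 * ell.
Proof.
have tt := t2; have ll := le0; have kk := k0.
case: q => j b [/=]; rewrite /side_lo /side_hi in_itv /= => + _.
case: b => /andP[h1 h2].
  have z0 : 0 <= z.1 by lra.
  by rewrite z0 ger0_norm//; split=> //; apply/andP; split; lra.
have z0 : z.1 < 0 by lra.
by rewrite leNgt z0 ltr0_norm//; split=> //; apply/andP; split; lra.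
Qed.

Lemma cell_wide q z : cell q z -> wide_cell q z.
Proof.
move=> [/=]; rewrite !in_itv /= => /andP[a1 a2] /andP[b1 b2]; have ll := le0.
by split; rewrite /= in_itv /=; apply/andP; split; lra.
Qed.

(** The enlargement is less than the height of a row, and the two sides remain
    disjoint. *)
Lemma wide_overlap z : \sum_q \1_(wide_cell q) z <= 3 :> R.
Proof.
(* z lies in the enlarged row q only if q is J, J - 1 or J - 2 *)
pose w := (z.2 + 2^-1) * n%:R; pose J := Num.trunc (w + 1).
pose P (a : nat) (q : 'I_n * bool) := (q.1 + a == J)%N && (q.2 == (0 <= z.1)).
have U a i j : P a i -> P a j -> i = j.
  case: i j => [i b] [j b'] /andP[/eqP /= e1 /eqP /= e2] /andP[/eqP /= e3 /eqP /= e4].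
  by rewrite e2 e4; congr pair; apply/val_inj/eqP; rewrite -(eqn_add2r a) e1 e3.
have H q : \1_(wide_cell q) z <= (P 0%N q)%:R + (P 1%N q)%:R + (P 2%N q)%:R :> R.
  have [qz|nqz] := pselect (wide_cell q z); last by rewrite indicE memNset ?addr_ge0.
  rewrite indicE mem_set//=.
  have [e2 _] := wide_side qz; case: qz => _ /=; rewrite in_itv /= => /andP[h1 h2].
  have nn := n2; have w1 : q.1%:R - 1 < w.
    rewrite -(ltr_pM2r h0) /w mulfK ?gt_eqF//; move: h1; rewrite /row_y mulrBl mul1r.
    by move: (_ / _) => *; lra.
  have w2 : w < q.1%:R + 2.
    rewrite -(ltr_pM2r h0) /w mulfK ?gt_eqF//; move: h2; rewrite row_yS /row_y [(_ + 2) * _]mulrDl.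
    by move: (q.1%:R / _) => *; lra.
  have wp : 0 <= w + 1 by have : 0 <= q.1%:R :> R by []; lra.
  have /andP[j1 j2] := truncn_itv wp; rewrite -/J in j1 j2.
  have a1 : (q.1 < J.+1)%N by rewrite -(ltr_nat R); lra.
  have a2 : (J < q.1 + 3)%N by rewrite -(ltr_nat R) natrD; lra.
  have [m Em m3] : exists2 m, J = (q.1 + m)%N & (m < 3)%N.
    by exists (J - q.1)%N; rewrite ?subnKC// -(ltn_add2l q.1) subnKC.
  rewrite /P e2 eqxx !andbT Em !eqn_add2l.
  by case: m m3 {Em} => [|[|[|m]]]//= _; rewrite ?addr0 ?add0r.
apply: (le_trans (ler_sum _ (fun q _ => H q))); rewrite !big_split /=.
have := sum_unique_le1 R (U 0%N); have := sum_unique_le1 R (U 1%N); have := sum_unique_le1 R (U 2%N).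
by move: (\sum_i _) (\sum_i _) (\sum_i _) => *; lra.
Qed.

Lemma wide_strip z : T z -> \sum_q \1_(wide_cell q) z <= 3 * \1_strip z :> R.
Proof.
move=> Tz; have [Zz|nZz] := pselect (strip z).
  by rewrite [\1_strip z]indicE mem_set// mulr1; exact: wide_overlap.
rewrite big1 ?mulr_ge0// => q _; rewrite indicE memNset// => /wide_side [_ hz]; apply: nZz; by split.
Qed.

(** A bad cell is within one radius of a singular point. The square of side a
    third of the radius with a corner at that point, placed on the side of the
    origin so as to remain in the square, lies in the tube and in the cell
    enlarged by two radii. *)
Lemma bad_area q : bad q -> (((ell / 3) ^+ 2)%:E <= mu2 (tube0 `&` wide_cell q))%E.
Proof.
move=> /asboolP[x qx /tubeP[Tx [s [Ts Cs] hs]]].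
have ll := le0; pose d := ell / 3; have d0 : 0 < d by rewrite divr_gt0.
(* towards the origin, so that the small square stays in T *)
pose lo (a : R) := if 0 <= a then a - d else a.
have lo1 a b : lo a <= b <= lo a + d -> `|b - a| <= d.
  by rewrite /lo ler_norml; case: ifP => _ /andP[h1 h2]; apply/andP; split; lra.
have lo2 a b : - 2^-1 < a < 2^-1 -> lo a <= b <= lo a + d -> - 2^-1 < b < 2^-1.
  have l1' := l1.
  by rewrite /lo /d; case: ifP => h /andP[h1 h2] /andP[h3 h4]; apply/andP; split; lra.
pose B := box (lo s.1) (lo s.1 + d) (lo s.2) (lo s.2 + d).
have -> : ((ell / 3) ^+ 2)%:E = mu2 B by rewrite /B box_measure; [congr EFin; rewrite /d; ring|lra|lra].
apply: le_measure; rewrite ?inE; [exact: box_measurable| |].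
  by apply: measurableI; [exact: tube_measurable|exact: thick_measurable].
move=> z [/=]; rewrite !in_itv /= => z1 z2.
have a1 := lo1 _ _ z1; have a2 := lo1 _ _ z2.
move: Ts => [/=]; rewrite !in_itv /= => s1 s2.
have Tz : T z by split; rewrite /= in_itv /=; [exact: lo2 z1|exact: lo2 z2].
split.
  apply/tubeP; split=> //; exists s; first by split=> //; split; rewrite /= in_itv.
  by apply: le_lt_trans (enorm_le _) _ => /=; rewrite /d in a1 a2; lra.
have [/= d1 d2] := enorm_coord (x - s); have {}d1 := le_lt_trans d1 hs; have {}d2 := le_lt_trans d2 hs.
move: qx d1 d2 a1 a2 => [/=]; rewrite !in_itv /= !ltr_norml !ler_norml /d.
move=> /andP[? ?] /andP[? ?] /andP[? ?] /andP[? ?] /andP[? ?] /andP[? ?].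
by split; rewrite /= in_itv /=; apply/andP; split; lra.
Qed.

(** Sum bad_area over the bad cells, with overlap at most 3. *)
Lemma bad_count : (((\sum_q (bad q)%:R) * (ell / 3) ^+ 2)%:E <= 3%:E * mu2 (tube0 `&` strip))%E.
Proof.
have mt : measurable tube0 by exact: tube_measurable.
have mw q : measurable (wide_cell q) by exact: thick_measurable.
have mz := strip_measurable.
have nq q : nnm (fun z => (bad q)%:R * \1_(tube0 `&` wide_cell q) z).
  by apply: nnmZ => //; apply: nnm_indic; exact: measurableI.
have mtz : measurable (tube0 `&` strip) by exact: measurableI.
apply: (@le_trans _ _ (nnint (fun z => \sum_q (bad q)%:R * \1_(tube0 `&` wide_cell q) z))).
  rewrite nnint_sum// mulr_suml -sumEFin; apply: lee_sum => q _.
  rewrite nnintZ//; last by apply: nnm_indic; exact: measurableI.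
  rewrite (nnint_indic (measurableI _ _ mt (mw q))) EFinM.
  have [bq|nbq] := boolP (bad q); last by rewrite !mul0e.
  by rewrite !mul1e; exact: bad_area.
rewrite -(nnint_indic mtz) -(nnintZ (ler0n _ 3) (nnm_indic mtz)).
apply: nnint_le; [exact: nnm_sum|by apply: nnmZ => //; exact: nnm_indic|] => z.
have [tz|ntz] := pselect (tube0 z); last first.
  rewrite big1 ?mulr_ge0// => q _; rewrite indicE memNset ?mulr0// => -[tz' _]; exact: (ntz tz').
have Tz : T z by move: tz => /tubeP[].
apply: (@le_trans _ _ (\sum_q \1_(wide_cell q) z)).
  apply: ler_sum => q _; rewrite !indicE in_setI [z \in tube0]mem_set//=.
  by case: (bad q); rewrite ?mul1r ?mul0r.
apply: (le_trans (wide_strip Tz)).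
by rewrite !indicE in_setI [z \in tube0]mem_set.
Qed.

Lemma dev_measurable r s : measurable_fun setT (dev r s).
Proof. by apply: integ_measurable; exact: dev_integ admA r s. Qed.

Lemma devsq_nnm : nnm devsq.
Proof. by do 2 (apply: nnm_sum => ?); apply: nnm_sqr; exact: dev_measurable. Qed.

(** The deviation from the interface that the welds have to pay for. The tube is
    left out because good cells do not meet it. *)
Definition strip_dev : \bar R := nnint (fun z => \1_(strip `\` tube0) z * devsq z).

Lemma good_cells : (\sum_q (good R bad q)%:E * nnint (fun z => (\1_(cell q) z * devsq z)%R) <= 3%:E * strip_dev)%E.
Proof.
have nd := devsq_nnm; have mzt : measurable (strip `\` tube0).
  by apply: measurableD; [exact: strip_measurable|exact: tube_measurable].
have nc q : nnm (fun z => \1_(cell q) z * devsq z).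
  by apply: nnmM => //; apply: nnm_indic; exact: cell_measurable.
have g0 q : 0 <= good R bad q by rewrite /good.
rewrite -nnintZ//; last by apply: nnmM => //; exact: nnm_indic.
rewrite (eq_bigr (fun q => nnint (fun z => good R bad q * (\1_(cell q) z * devsq z)))); last first.
  by move=> q _; rewrite nnintZ.
rewrite -nnint_sum; last by move=> q; exact: nnmZ.
apply: nnint_le.
- by apply: nnm_sum => q; exact: nnmZ.
- by apply: nnmZ => //; apply: nnmM => //; exact: nnm_indic.
move=> z; have [Tz|nTz] := pselect (T z); last first.
  by rewrite devsq_out// !mulr0 big1// => q _; rewrite !mulr0.
have -> : \sum_q good R bad q * (\1_(cell q) z * devsq z) = (\sum_q good R bad q * \1_(cell q) z) * devsq z.
  by rewrite mulr_suml; apply: eq_bigr => q _; rewrite mulrA.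
rewrite mulrA; apply: ler_wpM2r; first by have [_] := nd.
have [tz|ntz] := pselect (tube0 z).
  rewrite big1 ?mulr_ge0// => q _; rewrite /good; case: (boolP (bad q)) => [|nb]; first by rewrite mul0r.
  rewrite indicE memNset ?mulr0// => qz; move/negP: nb; apply; apply/asboolP; by exists z.
apply: (@le_trans _ _ (\sum_q \1_(wide_cell q) z)).
  apply: ler_sum => q _; rewrite /good; case: (bad q); rewrite ?mul0r// mul1r !indicE.
  by have [qz|nqz] := pselect (cell q z); [rewrite !mem_set//; exact: cell_wide|rewrite [z \in cell q]memNset].
apply: (le_trans (wide_strip Tz)).
by rewrite !indicE in_setD [z \in tube0]memNset// andbT.
Qed.

Lemma gap_measurable r q : measurable_fun setT (gap r q).
Proof. exact: strip_prim_measurable (dev_measurable r 1). Qed.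

Lemma zone_bound_nnm q : nnm (zbound q).
Proof.
apply: nnmD; first by apply: nnmZ => //; exact: devsq_nnm.
apply: nnmZ; first by rewrite mulr_ge0// sqr_ge0.
apply: nnm_sum => r; apply: nnmD; first by apply: nnm_sqr; exact: gap_measurable.
by apply: nnm_cst; exact: sqr_ge0.
Qed.

Lemma cell_measure q : mu2 (cell q) = (k * n%:R^-1)%:E.
Proof.
transitivity ((side_hi t k q.2 - side_lo t k q.2) * (row_y q.1.+1 - row_y q.1))%:E.
  by apply: box_measure; [exact/ltW/side_lt|rewrite ltW// row_y_lt].
congr EFin; rewrite row_yS; congr (_ * _); last by ring.
by rewrite /side_hi /side_lo; case: q.2; ring.
Qed.

Local Notation K4 := (4 * (Cp / k) ^+ 2).
Let K40 : 0 <= K4. Proof. by rewrite mulr_ge0// sqr_ge0. Qed.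

Lemma zone_integral q : (nnint (fun z => (\1_(cell q) z * zbound q z)%R) <=
  (2 + K4 * (n%:R^-1) ^+ 2)%:E * nnint (fun z => (\1_(cell q) z * devsq z)%R) +
  (2 * K4 * (tau * e) ^+ 2 * (k * n%:R^-1))%:E)%E.
Proof.
have mc := @cell_measurable R n t k q; have nc := nnm_indic mc.
have nd := devsq_nnm.
have ng r : nnm (fun z => \1_(cell q) z * gap r q z ^+ 2).
  by apply: nnmM => //; apply: nnm_sqr; exact: gap_measurable.
have n1 r : nnm (fun z => \1_(cell q) z * dev r 1 z ^+ 2).
  by apply: nnmM => //; apply: nnm_sqr; exact: dev_measurable.
have ncd : nnm (fun z => \1_(cell q) z * devsq z) by exact: nnmM.
rewrite (@nnint_eq _ _ (fun z => 2 * (\1_(cell q) z * devsq z) + (K4 * (\sum_r \1_(cell q) z * gap r q z ^+ 2) +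
   (K4 * (2 * (tau * e) ^+ 2)) * \1_(cell q) z))); last first.
  move=> z; rewrite /zone_bound big_split /= sumr_const card_ord -mulr_sumr -mulr_natl; ring.
have e0' : 0 <= K4 * (2 * (tau * e) ^+ 2) by rewrite mulr_ge0// mulr_ge0// sqr_ge0.
have nsg : nnm (fun z => \sum_r \1_(cell q) z * gap r q z ^+ 2) by exact: nnm_sum.
rewrite nnintD; [|by apply: nnmZ|by apply: nnmD; exact: nnmZ].
rewrite nnintD; [|by apply: nnmZ|by apply: nnmZ].
rewrite !nnintZ// (nnint_indic mc) cell_measure nnint_sum//.
have G r : (nnint (fun z => (\1_(cell q) z * gap r q z ^+ 2)%R) <=
   ((n%:R^-1) ^+ 2)%:E * nnint (fun z => (\1_(cell q) z * dev r 1 z ^+ 2)%R))%E.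
  have := @integral_strip_prim_sqr R (side_lo t k q.2) (side_hi t k q.2) (row_y q.1) (row_y q.1.+1) (dev r 1).
  rewrite row_y_lt// ltnSn => /(_ erefl (dev_measurable r 1)).
  by rewrite (_ : row_y q.1.+1 - row_y q.1 = n%:R^-1)//; rewrite row_yS; ring.
have GS : (\sum_r nnint (fun z => (\1_(cell q) z * gap r q z ^+ 2)%R) <=
   ((n%:R^-1) ^+ 2)%:E * nnint (fun z => (\1_(cell q) z * devsq z)%R))%E.
  apply: (@le_trans _ _ (\sum_r ((n%:R^-1) ^+ 2)%:E * nnint (fun z => (\1_(cell q) z * dev r 1 z ^+ 2)%R))%E).
    by apply: lee_sum => r _; exact: G.
  rewrite -ge0_sume_distrr; last by move=> r _; exact: nnint_ge0.
  apply: lee_wpmul2l; first by rewrite lee_fin sqr_ge0.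
  rewrite -nnint_sum//; apply: nnint_le => //; first exact: nnm_sum.
  move=> z; rewrite -mulr_sumr; apply: ler_wpM2l => //; apply: ler_sum => r _.
  by rewrite ord2_sum lerDr sqr_ge0.
have X0 := nnint_ge0 ncd.
apply: (@le_trans _ _ (2%:E * nnint (fun z => (\1_(cell q) z * devsq z)%R) + (K4%:E * (((n%:R^-1) ^+ 2)%:E * nnint (fun z => (\1_(cell q) z * devsq z)%R)) +
   (K4 * (2 * (tau * e) ^+ 2))%:E * (k / n%:R)%:E))%E).
  by apply: leeD => //; apply: leeD => //; exact: lee_wpmul2l.
have K2 : (0 <= (K4 * (n%:R^-1) ^+ 2)%:E)%E by rewrite lee_fin (mulr_ge0 K40 (sqr_ge0 _)).
rewrite muleA -EFinM addeA -ge0_muleDl//.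
rewrite -EFinD -EFinM; apply: leeD => //; rewrite lee_fin le_eqVlt; apply/orP; left; apply/eqP; ring.
Qed.

(** What the welds cost even when the deviation vanishes: the constants c, the
    slits, and the edges. *)
Definition const_part : R := 4 * K4 * (tau * e) ^+ 2 * k +
  (2 * n.+1%:R * ((k + 2 * ell) * (2 * ell)) + 2 * ((2 * (t + k) + 2 * ell) * (2 * ell))).

Lemma slit_measure q : mu2 (@slit_thick R n t k lam e q) = ((k + 2 * ell) * (2 * ell))%:E.
Proof.
rewrite /slit_thick thick_measure//; [|exact: ltW|exact/ltW/side_lt].
by congr EFin; rewrite /side_hi /side_lo; case: q.2; ring.
Qed.

Lemma thick_cell_measure q : mu2 (@cell_thick R n t k lam e q) = ((k + 2 * ell) * (n%:R^-1 + 2 * ell))%:E.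
Proof.
rewrite /cell_thick thick_measure; [|exact: ltW|exact/ltW/side_lt|by rewrite ltW// row_y_lt].
by congr EFin; rewrite row_yS /side_hi /side_lo; case: q.2; ring.
Qed.

Lemma edge_measure y : mu2 (edge_thick t k lam e y) = ((2 * (t + k) + 2 * ell) * (2 * ell))%:E.
Proof.
have tt := t0; have kk := k0; have ll := le0.
by rewrite /edge_thick thick_measure//; [congr EFin; ring|exact: ltW|lra].
Qed.

Lemma density_energy : energy lam e A S T = nnint density /\ nnm density.
Proof. by have [LA _ _ _] := admA; exact: (energy_nnint lam e S LA). Qed.

Lemma majorant_nnm : nnm tile_majorant.
Proof.
have [_ nd] := density_energy.
apply: nnmD => //; apply: nnmD.
  apply: nnm_sum => q; apply: nnmZ; first by rewrite /good.
  by apply: nnmM; [apply: nnm_indic; exact: cell_measurable|exact: zone_bound_nnm].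
apply: nnmD; first by apply: nnm_sum => q; apply: nnm_indic; exact: thick_measurable.
apply: nnmD; first by apply: nnm_sum => q; apply: nnmZ => //; apply: nnm_indic; exact: thick_measurable.
by apply: nnmD; apply: nnm_indic; exact: thick_measurable.
Qed.

Lemma majorant_integral : (nnint tile_majorant <= energy lam e A S T +
  ((3 * (2 + K4 * (n%:R^-1) ^+ 2))%:E * strip_dev + (const_part%:E +
   (27 / ell ^+ 2 * ((k + 2 * ell) * (n%:R^-1 + 2 * ell)))%:E * mu2 (tube0 `&` strip))))%E.
Proof.
have [-> nd] := density_energy.
have g0 q : 0 <= good R bad q by rewrite /good.
have ncz q : nnm (fun z => \1_(cell q) z * zbound q z).
  by apply: nnmM; [apply: nnm_indic; exact: cell_measurable|exact: zone_bound_nnm].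
have ncd q : nnm (fun z => \1_(cell q) z * devsq z).
  by apply: nnmM; [apply: nnm_indic; exact: cell_measurable|exact: devsq_nnm].
have nm (r l u y0 y1 : R) : nnm (\1_(thick r l u y0 y1)) by apply: nnm_indic; exact: thick_measurable.
have nz : nnm (fun z => \sum_q good R bad q * (\1_(cell q) z * zbound q z)).
  by apply: nnm_sum => q; exact: nnmZ.
have ns : nnm (fun z => \sum_q \1_(@slit_thick R n t k lam e q) z) by apply: nnm_sum => q; exact: nm.
have nb : nnm (fun z => \sum_q (bad q)%:R * \1_(@cell_thick R n t k lam e q) z).
  by apply: nnm_sum => q; apply: nnmZ => //; exact: nm.
have ne y : nnm (\1_(edge_thick t k lam e y)) by exact: nm.
rewrite /majorant nnintD//; last by do !apply: nnmD.
apply: leeD => //.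
rewrite nnintD//; last by do !apply: nnmD.
rewrite nnintD//; last by do !apply: nnmD.
rewrite nnintD//; last by do !apply: nnmD.
rewrite (nnintD (ne _) (ne _)).
rewrite !(nnint_indic (thick_measurable _ _ _ _ _)) !edge_measure.
rewrite nnint_sum; last by move=> q; exact: nnmZ.
rewrite nnint_sum; last by move=> q; exact: nm.
rewrite nnint_sum; last by move=> q; apply: nnmZ => //; exact: nm.
have Z : (\sum_q nnint (fun z => (good R bad q * (\1_(cell q) z * zbound q z))%R) <=
   (3 * (2 + K4 * (n%:R^-1) ^+ 2))%:E * strip_dev + (4 * K4 * (tau * e) ^+ 2 * k)%:E)%E.
  apply: (@le_trans _ _ (\sum_q ((2 + K4 * (n%:R^-1) ^+ 2)%:E * ((good R bad q)%:E * nnint (fun z => (\1_(cell q) z * devsq z)%R)) +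
     (2 * K4 * (tau * e) ^+ 2 * (k * n%:R^-1))%:E))%E).
    apply: lee_sum => q _; rewrite nnintZ// /good; case: (bad q) => /=.
      rewrite !mul0e mule0 add0e lee_fin; apply: mulr_ge0; last by rewrite mulr_ge0// ltW.
      by apply: mulr_ge0; [exact: mulr_ge0 (ler0n _ 2) K40|exact: sqr_ge0].
    by rewrite !mul1e; exact: zone_integral.
  rewrite big_split /= -ge0_sume_distrr; last by move=> q _; rewrite mule_ge0 ?lee_fin// nnint_ge0.
  apply: leeD.
    rewrite [3 * _]mulrC [((2 + _) * 3)%:E]EFinM -muleA; apply: lee_wpmul2l; last exact: good_cells.
    by rewrite lee_fin addr_ge0// (mulr_ge0 K40 (sqr_ge0 _)).
  rewrite sumEFin lee_fin big_const iter_addr_0 card_prod card_ord card_bool.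
  rewrite -[(_ * _ * (_ / _)) *+ _]mulr_natr natrM.
  rewrite le_eqVlt; apply/orP; left; apply/eqP; field; rewrite ?gt_eqF//.
have Sl : (\sum_q nnint (\1_(@slit_thick R n t k lam e q)) = (2 * n.+1%:R * ((k + 2 * ell) * (2 * ell)))%:E)%E.
  rewrite (eq_bigr (fun=> ((k + 2 * ell) * (2 * ell))%:E)); last first.
    by move=> q _; rewrite nnint_indic ?slit_measure//; exact: thick_measurable.
  rewrite sumEFin big_const iter_addr_0 card_prod card_ord card_bool.
  by rewrite -[(_ * _) *+ _]mulr_natr natrM; congr EFin; ring.
have B : (\sum_q nnint (fun z => ((bad q)%:R * \1_(@cell_thick R n t k lam e q) z)%R) <=
   (27 / ell ^+ 2 * ((k + 2 * ell) * (n%:R^-1 + 2 * ell)))%:E * mu2 (tube0 `&` strip))%E.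
  rewrite (eq_bigr (fun q => ((bad q)%:R * ((k + 2 * ell) * (n%:R^-1 + 2 * ell)))%:E)); last first.
    move=> q _; rewrite nnintZ//; last exact: nm.
    by rewrite nnint_indic ?thick_cell_measure//; exact: thick_measurable.
  rewrite sumEFin -mulr_suml.
  have c0 : 0 <= 9 / ell ^+ 2 * ((k + 2 * ell) * (n%:R^-1 + 2 * ell)).
    by rewrite !mulr_ge0 ?invr_ge0 ?sqr_ge0 ?addr_ge0 ?mulr_ge0// ?ltW.
  have := lee_wpmul2l (ltac:(by rewrite lee_fin; exact: c0) : (0 <= (9 / ell ^+ 2 * ((k + 2 * ell) * (n%:R^-1 + 2 * ell)))%:E)%E) bad_count.
  rewrite muleA -!EFinM => H; apply: le_trans (le_trans H _).
    rewrite lee_fin le_eqVlt; apply/orP; left; apply/eqP; field; rewrite ?gt_eqF//.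
  apply: lee_wpmul2r; first exact: measure_ge0.
  by rewrite lee_fin le_eqVlt; apply/orP; left; apply/eqP; ring.
rewrite Sl.
apply: (@le_trans _ _ (((3 * (2 + K4 * (n%:R^-1) ^+ 2))%:E * strip_dev + (4 * K4 * (tau * e) ^+ 2 * k)%:E) +
  ((2 * n.+1%:R * ((k + 2 * ell) * (2 * ell)))%:E + ((27 / ell ^+ 2 * ((k + 2 * ell) * (n%:R^-1 + 2 * ell)))%:E * mu2 (tube0 `&` strip) +
   (((2 * (t + k) + 2 * ell) * (2 * ell))%:E + ((2 * (t + k) + 2 * ell) * (2 * ell))%:E))))%E).
  by apply: leeD => //; apply: leeD => //; apply: leeD.
rewrite -addeA; apply: leeD => //.
rewrite [X in (_ + (_ + X) <= _)%E]addeC !addeA; apply: leeD => //.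
by rewrite -!EFinD lee_fin /const_part le_eqVlt; apply/orP; left; apply/eqP; ring.
Qed.

End MajorantIntegral.

(** * Energy and distance of the tiled field *)

Section FrobeniusIntegral.
Variables (R : realType) (Rm Rp : 'M[R]_2).
Local Notation T := (open_square (2^-1 : R)).

Lemma frobenius_le (M : 'M[R]_2) : frobenius M <= \sum_r \sum_s `|M r s|.
Proof.
have a0 r s : 0 <= `|M r s| by [].
have S0 : 0 <= \sum_r \sum_s `|M r s| by apply: sumr_ge0 => r _; exact: sumr_ge0.
rewrite -(ger0_norm S0) -sqrtr_sqr; apply: ler_wsqrtr; rewrite !ord2_sum.
have E r s : M r s ^+ 2 = `|M r s| ^+ 2 by rewrite real_normK ?num_real.
rewrite !E; have := a0 0 0; have := a0 0 1; have := a0 1 0; have := a0 1 1.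
move: `|_| `|_| `|_| `|_| => a b c d *; rewrite -subr_ge0.
rewrite (_ : _ - _ = 2 * (a * b + a * c + a * d + b * c + b * d + c * d)); last by ring.
by rewrite mulr_ge0// !addr_ge0// mulr_ge0.
Qed.

Lemma frobenius_T_nnm (A : R * R -> 'M[R]_2) : L1_field T A ->
  nnm (fun x => \1_T x * frobenius (A x - interface Rm Rp x)).
Proof.
move=> LA; have mT := @T_measurable R.
split; last by move=> x; rewrite mulr_ge0// sqrtr_ge0.
have -> : (fun x => \1_T x * frobenius (A x - interface Rm Rp x)) =
   (fun x => Num.sqrt (\sum_r \sum_s (dev A Rm Rp r s x) ^+ 2)).
  apply/funext => x; rewrite /dev /deviation; have [Tx|nTx] := pselect (T x).
    rewrite indicE mem_set// mul1r /frobenius; congr Num.sqrt.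
    by apply: eq_bigr => r _; apply: eq_bigr => s _; rewrite jumpE !mxE mul1r.
  by rewrite indicE memNset// mul0r big1 ?sqrtr0// => r _; rewrite big1// => s _; rewrite mul0r expr0n.
have ms : measurable_fun setT (Num.sqrt : R -> R).
  by apply: continuous_measurable_fun; exact: sqrt_continuous.
apply: (measurableT_comp ms); apply: measurable_sum => r; apply: measurable_sum => s.
apply: measurable_funX; apply: integ_measurable; apply: deviation_integ.
exact: integ_entry (r) (s) mT LA.
Qed.

End FrobeniusIntegral.

Section TileOnce.
Variables (R : realType) (n : nat) (t k lam tau e Cp : R).
Notation leb := (@lebesgue_measure R).
Notation mu2 := (leb \x leb)%E.
Hypotheses (n0 : (0 < n)%N) (t0 : 0 < t) (k0 : 0 < k) (tk : t + k < 2^-1).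
Hypotheses (lam0 : 0 < lam) (tau0 : 0 < tau) (e0 : 0 < e) (lek : lam * e <= k).
Hypothesis tlk : t + lam * e < 2^-1.
Variables (C0 : set (R * R)) (A : R * R -> 'M[R]_2) (Rm Rp : 'M[R]_2).
Hypotheses (cC0 : closed C0) (SRm : SO2 Rm) (SRp : SO2 Rp).
Hypothesis dphi_le : forall s : R, `|'D_1 (plateau (- t) t k) s| <= Cp / k.
Local Notation T := (open_square (2^-1 : R)).
Hypothesis admA : admissible tau e T A (T `&` C0).
Local Notation bad := (@bad_cell R n t k lam e C0).
Local Notation dev := (dev A Rm Rp).
Local Notation cell := (@cell R n t k).
Local Notation majorant := (@majorant R n t k lam tau e Cp C0 A Rm Rp).
Local Notation W0 r c := (weld0 t k bad (dev r 0) (dev r 1) c).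
Local Notation W1 r := (weld1 t k bad (dev r 1)).

Let Ck0 : 0 <= Cp / k. Proof. exact: le_trans (dphi_le 0). Qed.
Let te0 : 0 < tau * e. Proof. exact: mulr_gt0. Qed.

(** Bounds the size of the weld of a tile whatever the constants, normalised
    to lie in [0, tau e), that were added in the cells. *)
Definition weld_size (z : R * R) : R := \sum_r (`|W0 r (fun=> 0) z| + `|W1 r z|) +
  \sum_q (2 * (Cp / k * (tau * e))) * \1_(cell q) z.

Lemma weld_size_le (c : 'I_2 -> 'I_n * bool -> R) z : (forall r q, 0 <= c r q < tau * e) ->
  \sum_r (`|W0 r (c r) z| + `|W1 r z|) <= weld_size z.
Proof.
move=> cb; rewrite /weld_size.
have H r : `|W0 r (c r) z| <= `|W0 r (fun=> 0) z| + \sum_q (Cp / k * (tau * e)) * \1_(cell q) z.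
  rewrite (_ : W0 r (c r) z = W0 r (fun=> 0) z +
    \sum_q good R bad q * (\1_(cell q) z * ('D_1 (plateau (- t) t k) z.1 * c r q))); last first.
    rewrite /weld0 -addrA; congr (_ + _); rewrite -big_split /=; apply: eq_bigr => q _; ring.
  apply: (le_trans (ler_normD _ _)); apply: lerD => //.
  apply: (le_trans (ler_norm_sum _ _ _)); apply: ler_sum => q _.
  have /andP[c1 c2] := cb r q; have h := dphi_le z.1.
  rewrite !normrM [`|c r q|]ger0_norm// /good.
  have h2 : `|'D_1 (plateau (- t) t k) z.1| * c r q <= Cp / k * (tau * e) by apply: ler_pM => //; exact: ltW.
  rewrite indicE; case: (z \in _); rewrite ?normr0 ?mul0r ?mulr0// normr1 mul1r mulr1.
  by case: (bad q); rewrite ?normr0 ?mul0r ?normr1 ?mul1r// mulr_ge0// ltW.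
rewrite !ord2_sum; have h0 := H 0; have h1 := H 1.
rewrite (_ : \sum_q (2 * (Cp / k * (tau * e))) * \1_(cell q) z = 2 * \sum_q (Cp / k * (tau * e)) * \1_(cell q) z).
  by move: (\sum_q _) h0 h1 => s *; lra.
by rewrite mulr_sumr; apply: eq_bigr => q _; rewrite -!mulrA.
Qed.

Lemma weld_size_integ : integ weld_size.
Proof.
apply: integD.
  apply: integ_sum => r; apply: integD; apply: integ_norm.
    by apply: weld0_integ => //; exact: dev_integ admA _ _.
  by apply: weld1_integ; exact: dev_integ admA _ _.
apply: integ_sum => q; apply: integZ; apply: integ_indic; first exact: cell_measurable.
by rewrite cell_measure// ltry.
Qed.

Lemma weld_size_nnm : nnm weld_size.
Proof.
split; first exact: integ_measurable weld_size_integ.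
move=> z; apply: addr_ge0; apply: sumr_ge0 => i _; first exact: addr_ge0.
by rewrite mulr_ge0// mulr_ge0// mulr_ge0// ltW.
Qed.

Lemma weld_support_strip z : @weld_support R n t k lam e C0 z -> `|z.1| <= t + k.
Proof. by have kk := k0; move=> [[_ h]|[q _ /(cell_side t0 k0)/andP[]]//]; lra. Qed.

Section Scale.
Variables (N : nat) (rho : R).
Hypotheses (rho0 : 0 < rho) (Nrho : rho * N%:R <= 1) (N1 : 1 <= rho * N.+1%:R) (rho1 : rho <= 1).
Variable c : 'I_2 -> 'I_N -> 'I_n * bool -> R.
Hypothesis c_bound : forall r i q, 0 <= c r i q < tau * e.
Local Notation tinv := (tile_inv rho).
Local Notation tset := (tiled_set N t k rho bad C0).
Local Notation G := (tiled_field t k rho lam e C0 A Rm Rp c).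
Local Notation top := (@top_thick R N t k rho lam e).

Lemma field_weld x r : G x r 0 - interface Rm Rp x r 0 = \sum_(i < N) W0 r (c r i) (tinv i x) /\
  G x r 1 - interface Rm Rp x r 1 = \sum_(i < N) W1 r (tinv i x).
Proof. by rewrite !mxE /tiled0 /tiled1 !jumpE /= ![_ + \sum_(_ < _) _ - _]addrC !addKr. Qed.

(** The transition ends at t + k in a tile, hence at rho (t + k) after scaling. *)
Lemma field_far x : rho * (t + k) < `|x.1| -> G x = interface Rm Rp x.
Proof.
move=> hx; have nW (i : 'I_N) : ~ @weld_support R n t k lam e C0 (tinv i x).
  move=> /weld_support_strip; rewrite tile_invE//= normrM normfV (gtr0_norm rho0).
  by rewrite ler_pdivrMr// mulrC leNgt hx.
apply/matrixP => r s; apply/eqP; rewrite -subr_eq0; apply/eqP; have [h0 h1] := field_weld x r.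
have [->|s0] := eqVneq s 0.
  by rewrite h0 big1// => i _; exact: (weld_out _ _ _ (nW i)).1.
have -> : s = 1 by move: s0; case: s => [[|[|m]] hm]// _; exact: val_inj.
by rewrite h1 big1// => i _; exact: (weld_out (dev r 0) _ (fun=> 0) (nW i)).2.
Qed.

Lemma field_dist x : frobenius (G x - interface Rm Rp x) <= \sum_(i < N) weld_size (tinv i x).
Proof.
apply: (le_trans (frobenius_le _)).
have -> : \sum_r \sum_s `|(G x - interface Rm Rp x) r s| =
   \sum_r (`|\sum_(i < N) W0 r (c r i) (tinv i x)| + `|\sum_(i < N) W1 r (tinv i x)|).
  apply: eq_bigr => r _; rewrite ord2_sum -(field_weld x r).1 -(field_weld x r).2.
  have E s : (G x - interface Rm Rp x) r s = G x r s - interface Rm Rp x r s.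
    by rewrite [LHS]mxE [X in _ + X]mxE.
  by rewrite !E.
apply: (@le_trans _ _ (\sum_r \sum_(i < N) (`|W0 r (c r i) (tinv i x)| + `|W1 r (tinv i x)|))).
  apply: ler_sum => r _; apply: le_trans (lerD (ler_norm_sum _ _ _) (ler_norm_sum _ _ _)) _.
  by rewrite -big_split.
rewrite exchange_big /=; apply: ler_sum => i _.
by apply: (@weld_size_le (fun r => c r i)) => r q; exact: c_bound.
Qed.

Let Nrho2 f : nnm f -> (nnint (fun x => (\sum_(i < N) f (tinv i x))%R) <= rho%:E * nnint f)%E.
Proof.
move=> nf; rewrite nnint_sum; last by move=> i; exact: (nnint_tile i rho0 nf).1.
rewrite (eq_bigr (fun=> ((rho ^+ 2)%:E * nnint f)%E)); last by move=> i _; exact: (nnint_tile i rho0 nf).2.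
rewrite -ge0_sume_distrl//; last by move=> i _; rewrite lee_fin sqr_ge0.
rewrite sumEFin big_const iter_addr_0 card_ord; apply: lee_wpmul2r; first exact: nnint_ge0.
by rewrite lee_fin -mulr_natr expr2 -mulrA -[leRHS]mulr1 ler_pM2l.
Qed.

Lemma field_L1 : (\int[mu2]_(x in T) (frobenius (G x - interface Rm Rp x))%:E <= rho%:E * nnint weld_size)%E.
Proof.
have nw := weld_size_nnm; apply: le_trans (Nrho2 nw).
rewrite integral_restrict; last exact: T_measurable.
apply: nnint_le => [| |x].
- by apply: frobenius_T_nnm; exact: tiled_L1 admA _.
- by apply: nnm_sum => i; exact: (nnint_tile i rho0 nw).1.
have f0 : 0 <= frobenius (G x - interface Rm Rp x) by exact: sqrtr_ge0.
by apply: le_trans (field_dist x); rewrite indicE; case: (x \in _); rewrite ?mul1r// mul0r.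
Qed.

(** There are about 1 / rho tiles, each of area rho^2; the leftover above the last
    one has height less than rho, whence the quadratic last term. *)
Lemma field_energy :
  (energy lam (rho * e) G (T `&` tset) T <= rho%:E * nnint majorant + (rho ^+ 2 * ((2 * (t + k) + 2 * (lam * e)) * (1 + 2 * (lam * e))))%:E)%E.
Proof.
have LG : L1_field T G by apply: tiled_L1 admA _.
have [-> ng] := energy_nnint lam (rho * e) (T `&` tset) LG.
have nm := majorant_nnm n t k lam Cp Rm Rp admA.
have mt : measurable top by exact: thick_measurable.
have nt := nnm_indic mt.
have ns : nnm (fun x => \sum_(i < N) majorant (tinv i x)).
  by apply: nnm_sum => i; exact: (nnint_tile i rho0 nm).1.
apply: (@le_trans _ _ (nnint (fun x => (\sum_(i < N) majorant (tinv i x) + \1_top x)%R))).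
  apply: nnint_le => //; first exact: nnmD.
  move=> x; have s0 : 0 <= \sum_(i < N) majorant (tinv i x) + \1_top x.
    by apply: addr_ge0 => //; have [_] := ns.
  have [Tx|nTx] := pselect (T x); last by rewrite indicE memNset// mul0r.
  rewrite indicE mem_set// mul1r; case: asboolP => [tx|ntx]; first exact: tube_cover tx.
  by apply: (@le_trans _ _ (\sum_(i < N) majorant (tinv i x))); [exact: field_cover|rewrite lerDl].
rewrite nnintD//; apply: leeD; first exact: Nrho2.
have ll : 0 < lam * e by exact: mulr_gt0.
have l2 : 0 <= lam * (rho * e) by rewrite !mulr_ge0// ltW.
have rtk : 0 < rho * (t + k) by rewrite mulr_gt0// addr_gt0.
have Nr := Nrho.
rewrite nnint_indic// /top_thick thick_measure//; [|lra|lra].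
rewrite lee_fin [leLHS](_ : _ = (rho * (2 * (t + k) + 2 * (lam * e))) * (1 - rho * N%:R + rho * (2 * (lam * e)))); last by field.
rewrite [leRHS](_ : _ = (rho * (2 * (t + k) + 2 * (lam * e))) * (rho * (1 + 2 * (lam * e)))); last by ring.
have tk0 : 0 < t + k by rewrite addr_gt0.
rewrite ler_pM2l; last by rewrite mulr_gt0//; lra.
have := N1; rewrite -natr1 mulrDr mulr1 => h; lra.
Qed.

End Scale.

(** Self-similarity: divided by the scale rho e, the energy is at most the
    integral of the majorant divided by e, up to a term vanishing with rho. *)
Lemma tile_scaling : exists2 w : R, 0 <= w & forall rho, 0 < rho -> rho <= 1 ->
  exists (G : R * R -> 'M[R]_2) (S : set (R * R)),
  [/\ admissible tau (rho * e) T G S,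
      (energy lam (rho * e) G S T <= rho%:E * nnint majorant +
         (rho ^+ 2 * ((2 * (t + k) + 2 * (lam * e)) * (1 + 2 * (lam * e))))%:E)%E,
      (\int[mu2]_(x in T) (frobenius (G x - interface Rm Rp x))%:E <= (rho * w)%:E)%E &
      forall x, rho < `|x.1| -> G x = interface Rm Rp x].
Proof.
have fw : nnint weld_size \is a fin_num.
  have /integrableP[_] := weld_size_integ; rewrite ge0_fin_numE; last exact: nnint_ge0 weld_size_nnm.
  apply: le_lt_trans; apply: ge0_le_integral => //.
  - by move=> x _; rewrite lee_fin; exact: weld_size_nnm.2.
  - by apply/measurable_EFinP; exact: weld_size_nnm.1.
  - by apply/measurable_EFinP/measurableT_comp => //; exact: weld_size_nnm.1.
  - by move=> x _ /=; rewrite lee_fin ler_norm.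
exists (fine (nnint weld_size)) => [|rho r0 r1]; first exact/fine_ge0/nnint_ge0/weld_size_nnm.
pose N := Num.trunc rho^-1.
have /andP[h1 h2] : N%:R <= rho^-1 < N.+1%:R by apply: truncn_itv; rewrite invr_ge0 ltW.
have Nrho : rho * N%:R <= 1 by rewrite mulrC -ler_pdivlMr// div1r.
have N1 : 1 <= rho * N.+1%:R by rewrite mulrC -ler_pdivrMr// div1r ltW.
have [c [cb adm]] : exists c : 'I_2 -> 'I_N -> 'I_n * bool -> R, (forall r i q, 0 <= c r i q < tau * e) /\
    admissible tau (rho * e) T (tiled_field t k rho lam e C0 A Rm Rp c) (T `&` tiled_set N t k rho bad C0).
  exact: tiled_admissible.
exists (tiled_field t k rho lam e C0 A Rm Rp c), (T `&` tiled_set N t k rho bad C0); split=> //.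
- exact: field_energy.
- by rewrite EFinM fineK//; exact: field_L1.
- move=> x hx; apply: field_far => //; apply: le_lt_trans hx.
  have tk' := tk; rewrite -[leRHS]mulr1 ler_pM2l//; lra.
Qed.

End TileOnce.

(** * Choice of a cheap strip *)

Section StripChoice.
Variables (R : realType) (lam tau e : R).
Notation leb := (@lebesgue_measure R).
Notation mu2 := (leb \x leb)%E.
Hypotheses (lam0 : 0 < lam) (e0 : 0 < e).
Variables (C0 : set (R * R)) (A : R * R -> 'M[R]_2) (Rm Rp : 'M[R]_2).
Hypotheses (SRm : SO2 Rm) (SRp : SO2 Rp).
Local Notation T := (open_square (2^-1 : R)).
Local Notation S := (T `&` C0).
Hypothesis admA : admissible tau e T A S.
Local Notation tube0 := (tube T (lam * e) S).
Local Notation devsq := (devsq A Rm Rp).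
Local Notation ell := (lam * e).
Local Notation strip t k := (strip t k lam e).
Local Notation strip_dev t k := (strip_dev t k lam e C0 A Rm Rp).

Definition far_dev : \bar R := nnint (fun z => \1_(T `\` tube0) z * devsq z).
Definition core_dist : \bar R :=
  (\int[mu2]_(x in T) (frobenius (outside_tube T ell A S x - interface Rm Rp x))%:E)%E.

Lemma frobenius_coord (M : 'M[R]_2) r s : `|M r s| <= frobenius M.
Proof.
rewrite -sqrtr_sqr; apply: ler_wsqrtr.
rewrite (bigD1 r)//= (bigD1 s)//= -addrA lerDl addr_ge0//.
  by apply: sumr_ge0 => *; exact: sqr_ge0.
by do 2 apply: sumr_ge0 => * ; exact: sqr_ge0.
Qed.

Lemma outside_L1 : L1_field T (outside_tube T ell A S).
Proof.
have [LA _ _ _] := admA; have mT := @T_measurable R.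
apply: L1_field_entry => // i j.
rewrite (_ : entry _ _ _ _ = fun x => \1_(T `\` tube0) x * entry T A i j x); last first.
  by apply/funext => x; rewrite /entry /outside_tube mxE; ring.
have mD : measurable (T `\` tube0) by apply: measurableD => //; exact: tube_measurable.
have mi : measurable_fun setT (\1_(T `\` tube0) : R * R -> R) by exact: measurable_indic.
by apply: (@integMbounded _ _ _ 1 mi); [move=> x; exact: indic_norm1|exact: integ_entry].
Qed.

(** Off the tube, the squared deviation from the interface is the squared
    distance to the rotations up to a linear term controlled in L^1. *)
Lemma far_dev_le : (far_dev <= energy lam e A S T + 16%:E * core_dist)%E.
Proof.
have [LA _ _ _] := admA; have mT := @T_measurable R.
have [-> ne] := energy_nnint lam e S LA.
have nf := frobenius_T_nnm Rm Rp outside_L1.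
rewrite /core_dist integral_restrict// -nnintZ// -nnintD//; last exact: nnmZ.
apply: nnint_le; last 1 first.
- move=> z; have [tz|ntz] := pselect (tube0 z).
    rewrite indicE in_setD [z \in tube0]mem_set// andbF mul0r.
    by apply: addr_ge0; [exact: ne.2|rewrite mulr_ge0//; exact: nf.2].
  have [Tz|nTz] := pselect (T z); last by rewrite !indicE in_setD [z \in T]memNset//= !mul0r mulr0 addr0.
  rewrite asboolF// !indicE in_setD [z \in tube0]memNset// [z \in T]mem_set//= !mul1r.
  rewrite /outside_tube indicE in_setD [z \in tube0]memNset// [z \in T]mem_set//= scale1r.
  have -> : devsq z = frob2 (A z - interface Rm Rp z).
    by apply: eq_bigr => r _; apply: eq_bigr => s _; rewrite devE// !mxE.
  apply: (le_trans (frob2_le_dist2 _ (interface_SO2 SRm SRp z))); rewrite lerD2l.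
  rewrite !ord2_sum; set M := A z - _.
  have := frobenius_coord M 0 0; have := frobenius_coord M 0 1.
  have := frobenius_coord M 1 0; have := frobenius_coord M 1 1; lra.
- apply: nnmM; last exact: devsq_nnm admA.
  by apply: nnm_indic; apply: measurableD => //; exact: tube_measurable.
- by apply: nnmD => //; exact: nnmZ.
Qed.

Lemma tube_le_energy : (mu2 tube0 <= energy lam e A S T)%E.
Proof.
rewrite /energy leeDr// integral_ge0// => x _; exact: sqre_ge0.
Qed.

Variables (m : nat) (k a b : R).
Hypotheses (m0 : (0 < m)%N) (k0 : 0 < k) (lk : 4 * ell < k) (a0 : 0 <= a) (b0 : 0 <= b).
(** Strips of width k separated by gaps of width k, so that their enlargements
    by two radii remain disjoint. *)
Definition strip_start (l : nat) : R := (2 * l%:R + 1) * k.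

Lemma strip_disjoint (i j : nat) z : strip (strip_start i) k z -> strip (strip_start j) k z -> i = j.
Proof.
move=> [_ /= /andP[h1 h2]] [_ /= /andP[h3 h4]].
wlog ij : i j h1 h2 h3 h4 / (i <= j)%N.
  by move=> H; have [/H->//|/ltnW/H->//] := leqP i j.
apply/eqP; rewrite eqn_leq ij /= leqNgt; apply/negP => ji; have lk' := lk; have kk := k0.
have : i%:R + 1 <= j%:R :> R by rewrite natr1 ler_nat.
rewrite -(ler_pM2r k0) mulrDl mul1r => hk.
move: h1 h2 h3 h4; rewrite /strip_start ![(2 * _ + 1) * k]mulrDl mul1r -![2 * _ * k]mulrA => *; lra.
Qed.

Let cost (l : 'I_m) : \bar R :=
  (a%:E * strip_dev (strip_start l) k + b%:E * mu2 (tube0 `&` strip (strip_start l) k))%E.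

Lemma strip_cost_sum : (\sum_l cost l <= a%:E * far_dev + b%:E * mu2 tube0)%E.
Proof.
have mt : measurable tube0 by exact: tube_measurable.
have ms l : measurable (strip (strip_start l) k) by exact: strip_measurable.
have nd := devsq_nnm Rm Rp admA.
have U (P : pred 'I_m) z : (forall l, P l -> strip (strip_start l) k z) -> \sum_l (P l)%:R <= 1 :> R.
  move=> H; apply: sum_unique_le1 => i j /H h1 /H h2; apply/val_inj; exact: strip_disjoint h1 h2.
have ns l : nnm (fun z => \1_(strip (strip_start l) k `\` tube0) z * devsq z).
  by apply: nnmM => //; apply: nnm_indic; exact: measurableD.
have nt l : nnm (\1_(tube0 `&` strip (strip_start l) k)) by apply: nnm_indic; exact: measurableI.
have mD : measurable (T `\` tube0) by apply: measurableD => //; exact: T_measurable.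
have d1 (l : 'I_m) : true -> (0 <= strip_dev (strip_start l) k)%E by move=> _; exact: nnint_ge0.
rewrite big_split /= -!ge0_sume_distrr//.
apply: leeD; apply: lee_wpmul2l; rewrite ?lee_fin//.
  rewrite /far_dev -nnint_sum//; apply: nnint_le.
  - exact: nnm_sum.
  - by apply: nnmM => //; exact: nnm_indic.
  move=> z; rewrite -mulr_suml; apply: ler_wpM2r; first exact: nd.2.
  have [Dz|nDz] := pselect ((T `\` tube0) z); last first.
    rewrite big1// => l _; rewrite indicE memNset// => -[[Tz _] ntz]; exact: nDz.
  rewrite [leRHS]indicE [z \in T `\` _]mem_set//.
  by apply: (U _ z) => l; rewrite inE => -[].
rewrite -(nnint_indic mt) (eq_bigr (fun l => nnint (\1_(tube0 `&` strip (strip_start (nat_of_ord l)) k)))); last first.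
  by move=> l _; rewrite nnint_indic//; exact: measurableI.
rewrite -nnint_sum//; apply: nnint_le; [exact: nnm_sum|exact: nnm_indic|].
move=> z; have [Dz|nDz] := pselect (tube0 z); last first.
  rewrite big1// => l _; rewrite indicE memNset// => -[tz _]; exact: nDz.
rewrite [leRHS]indicE [z \in tube0]mem_set//.
by apply: (U _ z) => l; rewrite inE => -[].
Qed.

(** Pigeonhole: the cheapest of m disjoint strips costs at most the mean. *)
Lemma cheap_strip : exists2 l : nat, (l < m)%N &
  (m%:R%:E * (a%:E * strip_dev (strip_start l) k + b%:E * mu2 (tube0 `&` strip (strip_start l) k)) <=
   a%:E * far_dev + b%:E * mu2 tube0)%E.
Proof.
pose i0 : 'I_m := Ordinal m0.
case: (@Order.TotalTheory.arg_minP _ _ _ i0 xpredT cost) => // l _ Hl.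
exists l => //; apply: le_trans strip_cost_sum; rewrite -/(cost l).
apply: (@le_trans _ _ (\sum_(i < m) cost l)%E); last by apply: lee_sum => i _; exact: Hl.
under [leRHS]eq_bigr do rewrite -[cost l]mul1e.
by rewrite -ge0_sume_distrl// sumEFin sumr_const card_ord.
Qed.

End StripChoice.

(** * Choice of the parameters *)

Section ScaleChoice.
Variables (R : realType) (lam tau Cp eta C1 : R).
Hypotheses (lam0 : 0 < lam) (eta0 : 0 < eta) (C10 : 0 <= C1) (Cp0 : 0 < Cp).

Lemma floor_half (x : R) : 1 <= x -> exists2 n, (0 < n)%N & n%:R <= x <= 2 * n%:R.
Proof.
move=> x1; have x0 : 0 <= x by exact: le_trans x1.
have /andP[] := truncn_itv x0; set n := Num.trunc x; rewrite -natr1 => h1 h2.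
have n0 : (0 < n)%N by rewrite -(ltr_nat R); lra.
by exists n => //; rewrite h1 /=; move: n0; rewrite -(ler_nat R) => h3; lra.
Qed.

(** The strips are sought in |x_1| <= delta and have width k = K e; the rows have
    height between M e and 2 M e. The error terms are made small in turn:
    delta takes care of the edges, K of the constants tau e, M of the slits (once K is fixed), and Z, the
    inverse of the largest scale, of everything that vanishes with e. The
    number m of strips is of order 1 / e, which beats the factor 1 / e in front
    of the energy. *)
Let delta : R := Num.min 8^-1 (eta / (40 * lam)).
Let K : R := 5 * lam + 80 * Cp ^+ 2 * tau ^+ 2 / eta.
Let M : R := 3 * lam + 20 * (K + 2 * lam) * lam / eta.
Let P : R := 3 * (2 + 4 * (2 * Cp * M / K) ^+ 2) * (C1 + 16) + 27 / lam ^+ 2 * ((K + 2 * lam) * (2 * M + 2 * lam)) * C1.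
Let Z : R := 1 + M + lam + 2 * K / delta + 40 * (K + 2 * lam) * lam / eta + 80 * lam ^+ 2 / eta + 20 * P * K / (delta * eta).

Let delta0 : 0 < delta. Proof. by rewrite /delta lt_min invr_gt0 ltr0n divr_gt0// mulr_gt0. Qed.
Let K0 : 5 * lam <= K. Proof. by rewrite lerDl divr_ge0 ?(ltW eta0)// mulr_ge0 ?sqr_ge0// mulr_ge0 ?sqr_ge0. Qed.
Let Kp : 0 < K. Proof. by apply: lt_le_trans K0; rewrite mulr_gt0. Qed.
Let M0 : 3 * lam <= M.
Proof. by rewrite lerDl divr_ge0 ?(ltW eta0)// mulr_ge0 ?(ltW lam0)// mulr_ge0// addr_ge0 ?(ltW Kp)// mulr_ge0// ltW. Qed.
Let Mp : 0 < M. Proof. by apply: lt_le_trans M0; rewrite mulr_gt0. Qed.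
Let P0 : 0 <= P.
Proof.
apply: addr_ge0; apply: mulr_ge0 => //.
- by apply: mulr_ge0 => //; apply: addr_ge0 => //; rewrite mulr_ge0// sqr_ge0.
- exact: addr_ge0.
- apply: mulr_ge0; first by rewrite divr_ge0// sqr_ge0.
  by apply: mulr_ge0; apply: addr_ge0; rewrite ?mulr_ge0// ltW.
Qed.

Let Z_parts : [/\ 0 <= M, 0 <= 2 * K / delta, 0 <= 40 * (K + 2 * lam) * lam / eta, 0 <= 80 * lam ^+ 2 / eta &
   0 <= 20 * P * K / (delta * eta)].
Proof.
split; first exact: ltW.
- by rewrite divr_ge0 ?(ltW delta0)// mulr_ge0// ltW.
- by rewrite divr_ge0 ?(ltW eta0)// mulr_ge0 ?(ltW lam0)// mulr_ge0// addr_ge0 ?(ltW Kp)// mulr_ge0// ltW.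
- by rewrite divr_ge0 ?(ltW eta0)// mulr_ge0// sqr_ge0.
- by rewrite divr_ge0//; [rewrite mulr_ge0 ?(ltW Kp)// mulr_ge0|rewrite ltW// mulr_gt0].
Qed.

Let Zp : 0 < Z. Proof. by have [h1 h2 h3 h4 h5] := Z_parts; have ll := lam0; rewrite /Z; lra. Qed.

Let Z_ge : [/\ M <= Z, 1 + lam <= Z, 2 * K / delta <= Z & [/\ 40 * (K + 2 * lam) * lam / eta <= Z,
   80 * lam ^+ 2 / eta <= Z & 20 * P * K / (delta * eta) <= Z]].
Proof.
have aux (a b c d f g : R) : 0 <= a -> 0 <= b -> 0 <= c -> 0 <= d -> 0 <= f -> 0 <= g ->
    let z := 1 + a + b + c + d + f + g in [/\ a <= z, 1 + b <= z, c <= z & [/\ d <= z, f <= z & g <= z]].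
  by move=> ? ? ? ? ? ? /=; split; [lra|lra|lra|split; lra].
by have [h1 h2 h3 h4 h5] := Z_parts; apply: aux => //; exact: ltW.
Qed.

Lemma parameters : exists2 e0 : R, 0 < e0 & forall e En : R, 0 < e -> e <= e0 -> 0 <= En -> En <= e * C1 ->
  exists (n m : nat) (k : R),
  [/\ (0 < n)%N /\ (0 < m)%N, 0 < k /\ 4 * (lam * e) < k, 2 * m%:R * k <= 8^-1,
      2 * (lam * e) < n%:R^-1 /\ lam * e < 1 &
      forall t, t + k <= 2 * m%:R * k ->
      (3 * (2 + 4 * (Cp / k) ^+ 2 * (n%:R^-1) ^+ 2) * (En + 16 * e0) +
       27 / (lam * e) ^+ 2 * ((k + 2 * (lam * e)) * (n%:R^-1 + 2 * (lam * e))) * En) / m%:R +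
      const_part n t k lam tau e Cp <= e * eta].
Proof.
exists Z^-1 => [|e En e0 eZ E0 EC]; first by rewrite invr_gt0.
have [z1 z2 z3 [z4 z5 z6]] := Z_ge; have ll := lam0; have kk := K0; have mm := M0.
have eZ1 x : x <= Z -> e * x <= 1.
  move=> xZ; apply: (@le_trans _ _ (e * Z)); first by rewrite ler_pM2l.
  by rewrite -(mulVf (lt0r_neq0 Zp)) ler_pM2r.
have Me : e * M <= 1 by exact: eZ1 z1.
have le1 : e * lam < 1.
  have := eZ1 _ z2.
  by rewrite mulrDr mulr1; lra.
have Kd : e * (2 * K / delta) <= 1 by exact: eZ1 z3.
have Ze x : x <= Z -> x * Z^-1 <= 1 by move=> xZ; rewrite ler_pdivrMr// mul1r.
have [n n0 /andP[n1 n2]] := @floor_half (e * M)^-1 (ltac:(by rewrite invf_ge1// mulr_gt0)).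
have [m m0 /andP[m1 m2]] := @floor_half (e * (2 * K / delta))^-1
  (ltac:(by rewrite invf_ge1// mulr_gt0// divr_gt0// mulr_gt0)).
have n0' : 0 < n%:R :> R by rewrite ltr0n.
have m0' : 0 < m%:R :> R by rewrite ltr0n.
have hM : e * M <= n%:R^-1 by rewrite -[leLHS]invrK lef_pV2// posrE invr_gt0 mulr_gt0.
have h2M : n%:R^-1 <= 2 * (e * M).
  rewrite -[n%:R^-1]mul1r ler_pdivrMr//.
  by move: n2; rewrite -[X in X <= _ -> _]mul1r ler_pdivrMr ?mulr_gt0// => n2; lra.
have Kd0 : 0 < e * (2 * K / delta) by rewrite mulr_gt0// divr_gt0// mulr_gt0.
have mk : 2 * m%:R * (K * e) <= delta.
  move: m1; rewrite -[leRHS]mul1r ler_pdivlMr//.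
  rewrite (_ : _ * (e * _) = 2 * m%:R * (K * e) / delta); last by field; rewrite ?gt_eqF.
  by rewrite ler_pdivrMr// mul1r.
have im : m%:R^-1 <= 4 * K * e / delta.
  rewrite -[m%:R^-1]mul1r ler_pdivrMr//.
  move: m2; rewrite -[X in X <= _ -> _]mul1r ler_pdivrMr// => m2.
  apply: le_trans m2 _; rewrite le_eqVlt; apply/orP; left; apply/eqP; field; rewrite ?gt_eqF//.
clear n2 m1 m2.
have d8 : delta <= 8^-1 by rewrite /delta ge_min lexx.
have dl : delta * (40 * lam) <= eta.
  by rewrite -ler_pdivlMr ?mulr_gt0// /delta ge_min lexx orbT.
have el : 0 < lam * e by rewrite mulr_gt0.
exists n, m, (K * e); split.
- by split.
- by split; [rewrite mulr_gt0|rewrite mulrA ltr_pM2r//; lra].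
- exact: le_trans mk d8.
- split; last by rewrite mulrC.
  by apply: lt_le_trans hM; rewrite mulrA [e * _]mulrC ltr_pM2r//; lra.
move=> t tk; have {}tk : t + K * e <= delta by exact: le_trans tk mk.
have X2 : 4 * (4 * (Cp / (K * e)) ^+ 2) * (tau * e) ^+ 2 * (K * e) <= e * (eta / 5).
  rewrite (_ : _ * (K * e) = e * (16 * Cp ^+ 2 * tau ^+ 2 / K)); last by field; rewrite ?gt_eqF.
  have EK : eta * K = 5 * (eta * lam) + 80 * Cp ^+ 2 * tau ^+ 2 by rewrite /K; field; rewrite ?gt_eqF.
  have el0 : 0 < eta * lam by rewrite mulr_gt0.
  by rewrite ler_pM2l// ler_pdivrMr//; lra.
have X3 : 2 * n.+1%:R * ((K * e + 2 * (lam * e)) * (2 * (lam * e))) <= e * (eta / 5 + eta / 10).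
  rewrite (_ : _ * (_ * _) = e * (4 * (K + 2 * lam) * lam * (n%:R * e) + 4 * (K + 2 * lam) * lam * e)); last first.
    by rewrite -(natr1 n); ring.
  have q0 : 0 < 4 * (K + 2 * lam) * lam by rewrite mulr_gt0// mulr_gt0//; lra.
  rewrite ler_pM2l//; apply: lerD.
    apply: (@le_trans _ _ (4 * (K + 2 * lam) * lam * M^-1)).
      by rewrite ler_pM2l// -ler_pdivlMr// -invfM mulrC.
    have EM : eta * M = 3 * (eta * lam) + 20 * (K + 2 * lam) * lam by rewrite /M; field; rewrite ?gt_eqF.
    have el0 : 0 < eta * lam by rewrite mulr_gt0.
    by rewrite ler_pdivrMr//; lra.
  have := eZ1 _ z4.
  by rewrite mulrA ler_pdivrMr// mul1r; lra.
have X4 : 2 * ((2 * (t + K * e) + 2 * (lam * e)) * (2 * (lam * e))) <= e * (eta / 5 + eta / 10).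
  rewrite (_ : 2 * _ = e * (8 * lam * (t + K * e) + 8 * lam ^+ 2 * e)); last by ring.
  rewrite ler_pM2l//; apply: lerD.
    apply: (@le_trans _ _ (8 * lam * delta)); first by rewrite ler_pM2l ?mulr_gt0.
    lra.
  have := eZ1 _ z5.
  by rewrite mulrA ler_pdivrMr// mul1r; lra.
have a1 : 4 * (Cp / (K * e)) ^+ 2 * (n%:R^-1) ^+ 2 <= 4 * (2 * Cp * M / K) ^+ 2.
  rewrite -mulrA -exprMn ler_pM2l// lerXn2r ?nnegrE//.
  - by rewrite mulr_ge0 ?invr_ge0// divr_ge0 ?(ltW Cp0)// ltW// mulr_gt0.
  - by rewrite divr_ge0 ?(ltW Kp)// mulr_ge0 ?(ltW Mp)// mulr_ge0// ltW.
  rewrite (_ : 2 * Cp * M / K = Cp / (K * e) * (2 * (e * M))); last by field; rewrite ?gt_eqF.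
  by rewrite ler_pM2l// divr_gt0// mulr_gt0.
have EZ : En <= Z^-1 * C1 by apply: le_trans EC _; exact: ler_wpM2r.
have A1 : 3 * (2 + 4 * (Cp / (K * e)) ^+ 2 * (n%:R^-1) ^+ 2) * (En + 16 * Z^-1) <=
   3 * (2 + 4 * (2 * Cp * M / K) ^+ 2) * (Z^-1 * (C1 + 16)).
  have z0 : 0 < Z^-1 by rewrite invr_gt0.
  apply: ler_pM; [|lra|lra|rewrite mulrDr; lra].
  by rewrite mulr_ge0// addr_ge0// mulr_ge0 ?sqr_ge0// mulr_ge0// sqr_ge0.
have B1 : 27 / (lam * e) ^+ 2 * ((K * e + 2 * (lam * e)) * (n%:R^-1 + 2 * (lam * e))) * En <=
   27 / lam ^+ 2 * ((K + 2 * lam) * (2 * M + 2 * lam)) * (Z^-1 * C1).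
  have q0 : 0 <= 27 / lam ^+ 2 by rewrite divr_ge0// sqr_ge0.
  apply: ler_pM => //.
    by rewrite mulr_ge0 ?divr_ge0 ?sqr_ge0// mulr_ge0// addr_ge0 ?invr_ge0// ?mulr_ge0// ltW.
  rewrite (_ : 27 / (lam * e) ^+ 2 * _ = 27 / lam ^+ 2 * ((K + 2 * lam) * (n%:R^-1 / e + 2 * lam))); last first.
    by field; rewrite ?gt_eqF.
  apply: ler_wpM2l => //; rewrite ler_pM2l; last by lra.
  rewrite lerD2r ler_pdivrMr//; lra.
have X1 : (3 * (2 + 4 * (Cp / (K * e)) ^+ 2 * (n%:R^-1) ^+ 2) * (En + 16 * Z^-1) +
       27 / (lam * e) ^+ 2 * ((K * e + 2 * (lam * e)) * (n%:R^-1 + 2 * (lam * e))) * En) / m%:R <= e * (eta / 5).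
  apply: (@le_trans _ _ (Z^-1 * P * (4 * K * e / delta))).
    apply: ler_pM => //.
    - apply: addr_ge0; apply: mulr_ge0 => //.
      + by rewrite mulr_ge0// addr_ge0// mulr_ge0 ?sqr_ge0// mulr_ge0// sqr_ge0.
      + by rewrite addr_ge0// mulr_ge0// invr_ge0 ltW.
      + by rewrite mulr_ge0 ?divr_ge0 ?sqr_ge0// mulr_ge0// addr_ge0 ?invr_ge0// ?mulr_ge0// ltW.
    - apply: le_trans (lerD A1 B1) _; rewrite /P le_eqVlt; apply/orP; left; apply/eqP; ring.
  rewrite (_ : Z^-1 * P * _ = e * (eta / 5) * (20 * P * K / (delta * eta) * Z^-1)); last first.
    by field; rewrite ?gt_eqF.
  rewrite -[leRHS]mulr1; apply: ler_wpM2l; first by rewrite mulr_ge0 ?divr_ge0// ltW.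
  exact: Ze z6.
by apply: le_trans (lerD X1 (lerD X2 (lerD X3 X4))) _; rewrite -!mulrDr ler_pM2l//; lra.
Qed.

End ScaleChoice.

Section Localisation.
Variables (R : realType) (lam tau : R) (Rm Rp : 'M[R]_2).
Hypotheses (lam0 : 0 < lam) (tau0 : 0 < tau) (SRm : SO2 Rm) (SRp : SO2 Rp).
Notation leb := (@lebesgue_measure R).
Notation mu2 := (leb \x leb)%E.
Local Notation T := (open_square (2^-1 : R)).

(** Weld in the cheapest strip, and tile: a single competitor of low energy, at
    one sufficiently small scale, is worth a competitor at every smaller scale.
    The bound C1 on its energy is fixed beforehand because the admissible size
    of e depends on it. *)
Lemma localisation (eta C1 : R) : 0 < eta -> 0 <= C1 -> exists2 e0 : R, 0 < e0 &
  forall e A S, 0 < e -> e <= e0 -> admissible tau e T A S ->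
  (energy lam e A S T <= (e * C1)%:E)%E ->
  (\int[mu2]_(x in T) (frobenius (outside_tube T (lam * e) A S x - interface Rm Rp x))%:E <= e0%:E)%E ->
  exists w w' : R, forall rho, 0 < rho -> rho <= 1 -> exists (G : R * R -> 'M[R]_2) (S' : set (R * R)),
  [/\ admissible tau (rho * e) T G S',
      (energy lam (rho * e) G S' T <= rho%:E * (energy lam e A S T + (e * eta)%:E) + (rho ^+ 2 * w')%:E)%E,
      (\int[mu2]_(x in T) (frobenius (G x - interface Rm Rp x))%:E <= (rho * w)%:E)%E &
      forall x, rho < `|x.1| -> G x = interface Rm Rp x].
Proof.
move=> eta0 C10; have [Cp Cp0 HCp] := D_plateau_bounded R.
have [e0 e00 He0] := parameters tau lam0 eta0 C10 Cp0.
exists e0 => // e A S ep ee adm EC CD.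
have [_ [C0 cC0 ES] _ _] := adm; rewrite ES in adm EC CD *.
have E0 : (0 <= energy lam e A (T `&` C0) T)%E.
  by have [LA _ _ _] := adm; have [-> n1] := energy_nnint lam e (T `&` C0) LA; exact: nnint_ge0.
have Efin : energy lam e A (T `&` C0) T \is a fin_num.
  by rewrite ge0_fin_numE//; apply: le_lt_trans EC _; exact: ltry.
set En := fine (energy lam e A (T `&` C0) T).
have EE : energy lam e A (T `&` C0) T = En%:E by rewrite fineK.
have [||n [m [k [[n0 m0] [k0 lk] mk [n2 l1] H]]]] := He0 e En ep ee.
- by rewrite -lee_fin -EE.
- by rewrite -lee_fin -EE.
have el : 0 < lam * e by rewrite mulr_gt0.
pose K4 := 4 * (Cp / k) ^+ 2.
pose a := 3 * (2 + K4 * (n%:R^-1) ^+ 2).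
pose b := 27 / (lam * e) ^+ 2 * ((k + 2 * (lam * e)) * (n%:R^-1 + 2 * (lam * e))).
have a0 : 0 <= a.
  by rewrite mulr_ge0// addr_ge0// mulr_ge0 ?sqr_ge0// mulr_ge0// sqr_ge0.
have b0 : 0 <= b.
  by rewrite mulr_ge0 ?divr_ge0 ?sqr_ge0// mulr_ge0// addr_ge0 ?invr_ge0// ?mulr_ge0// ltW.
have m0' : 0 < m%:R :> R by rewrite ltr0n.
have [l lm Hl] := cheap_strip Rm Rp adm m0 k0 lk a0 b0.
pose t := strip_start k l.
have t0 : 0 < t by rewrite mulr_gt0// ltr_wpDl// mulr_ge0.
have tm : t + k <= 2 * m%:R * k.
  rewrite /t /strip_start (_ : _ + k = 2 * (l%:R + 1) * k); last by ring.
  by rewrite ler_pM2r// ler_pM2l// natr1 ler_nat.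
have tk : t + k < 2^-1 by lra.
have lek : lam * e <= k by lra.
have tlk : t + lam * e < 2^-1 by lra.
have t2 : 2 * (lam * e) < t.
  have : k <= t by rewrite /t /strip_start -[leLHS]mul1r ler_pM2r// lerDr mulr_ge0.
  lra.
have dphi_le s : `|'D_1 (plateau (- t) t k) s| <= Cp / k by exact: HCp.
have M0 := majorant_integral Cp n0 t0 k0 lam0 ep t2 n2 l1 Rm Rp adm.
have [w w0 Hw] := tile_scaling n0 t0 k0 tk lam0 tau0 ep lek tlk cC0 SRm SRp dphi_le adm.
exists w, ((2 * (t + k) + 2 * (lam * e)) * (1 + 2 * (lam * e))) => rho r0 r1.
have [G [S' [h1 h2 h3 h4]]] := Hw rho r0 r1; exists G, S'; split=> //.
apply: le_trans h2 _; apply: leeD => //; apply: lee_wpmul2l; first by rewrite lee_fin ltW.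
apply: le_trans M0 _; apply: leeD => //.
have F1 : (far_dev lam e C0 A Rm Rp <= (En + 16 * e0)%:E)%E.
  apply: le_trans (far_dev_le lam SRm SRp adm) _; rewrite EE (EFinD En).
  by apply: leeD => //; rewrite EFinM; exact: lee_wpmul2l.
have F2 : (mu2 (tube T (lam * e) (T `&` C0)) <= En%:E)%E by rewrite -EE; exact: tube_le_energy.
have Y : (a%:E * strip_dev t k lam e C0 A Rm Rp + b%:E * mu2 (tube T (lam * e) (T `&` C0) `&` strip t k lam e) <=
   ((a * (En + 16 * e0) + b * En) / m%:R)%:E)%E.
  rewrite [leRHS]EFinM lee_pdivlMr// muleC; apply: le_trans Hl _; rewrite [leRHS]EFinD.
  by rewrite [X in (_ <= X + _)%E]EFinM [X in (_ <= _ + X)%E]EFinM; apply: leeD; apply: lee_wpmul2l.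
rewrite addeCA.
apply: (@le_trans _ _ ((const_part n t k lam tau e Cp)%:E + ((a * (En + 16 * e0) + b * En) / m%:R)%:E)%E).
  by apply: leeD.
by rewrite -EFinD lee_fin addrC; exact: H.
Qed.

End Localisation.

(** * Lower limits and bounds on the optimal energy *)

Section LowerLimits.
Variable R : realType.
Implicit Types f g : R -> \bar R.
Local Open Scope ereal_scope.

Lemma limf_einf_lt f (a : \bar R) (P : R -> Prop) : limf_einf f 0^'+ < a ->
  (\forall e \near 0%R^'+, P e) -> exists2 e, P e & f e < a.
Proof.
rewrite limf_einfE => h hP.
have : ereal_inf (f @` [set e | P e]) < a.
  by apply: le_lt_trans h; apply: ereal_sup_ubound; exists [set e | P e].
by move=> /ereal_inf_lt[_ [e Pe <-] fe]; exists e.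
Qed.

Lemma limf_einf_gt f (a : \bar R) : a < limf_einf f 0^'+ -> \forall e \near 0%R^'+, a < f e.
Proof.
rewrite limf_einfE => /ereal_sup_gt[_ [V FV <-] h].
by apply: filterS FV => e Ve; apply: lt_le_trans h _; apply: ereal_inf_lbound; exists e.
Qed.

Lemma limf_einf_ge f (a : \bar R) : (\forall e \near 0%R^'+, a <= f e) -> a <= limf_einf f 0^'+.
Proof.
move=> h; rewrite limf_einfE; apply: le_trans (ereal_sup_ubound _); last first.
  by exists [set e | a <= f e].
by apply: le_ereal_inf_tmp => _ [e /= ae <-].
Qed.

Lemma limf_einf_le f (a : \bar R) : (\forall e \near 0%R^'+, f e <= a) -> limf_einf f 0^'+ <= a.
Proof.
move=> h; rewrite leNgt; apply/negP => /limf_einf_gt h2.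
have [e [h1 h3]] := @filter_ex _ _ (at_right_proper_filter (0 : R)%R) _ (filterI h h2).
by move: (le_lt_trans h1 h3); rewrite ltxx.
Qed.

Lemma cvg_right_fin f (p : R) : (forall d : R, (0 < d)%R -> \forall e \near 0%R^'+, (p - d)%:E <= f e <= (p + d)%:E) ->
  f e @[e --> 0%R^'+] --> p%:E.
Proof.
move=> H; apply/fine_cvgP; split.
  apply: filterS (H _ ltr01) => e /andP[h1 h2]; rewrite fin_numE.
  by apply/andP; split; apply/eqP => E; move: h1 h2; rewrite E.
apply/cvgrPdist_le => d d0; apply: filterS (H _ d0) => e /andP[] /=.
case: (f e) => [r| |]//=; rewrite !lee_fin => h1 h2.
by rewrite distrC ler_distl h1 h2.
Qed.

Lemma cvg_right_squeeze0 f : (forall e, 0 <= f e) ->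
  (forall d : R, (0 < d)%R -> \forall e \near 0%R^'+, f e <= d%:E) -> f e @[e --> 0%R^'+] --> 0.
Proof.
move=> f0 H; apply: cvg_right_fin => d d0; apply: filterS (H d d0) => e h.
by rewrite sub0r add0r h andbT; apply: le_trans (f0 e); rewrite lee_fin oppr_le0 ltW.
Qed.

Lemma cvg_right_le f (d : R) : f e @[e --> 0%R^'+] --> 0 -> (0 < d)%R -> \forall e \near 0%R^'+, f e <= d%:E.
Proof.
move=> /fine_cvgP[h1 /cvgrPdist_le h2] d0; apply: filterS2 h1 (h2 _ d0) => e /=.
case: (f e) => [r| |]// _; rewrite sub0r normrN lee_fin; exact: le_trans (ler_norm _).
Qed.

End LowerLimits.

Section Competitors.
Variables (R : realType) (lam tau : R) (Rm Rp : 'M[R]_2).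
Hypotheses (lam0 : 0 < lam) (tau0 : 0 < tau) (SRm : SO2 Rm) (SRp : SO2 Rp).
Notation leb := (@lebesgue_measure R).
Notation mu2 := (leb \x leb)%E.
Local Notation T := (open_square (2^-1 : R)).
Local Notation I := (interface Rm Rp).
Local Notation dist1 A := (\int[mu2]_(x in T) (frobenius (A x - I x))%:E)%E.
Local Notation psi := (psi0 lam tau Rm Rp).

Lemma energy_ge0 e A S : L1_field T A -> (0 <= energy lam e A S T)%E.
Proof. by move=> LA; have [-> ne] := energy_nnint lam e S LA; exact: nnint_ge0. Qed.

(** On the tube the interface is bounded, and the area of the tube is part of the
    energy. *)
Lemma outside_dist e A S : admissible tau e T A S ->
  (dist1 (outside_tube T (lam * e) A S) <= dist1 A + 4%:E * energy lam e A S T)%E.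
Proof.
move=> adm; have [LA [C0 _ ES] _ _] := adm; rewrite ES in adm *.
have LO := outside_L1 lam adm; have mT := @T_measurable R.
have mt : measurable (tube T (lam * e) (T `&` C0)) by exact: tube_measurable.
apply: (@le_trans _ _ (dist1 A + 4%:E * mu2 (tube T (lam * e) (T `&` C0)))%E); last first.
  by apply: leeD => //; apply: lee_wpmul2l => //; exact: tube_le_energy.
have nA := frobenius_T_nnm Rm Rp LA; have nO := frobenius_T_nnm Rm Rp LO; have nt := nnm_indic mt.
rewrite !integral_restrict// -(nnint_indic mt) -nnintZ// -nnintD//; last exact: nnmZ.
apply: nnint_le => //; first by apply: nnmD => //; exact: nnmZ.
move=> x; have [Tx|nTx] := pselect (T x); last by rewrite [\1_T x]indicE memNset// !mul0r add0r mulr_ge0.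
rewrite [\1_T x]indicE mem_set// !mul1r /outside_tube.
have [tx|ntx] := pselect (tube T (lam * e) (T `&` C0) x); rewrite !indicE in_setD.
  rewrite [x \in tube _ _ _]mem_set// andbF scale0r sub0r mulr1.
  apply: (@le_trans _ _ 4); last by rewrite lerDr sqrtr_ge0.
  apply: (le_trans (frobenius_le _)).
  have h r s : `|(- I x) r s| <= 1 by rewrite mxE normrN; apply: SO2_entry_le; exact: interface_SO2.
  rewrite !ord2_sum; have := h 0 0; have := h 0 1; have := h 1 0; have := h 1 1; lra.
by rewrite [x \in tube _ _ _]memNset// [x \in T]mem_set//= scale1r mulr0 addr0.
Qed.

Lemma interface_L1 : L1_field T I.
Proof.
have mT := @T_measurable R; apply: L1_field_entry => // r s.
rewrite (_ : entry _ _ _ _ = fun x => \1_T x * jump (Rm r s) (Rp r s) x).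
  by apply: jump_integ => //; exact: T_finite.
by apply/funext => x; rewrite /entry jumpE.
Qed.

Local Notation axis := [set x : R * R | x.1 = 0].

(** A test function that is integral near the axis is constant along it, hence
    vanishes there, and row_pairing_interface applies. *)
Lemma interface_admissible e : 0 < e -> admissible tau e T I (T `&` axis).
Proof.
move=> e0; apply: admissible_of_lattice => //; [exact: open_square_open|exact: interface_L1| |].
  rewrite (_ : axis = fst @^-1` [set 0 : R]); last by [].
  by apply: closed_comp; [move=> x _; exact: cvg_fst|exact: closed_eq].
move=> r phi tphi iphi; rewrite (_ : row_pairing _ _ _ = 0); first exact: in_lattice0.
have [sphi _ suppT] := tphi; have [cphi _ _] := partial_continuous sphi.
have {}iphi : int_near axis phi.
  move=> x Sx; have [Tx|nTx] := pselect (T x); first by apply: iphi.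
  by exists 0; apply: supp_near0 => /suppT.
rewrite -[RHS](@row_pairing_interface R 2^-1 (Rm r 0) (Rp r 0) (Rm r 1) (Rp r 1) phi) ?invr_gt0//.
  by congr (row_pairing _ _ _); apply/funext => x; rewrite /entry /interface; case: ifP.
move=> y; have [_ ver] := int_near_continuous_const cphi iphi.
rewrite (ver 0 y (Num.max y 1)) ?le_max ?lexx//.
apply: (test_out tphi) => -[_ /=]; rewrite in_itv /= => /andP[_].
rewrite gt_max => /andP[_]; lra.
Qed.

Lemma interface_energy e : 0 < e -> (energy lam e I (T `&` axis) T <= (2 * lam * e)%:E)%E.
Proof.
move=> e0; have le0 : 0 < lam * e by rewrite mulr_gt0.
have [-> ne] := energy_nnint lam e (T `&` axis) interface_L1.
rewrite (_ : 2 * lam * e = (lam * e - - (lam * e)) * (2^-1 - - 2^-1)); last by lra.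
rewrite -box_measure; [|lra|lra].
have mb : measurable (box (- (lam * e)) (lam * e) (- 2^-1) 2^-1 : set (R * R)) by exact: box_measurable.
rewrite -(nnint_indic mb); apply: nnint_le; [exact: ne|exact: (nnm_indic mb)|].
move=> x; have [Tx|nTx] := pselect (T x); last by rewrite indicE memNset// mul0r.
rewrite indicE mem_set// mul1r; case: asboolP => [|_]; last by rewrite dist2_SO2_0//; exact: interface_SO2.
move=> /tubeP[_ [s [_ /= s0] h]]; rewrite indicE mem_set//.
have [/= h1 _] := enorm_coord (x - s); have {h1} := le_lt_trans h1 h; rewrite s0 subr0 ltr_norml => /andP[h1 h2].
move: Tx => [_ /=]; rewrite in_itv /= => /andP[h3 h4].
by split; rewrite /= in_itv /= !ltW.
Qed.

(** The interface itself, with the axis as singular set, is a competitor of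
    energy the area of a tube of radius lam e. Finiteness is what allows nearly
    optimal competitors to be chosen. *)
Lemma psi0_bounds : (0 <= psi <= (2 * lam)%:E)%E.
Proof.
have pos : \forall e \near (0:R)^'+, 0 < e by exact: nbhs_right_gt.
apply/andP; split.
  apply: le_ereal_inf_tmp => _ [A [S [adm _ ->]]]; apply: limf_einf_ge.
  apply: filterS pos => e e0; have [LA _ _ _] := adm e e0.
  by rewrite mule_ge0// ?lee_fin ?invr_ge0 ?(ltW e0)//; exact: energy_ge0.
have D0 : dist1 I = 0%E.
  rewrite integral_restrict; last exact: T_measurable.
  rewrite (@nnint_eq _ _ (fun=> 0)); first by rewrite /nnint integral0.
  by move=> x; rewrite subrr /frobenius big1 ?sqrtr0 ?mulr0// => i _; rewrite big1// => j _; rewrite mxE expr0n.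
apply: ge_ereal_inf; exists (limf_einf (fun e : R => ((e^-1)%:E * energy lam e I (T `&` axis) T)%E) 0^'+).
  exists (fun=> I), (fun=> T `&` axis); split=> //; first exact: interface_admissible.
  apply: cvg_right_squeeze0 => [e|d d0]; first by apply: integral_ge0 => x _; rewrite lee_fin sqrtr_ge0.
  have l8 : 0 < 8 * lam by rewrite mulr_gt0.
  apply: filterS2 pos (nbhs_right_le (divr_gt0 d0 l8)) => e e0; rewrite ler_pdivlMr// => ed.
  apply: le_trans (outside_dist (interface_admissible e0)) _; rewrite D0 add0e.
  apply: (@le_trans _ _ (4%:E * (2 * lam * e)%:E)%E); first by apply: lee_wpmul2l => //; exact: interface_energy.
  by rewrite -EFinM lee_fin; lra.
apply: limf_einf_le; apply: filterS pos => e e0; rewrite lee_pdivrMl//.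
by apply: le_trans (interface_energy e0) _; rewrite -EFinM lee_fin mulrC.
Qed.

End Competitors.

(** * The recovery family *)

Section Recovery.
Variables (R : realType) (lam tau : R) (Rm Rp : 'M[R]_2).
Hypotheses (lam0 : 0 < lam) (tau0 : 0 < tau) (SRm : SO2 Rm) (SRp : SO2 Rp).
Notation leb := (@lebesgue_measure R).
Notation mu2 := (leb \x leb)%E.
Local Notation T := (open_square (2^-1 : R)).
Local Notation I := (interface Rm Rp).
Local Notation dist1 A := (\int[mu2]_(x in T) (frobenius (A x - I x))%:E)%E.
Local Notation psi := (psi0 lam tau Rm Rp).
Let p0 : R := fine psi.

Lemma psi0_fin : psi = p0%:E /\ 0 <= p0.
Proof.
have /andP[h1 h2] := psi0_bounds lam0 tau0 SRm SRp.
have fp : psi \is a fin_num by rewrite ge0_fin_numE//; apply: le_lt_trans h2 _; exact: ltry.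
by rewrite /p0 fineK//; split=> //; apply: fine_ge0.
Qed.

Definition near_optimal (eps eta : R) (A : R * R -> 'M[R]_2) (S : set (R * R)) :=
  [/\ admissible tau eps T A S, (energy lam eps A S T <= (eps * (p0 + eta))%:E)%E,
      (dist1 A <= eta%:E)%E & forall x, eta < `|x.1| -> A x = I x].

Lemma near_optimal_le eps eta eta' A S : 0 < eps -> eta <= eta' ->
  near_optimal eps eta A S -> near_optimal eps eta' A S.
Proof.
move=> ep ee [h1 h2 h3 h4]; split=> //.
- by apply: le_trans h2 _; rewrite lee_fin ler_pM2l// lerD2l.
- by apply: le_trans h3 _; rewrite lee_fin.
- by move=> x hx; apply: h4; exact: le_lt_trans hx.
Qed.

(** A competitor for the lower limit provides one small scale with energy near
    the optimal one, and localisation provides the smaller scales. *)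
Lemma near_optimal_exists (eta : R) : 0 < eta ->
  \forall eps \near 0^'+, exists A S, near_optimal eps eta A S.
Proof.
move=> eta0; have [Ep p00] := psi0_fin; have e4 : 0 < eta / 4 by rewrite divr_gt0.
have C10 : 0 <= p0 + eta / 4 by rewrite addr_ge0// ltW.
have [e0 e00 He0] := localisation lam0 tau0 SRm SRp e4 C10.
have : (psi < (p0 + eta / 4)%:E)%E by rewrite Ep lte_fin ltrDl.
move=> /ereal_inf_lt[_ [A [S [adm cvA ->]]] hl].
have pos : \forall e \near (0 : R)^'+, 0 < e by exact: nbhs_right_gt.
have [e [[e1 e2] e3] he] := limf_einf_lt hl (filterI (filterI pos (nbhs_right_le e00)) (cvg_right_le cvA e00)).
have hE : (energy lam e (A e) (S e) T <= (e * (p0 + eta / 4))%:E)%E.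
  by rewrite EFinM -lee_pdivrMl//; exact: ltW.
have [w [w' Hw]] := He0 e (A e) (S e) e1 e2 (adm e e1) hE e3.
pose Z := 1 + `|w| / eta + eta^-1 + 2 * `|w'| / (e * eta).
have q1 : 0 <= `|w| / eta by rewrite divr_ge0// ltW.
have q2 : 0 < eta^-1 by rewrite invr_gt0.
have q3 : 0 <= 2 * `|w'| / (e * eta) by rewrite divr_ge0 ?mulr_ge0// ltW.
have Z0 : 0 < Z by rewrite /Z; lra.
have eZ : 0 < e / Z by rewrite divr_gt0.
apply: filterS2 pos (nbhs_right_le eZ) => eps ep; rewrite ler_pdivlMr// => epsZ.
have [rho rhoE] : exists rho, rho = eps / e by exists (eps / e).
have r0 : 0 < rho by rewrite rhoE divr_gt0.
have rZ x : x <= Z -> rho * x <= 1.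
  move=> xZ; rewrite rhoE mulrAC ler_pdivrMr// mul1r; apply: le_trans epsZ.
  by rewrite ler_pM2l.
have r1 : rho <= 1 by rewrite -[rho]mulr1; apply: rZ; rewrite /Z; lra.
have [G [S' [h1 h2 h3 h4]]] := Hw rho r0 r1.
have re : rho * e = eps by rewrite rhoE divfK// gt_eqF.
rewrite re in h1 h2; exists G, S'; split=> //.
- apply: le_trans h2 _; apply: (@le_trans _ _ (rho%:E * ((e * (p0 + eta / 4))%:E + (e * (eta / 4))%:E) + (rho ^+ 2 * w')%:E)%E).
    by apply: leeD => //; apply: lee_wpmul2l; rewrite ?lee_fin ?(ltW r0)//; apply: leeD.
  rewrite -(EFinD (e * _)) -(EFinM rho) -EFinD lee_fin -re.
  have h : rho * (2 * `|w'|) <= e * eta.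
    rewrite -[leRHS]mul1r -ler_pdivrMr ?mulr_gt0// -mulrA.
    by apply: rZ; rewrite /Z; lra.
  have h' : rho * w' <= rho * `|w'| by rewrite ler_pM2l// ler_norm.
  rewrite [leLHS](_ : _ = rho * (e * (p0 + eta / 4) + e * (eta / 4) + rho * w')); last by ring.
  by rewrite -[leRHS]mulrA ler_pM2l//; lra.
- apply: le_trans h3 _; rewrite lee_fin.
  have : rho * (`|w| / eta) <= 1 by apply: rZ; rewrite /Z; lra.
  rewrite mulrA ler_pdivrMr// mul1r; apply: le_trans; rewrite ler_pM2l//; exact: ler_norm.
- move=> x hx; apply: h4; apply: le_lt_trans hx.
  have : rho * eta^-1 <= 1 by apply: rZ; rewrite /Z; lra.
  by rewrite ler_pdivrMr// mul1r.
Qed.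

(** Diagonal choice: at each scale, a competitor that is as good as any up to
    a number of levels growing to infinity as the scale vanishes. *)
Lemma diagonal : exists A : R -> R * R -> 'M[R]_2,
  (forall eps, 0 < eps -> L1_field T (A eps)) /\
  forall eta, 0 < eta -> \forall eps \near 0^'+, exists S, near_optimal eps eta (A eps) S.
Proof.
pose lev (i : nat) : R := i.+1%:R^-1.
have H eps : exists A : R * R -> 'M[R]_2, (0 < eps -> L1_field T A) /\
    forall i, 0 < eps -> i%:R <= eps^-1 -> (exists A' S', near_optimal eps (lev i) A' S') ->
    exists S, near_optimal eps (lev i) A S.
  have [ep|nep] := boolP (0 < eps); last by exists I.
  have iep : 0 <= eps^-1 by rewrite invr_ge0 ltW.
  pose P i := (i%:R <= eps^-1) && `[< exists A' S', near_optimal eps (lev i) A' S' >].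
  have [[i0 Pi0]|nP] := pselect (exists i, P i); last first.
    exists I; split=> [_|i _ hi hA]; first exact: interface_L1.
    by exfalso; apply: nP; exists i; rewrite /P hi asboolT.
  have Pb i : P i -> (i <= Num.trunc eps^-1)%N.
    by move=> /andP[hi _]; rewrite truncn_ge_nat.
  case: (ex_maxnP (ex_intro _ i0 Pi0) Pb) => j /andP[_ /asboolP[A [S AS]]] jmax.
  exists A; split=> [_|i _ hi hA]; first by case: AS => -[].
  exists S; apply: near_optimal_le AS => //.
  by rewrite /lev lef_pV2 ?posrE// ler_nat ltnS; apply: jmax; rewrite /P hi asboolT.
have [A HA] := choice H; exists A; split=> [eps|eta eta0]; first exact: (HA eps).1.
have [i Hi] : exists i, lev i <= eta.
  exists (Num.trunc eta^-1); rewrite /lev -[leRHS]invrK lef_pV2 ?posrE ?invr_gt0//.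
  by apply/ltW; have /andP[] := truncn_itv (ltW (ltac:(by rewrite invr_gt0) : 0 < eta^-1)).
have l0 : 0 < lev i by rewrite invr_gt0.
have pos : \forall e \near (0 : R)^'+, 0 < e by exact: nbhs_right_gt.
apply: filterS2 (filterI pos (nbhs_right_le l0)) (near_optimal_exists l0) => eps [ep el] hA.
have [|S HS] := (HA eps).2 i ep _ hA; last by exists S; exact: near_optimal_le HS.
apply: (@le_trans _ _ i.+1%:R); first by rewrite ler_nat.
by rewrite -[leLHS]invrK lef_pV2 ?posrE.
Qed.

(** With everything singular there is no circuit left to test. *)
Lemma whole_admissible e A : L1_field T A -> admissible tau e T A T.
Proof.
move=> LA; split=> //.
- by exists setT; [exact: closedT|rewrite setIT].
- by move=> x [].
move=> gamma D phi _ _ tr; exfalso.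
by have [] : (T `\` T) (gamma 0) by apply: tr; exists 0 => //=; rewrite in_itv /= lexx ler01.
Qed.

Lemma reduced_ge0 e A : 0 < e -> L1_field T A -> (0 <= ereal_inf [set energy lam e A S T | S in admissible tau e T A])%E.
Proof. by move=> e0 LA; apply: le_ereal_inf_tmp => _ [S adm <-]; exact: energy_ge0. Qed.

(** The infimum in the reduced energy need not be attained; an error e^2 is
    negligible after division by e. *)
Lemma almost_optimal e A : 0 < e -> L1_field T A -> exists2 S, admissible tau e T A S &
  (energy lam e A S T <= ereal_inf [set energy lam e A S T | S in admissible tau e T A] + (e ^+ 2)%:E)%E.
Proof.
move=> e0 LA; have g0 := reduced_ge0 e0 LA.
set m := ereal_inf _ in g0 *; have [mf|] := boolP (m \is a fin_num).
  have [_ [S adm <-] h] := lb_ereal_inf_adherent (ltac:(by rewrite exprn_gt0) : 0 < e ^+ 2) mf.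
  by exists S => //; exact: ltW.
rewrite ge0_fin_numE// ltey negbK => /eqP ->; exists T; first exact: whole_admissible.
by rewrite addye// leey.
Qed.

Lemma reduced_near_optimal e eta A S : 0 < e -> near_optimal e eta A S ->
  (ereal_inf [set energy lam e A S T | S in admissible tau e T A] <= (e * (p0 + eta))%:E)%E.
Proof. by move=> e0 [adm h _ _]; apply: le_trans h; apply: ereal_inf_lbound; exists S. Qed.

(** Almost optimal singular sets for the recovery fields themselves form a
    competitor for the infimum that defines the optimal energy: their tubes have
    area of order the scale, so that the truncated fields still converge. *)
Lemma reduced_energy_lower A : (forall eps, 0 < eps -> L1_field T (A eps)) ->
  (forall eta, 0 < eta -> \forall eps \near 0^'+, exists S, near_optimal eps eta (A eps) S) ->
  forall d, 0 < d -> \forall eps \near 0^'+, ((p0 - d)%:E <= reduced_energy lam tau eps (A eps) T)%E.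
Proof.
move=> LA nearA d d0; have [Ep p00] := psi0_fin.
have pos : \forall e \near (0 : R)^'+, 0 < e by exact: nbhs_right_gt.
have HS e : exists S, 0 < e -> admissible tau e T (A e) S /\
    (energy lam e (A e) S T <= ereal_inf [set energy lam e (A e) S T | S in admissible tau e T (A e)] + (e ^+ 2)%:E)%E.
  have [e0|] := boolP (0 < e); last by exists set0.
  by have [S h1 h2] := almost_optimal e0 (LA e e0); exists S.
have [S {}HS] := choice HS.
have hl : (psi <= limf_einf (fun e : R => ((e^-1)%:E * energy lam e (A e) (S e) T)%E) 0^'+)%E.
  apply: ereal_inf_lbound; exists A, S; split=> //; first by move=> e /HS[].
  apply: cvg_right_squeeze0 => [e|c c0]; first by apply: integral_ge0 => x _; rewrite lee_fin sqrtr_ge0.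
  have c2 : 0 < c / 2 by rewrite divr_gt0.
  pose Z := 1 + 8 * (p0 + c / 2 + 1) / c.
  have q : 0 < 8 * (p0 + c / 2 + 1) / c by rewrite divr_gt0// mulr_gt0//; lra.
  have Zi : 0 < Z^-1 by rewrite invr_gt0 /Z; lra.
  have Z0 : 0 < Z by rewrite -invr_gt0.
  apply: filterS2 (filterI pos (nbhs_right_le Zi)) (nearA _ c2) => e [e0 eZ] [S' nS].
  have [adm hE] := HS e e0.
  apply: le_trans (outside_dist lam SRm SRp adm) _; have [_ _ hd _] := nS.
  have hE' := le_trans hE (leeD2r _ (reduced_near_optimal e0 nS)).
  apply: (@le_trans _ _ ((c / 2)%:E + 4%:E * ((e * (p0 + c / 2))%:E + (e ^+ 2)%:E))%E).
    by apply: leeD => //; apply: lee_wpmul2l.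
  rewrite -(EFinD (e * _)) -(EFinM 4) -EFinD lee_fin.
  have eZ' : e * Z <= 1 by rewrite -ler_pdivlMr// div1r.
  have e1 : e <= 1 by apply: le_trans eZ'; rewrite ler_peMr ?(ltW e0)// /Z; lra.
  have : e * (8 * (p0 + c / 2 + 1) / c) <= 1.
    by apply: le_trans eZ'; rewrite ler_pM2l// /Z; lra.
  rewrite mulrA ler_pdivrMr// mul1r => h.
  have e2 : e ^+ 2 <= e by rewrite expr2 ler_piMr// ltW.
  lra.
have d2 : 0 < d / 2 by rewrite divr_gt0.
have hlt : ((p0 - d / 2)%:E < limf_einf (fun e : R => ((e^-1)%:E * energy lam e (A e) (S e) T)%E) 0^'+)%E.
  by apply: lt_le_trans hl; rewrite Ep lte_fin; lra.
apply: filterS2 (filterI pos (nbhs_right_le d2)) (limf_einf_gt hlt) => e [e0 ed] h.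
have [_ hE] := HS e e0; rewrite /reduced_energy.
have h2 := lt_le_trans h (lee_wpmul2l (ltac:(by rewrite lee_fin invr_ge0 ltW) : (0 <= (e^-1)%:E)%E) hE).
set m := ereal_inf _ in h2 *.
have m0 : (0 <= m)%E by exact: reduced_ge0 (LA e e0).
rewrite ge0_muleDr ?lee_fin ?sqr_ge0// in h2.
rewrite -EFinM expr2 mulKf ?gt_eqF// in h2.
move: h2; case: ((e^-1)%:E * m)%E => [r| |]//; last by rewrite leey.
by rewrite -EFinD lte_fin lee_fin; lra.
Qed.

Theorem recovery_family : exists A : R -> R * R -> 'M[R]_2,
    [/\ forall eps, 0 < eps -> L1_field T (A eps), cvg_L1 T A I,
        reduced_energy lam tau eps (A eps) T @[eps --> 0^'+] --> psi &
        forall delta, 0 < delta -> \forall eps \near 0^'+,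
            forall x, delta < `|x.1| -> A eps x = I x].
Proof.
have [A [LA nearA]] := diagonal; exists A; have [Ep p00] := psi0_fin.
have pos : \forall e \near (0 : R)^'+, 0 < e by exact: nbhs_right_gt.
split=> //.
- apply: cvg_right_squeeze0 => [e|d d0]; first by apply: integral_ge0 => x _; rewrite lee_fin sqrtr_ge0.
  by apply: filterS (nearA d d0) => e [S []].
- rewrite Ep; apply: cvg_right_fin => d d0.
  apply: filterS2 (filterI pos (nearA d d0)) (reduced_energy_lower LA nearA d0) => e [e0 [S nS]] ->/=.
  rewrite /reduced_energy; rewrite lee_pdivrMl//; exact: reduced_near_optimal nS.
- by move=> d d0; apply: filterS (nearA d d0) => e [S []].
Qed.

End Recovery.

Theorem theorem5p3 (R : realType) (lam tau : R) (hlam : 0 < lam)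
    (htau : 0 < tau) (Rm Rp : 'M[R]_2) (hRm : SO2 Rm) (hRp : SO2 Rp) :
  exists A : R -> R * R -> 'M[R]_2,
    [/\ forall eps, 0 < eps -> L1_field (open_square 2^-1) (A eps),
        cvg_L1 (open_square 2^-1) A (interface Rm Rp),
        reduced_energy lam tau eps (A eps) (open_square 2^-1)
          @[eps --> 0^'+] --> psi0 lam tau Rm Rp &
        forall delta, 0 < delta -> delta < 4^-1 ->
          \forall eps \near 0^'+,
            forall x, open_square 2^-1 x -> delta < `|x.1| ->
              A eps x = interface Rm Rp x].
Proof.
have [A [LA cA rA fA]] := recovery_family hlam htau hRm hRp.
exists A; split=> // delta d0 _.
by apply: filterS (fA delta d0) => eps h x _; exact: h.
Qed.
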